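(* Let $A$ be a $\sigma$-unital $C^*$-algebra, let $G$ be a second-countable compact group, and let $\alpha\colon G\to\mathrm{Aut}(A)$ be an action with the Rokhlin property. If $A$ is purely infinite, then so are $A^\alpha$ and $A\rtimes_\alpha G$.
   Context: A (not necessarily simple) $C^*$-algebra $A$ is purely infinite (Kirchberg-Rørdam) if (1) there are no nonzero characters (homomorphisms onto $\mathbb{C}$) on $A$, and (2) for every pair $a,b$ of positive elements of $A$ with $a$ in the closed two-sided ideal generated by $b$, there is a sequence $(x_n)_{n\in\mathbb{N}}$ in $A$ with $\lim_{n\to\infty}\|x_n^*bx_n-a\|=0$. Conventions: homomorphisms between $C^*$-algebras are $*$-homomorphisms, subalgebras are $C^*$-subalgebras; actions on $C^*$-algebras are point-norm continuous; $A^\alpha$ is the fixed point algebra and $A\rtimes_\alpha G$ the crossed product. Sequence algebras: for a $C^*$-algebra $A$, let $\ell^\infty(\mathbb{N},A)$ be the $C^*$-algebra of bounded sequences in $A$, $c_0(\mathbb{N},A)$ the ideal of norm-null sequences, $A_\infty=\ell^\infty(\mathbb{N},A)/c_0(\mathbb{N},A)$ with quotient map $\eta_A$; $A$ sits in $A_\infty$ as constant sequences. For a subalgebra $D\subseteq A$, let $\mathrm{Ann}(D,A_\infty)$ be the annihilator of $D$ in $A_\infty$, an ideal of $A_\infty\cap D'$, let $F(D,A)=(A_\infty\cap D')/\mathrm{Ann}(D,A_\infty)$ and let $\kappa_{D,A}$ be the quotient map. If $\alpha\colon G\to\mathrm{Aut}(A)$ is an action and $D$ is $\alpha$-invariant,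 entrywise application of $\alpha$ gives actions (not necessarily continuous) $\alpha^\infty$ on $\ell^\infty(\mathbb{N},A)$, $\alpha_\infty$ on $A_\infty$ and on $A_\infty\cap D'$, and $F(\alpha)$ on $F(D,A)$. Let $\ell^\infty_\alpha(\mathbb{N},A)$ be the set of $a\in\ell^\infty(\mathbb{N},A)$ with $g\mapsto\alpha^\infty_g(a)$ norm continuous, $A_{\infty,\alpha}=\eta_A(\ell^\infty_\alpha(\mathbb{N},A))$ and $F_\alpha(D,A)=\kappa_{D,A}(A_{\infty,\alpha}\cap D')$. Rokhlin property: an action $\alpha\colon G\to\mathrm{Aut}(A)$ of a second-countable compact group $G$ on a $\sigma$-unital $C^*$-algebra $A$ has the Rokhlin property if for every separable $\alpha$-invariant subalgebra $D\subseteq A$ there is an equivariant unital homomorphism $\varphi\colon(C(G),\mathtt{Lt})\to(F_\alpha(D,A),F(\alpha))$, where $\mathtt{Lt}$ is the action of $G$ on $C(G)$ induced by left translation. *)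

(* Defs.v *)
(* The complex numbers are R[i] for R : realType. Norms on complex normed
   modules take their (nonnegative real) values in R[i] as well. *)
From HB Require Import structures.
From mathcomp Require Import all_boot all_order all_algebra.
From mathcomp Require Import all_classical all_reals all_analysis.
From mathcomp Require Import complex.

Set Implicit Arguments.
Unset Strict Implicit.
Unset Printing Implicit Defensive.

Import Order.TTheory GRing.Theory Num.Theory.
Import numFieldNormedType.Exports.

Local Open Scope classical_set_scope.
Local Open Scope quotient_scope.
Local Open Scope ring_scope.

(** * Star algebras (not necessarily unital) *)

HB.mixin Record Lmodule_isStarAlgebra (K : numClosedFieldType) A
    of GRing.Lmodule K A := {
  smul : A -> A -> A ;
  star : A -> A ;
  smulA : associative smul ;
  smulDl : left_distributive smul +%R ;
  smulDr : right_distributive smul +%R ;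
  smulZl : forall (k : K) x y, smul (k *: x) y = k *: smul x y ;
  smulZr : forall (k : K) x y, smul x (k *: y) = k *: smul x y ;
  starK : involutive star ;
  starD : {morph star : x y / x + y} ;
  starZ : forall (k : K) x, star (k *: x) = k^* *: star x ;
  starM : forall x y, star (smul x y) = smul (star y) (star x) }.

#[short(type="starAlgType")]
HB.structure Definition StarAlgebra (K : numClosedFieldType) :=
  {A of Lmodule_isStarAlgebra K A & GRing.Lmodule K A}.

Arguments smul {K s} _ _ : rename.
Arguments star {K s} _ : rename.

Notation "x ** y" := (smul x y) (at level 40, left associativity) : ring_scope.

Section StarAlgebraTheory.
Variables (K : numClosedFieldType) (A : starAlgType K).
Implicit Types x y z : A.

Lemma smul0l x : 0 ** x = 0.
Proof. by rewrite -[X in X ** x](scale0r x) smulZl scale0r. Qed.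

Lemma smul0r x : x ** 0 = 0.
Proof. by rewrite -[X in x ** X](scale0r x) smulZr scale0r. Qed.

Lemma star0 : star (0 : A) = 0.
Proof. by rewrite -[X in star X](scale0r 0) starZ conjC0 scale0r. Qed.

Lemma smulNl x y : (- x) ** y = - (x ** y).
Proof. by rewrite -(scaleN1r x) smulZl scaleN1r. Qed.

Lemma smulNr x y : x ** (- y) = - (x ** y).
Proof. by rewrite -(scaleN1r y) smulZr scaleN1r. Qed.

Lemma smulBl x y z : (x - y) ** z = x ** z - y ** z.
Proof. by rewrite smulDl smulNl. Qed.

Lemma smulBr x y z : z ** (x - y) = z ** x - z ** y.
Proof. by rewrite smulDr smulNr. Qed.

Lemma starN x : star (- x) = - star x.
Proof. by rewrite -(scaleN1r x) starZ rmorphN1 scaleN1r. Qed.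

Lemma starB x y : star (x - y) = star x - star y.
Proof. by rewrite starD starN. Qed.

End StarAlgebraTheory.

Definition star_hom (K : numClosedFieldType) (A B : starAlgType K)
    (f : A -> B) : Prop :=
  [/\ linear f, {morph f : x y / x ** y} & {morph f : x / star x}].

Section ScalarStarAlgebra.
Variable K : numClosedFieldType.

Lemma regular_smulZl (k : K) (x y : K^o) : (k *: x) * y = k *: (x * y) :> K^o.
Proof. by rewrite /GRing.scale /= mulrA. Qed.

Lemma regular_smulZr (k : K) (x y : K^o) : x * (k *: y) = k *: (x * y) :> K^o.
Proof. by rewrite /GRing.scale /= mulrCA. Qed.

Lemma regular_starD : {morph (fun z : K^o => (z^* : K^o)) : x y / x + y}.
Proof. exact: rmorphD. Qed.

Lemma regular_starZ (k : K) (x : K^o) : ((k *: x)^* : K^o) = k^* *: (x^* : K^o).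
Proof. exact: rmorphM. Qed.

Lemma regular_starM (x y : K^o) : ((x * y)^* : K^o) = y^* * x^*.
Proof. by rewrite mulrC; exact: rmorphM. Qed.

HB.instance Definition _ := Lmodule_isStarAlgebra.Build K K^o
  (@mulrA K) (@mulrDl K) (@mulrDr K) regular_smulZl regular_smulZr
  (@conjCK K) regular_starD regular_starZ regular_starM.

End ScalarStarAlgebra.

Section FunctionStarAlgebra.
Variables (T : Type) (K : numClosedFieldType) (A : starAlgType K).
Implicit Types f g h : T -> A.

Definition fct_smul f g : T -> A := fun t => f t ** g t.
Definition fct_star f : T -> A := fun t => star (f t).

Lemma fct_smulA : associative fct_smul.
Proof. by move=> f g h; apply/funext => t; exact: smulA. Qed.

Lemma fct_smulDl : left_distributive fct_smul +%R.
Proof. by move=> f g h; apply/funext => t; exact: smulDl. Qed.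

Lemma fct_smulDr : right_distributive fct_smul +%R.
Proof. by move=> f g h; apply/funext => t; exact: smulDr. Qed.

Lemma fct_smulZl k f g : fct_smul (k *: f) g = k *: fct_smul f g.
Proof. by apply/funext => t; exact: smulZl. Qed.

Lemma fct_smulZr k f g : fct_smul f (k *: g) = k *: fct_smul f g.
Proof. by apply/funext => t; exact: smulZr. Qed.

Lemma fct_starK : involutive fct_star.
Proof. by move=> f; apply/funext => t; exact: starK. Qed.

Lemma fct_starD : {morph fct_star : f g / f + g}.
Proof. by move=> f g; apply/funext => t; exact: starD. Qed.

Lemma fct_starZ k f : fct_star (k *: f) = k^* *: fct_star f.
Proof. by apply/funext => t; exact: starZ. Qed.

Lemma fct_starM f g : fct_star (fct_smul f g) = fct_smul (fct_star g) (fct_star f).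
Proof. by apply/funext => t; exact: starM. Qed.

HB.instance Definition _ := Lmodule_isStarAlgebra.Build K (T -> A)
  fct_smulA fct_smulDl fct_smulDr fct_smulZl fct_smulZr
  fct_starK fct_starD fct_starZ fct_starM.

End FunctionStarAlgebra.

(** ** Star subalgebras, and the star algebra carried by one *)

(* No topology: closed subalgebras of a C*-algebra are [cstarSub] below. *)
Record starSub (K : numClosedFieldType) (A : starAlgType K) := StarSub {
  star_sub :> set A ;
  star_sub0 : star_sub 0 ;
  star_subD : forall x y, star_sub x -> star_sub y -> star_sub (x + y) ;
  star_subZ : forall k x, star_sub x -> star_sub (k *: x) ;
  star_subM : forall x y, star_sub x -> star_sub y -> star_sub (x ** y) ;
  star_subV : forall x, star_sub x -> star_sub (star x) }.

Section SubStarAlgebra.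
Variables (K : numClosedFieldType) (A : starAlgType K) (S : starSub A).

Definition star_sub_pred : {pred A} := fun x => x \in (S : set A).

Lemma star_sub_submod : GRing.subsemimod_closed star_sub_pred.
Proof.
split; first split; rewrite /star_sub_pred.
- by apply/mem_set; exact: star_sub0.
- by move=> x y /set_mem Sx /set_mem Sy; apply/mem_set; exact: star_subD.
- by move=> k x /set_mem Sx; apply/mem_set; exact: star_subZ.
Qed.

Record subAlg := SubAlg { subval : A ; subvalP : star_sub_pred subval }.

HB.instance Definition _ := [isSub for subval].
HB.instance Definition _ := [Choice of subAlg by <:].
HB.instance Definition _ :=
  GRing.SubChoice_isSubLmodule.Build K A star_sub_pred subAlg star_sub_submod.

Definition to_sub (x : A) (Sx : star_sub S x) : subAlg := SubAlg (mem_set Sx).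

Lemma subval_in (x : subAlg) : star_sub S (val x).
Proof. exact: set_mem (subvalP x). Qed.

Definition sub_smul (x y : subAlg) : subAlg :=
  to_sub (star_subM (subval_in x) (subval_in y)).
Definition sub_star (x : subAlg) : subAlg := to_sub (star_subV (subval_in x)).

Lemma sub_smulA : associative sub_smul.
Proof. by move=> x y z; apply/val_inj; exact: smulA. Qed.

Lemma sub_smulDl : left_distributive sub_smul +%R.
Proof. by move=> x y z; apply/val_inj; exact: smulDl. Qed.

Lemma sub_smulDr : right_distributive sub_smul +%R.
Proof. by move=> x y z; apply/val_inj; exact: smulDr. Qed.

Lemma sub_smulZl k x y : sub_smul (k *: x) y = k *: sub_smul x y.
Proof. by apply/val_inj; exact: smulZl. Qed.

Lemma sub_smulZr k x y : sub_smul x (k *: y) = k *: sub_smul x y.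
Proof. by apply/val_inj; exact: smulZr. Qed.

Lemma sub_starK : involutive sub_star.
Proof. by move=> x; apply/val_inj; exact: starK. Qed.

Lemma sub_starD : {morph sub_star : x y / x + y}.
Proof. by move=> x y; apply/val_inj; exact: starD. Qed.

Lemma sub_starZ k x : sub_star (k *: x) = k^* *: sub_star x.
Proof. by apply/val_inj; exact: starZ. Qed.

Lemma sub_starM x y : sub_star (sub_smul x y) = sub_smul (sub_star y) (sub_star x).
Proof. by apply/val_inj; exact: starM. Qed.

HB.instance Definition _ := Lmodule_isStarAlgebra.Build K subAlg
  sub_smulA sub_smulDl sub_smulDr sub_smulZl sub_smulZr
  sub_starK sub_starD sub_starZ sub_starM.

End SubStarAlgebra.

(** ** Self-adjoint two-sided ideals, and the quotient by one *)

Record starIdeal (K : numClosedFieldType) (A : starAlgType K) := StarIdeal {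
  star_ideal :> set A ;
  star_ideal0 : star_ideal 0 ;
  star_idealD : forall x y, star_ideal x -> star_ideal y -> star_ideal (x + y) ;
  star_idealZ : forall k x, star_ideal x -> star_ideal (k *: x) ;
  star_idealMl : forall a x, star_ideal x -> star_ideal (a ** x) ;
  star_idealMr : forall a x, star_ideal x -> star_ideal (x ** a) ;
  star_idealV : forall x, star_ideal x -> star_ideal (star x) }.

Section QuotientStarAlgebra.
Variables (K : numClosedFieldType) (A : starAlgType K) (I : starIdeal A).

Definition star_ideal_pred : {pred A} := fun x => x \in (I : set A).

Lemma star_ideal_zmod : zmod_closed star_ideal_pred.
Proof.
split; rewrite /in_mem /= /star_ideal_pred.
  by apply/mem_set; exact: star_ideal0.
move=> x y /set_mem Ix /set_mem Iy; apply/mem_set.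
by rewrite -scaleN1r; apply: star_idealD => //; exact: star_idealZ.
Qed.

HB.instance Definition _ :=
  GRing.isZmodClosed.Build A star_ideal_pred star_ideal_zmod.

Definition quotAlg : Type := Quotient.quot star_ideal_pred.

HB.instance Definition _ := GRing.Zmodule.on quotAlg.

Definition quot_pi (x : A) : quotAlg := \pi_(Quotient.quot star_ideal_pred) x.
Definition quot_repr (x : quotAlg) : A :=
  repr (x : Quotient.quot star_ideal_pred).

Lemma quot_reprK : cancel quot_repr quot_pi.
Proof. by move=> x; exact: reprK. Qed.

Lemma quot_piP (x y : A) : quot_pi x = quot_pi y <-> star_ideal I (x - y).
Proof.
split=> [/eqP|Ixy]; last apply/eqP.
  by rewrite -Quotient.idealrBE => /set_mem.
by rewrite -Quotient.idealrBE; exact: mem_set.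
Qed.

Lemma quot_piD : {morph quot_pi : x y / x + y}.
Proof. by move=> x y; rewrite /quot_pi !piE. Qed.

Lemma quot_pi_repr (x : A) : star_ideal I (quot_repr (quot_pi x) - x).
Proof. by apply/quot_piP; rewrite quot_reprK. Qed.

Definition quot_scale (k : K) (x : quotAlg) := quot_pi (k *: quot_repr x).
Definition quot_smul (x y : quotAlg) := quot_pi (quot_repr x ** quot_repr y).
Definition quot_star (x : quotAlg) := quot_pi (star (quot_repr x)).

Lemma quot_scaleE k x : quot_scale k (quot_pi x) = quot_pi (k *: x).
Proof.
apply/quot_piP; rewrite -scalerBr.
by apply: star_idealZ; exact: quot_pi_repr.
Qed.

Lemma quot_smulE x y : quot_smul (quot_pi x) (quot_pi y) = quot_pi (x ** y).
Proof.
apply/quot_piP; set x' := quot_repr _; set y' := quot_repr _.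
have -> : x' ** y' - x ** y = x' ** (y' - y) + (x' - x) ** y.
  by rewrite smulBl smulBr addrA subrK.
apply: star_idealD; first by apply: star_idealMl; exact: quot_pi_repr.
by apply: star_idealMr; exact: quot_pi_repr.
Qed.

Lemma quot_starE x : quot_star (quot_pi x) = quot_pi (star x).
Proof.
apply/quot_piP; rewrite -starB.
by apply: star_idealV; exact: quot_pi_repr.
Qed.

Lemma quot_scaleA a b x :
  quot_scale a (quot_scale b x) = quot_scale (a * b) x.
Proof. by rewrite -[x]quot_reprK !quot_scaleE scalerA. Qed.

Lemma quot_scale1 : left_id 1 quot_scale.
Proof. by move=> x; rewrite -[x]quot_reprK quot_scaleE scale1r. Qed.

Lemma quot_scaleDr : right_distributive quot_scale +%R.
Proof.
move=> k x y; rewrite -[x]quot_reprK -[y]quot_reprK.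
by rewrite -quot_piD !quot_scaleE -quot_piD scalerDr.
Qed.

Lemma quot_scaleDl x : {morph quot_scale^~ x : a b / a + b}.
Proof.
by move=> a b; rewrite -[x]quot_reprK !quot_scaleE -quot_piD scalerDl.
Qed.

HB.instance Definition _ := GRing.Zmodule_isLmodule.Build K quotAlg
  quot_scaleA quot_scale1 quot_scaleDr quot_scaleDl.

Lemma quot_smulA : associative quot_smul.
Proof.
move=> x y z; rewrite -[x]quot_reprK -[y]quot_reprK -[z]quot_reprK.
by rewrite !quot_smulE smulA.
Qed.

Lemma quot_smulDl : left_distributive quot_smul +%R.
Proof.
move=> x y z; rewrite -[x]quot_reprK -[y]quot_reprK -[z]quot_reprK.
by rewrite -quot_piD !quot_smulE -quot_piD smulDl.
Qed.

Lemma quot_smulDr : right_distributive quot_smul +%R.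
Proof.
move=> x y z; rewrite -[x]quot_reprK -[y]quot_reprK -[z]quot_reprK.
by rewrite -quot_piD !quot_smulE -quot_piD smulDr.
Qed.

Lemma quot_smulZl k x y : quot_smul (k *: x) y = k *: quot_smul x y.
Proof.
rewrite -[x]quot_reprK -[y]quot_reprK /GRing.scale /=.
by rewrite quot_scaleE !quot_smulE quot_scaleE smulZl.
Qed.

Lemma quot_smulZr k x y : quot_smul x (k *: y) = k *: quot_smul x y.
Proof.
rewrite -[x]quot_reprK -[y]quot_reprK /GRing.scale /=.
by rewrite quot_scaleE !quot_smulE quot_scaleE smulZr.
Qed.

Lemma quot_starK : involutive quot_star.
Proof. by move=> x; rewrite -[x]quot_reprK !quot_starE starK. Qed.

Lemma quot_starD : {morph quot_star : x y / x + y}.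
Proof.
move=> x y; rewrite -[x]quot_reprK -[y]quot_reprK.
by rewrite -quot_piD !quot_starE -quot_piD starD.
Qed.

Lemma quot_starZ k x : quot_star (k *: x) = k^* *: quot_star x.
Proof.
rewrite -[x]quot_reprK /GRing.scale /=.
by rewrite quot_scaleE !quot_starE quot_scaleE starZ.
Qed.

Lemma quot_starM x y :
  quot_star (quot_smul x y) = quot_smul (quot_star y) (quot_star x).
Proof.
rewrite -[x]quot_reprK -[y]quot_reprK.
by rewrite quot_smulE !quot_starE quot_smulE starM.
Qed.

HB.instance Definition _ := Lmodule_isStarAlgebra.Build K quotAlg
  quot_smulA quot_smulDl quot_smulDr quot_smulZl quot_smulZr
  quot_starK quot_starD quot_starZ quot_starM.

End QuotientStarAlgebra.

(** * C*-algebras *)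

HB.mixin Record isCStarAlgebra (R : realType) A
    of CompleteNormedModule R[i] A & StarAlgebra R[i] A := {
  norm_smul : forall x y : A, `|x ** y| <= `|x| * `|y| ;
  norm_cstar : forall x : A, `|star x ** x| = `|x| ^+ 2 }.

#[short(type="cstarAlgType")]
HB.structure Definition CStarAlgebra (R : realType) :=
  {A of isCStarAlgebra R A & CompleteNormedModule R[i] A & StarAlgebra R[i] A}.

(** ** Star homomorphisms between C*-algebras are contractive *)

Section Contractive.
Variable R : realType.

Lemma norm_star (A : cstarAlgType R) (x : A) : `|star x| = `|x|.
Proof.
suff le_star (y : A) : `|y| <= `|star y|.
  by apply/eqP; rewrite eq_le le_star andbT -{2}[x]starK le_star.
have [->|y0] := eqVneq y 0; first by rewrite star0.
have y_gt0 : 0 < `|y| by rewrite normr_gt0.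
by rewrite -(ler_pM2r y_gt0) -expr2 -norm_cstar norm_smul.
Qed.

Lemma geometric_lt (r e : R[i]) :
  0 <= r -> r < 1 -> 0 < e -> exists N, r ^+ N < e.
Proof.
case: r => a b; case: e => c d.
rewrite !lecE !ltcE /= => /andP[/eqP -> a0] /andP[_ a1] /andP[/eqP -> c0].
have /cvgrPdist_lt/(_ _ c0)[N _ /(_ N (leqnn _))] :
    (fun n => a ^+ n) @ \oo --> (0 : R).
  by apply: cvg_expr; rewrite ger0_norm.
rewrite sub0r normrN ger0_norm ?exprn_ge0// => aN; exists N.
have -> : (a +i* 0)%C ^+ N = ((a ^+ N)%:C)%C.
  by rewrite -[(a +i* 0)%C]/((a%:C)%C) rmorphXn.
by rewrite ltcE /= eqxx.
Qed.

Lemma geometric_cvg (A : completeNormedModType R[i]) (u : nat -> A) (r : R[i]) :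
  0 <= r -> r < 1 -> (forall n, `|u n.+1 - u n| <= r ^+ n) -> cvgn u.
Proof.
move=> r0 r1 ur; have r1' : 0 < 1 - r by rewrite subr_gt0.
have dist n k : (1 - r) * `|u (n + k)%N - u n| <= r ^+ n - r ^+ (n + k).
  elim: k => [|k IH]; first by rewrite addn0 !subrr normr0 mulr0.
  have -> : u (n + k.+1)%N - u n =
      (u (n + k).+1 - u (n + k)%N) + (u (n + k)%N - u n).
    by rewrite addnS addrA subrK.
  apply: (le_trans (ler_wpM2l (ltW r1') (ler_normD _ _))).
  rewrite mulrDr addnS.
  apply: (le_trans (lerD (ler_wpM2l (ltW r1') (ur _)) IH)).
  by rewrite mulrBl mul1r -exprS addrC addrA subrK.
apply/cauchy_cvgP/cauchyP => e e0.
have [N rN] := geometric_lt r0 r1 (mulr_gt0 r1' e0).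
exists (u N), N => // m /= Nm; rewrite -ball_normE /= distrC.
rewrite -(ltr_pM2l r1'); apply: le_lt_trans rN.
rewrite -(subnKC Nm); apply: (le_trans (dist _ _)).
by rewrite gerBl exprn_ge0.
Qed.

Lemma smul_continuous (A : cstarAlgType R) (a : A) : continuous (smul a).
Proof.
move=> x; apply/cvgrPdist_le => e e0.
near=> y; rewrite -smulBr (le_trans (norm_smul _ _))//.
have a0 : 0 < `|a| + 1 by rewrite ltr_wpDl.
apply: (@le_trans _ _ ((`|a| + 1) * `|x - y|)).
  by rewrite ler_wpM2r// lerDl.
rewrite mulrC -ler_pdivlMr//; near: y.
by apply: cvgr_dist_le => //; rewrite divr_gt0.
Unshelve. all: by end_near. Qed.

Lemma star_continuous (A : cstarAlgType R) : continuous (@star _ A).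
Proof.
move=> x; apply/cvgrPdist_le => e e0; near=> y.
rewrite -starB norm_star; near: y.
exact: cvgr_dist_le.
Unshelve. all: by end_near. Qed.

(* For self-adjoint [h] with [`|h| < 1], [1 - k] plays the role of the
   square root of [1 - h ** h]; it is found as a fixed point. *)
Lemma sqrt_fixpoint (A : cstarAlgType R) (h : A) : star h = h -> `|h| < 1 ->
  exists k : A, [/\ star k = k, h ** k = k ** h & h ** h = k + k - k ** k].
Proof.
move=> hh h1.
pose F (k : A) := 2^-1 *: (h ** h + k ** k).
pose u n := iter n F 0.
pose r := `|h| ^+ 2.
have r0 : 0 <= r by rewrite exprn_ge0.
have r1 : r < 1 by rewrite expr_lt1.
have half0 : 0 <= 2^-1 :> R[i] by rewrite invr_ge0.
have normF (k : A) : `|k| <= r -> `|F k| <= r.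
  move=> kr; rewrite normrZ ger0_norm//.
  rewrite ler_pdivrMl//.
  apply: (le_trans (ler_normD _ _)); rewrite mulr_natl mulr2n lerD//.
    by rewrite (le_trans (norm_smul _ _))// -expr2.
  rewrite (le_trans (norm_smul _ _))//.
  apply: (le_trans (ler_pM _ _ kr kr)) => //.
  by rewrite ler_piMl// ltW.
have un n : `|u n| <= r by elim: n => [|n IH]; [rewrite normr0|exact: normF].
have lipF (k l : A) : `|k| <= r -> `|l| <= r -> `|F k - F l| <= r * `|k - l|.
  move=> kr lr; rewrite -scalerBr normrZ ger0_norm// ler_pdivrMl//.
  have -> : h ** h + k ** k - (h ** h + l ** l) =
      k ** (k - l) + (k - l) ** l.
    by rewrite opprD addrACA subrr add0r smulBl smulBr addrA subrK.
  apply: (le_trans (ler_normD _ _)); rewrite mulr_natl mulr2n lerD//.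
    by rewrite (le_trans (norm_smul _ _))// ler_wpM2r.
  by rewrite (le_trans (norm_smul _ _))// mulrC ler_wpM2r.
have cu : cvgn u.
  apply: (@geometric_cvg _ _ r) => //; elim=> [|n IH].
    by rewrite subr0 expr0 (le_trans (un 1%N))// ltW.
  rewrite exprS; apply: (le_trans (lipF _ _ (un n.+1) (un n))).
  by rewrite ler_wpM2l.
set l := limn u in cu *.
have lr : `|l| <= r.
  apply/ler_addgt0Pr => e e0; near \oo => n.
  rewrite -(subrK (u n) l) addrC (le_trans (ler_normD _ _))// lerD//.
  by near: n; exact: cvgr_dist_le.
have FuFl : (F \o u) @ \oo --> F l.
  apply/cvgrPdist_le => e e0; near=> n.
  apply: (le_trans (lipF _ _ lr (un n))).
  apply: (@le_trans _ _ (1 * `|l - u n|)); first by rewrite ler_wpM2r// ltW.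
  by rewrite mul1r; near: n; exact: cvgr_dist_le.
have FuE : F \o u = [sequence u n.+1]_n by [].
have lF : l = F l.
  apply: (cvg_unique (@norm_hausdorff _ A) _ FuFl).
  by have := cu; rewrite -cvg_shiftS.
have u_sa n : star (u n) = u n.
  elim: n => [|n IH]; first exact: star0.
  by rewrite /u iterS /F starZ starD !starM hh -/(u n) IH fmorphV rmorph_nat.
have hu n : h ** u n = u n ** h.
  elim: n => [|n IH]; first by rewrite smul0l smul0r.
  rewrite /u iterS /F smulZl smulZr smulDl smulDr -/(u n) smulA.
  by rewrite (smulA h (u n)) IH -!smulA IH.
have starl : star l = l.
  apply: (cvg_unique (@norm_hausdorff _ A) _ cu).
  rewrite (_ : u = star \o u); last by apply/funext => n /=; rewrite u_sa.
  by apply: (cvg_comp _ _ cu); exact: star_continuous.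
have hul : (smul h \o u) @ \oo --> h ** l.
  by apply: (cvg_comp _ _ cu); exact: smul_continuous.
exists l; split => //.
- rewrite -[RHS](_ : star (h ** l) = _); last by rewrite starM starl hh.
  apply: (cvg_unique (@norm_hausdorff _ A) hul).
  rewrite (_ : smul h \o u = star \o (smul h \o u)); last first.
    by apply/funext => n /=; rewrite starM u_sa hh hu.
  by apply: (cvg_comp _ _ hul); exact: star_continuous.
- apply/eqP; rewrite -subr_eq opprK; apply/eqP.
  by rewrite -mulr2n -scaler_nat {3}lF scalerA mulfV// scale1r.
Unshelve. all: by end_near. Qed.

Lemma unitary_isometry (B : cstarAlgType R) (p q b : B) (c : R[i]) :
  star p = p -> star q = q -> p ** q = q ** p -> p ** p = q + q - q ** q ->
  c^* = - c -> c * c^* = 1 -> `|p ** b + c *: (b - q ** b)| = `|b|.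
Proof.
move=> pp qq pq p2 cN cc.
set y := p ** b; set z := b - q ** b.
have sy : star y = star b ** p by rewrite starM pp.
have sz : star z = star b - star b ** q by rewrite starB starM qq.
have yz : star y ** z = star z ** y.
  by rewrite sy sz /y /z smulBr smulBl !smulA -(smulA _ p q) pq smulA.
suff E : star (y + c *: z) ** (y + c *: z) = star b ** b.
  by apply/eqP; rewrite -(eqrXn2 (n := 2))// -!norm_cstar E.
rewrite starD starZ smulDl !smulDr !smulZl !smulZr scalerA mulrC cc scale1r yz.
rewrite -addrA (addrA (c *: _)) -scalerDl cN subrr scale0r add0r.
rewrite sy sz /y /z !smulBl !smulBr !smulA.
rewrite -(smulA _ p p) p2 smulBr smulDr smulBl smulDl !smulA.
set s := star b ** b; set t := _ ** q ** b; set w := _ ** q ** q ** b.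
by rewrite -(addrA s) -opprD (addrA t t) addrC subrK.
Qed.

Lemma imaginary_unit (C : numClosedFieldType) : exists c : C,
  [/\ c^* = - c, c * c^* = 1, (- c)^* = - - c & (- c) * (- c)^* = 1].
Proof.
exists 'i; rewrite rmorphN /= conjCi.
by split=> //; rewrite ?mulrNN mulrN -expr2 sqrCi opprK.
Qed.

Lemma star_hom_contractive (A B : cstarAlgType R) (f : A -> B) (x : A) :
  star_hom f -> `|f x| <= `|x|.
Proof.
move=> [flin fM fV].
pose F : {linear A -> B} := HB.pack f (GRing.isLinear.Build _ _ _ _ f flin).
have fD y z : f (y + z) = f y + f z by exact: (raddfD F).
have fB y z : f (y - z) = f y - f z by exact: (raddfB F).
have f0 : f 0 = 0 by exact: (raddf0 F).
have fZ (k : R[i]) y : f (k *: y) = k *: f y by rewrite -[k *: y]addr0 flin f0 addr0.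
have f_sa (h : A) : star h = h -> `|h| < 1 -> `|f h| <= 1.
  move=> hh h1; have [k [kk hk h2]] := sqrt_fixpoint hh h1.
  pose p := f h; pose q := f k.
  have pp : star p = p by rewrite -fV hh.
  have qq : star q = q by rewrite -fV kk.
  have pq : p ** q = q ** p by rewrite -!fM hk.
  have p2 : p ** p = q + q - q ** q by rewrite -!fM h2 fB fD.
  have pb (b : B) : `|p ** b| <= `|b|.
    have [c [I1 I2 J1 J2]] := imaginary_unit R[i].
    have U := unitary_isometry b pp qq pq p2 I1 I2.
    have V := unitary_isometry b pp qq pq p2 J1 J2.
    rewrite -(ler_pM2l (ltr0n _ 2))// -normr_nat -normrZ.
    rewrite scaler_nat mulr2n.
    have -> : p ** b + p ** b = (p ** b + c *: (b - q ** b)) +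
                                (p ** b + (- c) *: (b - q ** b)).
      by rewrite addrACA scaleNr subrr addr0.
    by rewrite (le_trans (ler_normD _ _))// U V normr_nat mulr_natl mulr2n.
  rewrite -/p; have [->|p0] := eqVneq p 0; first by rewrite normr0.
  have p_gt0 : 0 < `|p| by rewrite normr_gt0.
  by rewrite -(ler_pM2r p_gt0) mul1r -expr2 -norm_cstar pp pb.
apply/ler_addgt0Pr => e e0; set c := `|x| + e.
have c0 : 0 < c by rewrite ltr_wpDl.
have cV0 : 0 <= c^-1 by rewrite invr_ge0 ltW.
pose y := c^-1 *: x; pose h := star y ** y.
have y1 : `|y| < 1.
  by rewrite normrZ ger0_norm// ltr_pdivrMl// mulr1 ltrDl.
have fy1 : `|f y| ^+ 2 <= 1.
  rewrite -norm_cstar -fV -fM f_sa//; first by rewrite starM starK.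
  by rewrite norm_cstar expr_lt1.
rewrite expr_le1// in fy1.
by rewrite -[c]mulr1 -ler_pdivrMl// -[X in X * _](ger0_norm cV0) -normrZ -fZ.
Qed.

End Contractive.
(** ** C*-subalgebras *)

Record cstarSub (R : realType) (A : cstarAlgType R) := CStarSub {
  cstar_sub :> starSub A ;
  cstar_sub_closed : closed (cstar_sub : set A) }.

Definition cstarSubAlg (R : realType) (A : cstarAlgType R) (S : cstarSub A) : Type :=
  subAlg S.

Section CStarSubalgebra.
Variables (R : realType) (A : cstarAlgType R) (S : cstarSub A).
Local Notation T := (cstarSubAlg S).

HB.instance Definition _ := StarAlgebra.on T.
HB.instance Definition _ := SubChoice.on T.

Lemma sub_ler_normD (x y : T) : `|val (x + y)| <= `|val x| + `|val y|.
Proof. exact: ler_normD. Qed.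

Lemma sub_normrZ (k : R[i]) (x : T) : `|val (k *: x)| = `|k| * `|val x|.
Proof. exact: normrZ. Qed.

Lemma sub_normr0_eq0 (x : T) : `|val x| = 0 -> x = 0.
Proof. by move=> /normr0_eq0 x0; apply/val_inj. Qed.

HB.instance Definition _ := Lmodule_isNormed.Build R[i] T
  sub_ler_normD sub_normrZ sub_normr0_eq0.

Lemma sub_complete (F : set_system T) : ProperFilter F -> cauchy F -> cvg F.
Proof.
move=> FF /cauchy_ballP Fc.
have /cauchy_cvgP : cauchy ((val : T -> A) @ F).
  apply/cauchy_ballP => e e0.
  have [[P Q] /= [FP FQ] PQ] := Fc _ e0.
  exists (val @` P, val @` Q).
    by split; [apply: filterS FP|apply: filterS FQ] => x ?; exists x.
  move=> [_ _] /= [[x Px <-] [y Qy <-]].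
  by have := PQ (x, y) (conj Px Qy); rewrite -!ball_normE.
set l := lim _ => cl.
have Sl : star_sub S l.
  apply: (closed_cvg _ (@cstar_sub_closed _ _ S) _ _ cl).
  by apply: nearW => x; exact: subval_in.
apply/cvg_ex; exists (to_sub Sl : T).
apply/cvgrPdist_lt => e e0.
by have /cvgrPdist_lt/(_ e e0) := cl.
Qed.

HB.instance Definition _ := Uniform_isComplete.Build T sub_complete.

Lemma sub_norm_smul (x y : T) : `|x ** y| <= `|x| * `|y|.
Proof. exact: (norm_smul (val x) (val y)). Qed.

Lemma sub_norm_cstar (x : T) : `|star x ** x| = `|x| ^+ 2.
Proof. exact: (norm_cstar (val x)). Qed.

HB.instance Definition _ := isCStarAlgebra.Build R T sub_norm_smul sub_norm_cstar.

End CStarSubalgebra.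
(** * Pure infiniteness and sigma-unitality *)

Section PureInfiniteness.
Variables (R : realType) (A : cstarAlgType R).

Definition positive (a : A) : Prop := exists x : A, a = star x ** x.

Definition closed_ideal (I : set A) : Prop :=
  [/\ closed I, I 0,
      forall (k : R[i]) x y, I x -> I y -> I (k *: x + y) &
      forall a x, I x -> I (a ** x) /\ I (x ** a)].

(* The closed two-sided ideal generated by [b]. *)
Definition ideal_generated (b : A) : set A := smallest closed_ideal [set b].

Definition character (chi : A -> R[i]^o) : Prop :=
  star_hom chi /\ forall z, exists a, chi a = z.

Definition purely_infinite : Prop :=
  ~ (exists chi, character chi) /\
  forall a b : A, positive a -> positive b -> ideal_generated b a ->
    exists x : nat -> A,
      (fun n => `|star (x n) ** b ** x n - a| : R[i]^o) @ \oo --> (0 : R[i]^o).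

(* A countable approximate unit consisting of positive contractions. *)
Definition sigma_unital : Prop :=
  exists e : nat -> A, (forall n, positive (e n) /\ `|e n| <= 1) /\
    forall a, (fun n => e n ** a) @ \oo --> a /\ (fun n => a ** e n) @ \oo --> a.

Definition separable (D : set A) : Prop :=
  exists S : set A, [/\ countable S, S `<=` D & D `<=` closure S].

End PureInfiniteness.

(** * The sequence algebra of A and the central sequence algebras F(D, A) *)

Section SequenceAlgebra.
Variables (R : realType) (A : cstarAlgType R).

Definition bounded_seqs_set : set (nat -> A) :=
  [set a | exists M : R[i], forall n, `|a n| <= M].

Lemma bounded_seqs0 : bounded_seqs_set 0.
Proof. by exists 0 => n; rewrite normr0. Qed.

Lemma bounded_seqsD a b :
  bounded_seqs_set a -> bounded_seqs_set b -> bounded_seqs_set (a + b).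
Proof.
move=> [M aM] [N bN]; exists (M + N) => n.
by rewrite (le_trans (ler_normD _ _))// lerD.
Qed.

Lemma bounded_seqsZ k a : bounded_seqs_set a -> bounded_seqs_set (k *: a).
Proof.
by move=> [M aM]; exists (`|k| * M) => n; rewrite normrZ ler_wpM2l.
Qed.

Lemma bounded_seqsM a b :
  bounded_seqs_set a -> bounded_seqs_set b -> bounded_seqs_set (a ** b).
Proof.
move=> [M aM] [N bN]; exists (M * N) => n.
by rewrite (le_trans (norm_smul _ _))// ler_pM.
Qed.

Lemma bounded_seqsV a : bounded_seqs_set a -> bounded_seqs_set (star a).
Proof. by move=> [M aM]; exists M => n; rewrite norm_star. Qed.

Definition bounded_seqs : starSub (nat -> A) :=
  StarSub bounded_seqs0 bounded_seqsD bounded_seqsZ bounded_seqsM bounded_seqsV.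

Definition linf := subAlg bounded_seqs.

HB.instance Definition _ := StarAlgebra.on linf.

Definition null_seqs_set : set linf := [set a | val a @ \oo --> (0 : A)].

Lemma null_seqsP (a : linf) :
  null_seqs_set a <-> forall e : R[i], 0 < e -> \forall n \near \oo, `|val a n| <= e.
Proof.
split=> [/cvgrPdist_le a0 e /a0|a0]; last apply/cvgrPdist_le => e /a0.
  by apply: filterS => n; rewrite sub0r normrN.
by apply: filterS => n; rewrite sub0r normrN.
Qed.

Lemma null_seqs_dom (a b : linf) (M : R[i]) : null_seqs_set a -> 0 <= M ->
  (forall n, `|val b n| <= M * `|val a n|) -> null_seqs_set b.
Proof.
move=> /null_seqsP a0 M0 ba; apply/null_seqsP => e e0.
have M1 : 0 < M + 1 by rewrite ltr_wpDl.
apply: filterS (a0 (e / (M + 1)) (divr_gt0 e0 M1)) => n an.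
apply: (le_trans (ba n)); apply: (@le_trans _ _ ((M + 1) * `|val a n|)).
  by rewrite ler_wpM2r// lerDl.
by rewrite mulrC -ler_pdivlMr.
Qed.

Lemma null_seqs0 : null_seqs_set 0.
Proof. exact: cvg_cst. Qed.

Lemma null_seqsD a b :
  null_seqs_set a -> null_seqs_set b -> null_seqs_set (a + b).
Proof.
by move=> a0 b0; rewrite /null_seqs_set /= -[0](addr0 0); exact: cvgD.
Qed.

Lemma null_seqsZ k a : null_seqs_set a -> null_seqs_set (k *: a).
Proof.
move=> a0; apply: (@null_seqs_dom a _ `|k|) => // n.
by rewrite -normrZ.
Qed.

Lemma null_seqsMl a b : null_seqs_set b -> null_seqs_set (a ** b).
Proof.
move=> b0; have [M aM] := subval_in a.
apply: (@null_seqs_dom b _ M) => //; first exact: le_trans (aM 0%N).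
by move=> n; rewrite (le_trans (norm_smul _ _))// ler_wpM2r.
Qed.

Lemma null_seqsMr a b : null_seqs_set b -> null_seqs_set (b ** a).
Proof.
move=> b0; have [M aM] := subval_in a.
apply: (@null_seqs_dom b _ M) => //; first exact: le_trans (aM 0%N).
by move=> n; rewrite (le_trans (norm_smul _ _))// mulrC ler_wpM2r.
Qed.

Lemma null_seqsV a : null_seqs_set a -> null_seqs_set (star a).
Proof.
move=> a0; apply: (@null_seqs_dom a _ 1) => // n.
by rewrite mul1r norm_star.
Qed.

Definition null_seqs : starIdeal linf :=
  StarIdeal null_seqs0 null_seqsD null_seqsZ null_seqsMl null_seqsMr null_seqsV.

Definition Ainf := quotAlg null_seqs.

HB.instance Definition _ := StarAlgebra.on Ainf.

Definition eta (a : linf) : Ainf := quot_pi null_seqs a.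

Lemma bounded_cst (a : A) : bounded_seqs_set (fun=> a).
Proof. by exists `|a|. Qed.

Definition const_seq (a : A) : Ainf := eta (to_sub (S := bounded_seqs) (bounded_cst a)).

Lemma const_seq_star a : const_seq (star a) = star (const_seq a).
Proof.
rewrite /const_seq /eta [RHS]quot_starE; congr (quot_pi _ _).
exact/val_inj.
Qed.

Variable D : cstarSub A.

Definition commutant_set : set Ainf :=
  [set x | forall d, star_sub D d -> x ** const_seq d = const_seq d ** x].

Lemma commutant0 : commutant_set 0.
Proof. by move=> d _; rewrite smul0l smul0r. Qed.

Lemma commutantD x y :
  commutant_set x -> commutant_set y -> commutant_set (x + y).
Proof. by move=> xD yD d dD; rewrite smulDl smulDr xD// yD. Qed.

Lemma commutantZ k x : commutant_set x -> commutant_set (k *: x).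
Proof. by move=> xD d dD; rewrite smulZl smulZr xD. Qed.

Lemma commutantM x y :
  commutant_set x -> commutant_set y -> commutant_set (x ** y).
Proof. by move=> xD yD d dD; rewrite -smulA yD// smulA xD// smulA. Qed.

Lemma commutantV x : commutant_set x -> commutant_set (star x).
Proof.
move=> xD d dD; apply: (can_inj (@starK _ Ainf)).
by rewrite !starM starK -const_seq_star xD//; exact: star_subV.
Qed.

Definition commutant : starSub Ainf :=
  StarSub commutant0 commutantD commutantZ commutantM commutantV.

Definition annihilator_set : set (subAlg commutant) :=
  [set x | forall d, star_sub D d ->
     val x ** const_seq d = 0 /\ const_seq d ** val x = 0].

Lemma annihilator0 : annihilator_set 0.
Proof. by move=> d _; rewrite /= smul0l smul0r. Qed.

Lemma annihilatorD x y :
  annihilator_set x -> annihilator_set y -> annihilator_set (x + y).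
Proof.
move=> xD yD d dD; have [x1 x2] := xD d dD; have [y1 y2] := yD d dD.
by rewrite /= smulDl smulDr x1 x2 y1 y2 addr0.
Qed.

Lemma annihilatorZ k x : annihilator_set x -> annihilator_set (k *: x).
Proof.
move=> xD d dD; have [x1 x2] := xD d dD.
by rewrite /= smulZl smulZr x1 x2 scaler0.
Qed.

Lemma annihilatorMl a x : annihilator_set x -> annihilator_set (a ** x).
Proof.
move=> xD d dD; have [x1 x2] := xD d dD.
have ad : val a ** const_seq d = const_seq d ** val a.
  exact: (subval_in a d dD).
rewrite /= -smulA x1 smul0r smulA; split=> //.
by rewrite -ad -smulA x2 smul0r.
Qed.

Lemma annihilatorMr a x : annihilator_set x -> annihilator_set (x ** a).
Proof.
move=> xD d dD; have [x1 x2] := xD d dD.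
have ad : val a ** const_seq d = const_seq d ** val a.
  exact: (subval_in a d dD).
rewrite /= smulA x2 smul0l -smulA; split=> //.
by rewrite ad smulA x1 smul0l.
Qed.

Lemma annihilatorV x : annihilator_set x -> annihilator_set (star x).
Proof.
move=> xD d dD; have [x1 x2] := xD _ (star_subV dD).
rewrite /= -[const_seq d]starK -!starM -const_seq_star x1 x2.
by rewrite star0.
Qed.

Definition annihilator : starIdeal (subAlg commutant) :=
  StarIdeal annihilator0 annihilatorD annihilatorZ
    annihilatorMl annihilatorMr annihilatorV.

(* F(D, A) *)
Definition centralF := quotAlg annihilator.

HB.instance Definition _ := StarAlgebra.on centralF.

Definition kappa (x : subAlg commutant) : centralF := quot_pi annihilator x.

End SequenceAlgebra.

(** * Group actions *)

(* Pointedness serves only to equip G with its Borel sigma-algebra. *)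
HB.mixin Record isTopologicalGroup G of Group G & PointedTopological G := {
  mulg_continuous : continuous (fun p : G * G => (p.1 * p.2)%g) ;
  invg_continuous : continuous (fun g : G => (g^-1)%g) }.

#[short(type="topGroupType")]
HB.structure Definition TopologicalGroup :=
  {G of isTopologicalGroup G & Group G & PointedTopological G}.

Record cstarAction (R : realType) (G : topGroupType) (A : cstarAlgType R) :=
  CStarAction {
    cstar_act :> G -> A -> A ;
    act_hom : forall g, star_hom (cstar_act g) ;
    act1 : forall a, cstar_act 1%g a = a ;
    actM : forall g h a, cstar_act (g * h)%g a = cstar_act g (cstar_act h a) ;
    act_continuous : forall a, continuous (cstar_act^~ a) }.

Section Actions.
Variables (R : realType) (G : topGroupType) (A : cstarAlgType R).
Variable alpha : cstarAction G A.

Lemma act_contractive g a : `|alpha g a| <= `|a|.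
Proof. by apply: star_hom_contractive; exact: act_hom. Qed.

Lemma actD g : {morph alpha g : x y / x + y}.
Proof.
by move=> x y; have [/(_ 1 x y)] := act_hom alpha g; rewrite !scale1r.
Qed.

Lemma act0 g : alpha g 0 = 0.
Proof. by apply: (addIr (alpha g 0)); rewrite -actD !add0r. Qed.

Lemma actZ g k x : alpha g (k *: x) = k *: alpha g x.
Proof.
by have [/(_ k x 0)] := act_hom alpha g; rewrite act0 !addr0.
Qed.

Lemma actB g x y : alpha g (x - y) = alpha g x - alpha g y.
Proof. by rewrite -(scaleN1r y) actD actZ scaleN1r. Qed.

Lemma act_smul g : {morph alpha g : x y / x ** y}.
Proof. by have [] := act_hom alpha g. Qed.

Lemma act_star g : {morph alpha g : x / star x}.
Proof. by have [] := act_hom alpha g. Qed.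

(** ** The fixed point algebra *)

Definition fixed_set : set A := [set a | forall g, alpha g a = a].

Lemma fixed0 : fixed_set 0.
Proof. by move=> g; exact: act0. Qed.

Lemma fixedD x y : fixed_set x -> fixed_set y -> fixed_set (x + y).
Proof. by move=> xf yf g; rewrite actD xf yf. Qed.

Lemma fixedZ k x : fixed_set x -> fixed_set (k *: x).
Proof. by move=> xf g; rewrite actZ xf. Qed.

Lemma fixedM x y : fixed_set x -> fixed_set y -> fixed_set (x ** y).
Proof. by move=> xf yf g; rewrite act_smul xf yf. Qed.

Lemma fixedV x : fixed_set x -> fixed_set (star x).
Proof. by move=> xf g; rewrite act_star xf. Qed.

Lemma fixed_closed : closed fixed_set.
Proof.
move=> x clx g; apply/eqP; rewrite -subr_eq0 -normr_eq0 eq_le normr_ge0 andbT.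
apply/ler_addgt0Pr => e e0; rewrite add0r.
have e20 : 0 < e / 2 by rewrite divr_gt0.
have [y [yf]] := clx _ (nbhsx_ballx x (e / 2) e20).
rewrite -ball_normE /= => /ltW xy.
have -> : alpha g x - x = alpha g (x - y) - (x - y).
  by rewrite actB yf opprB addrA subrK.
rewrite (le_trans (ler_normB _ _))// [leRHS](splitr e) lerD//.
exact: le_trans (act_contractive _ _) xy.
Qed.

Definition fixed_sub : cstarSub A := @CStarSub _ _
  (StarSub fixed0 fixedD fixedZ fixedM fixedV) fixed_closed.

Definition fixed_point_algebra : cstarAlgType R := cstarSubAlg fixed_sub.

(** ** Induced actions on sequence algebras *)

Lemma act_linf_bounded g (a : linf A) :
  bounded_seqs_set (fun n => alpha g (val a n)).
Proof.
have [M aM] := subval_in a; exists M => n.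
exact: le_trans (act_contractive _ _) (aM n).
Qed.

Definition act_linf g (a : linf A) : linf A :=
  to_sub (S := bounded_seqs A) (act_linf_bounded g a).

(* Independent of the representative, see [act_infE]. *)
Definition act_inf g (x : Ainf A) : Ainf A := eta (act_linf g (quot_repr x)).

Lemma act_infE g a : act_inf g (eta a) = eta (act_linf g a).
Proof.
apply/quot_piP; have an := quot_pi_repr (null_seqs A) a.
apply: (@null_seqs_dom _ _ _ _ 1 an) => // n.
rewrite mul1r; apply: le_trans (act_contractive g _).
by rewrite actB.
Qed.

Lemma eta_repr (x : Ainf A) : exists a, x = eta a.
Proof. by exists (quot_repr x); rewrite /eta quot_reprK. Qed.

Lemma act_infM g : {morph act_inf g : x y / x ** y}.
Proof.
move=> x y; have [a ->] := eta_repr x; have [b ->] := eta_repr y.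
have etaM c d : eta c ** eta d = eta (c ** d) by exact: quot_smulE.
rewrite etaM !act_infE etaM; congr eta; apply/val_inj/funext => n.
exact: act_smul.
Qed.

Lemma act_infB g x y : act_inf g (x - y) = act_inf g x - act_inf g y.
Proof.
have [a ->] := eta_repr x; have [b ->] := eta_repr y.
have etaB c d : eta c - eta d = eta (c - d).
  by rewrite -scaleN1r [-1 *: _]quot_scaleE -quot_piD scaleN1r.
rewrite etaB !act_infE etaB; congr eta; apply/val_inj/funext => n /=.
exact: actB.
Qed.

Lemma act_inf0 g : act_inf g 0 = 0.
Proof. by rewrite -[X in act_inf g X](subrr 0) act_infB subrr. Qed.

Lemma act_inf_const g a : act_inf g (const_seq a) = const_seq (alpha g a).
Proof.
by rewrite act_infE; congr eta; apply/val_inj/funext => n.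
Qed.

Definition invariant_sub (D : set A) : Prop := forall g d, D d -> D (alpha g d).

Variables (D : cstarSub A) (D_inv : invariant_sub (D : starSub A)).

Lemma act_comm_in g (x : subAlg (commutant D)) :
  commutant_set D (act_inf g (val x)).
Proof.
move=> d dD; have -> : d = alpha g (alpha g^-1%g d).
  by rewrite -actM mulgV act1.
rewrite -act_inf_const -!act_infM; congr act_inf.
exact: (subval_in x _ (D_inv _ dD)).
Qed.

Definition act_comm g (x : subAlg (commutant D)) : subAlg (commutant D) :=
  to_sub (S := commutant D) (act_comm_in g x).

(* Independent of the representative, see [act_FE]. *)
Definition act_F g (x : centralF D) : centralF D :=
  kappa (act_comm g (quot_repr x)).

Lemma act_FE g x : act_F g (kappa x) = kappa (act_comm g x).
Proof.
apply/quot_piP; have xn := quot_pi_repr (annihilator D) x.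
move=> d dD /=; have -> : d = alpha g (alpha g^-1%g d).
  by rewrite -actM mulgV act1.
rewrite -act_infB -act_inf_const -!act_infM.
have [/= -> ->] := xn _ (D_inv g^-1%g dD).
by rewrite act_inf0.
Qed.

End Actions.
(** * C(G) with the action by left translation *)

Section ContinuousFunctions.
Variables (R : realType) (G : topGroupType).

Definition contG_set : set (G -> R[i]^o) := [set f | continuous f].

Lemma contG0 : contG_set 0.
Proof. by move=> g; exact: cvg_cst. Qed.

Lemma contGD f g : contG_set f -> contG_set g -> contG_set (f + g).
Proof. by move=> cf cg x; exact: cvgD (cf x) (cg x). Qed.

Lemma contGZ k f : contG_set f -> contG_set (k *: f).
Proof. by move=> cf x; exact: cvgZr (cf x). Qed.

Lemma contGM f g : contG_set f -> contG_set g -> contG_set (f ** g).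
Proof. by move=> cf cg x; exact: cvgM (cf x) (cg x). Qed.

Lemma contGV f : contG_set f -> contG_set (star f).
Proof.
move=> cf x; apply/cvgrPdist_lt => e e0.
have /cvgrPdist_lt/(_ e e0) := cf x.
apply: filterS => y; rewrite /star /= /fct_star /star /=.
by rewrite -rmorphB norm_conjC.
Qed.

Definition contG_sub : starSub (G -> R[i]^o) :=
  StarSub contG0 contGD contGZ contGM contGV.

Definition contG := subAlg contG_sub.

HB.instance Definition _ := StarAlgebra.on contG.

Lemma contG1_continuous : contG_set (fun=> 1).
Proof. by move=> g; exact: cvg_cst. Qed.

Definition contG1 : contG := to_sub (S := contG_sub) contG1_continuous.

Lemma left_translate_continuous (g : G) (f : contG) :
  contG_set (fun h => val f (g^-1 * h)%g).
Proof.
move=> h; apply: (@continuous_comp _ _ _ (fun h => (g^-1 * h)%g) (val f)).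
  apply: (@continuous_comp _ _ _ (fun h => (g^-1%g, h))
    (fun p : G * G => (p.1 * p.2)%g)); last exact: mulg_continuous.
  by apply: cvg_pair; [exact: cvg_cst|exact: cvg_id].
exact: (subval_in f).
Qed.

Definition left_translate (g : G) (f : contG) : contG :=
  to_sub (S := contG_sub) (@left_translate_continuous g f).

End ContinuousFunctions.

(** * The Rokhlin property *)

Section Rokhlin.
Variables (R : realType) (G : topGroupType) (A : cstarAlgType R).
Variable alpha : cstarAction G A.

(* Continuity in the uniform topology on functions from nat to A, which
   restricts to the norm topology of [linf A]. *)
Definition linf_alpha : set (linf A) :=
  [set a | continuous
     (fun g => (fun n => alpha g (val a n)) : {uniform nat -> A})].

Definition Ainf_alpha : set (Ainf A) := [set eta a | a in linf_alpha].

Definition centralF_alpha (D : cstarSub A) : set (centralF D) :=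
  [set kappa x | x in [set x : subAlg (commutant D) | Ainf_alpha (val x)]].

(* A homomorphism into the algebra F_alpha(D, A) is a homomorphism into F(D, A)
   with values in it; it is unital when it maps 1 to the unit of
   F_alpha(D, A). *)
Definition rokhlin : Prop :=
  forall (D : cstarSub A) (D_inv : invariant_sub alpha (D : starSub A)),
    separable (D : starSub A) ->
    exists phi : contG R G -> centralF D,
      [/\ star_hom phi,
          forall f, centralF_alpha (phi f),
          forall x, centralF_alpha x ->
            phi (contG1 R G) ** x = x /\ x ** phi (contG1 R G) = x &
          forall g f, phi (left_translate g f) = act_F D_inv g (phi f)].

End Rokhlin.

(** * Crossed products by compact groups *)

HB.mixin Record isHilbert (R : realType) H of CompleteNormedModule R[i] H := {
  dot : H -> H -> R[i] ;
  dot_linear : forall (k : R[i]) x y z, dot (k *: x + y) z = k * dot x z + dot y z ;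
  dot_conj : forall x y, dot y x = (dot x y)^* ;
  dot_norm : forall x, dot x x = `|x| ^+ 2 }.

#[short(type="hilbertType")]
HB.structure Definition Hilbert (R : realType) :=
  {H of isHilbert R H & CompleteNormedModule R[i] H}.

Notation borel G := (g_sigma_algebraType (@open G)).

Section CrossedProduct.
Variables (R : realType) (G : topGroupType) (mu : probability (borel G) R).

Definition left_haar : Prop :=
  forall (g : G) (E : set (borel G)), measurable E ->
    mu ((fun h : G => (g * h)%g) @^-1` E) = mu E.

Definition cintegral (f : G -> R[i]) : R[i] :=
  Complex (\int[mu]_x complex.Re (f x)) (\int[mu]_x complex.Im (f x)).

(* The weak (Pettis) integral. For continuous [F] on compact [G] it exists, and
   it is unique by the Hahn-Banach theorem. *)
Definition vintegral (V : completeNormedModType R[i]) (F : G -> V) : V :=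
  xget 0 [set v | forall phi : V -> R[i]^o, linear phi -> continuous phi ->
                    phi v = cintegral (fun g => phi (F g))].

Variables (A : cstarAlgType R) (alpha : cstarAction G A).

(* No modular function appears, compact groups being unimodular. *)
Definition conv (f f' : G -> A) : G -> A :=
  fun s => vintegral (fun r => f r ** alpha r (f' (r^-1 * s)%g)).

Definition conv_star (f : G -> A) : G -> A :=
  fun s => alpha s (star (f s^-1%g)).

Record covariant_rep (H : hilbertType R) (pi : A -> H -> H) (U : G -> H -> H) :
  Prop := {
  cov_pi_linear : forall a, linear (pi a) ;
  cov_pi_bounded : forall a, continuous (pi a) ;
  cov_piD : forall (k : R[i]) a b x, pi (k *: a + b) x = k *: pi a x + pi b x ;
  cov_piM : forall a b x, pi (a ** b) x = pi a (pi b x) ;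
  cov_piV : forall a x y, dot (pi (star a) x) y = dot x (pi a y) ;
  cov_U_linear : forall g, linear (U g) ;
  cov_U1 : forall x, U 1%g x = x ;
  cov_UM : forall g h x, U (g * h)%g x = U g (U h x) ;
  cov_U_unitary : forall g x y, dot (U g x) (U g y) = dot x y ;
  cov_U_continuous : forall x, continuous (U^~ x) ;
  cov_covariant : forall g a x, U g (pi a x) = pi (alpha g a) (U g x) }.

Definition integrated_form (H : hilbertType R) (pi : A -> H -> H)
    (U : G -> H -> H) (f : G -> A) : H -> H :=
  fun x => vintegral (fun g => pi (f g) (U g x)).

Definition universal_bound (f : G -> A) (c : R[i]) : Prop :=
  forall (H : hilbertType R) (pi : A -> H -> H) (U : G -> H -> H),
    covariant_rep pi U -> forall x, `|integrated_form pi U f x| <= c * `|x|.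

(* [B] is the completion, via [iota], of the convolution algebra of continuous
   functions from G to A in the universal norm, the supremum of the norms of
   the integrated forms of all covariant representations. *)
Record crossed_product (B : cstarAlgType R) (iota : (G -> A) -> B) : Prop := {
  cp_linear : forall (k : R[i]) (f f' : G -> A), continuous f -> continuous f' ->
    iota (k *: f + f') = k *: iota f + iota f' ;
  cp_conv : forall f f' : G -> A, continuous f -> continuous f' ->
    iota (conv f f') = iota f ** iota f' ;
  cp_star : forall f : G -> A, continuous f -> iota (conv_star f) = star (iota f) ;
  cp_norm_ub : forall f : G -> A, continuous f -> universal_bound f `|iota f| ;
  cp_norm_lub : forall (f : G -> A) (c : R[i]), continuous f -> 0 <= c ->
    universal_bound f c -> `|iota f| <= c ;
  cp_dense : dense [set iota f | f in [set f : G -> A | continuous f]] }.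

End CrossedProduct.

(* Main.v *)
(* Pure infiniteness amounts to comparison: [x^* b x] approximates [a] whenever
   [a] lies in the closed ideal generated by [b]. In the presence of comparison,
   the absence of characters is equivalent to every positive [a] being properly
   infinite: [y^* a y] and [z^* a z] are close to [a] with [y^* a z] close to 0.

   A partition of unity [(f_i)] of [G] subordinate to translates [k_i U], pushed
   through the Rokhlin homomorphism to sequences [c(f_i)] in [A], turns a
   solution [x] in [A] into [\sum_i c(f_i) alpha_(k_i)(x)], which is nearly
   invariant and solves the same equations as long as the data are invariant;
   averaging makes it invariant. Hence comparison and proper infiniteness pass
   from [A] to [A^alpha].

   For the crossed product write [kp y] for the image of the constant function
   [y]. The Rokhlin property makes the elements [kp y (kp z)^*] span a dense
   subspace, while [(kp y)^* kp z = kp E(y^* z)] with [E] the conditional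
   expectation onto [A^alpha]. With [S_i] in [A^alpha] such that [S_i^* S_j] is
   close to [delta_ij a], for [a] acting as a unit, the elements
   [Q = \sum_i kp(S_i) (kp w_i)^*] compress the crossed product into
   [kp A^alpha], and [Q^* Q] runs through an approximate unit. So comparison
   passes from [A^alpha] to the crossed product. *)

(* The Rokhlin homomorphism takes values in a quotient by an annihilator, so its lifts [c f] satisfy
   the identities only asymptotically and only against elements of a separable invariant [D]; every
   estimate is arranged to keep a factor from [D]. The sum [\sum_i c(f_i) alpha_(k_i)(x)]
   discretizes the orbit function [t |-> alpha_t(x)], a fixed point of [C(G, A)] under the diagonal
   action. Such sums must be bounded independently of the number of terms, which is why the
   partition consists of squares.

   Proper infiniteness without characters rests on ideals: what a positive [a] absorbs forms a
   closed ideal, and by comparison it contains every square-zero element of the ideal of [a]. If it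
   misses [a], a larger ideal [J] that is prime for orthogonal pairs makes the ideal of [a]
   one-dimensional modulo [J], and multiplication on that line is a character of [A].

   Since the algebras may lack units, positivity is developed in the unitization from a single tool,
   an iterative square root; spectra never appear. *)
Require Import Defs.
From HB Require Import structures.
From mathcomp Require Import all_boot all_order all_algebra.
From mathcomp Require Import all_classical all_reals all_analysis.
From mathcomp Require Import complex ring lra measurable_realfun.
Set Implicit Arguments.
Unset Strict Implicit.
Unset Printing Implicit Defensive.
Import Order.TTheory GRing.Theory Num.Theory.
Import numFieldNormedType.Exports.
Local Open Scope classical_set_scope.
Local Open Scope ring_scope.

(* The square-zero extension [K * V] is a commutative ring, so that the [ring]
   tactic decides linear identities in [V]. *)
Section SquareZero.
Variables (K : comNzRingType) (V : lmodType K).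

Definition sqz : Type := (K * V)%type.
HB.instance Definition _ := GRing.Zmodule.on sqz.

Definition sqz_mul (a b : sqz) : sqz := (a.1 * b.1, a.1 *: b.2 + b.1 *: a.2).
Definition sqz1 : sqz := (1, 0).

Lemma sqz_mulA : associative sqz_mul.
Proof.
move=> a b c; rewrite /sqz_mul /= mulrA; congr pair.
rewrite !scalerDr !scalerA addrA; congr (_ + _).
  by congr (_ + _); rewrite mulrC.
by rewrite mulrC.
Qed.

Lemma sqz_mulC : commutative sqz_mul.
Proof. by move=> a b; rewrite /sqz_mul mulrC addrC. Qed.

Lemma sqz_mul1 : left_id sqz1 sqz_mul.
Proof. by move=> [a x]; rewrite /sqz_mul /= mul1r scale1r scaler0 addr0. Qed.

Lemma sqz_mulDl : left_distributive sqz_mul +%R.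
Proof.
move=> a b c; rewrite /sqz_mul /= mulrDl; congr pair => /=.
by rewrite scalerDl scalerDr addrACA.
Qed.

Lemma sqz1_neq0 : sqz1 != 0.
Proof. by rewrite xpair_eqE negb_and oner_neq0. Qed.

HB.instance Definition _ := GRing.Zmodule_isComNzRing.Build sqz
  sqz_mulA sqz_mulC sqz_mul1 sqz_mulDl sqz1_neq0.

Definition sqzV (x : V) : sqz := (0, x).
Definition sqzK (k : K) : sqz := (k, 0).

Lemma sqzV_inj : injective sqzV.
Proof. by move=> x y []. Qed.

Lemma sqzV0 : sqzV 0 = 0. Proof. by []. Qed.

Lemma sqzVD x y : sqzV (x + y) = sqzV x + sqzV y.
Proof. by congr pair; rewrite addr0. Qed.

Lemma sqzVN x : sqzV (- x) = - sqzV x.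
Proof. by congr pair; rewrite oppr0. Qed.

Lemma sqzVMn x n : sqzV (x *+ n) = sqzV x *+ n.
Proof. by elim: n => // n IH; rewrite !mulrS sqzVD IH. Qed.

Lemma sqzVZ k x : sqzV (k *: x) = sqzK k * sqzV x.
Proof. by congr pair; rewrite /= ?mulr0// scale0r addr0. Qed.

Lemma sqzK_zmod : zmod_morphism sqzK.
Proof. by move=> k l; congr pair; rewrite subr0. Qed.

Lemma sqzK_monoid : monoid_morphism sqzK.
Proof. by split=> // k l; congr pair; rewrite /= !scaler0 addr0. Qed.

HB.instance Definition _ := GRing.isZmodMorphism.Build K sqz sqzK sqzK_zmod.
HB.instance Definition _ := GRing.isMonoidMorphism.Build K sqz sqzK sqzK_monoid.

End SquareZero.

Ltac lin :=
  apply: sqzV_inj;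
  rewrite ?(sqzVD, sqzVN, sqzVZ, sqzV0, sqzVMn, rmorphM, rmorphD, rmorphN); ring.

(** * Real-valued norms and limits expressed by them *)

Section RealNorm.
Variable R : realType.

(** Norms are values in [R[i]], whose order is only partial; their real parts are open to [lra] and
    [nra]. *)
Definition nm (V : normedModType R[i]) (x : V) : R := complex.Re `|x|.

Section Theory.
Variable V : normedModType R[i].
Implicit Types x y z : V.

Lemma nmE x : `|x| = (nm x)%:C%C.
Proof.
have := normr_ge0 x; rewrite /nm; case: (`|x|) => a b /=.
by rewrite lecE /= => /andP[/eqP -> _].
Qed.

Lemma nm_ge0 x : 0 <= nm x.
Proof. by have := normr_ge0 x; rewrite nmE lecE /= => /andP[]. Qed.

Lemma nmle x (r : R) : (nm x <= r) = (`|x| <= r%:C%C).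
Proof. by rewrite nmE lecE /= eqxx. Qed.

Lemma nmlt x (r : R) : (nm x < r) = (`|x| < r%:C%C).
Proof. by rewrite nmE ltcE /= eqxx. Qed.

Lemma nmD x y : nm (x + y) <= nm x + nm y.
Proof. by rewrite nmle rmorphD /= -!nmE ler_normD. Qed.

Lemma nmN x : nm (- x) = nm x.
Proof. by rewrite /nm normrN. Qed.

Lemma nmB x y : nm (x - y) <= nm x + nm y.
Proof. by rewrite -(nmN y) nmD. Qed.

Lemma nmBC x y : nm (x - y) = nm (y - x).
Proof. by rewrite -nmN opprB. Qed.

Lemma nm0 : nm (0 : V) = 0.
Proof. by rewrite /nm normr0. Qed.

Lemma nm_eq0 x : nm x = 0 -> x = 0.
Proof. by move=> x0; apply/normr0_eq0; rewrite nmE x0. Qed.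

Lemma nm_le0 x : nm x <= 0 -> x = 0.
Proof. by move=> x0; apply: nm_eq0; apply/eqP; rewrite eq_le x0 nm_ge0. Qed.

Lemma nm_tri z x y : nm (x - y) <= nm (x - z) + nm (z - y).
Proof. by rewrite -{1}(subrK z x) -addrA nmD. Qed.

Lemma nm_sum (I : Type) (r : seq I) (P : pred I) (F : I -> V) :
  nm (\sum_(i <- r | P i) F i) <= \sum_(i <- r | P i) nm (F i).
Proof.
apply: (big_ind2 (fun x (a : R) => nm x <= a)) => [|x a y b xa yb|//].
  by rewrite nm0.
by rewrite (le_trans (nmD _ _))// lerD.
Qed.

Lemma nm_small x : (forall e : R, 0 < e -> nm x <= e) -> x = 0.
Proof.
by move=> H; apply/nm_le0/ler_addgt0Pl => e e0; rewrite addr0 H.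
Qed.

End Theory.

Lemma nmC (k : R[i]) : `|k| = (nm (k : R[i]^o))%:C%C.
Proof. by rewrite -nmE. Qed.

Lemma nmZ (V : normedModType R[i]) (k : R[i]) (x : V) :
  nm (k *: x) = nm (k : R[i]^o) * nm x.
Proof. by rewrite /nm normrZ !nmE -rmorphM. Qed.

Lemma nm_real (r : R) : nm (r%:C%C : R[i]^o) = `|r|.
Proof. by rewrite /nm normc_def /= expr0n addr0 sqrtr_sqr. Qed.

Lemma nmZr (V : normedModType R[i]) (r : R) (x : V) :
  nm (r%:C%C *: x) = `|r| * nm x.
Proof. by rewrite nmZ nm_real. Qed.

Lemma nmM (A : cstarAlgType R) (x y : A) : nm (x ** y) <= nm x * nm y.
Proof. by rewrite nmle rmorphM /= -!nmE norm_smul. Qed.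

Lemma nm_star (A : cstarAlgType R) (x : A) : nm (star x) = nm x.
Proof. by rewrite /nm norm_star. Qed.

Lemma nm_cstar (A : cstarAlgType R) (x : A) : nm (star x ** x) = nm x ^+ 2.
Proof. by rewrite /nm norm_cstar nmE -rmorphXn. Qed.

Lemma nm_cstarr (A : cstarAlgType R) (x : A) : nm (x ** star x) = nm x ^+ 2.
Proof. by rewrite -{1}[x]starK nm_cstar nm_star. Qed.

Lemma le_sqr_nm (a b : R) : 0 <= a -> 0 <= b -> a ^+ 2 <= b ^+ 2 -> a <= b.
Proof. by move=> a0 b0; rewrite ler_pXn2r. Qed.

(** The form in which the C*-identity delivers bounds: [|x|^2 = |x^* x| <= m |x|], and one factor
    cancels. *)
Lemma le_mul_nm (a m : R) : 0 <= a -> 0 <= m -> a ^+ 2 <= m * a -> a <= m.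
Proof.
move=> a0 m0 h; case: (eqVneq a 0) => [->//|an].
by rewrite -(ler_pM2r (_ : 0 < a)) -?expr2// lt_neqAle eq_sym an.
Qed.

Lemma half_norm_nm (V : normedModType R[i]) (x y : V) : nm x <= nm (x - y) + nm y.
Proof. by rewrite -{1}(subrK y x) nmD. Qed.

Lemma nm_cvg (V : normedModType R[i]) (u : nat -> V) (l : V) :
  (forall e : R, 0 < e -> exists N, forall n, (N <= n)%N -> nm (u n - l) <= e) ->
  u @ \oo --> l.
Proof.
move=> H; apply/cvgrPdist_le => e e0.
have e1 : 0 < complex.Re e by move: e0; rewrite ltcE /= => /andP[].
have eE : e = (complex.Re e)%:C%C.
  by case: (e) e0 => a b; rewrite ltcE /= => /andP[/eqP -> _].
have [N HN] := H _ e1.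
by exists N => // n /= /HN; rewrite nmle distrC -eE.
Qed.

Lemma cvg_nm (V : normedModType R[i]) (u : nat -> V) (l : V) :
  u @ \oo --> l ->
  forall e : R, 0 < e -> exists N, forall n, (N <= n)%N -> nm (u n - l) <= e.
Proof.
move=> /cvgrPdist_le H e e0.
have e1 : 0 < e%:C%C :> R[i] by rewrite ltcE /= eqxx.
have [N _ HN] := H _ e1; exists N => n Nn.
by rewrite nmle distrC; exact: HN.
Qed.

Lemma closed_nm (V : normedModType R[i]) (S : set V) (x : V) : closed S ->
  (forall e : R, 0 < e -> exists2 y, S y & nm (x - y) <= e) -> S x.
Proof.
move=> cS H; apply: cS => B /nbhs_ballP[e /= e0 eB].
have e1 : 0 < complex.Re e / 2.
  by move: e0; rewrite ltcE /= => /andP[_ ?]; rewrite divr_gt0.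
have eE : e = (complex.Re e)%:C%C.
  by case: (e) e0 => a b; rewrite ltcE /= => /andP[/eqP -> _].
have [y Sy xy] := H _ e1; exists y; split => //; apply: eB.
rewrite -ball_normE /= eE -nmlt; apply: le_lt_trans xy _.
by rewrite ltr_pdivrMr// ltr_pMr; [lra|lra].
Qed.

Lemma nm_closed (V : normedModType R[i]) (S : set V) :
  (forall x, (forall e : R, 0 < e -> exists2 y, S y & nm (x - y) <= e) -> S x) ->
  closed S.
Proof.
move=> H x clx; apply: H => e e0.
have e1 : 0 < e%:C%C :> R[i] by rewrite ltcE /= eqxx.
have [y [Sy]] := clx _ (nbhsx_ballx x _ e1).
by rewrite -ball_normE /= => /ltW xy; exists y => //; rewrite nmle.
Qed.

Lemma nm_complete (V : completeNormedModType R[i]) (u : nat -> V) :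
  (forall e : R, 0 < e -> exists N, forall n m, (N <= n)%N -> (n <= m)%N ->
     nm (u m - u n) <= e) ->
  exists l : V, u @ \oo --> l.
Proof.
move=> H; suff : cvgn u by move=> /cvg_ex.
apply/cauchy_cvgP/cauchyP => e e0.
have e1 : 0 < complex.Re e / 2.
  by move: e0; rewrite ltcE /= => /andP[_ ?]; rewrite divr_gt0.
have eE : e = (complex.Re e)%:C%C.
  by case: (e) e0 => a b; rewrite ltcE /= => /andP[/eqP -> _].
have [N HN] := H _ e1.
exists (u N); exists N => // n /= Nn; rewrite -ball_normE /= eE -nmlt nmBC.
apply: le_lt_trans (HN _ _ (leqnn _) Nn) _.
by rewrite ltr_pdivrMr// ltr_pMr; lra.
Qed.

End RealNorm.

(** * The unitization and its positive elements *)

Section ComplexLimits.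
Variable R : realType.

Lemma real_complete (u : nat -> R) :
  (forall e : R, 0 < e -> exists N, forall n m, (N <= n)%N -> (n <= m)%N ->
     `|u m - u n| <= e) ->
  exists l : R, forall e : R, 0 < e ->
    exists N, forall n, (N <= n)%N -> `|u n - l| <= e.
Proof.
move=> H; have : cvgn (u : nat -> R^o).
  apply/cauchy_cvgP/cauchyP => e e0; have [N HN] := H _ (divr_gt0 e0 (ltr0n _ 2)).
  exists (u N); exists N => // n /= Nn; rewrite -ball_normE /= distrC.
  by apply: le_lt_trans (HN _ _ (leqnn _) Nn) _; lra.
move=> /cvg_ex[l /cvgrPdist_le ul]; exists l => e /ul[N _ HN]; exists N => n Nn.
by rewrite distrC; exact: HN.
Qed.

Lemma Re_le_nm (z : R[i]) : `|complex.Re z| <= nm (z : R[i]^o).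
Proof.
case: z => a b; rewrite /nm normc_def /= -sqrtr_sqr ler_sqrt ?lerDl ?sqr_ge0//.
by rewrite addr_ge0 ?sqr_ge0.
Qed.

Lemma Im_le_nm (z : R[i]) : `|complex.Im z| <= nm (z : R[i]^o).
Proof.
case: z => a b; rewrite /nm normc_def /= -sqrtr_sqr ler_sqrt ?lerDr ?sqr_ge0//.
by rewrite addr_ge0 ?sqr_ge0.
Qed.

Lemma nm_le_ReIm (z : R[i]) :
  nm (z : R[i]^o) <= `|complex.Re z| + `|complex.Im z|.
Proof.
case: z => a b; rewrite /nm normc_def /=.
rewrite -[leRHS]ger0_norm ?addr_ge0// -sqrtr_sqr ler_sqrt ?sqr_ge0//.
rewrite sqrrD !real_normK ?num_real// -addrA lerD2l lerDr.
by rewrite mulrn_wge0// mulr_ge0.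
Qed.

Lemma complex_complete (u : nat -> R[i]) :
  (forall e : R, 0 < e -> exists N, forall n m, (N <= n)%N -> (n <= m)%N ->
     nm (u m - u n : R[i]^o) <= e) ->
  exists l : R[i], forall e : R, 0 < e ->
    exists N, forall n, (N <= n)%N -> nm (u n - l : R[i]^o) <= e.
Proof.
move=> H.
have [a ua] : exists l : R, forall e : R, 0 < e ->
    exists N, forall n, (N <= n)%N -> `|complex.Re (u n) - l| <= e.
  apply: real_complete => e /H[N HN]; exists N => n m Nn nm'.
  by apply: le_trans (HN _ _ Nn nm'); rewrite -raddfB Re_le_nm.
have [b ub] : exists l : R, forall e : R, 0 < e ->
    exists N, forall n, (N <= n)%N -> `|complex.Im (u n) - l| <= e.
  apply: real_complete => e /H[N HN]; exists N => n m Nn nm'.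
  by apply: le_trans (HN _ _ Nn nm'); rewrite -raddfB Im_le_nm.
exists (Complex a b) => e e0; have e20 : 0 < e / 2 by lra.
have [N HN] := ua _ e20; have [M HM] := ub _ e20; exists (maxn N M) => n.
rewrite geq_max => /andP[/HN h1 /HM h2]; apply: le_trans (nm_le_ReIm _) _.
by rewrite !raddfB /=; lra.
Qed.

Lemma nm1 : nm (1 : R[i]^o) = 1.
Proof. by rewrite /nm normr1. Qed.

Lemma nm_conj (z : R[i]) : nm (z^* : R[i]^o) = nm (z : R[i]^o).
Proof. by rewrite /nm norm_conjC. Qed.

Lemma nmMC (z w : R[i]) : nm (z * w : R[i]^o) = nm (z : R[i]^o) * nm (w : R[i]^o).
Proof. by rewrite -nmZ. Qed.

Lemma conj_real (r : R) : (r%:C%C)^* = r%:C%C :> R[i].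
Proof. by apply: conj_Creal; rewrite complex_real. Qed.

End ComplexLimits.

Section Unitization.
Variables (R : realType) (A : cstarAlgType R).
Local Notation K := R[i].

(** Only an algebra with involution: it never receives a C*-norm, and sizes are measured by [ob].
    This avoids distinguishing whether [A] is already unital. *)
Definition unitz : Type := (K^o * A)%type.
HB.instance Definition _ := GRing.Lmodule.on unitz.

Definition umul (T U : unitz) : unitz :=
  (T.1 * U.1, T.1 *: U.2 + U.1 *: T.2 + T.2 ** U.2).
Definition uone : unitz := (1, 0).

Lemma umulA : associative umul.
Proof.
move=> [a x] [b y] [c z]; rewrite /umul /= mulrA; congr pair.
rewrite !(smulDl, smulDr, smulZl, smulZr, scalerDr, scalerA, smulA).
by lin.
Qed.

Lemma umul1 : left_id uone umul.
Proof.
move=> [a x]; rewrite /umul /= mul1r; congr pair.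
by rewrite smul0l scale1r scaler0 !addr0.
Qed.

Lemma umulr1 : right_id uone umul.
Proof.
move=> [a x]; rewrite /umul /= mulr1; congr pair.
by rewrite smul0r scale1r scaler0 addr0 add0r.
Qed.

Lemma umulDl : left_distributive umul +%R.
Proof.
move=> [a x] [b y] [c z]; rewrite /umul /= mulrDl; congr pair => /=.
rewrite smulDl; by lin.
Qed.

Lemma umulDr : right_distributive umul +%R.
Proof.
move=> [a x] [b y] [c z]; rewrite /umul /= mulrDr; congr pair => /=.
rewrite smulDr; by lin.
Qed.

Lemma uone_neq0 : uone != 0.
Proof. by rewrite xpair_eqE negb_and oner_neq0. Qed.

HB.instance Definition _ := GRing.Zmodule_isNzRing.Build unitz
  umulA umul1 umulr1 umulDl umulDr uone_neq0.

Lemma uscaleAl (k : K) (T U : unitz) : k *: (T * U) = k *: T * U.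
Proof.
case: T U => [a x] [b y]; congr pair => /=; first exact: mulrA.
rewrite smulZl; by lin.
Qed.

HB.instance Definition _ := GRing.Lmodule_isLalgebra.Build K unitz uscaleAl.

Lemma uscaleAr (k : K) (T U : unitz) : k *: (T * U) = T * (k *: U).
Proof.
case: T U => [a x] [b y]; congr pair => /=; first exact: mulrCA.
rewrite smulZr; by lin.
Qed.

HB.instance Definition _ := GRing.Lalgebra_isAlgebra.Build K unitz uscaleAr.

Implicit Types S T U : unitz.

Definition ustar T : unitz := ((T.1)^*, star T.2).

Lemma ustarK : involutive ustar.
Proof. by case=> a x; rewrite /ustar /= conjCK starK. Qed.

Lemma ustarD : {morph ustar : T U / T + U}.
Proof. by move=> [a x] [b y]; congr pair => /=; rewrite ?rmorphD ?starD. Qed.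

Lemma ustarZ (k : K) T : ustar (k *: T) = k^* *: ustar T.
Proof. by case: T => a x; congr pair => /=; rewrite ?rmorphM ?starZ. Qed.

Lemma ustarZr (r : R) T : ustar (r%:C%C *: T) = r%:C%C *: ustar T.
Proof. by rewrite ustarZ conj_real. Qed.

Lemma ustarN T : ustar (- T) = - ustar T.
Proof. by rewrite -scaleN1r ustarZ rmorphN1 scaleN1r. Qed.

Lemma ustarB T U : ustar (T - U) = ustar T - ustar U.
Proof. by rewrite ustarD ustarN. Qed.

Lemma ustar1 : ustar 1 = 1.
Proof. by congr pair => /=; rewrite ?conjC1 ?star0. Qed.

Lemma ustar0 : ustar 0 = 0.
Proof. by congr pair => /=; rewrite ?conjC0 ?star0. Qed.

Lemma ustarM T U : ustar (T * U) = ustar U * ustar T.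
Proof.
case: T U => [a x] [b y]; congr pair => /=; first by rewrite rmorphM mulrC.
by rewrite !starD !starZ starM [_ *: star y + _]addrC.
Qed.

Lemma ustarX T n : ustar (T ^+ n) = ustar T ^+ n.
Proof.
elim: n => [|n IH]; first by rewrite !expr0 ustar1.
by rewrite exprS exprSr ustarM IH.
Qed.

Definition em (a : A) : unitz := (0, a).

Lemma em_inj : injective em.
Proof. by move=> x y []. Qed.

Lemma em0 : em 0 = 0. Proof. by []. Qed.

Lemma emD a b : em (a + b) = em a + em b.
Proof. by congr pair; rewrite addr0. Qed.

Lemma emN a : em (- a) = - em a.
Proof. by congr pair; rewrite oppr0. Qed.

Lemma emB a b : em (a - b) = em a - em b.
Proof. by rewrite emD emN. Qed.

Lemma emM a b : em (a ** b) = em a * em b.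
Proof. by congr pair; rewrite /= ?mulr0// !scale0r !add0r. Qed.

Lemma emZ (k : K) a : em (k *: a) = k *: em a.
Proof. by congr pair; rewrite /= /GRing.scale /= mulr0. Qed.

Lemma em_star a : em (star a) = ustar (em a).
Proof. by congr pair; rewrite /= conjC0. Qed.

(** The left multiplier that [T] induces on the ideal [A]. *)
Definition ua T (b : A) : A := T.1 *: b + T.2 ** b.

Lemma em_ua T b : em (ua T b) = T * em b.
Proof. by congr pair; rewrite /= ?mulr0// scale0r addr0. Qed.

Lemma ua_em a b : ua (em a) b = a ** b.
Proof. by rewrite /ua scale0r add0r. Qed.

Lemma uaM T U b : ua (T * U) b = ua T (ua U b).
Proof. by apply: em_inj; rewrite !em_ua mulrA. Qed.

Lemma uaD T U b : ua (T + U) b = ua T b + ua U b.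
Proof. by apply: em_inj; rewrite emD !em_ua mulrDl. Qed.

Lemma uaZ (k : K) T b : ua (k *: T) b = k *: ua T b.
Proof. by apply: em_inj; rewrite emZ !em_ua -scalerAl. Qed.

Lemma uaN T b : ua (- T) b = - ua T b.
Proof. by rewrite -scaleN1r uaZ scaleN1r. Qed.

Lemma ua1 b : ua 1 b = b.
Proof. by apply: em_inj; rewrite em_ua mul1r. Qed.

Lemma ua_star T a b : star (ua T a) ** b = star a ** ua (ustar T) b.
Proof.
by apply: em_inj; rewrite !(emM, em_star, em_ua) ustarM mulrA.
Qed.

(* A bound on the norm of [T] in [K * M(A)], which dominates the norm of the
   scalar component even when [A] already has a unit. *)
Definition ob T (M : R) : Prop :=
  nm (T.1 : K^o) <= M /\ forall b, nm (ua T b) <= M * nm b.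

Lemma ob_ge0 T M : ob T M -> 0 <= M.
Proof. by case=> h _; apply: le_trans h; exact: nm_ge0. Qed.

Lemma ob_le T M N : M <= N -> ob T M -> ob T N.
Proof.
move=> MN [h1 h2]; split=> [|b]; first exact: le_trans MN.
by apply: le_trans (h2 b) _; rewrite ler_wpM2r ?nm_ge0.
Qed.

Lemma obD T U M N : ob T M -> ob U N -> ob (T + U) (M + N).
Proof.
move=> [t1 t2] [u1 u2]; split=> [|b].
  by apply: le_trans (nmD _ _) _; rewrite lerD.
by rewrite uaD mulrDl; apply: le_trans (nmD _ _) _; rewrite lerD.
Qed.

Lemma obN T M : ob T M -> ob (- T) M.
Proof. by case=> t1 t2; split=> [|b]; rewrite ?uaN nmN. Qed.

Lemma obB T U M N : ob T M -> ob U N -> ob (T - U) (M + N).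
Proof. by move=> hT hU; apply: obD => //; exact: obN. Qed.

Lemma obZ (r : R) T M : ob T M -> ob (r%:C%C *: T) (`|r| * M).
Proof.
move=> [t1 t2]; split=> [|b]; first by rewrite /= nmZr ler_wpM2l.
by rewrite uaZ nmZr -mulrA ler_wpM2l.
Qed.

Lemma obM T U M N : ob T M -> ob U N -> ob (T * U) (M * N).
Proof.
move=> hT hU; have M0 := ob_ge0 hT; case: hT hU => t1 t2 [u1 u2]; split=> [|b].
  by rewrite /= nmMC ler_pM ?nm_ge0.
by rewrite uaM -mulrA; apply: le_trans (t2 _) _; rewrite ler_wpM2l.
Qed.

Lemma ob1 : ob 1 1.
Proof. by split=> [|b]; rewrite ?nm1// ua1 mul1r. Qed.

Lemma ob0 : ob 0 0.
Proof. by split=> [|b]; rewrite ?nm0// /ua scale0r smul0l addr0 nm0 mul0r. Qed.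

Lemma obX T M n : ob T M -> ob (T ^+ n) (M ^+ n).
Proof.
move=> hT; elim: n => [|n IH]; first by rewrite !expr0; exact: ob1.
by rewrite !exprS; exact: obM.
Qed.

Lemma ob_ex T : exists2 M, 0 < M & ob T M.
Proof.
exists (nm (T.1 : K^o) + nm T.2 + 1).
  by rewrite ltr_wpDl// addr_ge0 ?nm_ge0.
split=> [|b]; first by have := nm_ge0 T.2; lra.
rewrite /ua (le_trans (nmD _ _))// nmZ.
have := nmM T.2 b; have := nm_ge0 b; nra.
Qed.

(** The C*-identity is applied inside [A]: [|T b|^2 = |b^* (T^* T b)|]. *)
Lemma ob_cstar T M : 0 <= M -> ob (ustar T * T) (M ^+ 2) -> ob T M.
Proof.
move=> M0 [h1 h2]; split=> [|b].
  apply: le_sqr_nm; rewrite ?nm_ge0//; apply: le_trans h1.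
  by rewrite /= nmMC nm_conj.
apply: le_sqr_nm; rewrite ?nm_ge0 ?mulr_ge0 ?nm_ge0//.
rewrite -nm_cstar ua_star -uaM; apply: le_trans (nmM _ _) _.
rewrite nm_star exprMn expr2 mulrCA ler_wpM2l ?nm_ge0//.
Qed.

Lemma ob_ustar T M : ob T M -> ob (ustar T) M.
Proof.
move=> hT; have M0 := ob_ge0 hT; case: hT => h1 h2; split=> [|b].
  by rewrite /= nm_conj.
apply: le_mul_nm; rewrite ?nm_ge0 ?mulr_ge0 ?nm_ge0//.
rewrite -nm_cstar ua_star ustarK; apply: le_trans (nmM _ _) _.
rewrite nm_star [leRHS]mulrAC mulrC ler_wpM2r ?nm_ge0//.
Qed.

(** [T.2 ** star T.2] differs from [ua T (star T.2)] by a scalar multiple of [star T.2]. Thus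
    smallness in the sense of [ob] controls both components, which yields completeness and
    uniqueness of limits. *)
Lemma ob_snd T M : ob T M -> nm T.2 <= M + M.
Proof.
move=> hT; have M0 := ob_ge0 hT; case: hT => h1 h2.
apply: le_mul_nm; rewrite ?nm_ge0 ?addr_ge0//.
rewrite -nm_cstarr -[T.2 ** _](addKr (T.1 *: star T.2)) addrC.
apply: le_trans (nmB _ _) _; rewrite nmZ nm_star mulrDl lerD//.
  by have := h2 (star T.2); rewrite nm_star.
by rewrite ler_wpM2r ?nm_ge0.
Qed.

Lemma ob_em a M : ob (em a) M <-> nm a <= M.
Proof.
split=> [hT|aM]; last first.
  split=> [|b]; first by rewrite nm0 (le_trans (nm_ge0 a)).
  by rewrite ua_em (le_trans (nmM _ _))// ler_wpM2r ?nm_ge0.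
have M0 := ob_ge0 hT; case: hT => h1 h2.
apply: le_mul_nm; rewrite ?nm_ge0//.
by rewrite -nm_cstarr -ua_em -(nm_star a).
Qed.

Lemma ob_small T : (forall e : R, 0 < e -> ob T e) -> T = 0.
Proof.
move=> H; rewrite [T]surjective_pairing; congr pair.
  by apply: (@nm_small _ K^o) => e e0; have [] := H _ e0.
apply: nm_small => e e0; have e20 : 0 < e / 2 by lra.
by apply: le_trans (ob_snd (H _ e20)) _; lra.
Qed.

(** Completeness of the unitization in a form that keeps the rate [e]. *)
Lemma ob_lim (k : nat -> unitz) (e : nat -> R) :
  (forall d : R, 0 < d -> exists N, forall n, (N <= n)%N -> e n <= d) ->
  (forall n m, (n <= m)%N -> ob (k m - k n) (e n)) ->
  exists T, forall n, ob (T - k n) (e n).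
Proof.
move=> e0 H.
have [l hl] : exists l : K, forall d : R, 0 < d ->
    exists N, forall n, (N <= n)%N -> nm ((k n).1 - l : K^o) <= d.
  apply: complex_complete => d /e0[N HN]; exists N => n m Nn nm'.
  by apply: le_trans (HN _ Nn); have [] := H _ _ nm'.
have [x /cvg_nm hx] : exists x : A, (fun n => (k n).2) @ \oo --> x.
  apply: nm_complete => d d0; have d20 : 0 < d / 2 by lra.
  have [N HN] := e0 _ d20; exists N => n m Nn nm'.
  have := ob_snd (H _ _ nm'); rewrite /= => /le_trans; apply.
  by have := HN _ Nn; lra.
exists (l, x) => n; split=> [|b] /=.
  apply/ler_addgt0Pl => d d0; have [N HN] := hl _ d0.
  apply: le_trans (nm_tri (k (maxn N n)).1 _ _) _.
  rewrite nmBC; apply: lerD; first by apply: HN; exact: leq_maxl.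
  by have [] := H n (maxn N n) (leq_maxr _ _).
apply/ler_addgt0Pl => d d0.
pose c := nm b + 1; have c0 : 0 < c by rewrite ltr_wpDl ?nm_ge0.
have dc : 0 < d / c / 2 by rewrite !divr_gt0.
have [N HN] := hl _ dc; have [M HM] := hx _ dc; pose m := maxn n (maxn N M).
have -> : ua ((l, x) - k n) b = ua ((l, x) - k m) b + ua (k m - k n) b.
  by rewrite -uaD addrA subrK.
apply: le_trans (nmD _ _) _; apply: lerD; last first.
  by have [_] := H n m (leq_maxl _ _); exact.
have h1 : nm (l - (k m).1 : K^o) <= d / c / 2.
  by rewrite nmBC; apply: HN; rewrite /m !leq_max leqnn !orbT.
have h2 : nm (x - (k m).2) <= d / c / 2.
  by rewrite nmBC; apply: HM; rewrite /m !leq_max leqnn !orbT.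
rewrite /ua /=; apply: le_trans (nmD _ _) _; rewrite nmZ.
apply: (@le_trans _ _ (d / c * nm b)).
  have := nmM (x - (k m).2) b; have b0 := nm_ge0 b.
  have := ler_wpM2r b0 h1; have := ler_wpM2r b0 h2; lra.
rewrite -[leRHS](divfK (lt0r_neq0 c0)) ler_wpM2l ?divr_ge0 ?ltW//.
by rewrite /c ltrDl.
Qed.

End Unitization.

(** Expands all products, after which [lin] treats the noncommutative monomials as vectors. *)
Ltac ncring :=
  rewrite ?expr2 ?(mulrDl, mulrDr, mulrBl, mulrBr, mulrN, mulNr, mul1r, mulr1,
    mul0r, mulr0, =^~ scalerAl, =^~ scalerAr, mulrA); lin.

(** * Square roots by iteration *)

Section SquareRoot.
Variables (R : realType) (A : cstarAlgType R).
Implicit Types S T U Y : unitz A.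

Fixpoint kap (n : nat) : R := if n is m.+1 then 2^-1 * (1 + kap m ^+ 2) else 0.

(** With [d_n = 1 - kap n] the recursion reads [d_(n+1) = d_n - d_n^2 / 2], whence a decay of order
    [2 / n]. *)
Lemma kap_bound n : [/\ 0 <= kap n, kap n <= 1 & 1 - kap n <= 2 / (n.+2)%:R].
Proof.
elim: n => [|n [k0 k1 IH]] /=; first by split; lra.
split; [nra|nra|].
pose m : R := n.+2%:R; have m0 : 2 <= m by rewrite /m ler_nat.
have -> : n.+3%:R = m + 1 by rewrite /m -natr1.
move: IH; rewrite -/m !ler_pdivlMr; [|lra|lra].
move: k0 k1; set k := kap n; move=> k0 k1 h.
have [d0 d1] : 0 <= 1 - k /\ 1 - k <= 1 by lra.
have -> : 1 - 2^-1 * (1 + k ^+ 2) = (1 - k) - (1 - k) ^+ 2 / 2 by field.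
move: d0 d1 h; set d := 1 - k; move=> d0 d1 h.
(* [x - x^2 / 2] increases on [0, 1] *)
nra.
Qed.

Lemma kap_small (d : R) : 0 < d ->
  exists N, forall n, (N <= n)%N -> 1 - kap n <= d.
Proof.
move=> d0; pose N := Num.bound (2 / d); exists N => n Nn.
have [_ _ h] := kap_bound n; apply: le_trans h _.
rewrite ler_pdivrMr ?ltr0n// mulrC -ler_pdivrMr//.
apply: ltW; apply: lt_le_trans (archi_boundP _) _.
  by rewrite divr_ge0// ltW.
by rewrite ler_nat (leq_trans Nn)// -addn2 leq_addr.
Qed.

(** No involution is demanded: closed ideals qualify before their self-adjointness is known, and so
    do annihilators [m ** z = 0]. Tracking [Q] through all constructions shows that roots, parts and
    approximate units stay in it. *)
Definition closed_subalg (Q : set A) : Prop :=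
  [/\ closed Q, Q 0, forall (k : R[i]) x y, Q x -> Q y -> Q (k *: x + y) &
      forall x y, Q x -> Q y -> Q (x ** y)].

Lemma closed_subalgZ Q k x : closed_subalg Q -> Q x -> Q (k *: x).
Proof. by case=> _ Q0 QD _ Qx; rewrite -[_ *: _]addr0; exact: QD. Qed.

Lemma closed_subalgD Q x y : closed_subalg Q -> Q x -> Q y -> Q (x + y).
Proof. by case=> _ _ QD _ Qx Qy; rewrite -[x]scale1r; exact: QD. Qed.

Lemma closed_subalgN Q x : closed_subalg Q -> Q x -> Q (- x).
Proof. by rewrite -scaleN1r; exact: closed_subalgZ. Qed.

Lemma closed_subalgM Q x y : closed_subalg Q -> Q x -> Q y -> Q (x ** y).
Proof. by case=> _ _ _; exact. Qed.

Let half : R[i] := (2^-1 : R)%:C%C.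

Lemma half2 T : half *: (T + T) = T.
Proof.
rewrite -mulr2n -scaler_nat scalerA /half.
have -> : 2%:R = (2 : R)%:C%C :> R[i] by rewrite rmorph_nat.
by rewrite -rmorphM /= mulVf// scale1r.
Qed.

Fixpoint sqit Y n : unitz A :=
  if n is m.+1 then half *: (Y + sqit Y m * sqit Y m) else 0.

Lemma sqit_comm Y T n : T * Y = Y * T -> T * sqit Y n = sqit Y n * T.
Proof.
move=> TY; elim: n => [|n IH] /=; first by rewrite mulr0 mul0r.
rewrite -scalerAr -scalerAl mulrDr mulrDl TY; congr (_ *: (_ + _)).
by rewrite mulrA IH -!mulrA IH.
Qed.

Lemma sqit_ob Y n : ob Y 1 -> ob (sqit Y n) (kap n).
Proof.
move=> hY; elim: n => [|n IH] /=; first exact: ob0.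
rewrite -(ger0_norm (_ : 0 <= 2^-1)) ?invr_ge0//.
by apply: obZ; apply: obD => //; rewrite expr2; exact: obM.
Qed.

(** All iterates commute, so a difference of consecutive squares factors as sum times difference;
    [kap] obeys the same factorization, which lets the bound be carried along by induction. *)
Lemma sqit_step Y n : ob Y 1 -> ob (sqit Y n.+1 - sqit Y n) (kap n.+1 - kap n).
Proof.
move=> hY; elim: n => [|n IH].
  rewrite subr0 [kap 0]/= subr0; exact: sqit_ob.
have -> : sqit Y n.+2 - sqit Y n.+1 =
    half *: ((sqit Y n.+1 + sqit Y n) * (sqit Y n.+1 - sqit Y n)).
  have c : sqit Y n * sqit Y n.+1 = sqit Y n.+1 * sqit Y n.
    by apply: sqit_comm; rewrite -(@sqit_comm Y Y).
  have E1 : sqit Y n.+2 = half *: (Y + sqit Y n.+1 * sqit Y n.+1) by [].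
  have E2 : sqit Y n.+1 = half *: (Y + sqit Y n * sqit Y n) by [].
  rewrite E1 {2}E2 -scalerBr; congr (_ *: _).
  rewrite mulrBr !mulrDl c; lin.
have -> : kap n.+2 - kap n.+1 =
    `|2^-1| * ((kap n.+1 + kap n) * (kap n.+1 - kap n)).
  rewrite ger0_norm ?invr_ge0// [kap n.+2]/= -/(kap n.+1) [X in _ - X]/=.
  by rewrite [kap n.+1]/=; field.
by apply: obZ; apply: obM => //; apply: obD; exact: sqit_ob.
Qed.

Lemma sqit_cauchy Y n m : ob Y 1 -> (n <= m)%N ->
  ob (sqit Y m - sqit Y n) (kap m - kap n).
Proof.
move=> hY /subnKC <-; elim: (m - n)%N => [|d IH].
  by rewrite addn0 !subrr; exact: ob0.
rewrite addnS; set m' := (n + d)%N.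
have -> : sqit Y m'.+1 - sqit Y n =
    (sqit Y m'.+1 - sqit Y m') + (sqit Y m' - sqit Y n).
  by rewrite addrA subrK.
have -> : kap m'.+1 - kap n = (kap m'.+1 - kap m') + (kap m' - kap n).
  by rewrite addrA subrK.
by apply: obD => //; exact: sqit_step.
Qed.

(* With [Y = 1 - S], the limit [L] of [L' = (Y + L^2) / 2] satisfies
   [(1 - L)^2 = S]; the scalar iteration [kap] majorizes the operator one. *)
Lemma ob_sqrt S : ustar S = S -> ob (1 - S) 1 ->
  exists T, [/\ ustar T = T, T * T = S, ob (1 - T) 1,
    (forall U, U * S = S * U -> U * T = T * U) &
    (forall Q, closed_subalg Q -> Q S.2 -> Q T.2)].
Proof.
move=> Ss hY; set Y := 1 - S in hY.
have [||L HL] := @ob_lim _ _ (sqit Y) (fun n => 1 - kap n).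
- exact: kap_small.
- move=> n m nm'; apply: ob_le (sqit_cauchy hY nm').
  by have [_ h _] := kap_bound m; lra.
have hL : ob L 1 by have := HL 0%N; rewrite /= !subr0.
have LE : L = half *: (Y + L * L).
  apply/subr0_eq/ob_small => e e0; have e20 : 0 < e / 2 by lra.
  have [N HN] := kap_small e20; have h1 := HL N.+1; have h2 := HL N.
  have -> : L - half *: (Y + L * L) = (L - sqit Y N.+1) -
      half *: ((L - sqit Y N) * L + sqit Y N * (L - sqit Y N)).
    rewrite [sqit Y N.+1]/=; ncring.
  have hk := HN _ (leqnn _); have hk1 := HN _ (leqnSn _).
  have hs : ob (sqit Y N) 1.
    by apply: ob_le (sqit_ob N hY); have [] := kap_bound N.
  apply: ob_le (obB h1 (obZ 2^-1 (obD (obM h2 hL) (obM hs h2)))).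
  by rewrite ger0_norm ?invr_ge0//; lra.
have Ls : ustar L = L.
  apply/subr0_eq/ob_small => e e0; have e20 : 0 < e / 2 by lra.
  have [N HN] := kap_small e20.
  have sN n : ustar (sqit Y n) = sqit Y n.
    elim: n => [|n IH] /=; first exact: ustar0.
    by rewrite ustarZr ustarD ustarM IH /Y ustarB ustar1 Ss.
  have -> : ustar L - L = ustar (L - sqit Y N) - (L - sqit Y N).
    by rewrite ustarB sN; lin.
  by apply: ob_le (obB (ob_ustar (HL N)) (HL N)); have := HN _ (leqnn _); lra.
exists (1 - L); split.
- by rewrite ustarB ustar1 Ls.
- have -> : (1 - L) * (1 - L) = 1 - (L + L) + L * L by ncring.
  rewrite {1 2}LE -scalerDr half2 /Y; lin.
- by rewrite opprB addrCA subrr addr0.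
- move=> U US; suff UL : U * L = L * U by rewrite mulrBr mulrBl mulr1 mul1r UL.
  have UY : U * Y = Y * U by rewrite mulrBr mulrBl mulr1 mul1r US.
  have [M M0 hU] := ob_ex U.
  apply/subr0_eq/ob_small => e e0.
  have e20 : 0 < e / M / 2 by rewrite !divr_gt0.
  have [N HN] := kap_small e20.
  have -> : U * L - L * U = U * (L - sqit Y N) - (L - sqit Y N) * U.
    by rewrite mulrBr mulrBl (sqit_comm N UY); lin.
  apply: ob_le (obB (obM hU (HL N)) (obM (HL N) hU)).
  have := HN _ (leqnn _); set k := 1 - _ => hk.
  have : M * k <= M * (e / M / 2) by rewrite ler_wpM2l// ltW.
  have -> : M * (e / M / 2) = e / 2 by field; rewrite lt0r_neq0.
  by lra.
- move=> Q Qsub QS.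
  have QN n : Q (sqit Y n).2.
    elim: n => [|n IH] /=; first by have [] := Qsub.
    apply: closed_subalgZ => //; apply: closed_subalgD => //.
      by rewrite /= add0r; exact: closed_subalgN.
    apply: closed_subalgD => //; last exact: closed_subalgM.
    by apply: closed_subalgD => //; exact: closed_subalgZ.
  rewrite /= add0r; apply: closed_subalgN => //.
  have [cQ _ _ _] := Qsub; apply: (closed_nm cQ) => e e0.
  have e20 : 0 < e / 2 by lra.
  have [N HN] := kap_small e20; exists (sqit Y N).2 => //.
  apply: le_trans (ob_snd (HL N)) _; have := HN _ (leqnn _); lra.
Qed.

End SquareRoot.

(** * Positivity in the unitization *)

Section Positivity.
Variables (R : realType) (A : cstarAlgType R).
Implicit Types S T U H P Q : unitz A.

Definition ur (r : R) : unitz A := r%:C%C *: 1.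

Lemma ur0 : ur 0 = 0. Proof. by rewrite /ur rmorph0 scale0r. Qed.
Lemma ur1 : ur 1 = 1. Proof. by rewrite /ur rmorph1 scale1r. Qed.
Lemma urD r s : ur (r + s) = ur r + ur s.
Proof. by rewrite /ur rmorphD scalerDl. Qed.
Lemma urB r s : ur (r - s) = ur r - ur s.
Proof. by rewrite /ur rmorphB scalerBl. Qed.
Lemma urZ r s : r%:C%C *: ur s = ur (r * s).
Proof. by rewrite /ur scalerA rmorphM. Qed.
Lemma ur_mull r T : ur r * T = r%:C%C *: T.
Proof. by rewrite /ur -scalerAl mul1r. Qed.
Lemma ur_mulr r T : T * ur r = r%:C%C *: T.
Proof. by rewrite /ur -scalerAr mulr1. Qed.
Lemma ur_comm r T : ur r * T = T * ur r.
Proof. by rewrite ur_mull ur_mulr. Qed.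
Lemma ur_star r : ustar (ur r) = ur r.
Proof. by rewrite /ur ustarZr ustar1. Qed.
Lemma ob_ur r : 0 <= r -> ob (ur r) r.
Proof.
by move=> r0; rewrite -{2}(mulr1 r) -{2}(ger0_norm r0); apply: obZ; exact: ob1.
Qed.

Lemma obZp r T M : 0 <= r -> ob T M -> ob (r%:C%C *: T) (r * M).
Proof. by move=> r0 hT; rewrite -{2}(ger0_norm r0); exact: obZ. Qed.

Lemma scaleC_mul r s T : r%:C%C *: (s%:C%C *: T) = (r * s)%:C%C *: T.
Proof. by rewrite scalerA rmorphM. Qed.

Lemma scaleC1 T : (1 : R)%:C%C *: T = T.
Proof. by rewrite rmorph1 scale1r. Qed.

Lemma scaleCK r T : r != 0 -> r%:C%C *: (r^-1%:C%C *: T) = T.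
Proof. by move=> r0; rewrite scaleC_mul mulfV// scaleC1. Qed.

Lemma scaleC_sq r T U :
  (r%:C%C *: T) * (r%:C%C *: U) = (r * r)%:C%C *: (T * U).
Proof. by rewrite -scalerAl -scalerAr scaleC_mul. Qed.

Lemma scaleCD r s T : (r + s)%:C%C *: T = r%:C%C *: T + s%:C%C *: T.
Proof. by rewrite rmorphD scalerDl. Qed.

Lemma scaleC2 T : (2 : R)%:C%C *: T = T + T.
Proof. by rewrite (_ : 2 = 1 + 1 :> R)// scaleCD scaleC1. Qed.

Lemma ob_lim_le T M : (forall e : R, 0 < e -> ob T (M + e)) -> ob T M.
Proof.
move=> H; split=> [|b].
  by apply/ler_addgt0Pr => e e0; have [] := H _ e0.
apply/ler_addgt0Pr => e e0.
have c0 : 0 < nm b + 1 by rewrite ltr_wpDl ?nm_ge0.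
have e1 : 0 < e / (nm b + 1) by rewrite divr_gt0.
have [_ h] := H _ e1; apply: le_trans (h b) _; rewrite mulrDl lerD2l.
rewrite -mulrAC ler_pdivrMr// ler_wpM2l ?ltW//; lra.
Qed.

(** The norm criterion for positivity: [|M - T| <= M] for a self-adjoint [T] places its spectrum in
    [[0, 2M]]. Sums of positive elements are then immediate, whereas squares and [T^* T] need an
    argument. *)
Definition psd T : Prop :=
  ustar T = T /\ exists2 M : R, 0 < M & ob (ur M - T) M.

Lemma psd_star T : psd T -> ustar T = T. Proof. by case. Qed.

(* [H + i sqrt(1 - H^2)] is unitary. *)
Lemma ob_cos H : ustar H = H -> ob H 1 -> ob (1 - (H * H + H * H)) 1.
Proof.
move=> Hs hH.
have [||T [Ts T2 _ Tc _]] := @ob_sqrt _ _ (1 - H * H).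
- by rewrite ustarB ustar1 ustarM Hs.
- rewrite opprB addrCA subrr addr0 -[1]mulr1; exact: obM.
have HT : H * T = T * H.
  by apply: Tc; rewrite mulrBr mulrBl mulr1 mul1r mulrA.
pose c : R[i] := 'i; have cc : c^* = - c by exact: conjCi.
have c2 : c * c = -1 by rewrite -expr2 sqrCi.
pose U := H + c *: T.
have Us : ustar U = H - c *: T by rewrite ustarD ustarZ Hs Ts cc scaleNr.
have U1 : ob U 1.
  apply: ob_cstar => //; rewrite expr1n Us.
  have -> : (H - c *: T) * U = H * H + c *: (H * T - T * H) - (c * c) *: (T * T).
    by rewrite /U; ncring.
  by rewrite HT subrr scaler0 addr0 c2 T2 scaleN1r opprK addrC subrK; exact: ob1.
have U1s := ob_ustar U1.
(* With [H = cos t] and [U = e^(it)] this is [1 - 2 cos^2 t = - cos 2t], the negative of the real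
   part of [U^2]. *)
have -> : 1 - (H * H + H * H) =
    (2^-1 : R)%:C%C *: - (U * U + ustar U * ustar U).
  rewrite Us; have -> : U * U + (H - c *: T) * (H - c *: T) =
      (H * H + H * H) + (c * c) *: (T * T + T * T).
    by rewrite /U; ncring.
  rewrite c2 T2 scaleN1r -[LHS](@scaleCK 2^-1) ?invr_eq0// invrK scaleC2.
  by congr (_ *: _); lin.
have h2 : 0 <= 2^-1 :> R by rewrite invr_ge0.
by apply: ob_le (obZp h2 (obN (obD (obM U1 U1) (obM U1s U1s)))); lra.
Qed.

Lemma psdW T : psd T -> exists2 M : R, 0 < M &
  forall N, M <= N -> ob (ur N - T) N.
Proof.
case=> _ [M M0 hM]; exists M => // N MN.
have -> : ur N - T = ur (N - M) + (ur M - T) by rewrite urB; lin.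
have {2}-> : N = (N - M) + M by lra.
by apply: obD => //; apply: ob_ur; lra.
Qed.

Lemma psdD S T : psd S -> psd T -> psd (S + T).
Proof.
move=> hS hT; split; first by rewrite ustarD !psd_star.
have [_ [M M0 hM]] := hS; have [_ [N N0 hN]] := hT.
exists (M + N); first exact: addr_gt0.
by rewrite urD opprD addrACA; exact: obD.
Qed.

Lemma psdZ r T : 0 <= r -> psd T -> psd (r%:C%C *: T).
Proof.
move=> r0 hT; split; first by rewrite ustarZr psd_star.
have [M M0 hM] := psdW hT.
have [->|rn] := eqVneq r 0.
  by exists 1; rewrite // rmorph0 scale0r subr0; exact: ob_ur.
have rp : 0 < r by rewrite lt_neqAle eq_sym rn.
exists (r * M); first exact: mulr_gt0.
by rewrite -urZ -scalerBr; apply: obZp => //; exact: hM.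
Qed.

Lemma psd_ur r : 0 <= r -> psd (ur r).
Proof.
move=> r0; split; first exact: ur_star.
exists (r + 1); first by lra.
by rewrite -urB addrAC subrr add0r; apply: ob_le (ob_ur _); lra.
Qed.

Lemma psd1 : psd 1. Proof. by rewrite -ur1; exact: psd_ur. Qed.
Lemma psd0 : psd 0. Proof. by rewrite -ur0; exact: psd_ur. Qed.

Lemma psd_sum (I : Type) (r : seq I) (F : I -> unitz A) :
  (forall i, psd (F i)) -> psd (\sum_(i <- r) F i).
Proof. by move=> h; apply: big_ind => //; [exact: psd0|exact: psdD]. Qed.

Lemma psd_sqrt T : psd T -> exists H, [/\ psd H, H * H = T,
  (forall U, U * T = T * U -> U * H = H * U) &
  (forall Q : set A, closed_subalg Q -> Q T.2 -> Q H.2)].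
Proof.
move=> [Ts [M M0 hM]]; have Mn := lt0r_neq0 M0.
have iM : 0 <= M^-1 by rewrite invr_ge0 ltW.
have [||H [Hs H2 h1 Hc HQ]] := @ob_sqrt _ _ (M^-1%:C%C *: T).
- by rewrite ustarZr Ts.
- rewrite -ur1 -(mulVf Mn) -urZ -scalerBr; exact: obZp.
pose s := Num.sqrt M; have s0 : 0 < s by rewrite sqrtr_gt0.
have ss : s * s = M by rewrite -expr2 sqr_sqrtr// ltW.
exists (s%:C%C *: H); split.
- split; first by rewrite ustarZr Hs.
  exists s => //; rewrite /ur -scalerBr.
  by apply: ob_le (obZp (ltW s0) h1); rewrite mulr1.
- by rewrite -scalerAl -scalerAr H2 !scaleC_mul ss mulfV// scaleC1.
- move=> U UT; rewrite -scalerAr -scalerAl Hc// -scalerAr -scalerAl UT//.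
- move=> Q Qs QT; apply: closed_subalgZ => //; apply: HQ => //.
  exact: closed_subalgZ.
Qed.

(** For the contraction [G = H / M], [ob_cos] says [|1/2 - G^2| <= 1/2], which is the criterion for
    [G^2]; scaling by [M^2] gives the radius [M^2 / 2]. *)
Lemma psd_sq H : ustar H = H -> psd (H * H).
Proof.
move=> Hs; split; first by rewrite ustarM Hs.
have [M M0 hM] := ob_ex H; have Mn := lt0r_neq0 M0.
have iM : 0 <= M^-1 by rewrite invr_ge0 ltW.
pose G := M^-1%:C%C *: H.
have hG : ob G 1 by rewrite -(mulVf Mn); exact: obZp.
have := ob_cos (_ : ustar G = G) hG.
rewrite ustarZr Hs => /(_ erefl) h.
have m0 : 0 < M * M / 2 by rewrite !divr_gt0 ?mulr_gt0.
exists (M * M / 2) => //.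
rewrite -[X in ob _ X]mulr1.
have -> : ur (M * M / 2) - H * H = (M * M / 2)%:C%C *: (1 - (G * G + G * G)).
  rewrite scalerBr; congr (_ - _).
  rewrite -scaleC2 /G scaleC_sq !scaleC_mul -[LHS]scaleC1.
  by congr (_%:C%C *: _); field.
by apply: obZp => //; exact: ltW.
Qed.

(** The radius in [psd] is existential; here it depends on the size of [T] only, again by [ob_cos],
    now for the square root of [T / M]. *)
Lemma psd_ob_half T M : psd T -> 0 < M -> ob T M -> ob (ur (M / 2) - T) (M / 2).
Proof.
move=> hT M0 hM; have [H [hH H2 _ _]] := psd_sqrt hT; have Hs := psd_star hH.
pose s := Num.sqrt M; have s0 : 0 < s by rewrite sqrtr_gt0.
have ss : s * s = M by rewrite -expr2 sqr_sqrtr// ltW.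
have hH' : ob H s.
  by apply: ob_cstar; [exact: ltW|rewrite Hs H2 expr2 ss].
pose G := s^-1%:C%C *: H; have sn := lt0r_neq0 s0.
have iM : 0 <= s^-1 by rewrite invr_ge0 ltW.
have hG : ob G 1 by rewrite -(mulVf sn); exact: obZp.
have := ob_cos (_ : ustar G = G) hG; rewrite ustarZr Hs => /(_ erefl) h.
rewrite -[X in ob _ X]mulr1.
have -> : ur (M / 2) - T = (M / 2)%:C%C *: (1 - (G * G + G * G)).
  rewrite scalerBr; congr (_ - _).
  rewrite -scaleC2 /G scaleC_sq !scaleC_mul H2 -[LHS]scaleC1.
  by rewrite -ss; congr (_%:C%C *: _); field.
by apply: obZp => //; rewrite divr_ge0// ltW.
Qed.

Lemma psd_ob_sub T M : psd T -> ob T M -> ob (ur M - T) M.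
Proof.
move=> hT hM; apply: ob_lim_le => e e0.
have M0 := ob_ge0 hM; have hM' : ob T (M + e) by apply: ob_le hM; lra.
have Me : 0 < M + e by lra.
have := psd_ob_half hT Me hM' => h.
have -> : ur M - T = (ur ((M + e) / 2) - T) + ur ((M - e) / 2).
  rewrite -addrA [- T + _]addrC addrA -urD; congr (ur _ - _); lra.
have h3 : ob (ur ((M - e) / 2)) ((M + e) / 2).
  case: (lerP 0 ((M - e) / 2)) => h2; first by apply: ob_le (ob_ur h2); lra.
  rewrite -[ur _]opprK -[- ur _]sub0r -ur0 -urB sub0r; apply: obN.
  by apply: ob_le (ob_ur _); lra.
by apply: ob_le (obD h h3); lra.
Qed.

Lemma psd_sub_ob T M : ustar T = T -> ob T M -> psd (ur M - T).
Proof.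
move=> Ts hM; have M0 := ob_ge0 hM.
split; first by rewrite ustarB ur_star Ts.
exists (M + 1); first by lra.
have -> : ur (M + 1) - (ur M - T) = 1 + T by rewrite urD ur1; lin.
by apply: ob_le (obD (@ob1 _ A) hM); lra.
Qed.

(** With commuting roots [H] of [P] and [T] of [M - P], the element [U = H + i T] satisfies
    [U^* U = M], hence is bounded by the root of [M], and so is its real part [H]. *)
Lemma psd_le_ob P M : psd P -> psd (ur M - P) -> 0 <= M -> ob P M.
Proof.
move=> hP hQ M0.
have [H [hH H2 Hc _]] := psd_sqrt hP; have [T [hT T2 Tc _]] := psd_sqrt hQ.
have HP : H * P = P * H by rewrite -H2 mulrA.
have HT : H * T = T * H.
  by apply: Tc; rewrite mulrBr mulrBl HP ur_comm.
pose c : R[i] := 'i; have cc : c^* = - c by exact: conjCi.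
have c2 : c * c = -1 by rewrite -expr2 sqrCi.
pose U := H + c *: T.
have Us : ustar U = H - c *: T.
  by rewrite ustarD ustarZ !psd_star// cc scaleNr.
pose s := Num.sqrt M; have s0 : 0 <= s by exact: sqrtr_ge0.
have ss : s * s = M by rewrite -expr2 sqr_sqrtr.
have hU : ob U s.
  apply: ob_cstar => //; rewrite expr2 ss Us.
  have -> : (H - c *: T) * U = H * H + c *: (H * T - T * H) - (c * c) *: (T * T).
    by rewrite /U; ncring.
  rewrite HT subrr scaler0 addr0 c2 T2 H2 scaleN1r opprK addrC subrK.
  exact: ob_ur.
have hH' : ob H s.
  have -> : H = (2^-1 : R)%:C%C *: (U + ustar U).
    by rewrite Us /U addrACA subrr addr0 -scaleC2 scaleC_mul mulVf// scaleC1.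
  have h2 : 0 <= 2^-1 :> R by rewrite invr_ge0.
  by apply: ob_le (obZp h2 (obD hU (ob_ustar hU))); lra.
by rewrite -H2 -ss; exact: obM.
Qed.

Lemma psd_anti P : psd P -> psd (- P) -> P = 0.
Proof.
move=> hP hN; apply: ob_small => e e0.
by apply: (@ob_le _ _ _ 0); [exact: ltW|apply: psd_le_ob; rewrite ?ur0 ?sub0r].
Qed.

Lemma psd_mulC P Q : psd P -> psd Q -> P * Q = Q * P -> psd (P * Q).
Proof.
move=> hP hQ PQ.
have [H [hH H2 Hc _]] := psd_sqrt hP; have [G [hG G2 Gc _]] := psd_sqrt hQ.
have QH : Q * H = H * Q by exact: Hc.
have HG : H * G = G * H by apply: Gc; rewrite QH.
have -> : P * Q = (H * G) * (H * G).
  by rewrite -H2 -G2 -!mulrA; congr (_ * _); rewrite !mulrA HG.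
by apply: psd_sq; rewrite ustarM !psd_star.
Qed.

Lemma psdX P n : psd P -> psd (P ^+ n).
Proof.
move=> hP; elim: n => [|n IH]; first by rewrite expr0; exact: psd1.
by rewrite exprS; apply: psd_mulC => //; rewrite -exprS exprSr.
Qed.

(** Approximants within distance 1 are all bounded by [M + 1], so [psd_ob_sub] gives them one common
    radius, and the criterion survives the limit. *)
Lemma psd_closed T : ustar T = T ->
  (forall e : R, 0 < e -> exists2 S, psd S & ob (T - S) e) -> psd T.
Proof.
move=> Ts H; split => //; have [M M0 hM] := ob_ex T; exists (M + 1); first lra.
apply: ob_lim_le => e e0; have [|S hS h] := H (Num.min e 1).
  by rewrite lt_min e0 ltr01.
have hS1 : ob S (M + 1).
  rewrite -(subrK T S) [M + 1]addrC; apply: obD => //.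
  by rewrite -opprB; apply: obN; apply: ob_le h; rewrite ge_min lexx orbT.
have -> : ur (M + 1) - T = (ur (M + 1) - S) - (T - S) by lin.
apply: obB; first exact: psd_ob_sub.
by apply: ob_le h; rewrite ge_min lexx.
Qed.

Lemma one_minus_psd P n : psd P -> ob P 1 -> psd (1 - (1 - P) ^+ n).
Proof.
move=> hP h1; have ht : psd (1 - P).
  by rewrite -ur1; apply: psd_sub_ob h1; exact: psd_star.
rewrite -opprB subrX1.
have -> : (1 - P) - 1 = - P by rewrite addrAC subrr add0r.
rewrite mulNr opprK mulr_sumr; apply: psd_sum => i; apply: psd_mulC => //.
  exact: psdX.
by apply: commrX; rewrite /GRing.comm mulrBr mulrBl mulr1 mul1r.
Qed.

(* [(n + 1) P (1 - P)^n <= sum_(k <= n) P (1 - P)^k = 1 - (1 - P)^(n + 1) <= 1]. *)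
Lemma decay P n : psd P -> ob P 1 -> ob (P * (1 - P) ^+ n) (n.+1%:R^-1).
Proof.
move=> hP h1; set t := 1 - P.
have ht : psd t by rewrite /t -ur1; apply: psd_sub_ob h1; exact: psd_star.
have Pt : P * t = t * P by rewrite mulrBr mulrBl mulr1 mul1r.
have PtX k : P * t ^+ k = t ^+ k * P by exact: commrX.
have hPt k : psd (P * t ^+ k) by apply: psd_mulC => //; exact: psdX.
have n0 : (n.+1%:R : R) != 0 by rewrite pnatr_eq0.
have nV : 0 <= n.+1%:R^-1 :> R by rewrite invr_ge0.
have nE T : n.+1%:R%:C%C *: T = T *+ n.+1 by rewrite rmorph_nat scaler_nat.
suff : ob (n.+1%:R%:C%C *: (P * t ^+ n)) 1.
  move=> /(obZp nV); rewrite mulr1 scaleC_mul mulVf// scaleC1; exact.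
apply: psd_le_ob => //; first exact: psdZ.
rewrite ur1 nE.
have -> : 1 - P * t ^+ n *+ n.+1 =
    t ^+ n.+1 + \sum_(k < n.+1) (P * t ^+ k - P * t ^+ n).
  rewrite sumrB sumr_const card_ord addrA; congr (_ - _).
  rewrite -mulr_sumr -[P]opprK mulNr.
  have -> : - P = t - 1 by rewrite /t addrAC subrr add0r.
  by rewrite -subrX1 opprB addrC subrK.
apply: psdD; first exact: psdX.
apply: psd_sum => -[k /= kn]; rewrite ltnS in kn.
have -> : P * t ^+ k - P * t ^+ n = (P * t ^+ k) * (1 - t ^+ (n - k)).
  by rewrite mulrBr mulr1 -mulrA -exprD subnKC.
apply: psd_mulC => //; first exact: one_minus_psd.
rewrite mulrBr mulrBl mulr1 mul1r; congr (_ - _).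
by rewrite -mulrA -exprD mulrA -PtX -mulrA -exprD addnC.
Qed.

Lemma natV_small (d : R) : 0 < d ->
  exists N, forall n, (N <= n)%N -> n.+1%:R^-1 <= d.
Proof.
move=> d0; exists (Num.bound d^-1) => n Nn.
rewrite -[d]invrK lef_pV2 ?posrE ?invr_gt0//.
apply: ltW; apply: lt_le_trans (archi_boundP _) _; first by rewrite invr_ge0 ltW.
by rewrite ler_nat (leq_trans Nn).
Qed.

(** Formally [Z = Z^2 / m]. With [t = 1 - m] a truncated geometric series replaces [1 / m]: the
    element [Z (1 - t^N) = Z^2 \sum_(i < N) t^i] is positive, and the square of the remainder
    [Z t^N] is [Z m t^(2N)], small by [decay]. *)
Lemma psd_abs1 Z m : ustar Z = Z -> psd m -> ob m 1 -> Z * Z = m * Z ->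
  m * Z = Z * m -> psd Z.
Proof.
move=> Zs hm m1 Z2 mZ; set t := 1 - m.
have ht : psd t by rewrite /t -ur1; apply: psd_sub_ob m1; exact: psd_star.
have tZ : t * Z = Z * t by rewrite mulrBr mulrBl mulr1 mul1r mZ.
have tZX k : t ^+ k * Z = Z * t ^+ k by apply/esym/commrX.
have [M M0 hM] := ob_ex Z.
apply: psd_closed => // e e0.
have e1 : 0 < e ^+ 2 / M by rewrite divr_gt0 ?exprn_gt0.
have [N HN] := natV_small e1.
exists (Z * (1 - t ^+ N)).
  have -> : 1 - t ^+ N = m * \sum_(i < N) t ^+ i.
    rewrite -opprB subrX1; have -> : t - 1 = - m by rewrite /t addrAC subrr add0r.
    by rewrite mulNr opprK.
  rewrite mulrA -mZ -Z2 mulr_sumr; apply: psd_sum => i; apply: psd_mulC.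
  - exact: psd_sq.
  - exact: psdX.
  - by rewrite [RHS]mulrA tZX -!mulrA tZX.
have -> : Z - Z * (1 - t ^+ N) = Z * t ^+ N by rewrite mulrBr mulr1 subKr.
apply: ob_cstar; first exact: ltW.
rewrite ustarM Zs ustarX (psd_star ht).
have -> : t ^+ N * Z * (Z * t ^+ N) = Z * (m * t ^+ (N + N)).
  by rewrite tZX -mulrA (mulrA (t ^+ N)) tZX -mulrA mulrA Z2 mZ -exprD -mulrA.
have := obM hM (decay (N + N) hm m1); apply: ob_le.
rewrite mulrC -ler_pdivlMr//; apply: HN; exact: leq_addr.
Qed.

Lemma psd_abs Z m : ustar Z = Z -> psd m -> Z * Z = m * Z ->
  m * Z = Z * m -> psd Z.
Proof.
move=> Zs hm Z2 mZ; have [M M0 hM] := ob_ex m; have Mn := lt0r_neq0 M0.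
have iM : 0 <= M^-1 by rewrite invr_ge0 ltW.
rewrite -[Z](scaleCK Z Mn); apply: psdZ; first exact: ltW.
apply: (@psd_abs1 _ (M^-1%:C%C *: m)).
- by rewrite ustarZr Zs.
- exact: psdZ.
- by rewrite -(mulVf Mn); exact: obZp.
- by rewrite -!scalerAl -!scalerAr Z2.
- by rewrite -!scalerAl -!scalerAr mZ.
Qed.

Lemma sq_eq0 H : ustar H = H -> H * H = 0 -> H = 0.
Proof.
move=> Hs H2; apply: ob_small => e e0; apply: ob_cstar; first exact: ltW.
by rewrite Hs H2; apply: ob_le (@ob0 _ A); rewrite sqr_ge0.
Qed.

(** Here [m = |T|] is the root of [T^2], and the parts are [P = (m + T) / 2] and [N = (m - T) / 2].
    Their positivity is [psd_abs], since [P^2 = m P] and [N^2 = m N]. *)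
Lemma psd_parts T : ustar T = T -> exists P N,
  [/\ psd P, psd N, T = P - N, P * N = 0 & N * P = 0] /\
  [/\ (forall U, U * T = T * U -> U * P = P * U /\ U * N = N * U),
      (forall Q : set A, closed_subalg Q -> Q T.2 -> Q (T * T).2 -> Q P.2 /\ Q N.2),
      P + N = (P + N) & (P + N) * (P + N) = T * T].
Proof.
move=> Ts; have [m [hm m2 mc mQ]] := psd_sqrt (psd_sq Ts).
have mT : T * m = m * T by apply: mc; rewrite mulrA.
pose h : R[i] := (2^-1 : R)%:C%C.
have ss S : h *: (S + S) = S.
  by rewrite -scaleC2 /h scaleC_mul mulVf// scaleC1.
pose P := h *: (m + T); pose N := h *: (m - T).
have hP : psd P.
  apply: (@psd_abs _ m) => //.
  - by rewrite /P ustarZr ustarD Ts psd_star.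
  - have -> : P * P = (h * h) *: (m * m + T * T + T * m + m * T).
      by rewrite /P; ncring.
    have -> : m * P = (h * h) *: ((m * m + m * T) + (m * m + m * T)).
      by rewrite -[RHS]scalerA ss /P; ncring.
    by rewrite m2 mT; congr (_ *: _); lin.
  - by rewrite /P -scalerAl -scalerAr mulrDl mulrDr mT.
have hN : psd N.
  apply: (@psd_abs _ m) => //.
  - by rewrite /N ustarZr ustarB Ts psd_star.
  - have -> : N * N = (h * h) *: (m * m + T * T - T * m - m * T).
      by rewrite /N; ncring.
    have -> : m * N = (h * h) *: ((m * m - m * T) + (m * m - m * T)).
      by rewrite -[RHS]scalerA ss /N; ncring.
    by rewrite m2 mT; congr (_ *: _); lin.
  - by rewrite /N -scalerAl -scalerAr mulrBl mulrBr mT.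
have PN : P + N = m by rewrite /P /N -scalerDr addrACA subrr addr0 ss.
exists P, N; split; split => //.
- by rewrite -[LHS]ss /P /N; lin.
- have -> : P * N = (h * h) *: (m * m - T * T + T * m - m * T).
    by rewrite /P /N; ncring.
  by rewrite m2 mT subrr add0r subrr scaler0.
- have -> : N * P = (h * h) *: (m * m - T * T - T * m + m * T).
    by rewrite /P /N; ncring.
  by rewrite m2 mT subrr sub0r addNr scaler0.
- move=> U UT; have Um : U * m = m * U by apply: mc; rewrite mulrA UT -!mulrA UT.
  by rewrite /P /N -!scalerAr -!scalerAl mulrDr mulrBr mulrDl mulrBl UT Um.
- move=> Q Qs QT QT2; have Qm : Q m.2 by exact: mQ.
  split; apply: closed_subalgZ => //; apply: closed_subalgD => //.
  exact: closed_subalgN.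
- by rewrite PN.
Qed.

(** If [z] is the negative part of [T^* T] and [v = T z], then [v^* v = - z^3]. Since
    [u^* u + u u^*] is a sum of two squares of self-adjoint elements up to a factor, it is always
    positive, which forces [z = 0]. *)
Lemma psd_mulstar T : psd (ustar T * T).
Proof.
set y := ustar T * T.
have ys : ustar y = y by rewrite ustarM ustarK.
have [w [z [[hw hz yE wz zw] _]]] := psd_parts ys.
have zs := psd_star hz.
suff z0 : z = 0 by rewrite yE z0 subr0.
pose v := T * z.
have vv : ustar v * v = - (z * z * z).
  rewrite ustarM zs -mulrA (mulrA (ustar T)) -/y yE mulrBl wz sub0r mulrN.
  by rewrite mulrA.
pose N := z * z * z; have hN : psd N.
  have -> : N = z ^+ 3 by rewrite !exprS expr0 mulr1 mulrA.
  exact: psdX.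
pose P := v * ustar v.
have sumpsd u : psd (ustar u * u + u * ustar u).
  pose c : R[i] := 'i; have cc : c^* = - c by exact: conjCi.
  have c2 : c * c = -1 by rewrite -expr2 sqrCi.
  pose a := u + ustar u; pose b := c *: (u - ustar u).
  have as_ : ustar a = a by rewrite ustarD ustarK addrC.
  have bs : ustar b = b by rewrite ustarZ ustarB ustarK cc scaleNr -scalerN opprB.
  have -> : ustar u * u + u * ustar u = (2^-1 : R)%:C%C *: (a * a + b * b).
    rewrite -[LHS](@scaleCK 2^-1) ?invr_eq0// invrK scaleC2; congr (_ *: _).
    have -> : b * b = (c * c) *: ((u - ustar u) * (u - ustar u)).
      by rewrite /b -scalerAl -scalerAr scalerA.
    by rewrite c2 scaleN1r /a; ncring.
  by apply: psdZ; rewrite ?invr_ge0//; apply: psdD; exact: psd_sq.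
have hP : psd P.
  have -> : P = (ustar v * v + v * ustar v) + N by rewrite vv /P /N; lin.
  exact: psdD.
have [r [hr r2 _ _]] := psd_sqrt hN; have rs := psd_star hr.
(* For [u = v r] with [r^2 = N] one has [u^* u = - N^2] and [u u^* = - P^2], so [- (N^2 + P^2)] is
   positive. This replaces the comparison of the spectra of [v^* v] and [v v^*]. *)
have := sumpsd (v * r); rewrite ustarM rs.
have -> : r * ustar v * (v * r) = - (N * N).
  rewrite -mulrA (mulrA (ustar v)) vv -/N -r2 mulNr mulrN; congr (- _).
  by rewrite !mulrA.
have -> : v * r * (r * ustar v) = - (P * P).
  rewrite -mulrA (mulrA r) r2 /P -mulrA (mulrA (ustar v)) vv -/N.
  by rewrite mulNr mulrN opprK.
have Ns := psd_star hN; have Ps := psd_star hP.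
rewrite -opprD => h.
have h0 : N * N + P * P = 0.
  by apply: psd_anti => //; apply: psdD; exact: psd_sq.
have NN : N * N = 0.
  apply: psd_anti; first exact: psd_sq.
  have -> : - (N * N) = P * P by apply: (addrI (N * N)); rewrite subrr h0.
  exact: psd_sq.
have N0 := sq_eq0 Ns NN.
have z2 : z * z = 0.
  apply: sq_eq0; first by rewrite ustarM zs.
  by rewrite mulrA -/N N0 mul0r.
exact: sq_eq0.
Qed.

Lemma psd_conj P T : psd P -> psd (ustar T * P * T).
Proof.
move=> hP; have [H [hH H2 _ _]] := psd_sqrt hP.
have -> : ustar T * P * T = ustar (H * T) * (H * T).
  by rewrite ustarM (psd_star hH) -H2 !mulrA.
exact: psd_mulstar.
Qed.

Lemma psd_le_nm P Q M : psd P -> psd (Q - P) -> ob Q M -> ob P M.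
Proof.
move=> hP hQP hQ; have Ps := psd_star hP.
have Qs : ustar Q = Q by rewrite -(subrK P Q) ustarD Ps (psd_star hQP).
apply: psd_le_ob (ob_ge0 hQ) => //.
have -> : ur M - P = (ur M - Q) + (Q - P) by lin.
by apply: psdD => //; exact: psd_sub_ob.
Qed.

End Positivity.
Arguments ur {R A} r.
Arguments ob1 {R A}.
Arguments ob0 {R A}.

(** Source of most small constants below; dividing by [K + 1] covers [K = 0]. *)
Lemma small_mul (R : realType) (K e : R) : 0 <= K -> 0 < e ->
  exists2 d : R, 0 < d & d * K <= e.
Proof.
move=> K0 e0; exists (e / (K + 1)); first by rewrite divr_gt0// ltr_wpDl.
rewrite mulrAC ler_pdivrMr ?ltr_wpDl//; nra.
Qed.

(** * Positive elements of the algebra and approximate units *)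

Section PositiveElements.
Variables (R : realType) (A : cstarAlgType R).
Implicit Types (a b p q s x y z : A) (T : unitz A).

Lemma nm3 x y z : nm (x ** y ** z) <= nm x * nm y * nm z.
Proof.
apply: le_trans (nmM _ _) _; rewrite ler_wpM2r ?nm_ge0//; exact: nmM.
Qed.

Lemma nm_conj3 x y z : nm (star x ** y ** z) <= nm x * nm y * nm z.
Proof. by rewrite -(nm_star x) nm3. Qed.

Definition up T : A := T.2.

Lemma em_up T : T.1 = 0 -> em (up T) = T.
Proof. by case: T => t x /= ->. Qed.

Lemma psd_em_star a : psd (em a) -> star a = a.
Proof. by move=> [+ _]; rewrite -em_star => /em_inj. Qed.

Lemma pos_sqrt a : psd (em a) -> exists h, [/\ star h = h, h ** h = a,
  psd (em h) & forall Q : set A, closed_subalg Q -> Q a -> Q h].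
Proof.
move=> /psd_sqrt[H [hH H2 _ HQ]].
have HE : em (up H) = H.
  apply: em_up; have := congr1 fst H2 => /= /eqP.
  by rewrite mulf_eq0 orbb => /eqP.
exists (up H); split.
- by apply: psd_em_star; rewrite HE.
- by apply: em_inj; rewrite emM HE.
- by rewrite HE.
- by move=> Q Qs Qa; exact: HQ.
Qed.

Lemma psd_em_sq x : psd (em (star x ** x)).
Proof. by rewrite emM em_star; exact: psd_mulstar. Qed.

Lemma psd_em_sqr x : psd (em (x ** star x)).
Proof. by rewrite -{1}[x]starK; exact: psd_em_sq. Qed.

Lemma positiveP a : positive a <-> psd (em a).
Proof.
split=> [[x ->]|/pos_sqrt[h [hs <- _ _]]]; first exact: psd_em_sq.
by exists h; rewrite hs.
Qed.

Lemma psd_emD a b : psd (em a) -> psd (em b) -> psd (em (a + b)).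
Proof. by move=> ha hb; rewrite emD; exact: psdD. Qed.

Lemma psd_em0 : psd (em (0 : A)).
Proof. by rewrite em0; exact: psd0. Qed.

Lemma psd_em_sum (I : Type) (r : seq I) (F : I -> A) :
  (forall i, psd (em (F i))) -> psd (em (\sum_(i <- r) F i)).
Proof.
by move=> h; apply: (big_ind (fun x => psd (em x)));
  [exact: psd_em0|exact: psd_emD|move=> i _; exact: h].
Qed.

Lemma psd_em_conj x p : psd (em p) -> psd (em (star x ** p ** x)).
Proof. by move=> hp; rewrite !emM em_star; exact: psd_conj. Qed.

Lemma psd_em_conjr x p : psd (em p) -> psd (em (x ** p ** star x)).
Proof. by move=> /(psd_em_conj (star x)); rewrite starK. Qed.

Lemma em_sum (I : Type) (r : seq I) (F : I -> A) :
  em (\sum_(i <- r) F i) = \sum_(i <- r) em (F i).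
Proof. by elim/big_rec2: _ => // i x y _ <-; rewrite emD. Qed.

Lemma pos_le_nm p q : psd (em p) -> psd (em q - em p) -> nm p <= nm q.
Proof.
by move=> hp hq; apply/ob_em; apply: psd_le_nm hq _ => //; apply/ob_em.
Qed.

(* [u = q p q = (1 - (1 - p)^n)^2] for normalized [p]. *)
Lemma approx_unit p (e : R) : psd (em p) -> 0 < e ->
  exists q u, [/\ star q = q, u = q ** p ** q, psd (em u) /\ ob (1 - em u) 1,
    forall Q : set A, closed_subalg Q -> Q p -> Q q /\ Q u &
    forall x, (psd (em p - em (star x ** x)) -> nm (x - x ** u) <= e) /\
      (psd (em p - em (x ** star x)) -> nm (x - u ** x) <= e)].
Proof.
move=> hp e0; pose M := nm p + 1; have M0 : 0 < M by rewrite ltr_wpDl ?nm_ge0.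
have Mn := lt0r_neq0 M0; have iM : 0 <= M^-1 by rewrite invr_ge0 ltW.
pose s := M^-1%:C%C *: p.
have hs : psd (em s) by rewrite emZ; exact: psdZ.
have s1 : ob (em s) 1.
  apply/ob_em; rewrite nmZr ger0_norm// ler_pdivrMl// mulr1 /M; lra.
have [w [ws w2 hw wQ]] := pos_sqrt hs.
(* By [decay], [|x t^n|^2 <= M / (2n + 1)], which has to be at most [(e / 2)^2]; the remaining
   factor 2 is the bound on [2 - t^n] in [1 - u = t^n (2 - t^n)]. *)
have e1 : 0 < (e / 2) ^+ 2 / M by rewrite divr_gt0 ?exprn_gt0 ?divr_gt0.
have [n Hn] := natV_small e1.
pose t : unitz A := 1 - em s; pose g := \sum_(i < n) t ^+ i.
have ht : psd t by rewrite /t -ur1; exact: psd_sub_ob (psd_star hs) s1.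
have t1 : ob t 1 by rewrite /t -{1}ur1; exact: psd_ob_sub.
have tn1 : ob (t ^+ n) 1 by have := obX n t1; rewrite expr1n.
have sg : em s * g = 1 - t ^+ n.
  rewrite -opprB subrX1.
  have -> : t - 1 = - em s by rewrite /t addrAC subrr add0r.
  by rewrite mulNr opprK.
have tw : t * em w = em w * t.
  by rewrite mulrBr mulrBl mulr1 mul1r -w2 emM mulrA.
have gw : g * em w = em w * g.
  rewrite /g mulr_suml mulr_sumr; apply: eq_bigr => i _.
  by apply/esym; apply: commrX; rewrite /GRing.comm tw.
have gs : ustar g = g.
  rewrite /g (big_morph _ (@ustarD _ A) (@ustar0 _ A)); apply: eq_bigr => i _.
  by rewrite ustarX psd_star.
have ws' : ustar (em w) = em w by rewrite -em_star ws.
(* [g] is a truncated series for the inverse of [s], so [w g] is a truncated [s^(-1/2)]; the factor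
   [w] keeps it inside the algebra. *)
pose q0 := up (em w * g).
have q0E : em q0 = em w * g by apply: em_up; rewrite /= mul0r.
pose r := Num.sqrt M^-1; have rr : r * r = M^-1 by rewrite -expr2 sqr_sqrtr.
pose q := r%:C%C *: q0; pose u := q ** p ** q.
have qs : star q = q.
  apply: em_inj; rewrite em_star /q emZ ustarZr q0E ustarM gs ws' gw//.
have uE : em u = 1 - (t ^+ n *+ 2 - t ^+ (n + n)).
  rewrite /u /q !emM !emZ.
  have -> : r%:C%C *: em q0 * em p * (r%:C%C *: em q0) = em q0 * em s * em q0.
    by rewrite -scalerAl scaleC_sq rr /s emZ -scalerAr -scalerAl.
  rewrite q0E.
  have -> : em w * g * em s * (em w * g) = (em s * g) * (em s * g).
    have c : g * em s = em s * g by rewrite -w2 emM mulrA gw -!mulrA gw.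
    have ws2 : em s * em w = em w * em s by rewrite -w2 emM !mulrA.
    rewrite !mulrA -(mulrA (em w) g) c (mulrA (em w)) -ws2.
    rewrite -(mulrA (em s * em w) g) gw (mulrA (em s * em w)).
    rewrite -(mulrA (em s) (em w)) -emM w2.
    by rewrite -[em s * g * em s]mulrA c mulrA.
  by rewrite sg mulr2n exprD; ncring.
have uq : em u = (1 - t ^+ n) * (1 - t ^+ n).
  by rewrite uE mulr2n exprD; ncring.
have tns : ustar (t ^+ n) = t ^+ n by rewrite ustarX psd_star.
have t2n1 : ob ((2 : R)%:C%C *: 1 - t ^+ n) 2.
  rewrite -/(ur 2); have -> : ur 2 - t ^+ n = 1 + (ur 1 - t ^+ n).
    by rewrite (_ : 2 = 1 + 1 :> R)// urD ur1; lin.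
  by apply: ob_le (obD ob1 (psd_ob_sub (psdX n ht) tn1)); lra.
have cu : 1 - em u = t ^+ n * ((2 : R)%:C%C *: 1 - t ^+ n).
  rewrite uE mulrBr -scalerAr mulr1 scaleC2 -exprD mulr2n; lin.
have hu : psd (em u) by rewrite uq; apply: psd_sq; rewrite ustarB ustar1 tns.
have hu1 : ob (1 - em u) 1.
  have u1 : ob (em u) 1.
    have h : ob (1 - t ^+ n) 1 by rewrite -{1}ur1; apply: psd_ob_sub => //; exact: psdX.
    by rewrite uq; apply: ob_le (obM h h); rewrite mulr1.
  by rewrite -{1}ur1; exact: psd_ob_sub.
have decx x : psd (em p - em (star x ** x)) -> ob (em x * t ^+ n) (e / 2).
  move=> hx; apply: ob_cstar; first by lra.
  rewrite ustarM tns -em_star.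
  have -> : t ^+ n * em (star x) * (em x * t ^+ n) =
      ustar (t ^+ n) * em (star x ** x) * t ^+ n by rewrite emM tns !mulrA.
  apply: (@psd_le_nm _ _ _ (ustar (t ^+ n) * em p * t ^+ n)).
  - exact: psd_conj (psd_em_sq x).
  - by rewrite -mulrBl -mulrBr; exact: psd_conj.
  rewrite tns; have -> : t ^+ n * em p * t ^+ n = M%:C%C *: (em s * t ^+ (n + n)).
    rewrite /s emZ -scalerAl scaleCK// exprD mulrA; congr (_ * _).
    apply/esym/commrX; rewrite /GRing.comm /t mulrBr mulrBl mulr1 mul1r.
    by rewrite /s emZ -scalerAl -scalerAr.
  apply: ob_le (obZp (ltW M0) (decay (n + n) hs s1)).
  by rewrite -ler_pdivlMl// mulrC; apply: Hn; exact: leq_addr.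
have xu x : psd (em p - em (star x ** x)) -> nm (x - x ** u) <= e.
  move=> hx; apply/ob_em; rewrite emB emM -[X in X - _]mulr1 -mulrBr cu mulrA.
  by apply: ob_le (obM (decx _ hx) t2n1); lra.
have us : star u = u by exact: psd_em_star.
exists q, u; split => // [Q Qs Qp|x]; last first.
  split=> [|hx]; first exact: xu.
  by rewrite -nm_star starB starM us; apply: xu; rewrite starK.
have Qsp : Q s by exact: closed_subalgZ.
have Qw : Q w by exact: wQ.
have Qt i : Q (up (em w * t ^+ i)).
  elim: i => [|i IH]; first by rewrite expr0 mulr1.
  have -> : up (em w * t ^+ i.+1) = up (em w * t ^+ i) - up (em w * t ^+ i) ** s.
    have E : em w * t ^+ i = em (up (em w * t ^+ i)) by rewrite em_up//= mul0r.
    by rewrite exprSr mulrA E {1}/t mulrBr mulr1 -emM -emB.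
  by apply: closed_subalgD => //; apply: closed_subalgN => //; exact: closed_subalgM.
have Qq : Q q.
  apply: closed_subalgZ => //.
  have -> : q0 = \sum_(i < n) up (em w * t ^+ i).
    apply: em_inj; rewrite q0E em_sum /g mulr_sumr; apply: eq_bigr => i _.
    by rewrite em_up//= mul0r.
  by apply: big_ind => //; [case: Qs|move=> *; exact: closed_subalgD].
split => //; apply: closed_subalgM => //; exact: closed_subalgM.
Qed.

(** Let [h] be the root of [p]. Because [h^2 <= s], the approximate unit [u = q s q] nearly fixes
    [h], so [h q s q h] is close to [h^2]; hence [v = q h]. *)
Lemma hereditary s p (e : R) : psd (em p) -> psd (em s - em p) -> 0 < e ->
  exists v, nm (star v ** s ** v - p) <= e.
Proof.
move=> hp hsp e0; have [h [hs h2 _ _]] := pos_sqrt hp.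
have hS : psd (em s) by rewrite -(subrK (em p) (em s)); exact: psdD.
have [d d0 de] := small_mul (nm_ge0 h) e0.
have [q [u [qs uE _ _ H]]] := approx_unit hS d0.
exists (q ** h); rewrite nmBC starM hs qs.
have -> : p - h ** q ** s ** (q ** h) = h ** (h - u ** h).
  by rewrite uE smulBr h2 !smulA.
apply: le_trans (nmM _ _) _; rewrite mulrC; apply: le_trans de.
rewrite ler_wpM2r ?nm_ge0//.
by have [_] := H h; apply; rewrite hs h2.
Qed.

End PositiveElements.

(** * Closed ideals and proper infiniteness *)

Section ClosedIdeals.
Variables (R : realType) (A : cstarAlgType R).
Implicit Types (a b c d p q s x y z : A) (I J : set A).

Lemma ci_subalg I : closed_ideal I -> closed_subalg I.
Proof. by case=> cI I0 ID IM; split=> // x y Ix Iy; have [] := IM x _ Iy. Qed.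

Lemma ciMl I a x : closed_ideal I -> I x -> I (a ** x).
Proof. by case=> _ _ _ IM /(IM a)[]. Qed.

Lemma ciMr I a x : closed_ideal I -> I x -> I (x ** a).
Proof. by case=> _ _ _ IM /(IM a)[]. Qed.

Lemma ci_lim I x : closed_ideal I ->
  (forall e : R, 0 < e -> exists2 y, I y & nm (x - y) <= e) -> I x.
Proof. by case=> cI _ _ _; exact: closed_nm. Qed.

(** An approximate unit [u] made from [x^* x] lies in [I], and [x u] is close to [x]. *)
Lemma ci_sq I x : closed_ideal I -> I (star x ** x) -> I x.
Proof.
move=> cI Ix; apply: ci_lim => // e e0.
have [q [u [_ _ _ HQ H]]] := approx_unit (psd_em_sq x) e0.
exists (x ** u); last by apply: (H x).1; rewrite subrr; exact: psd0.
by apply: ciMl => //; have [] := HQ I (ci_subalg cI) Ix.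
Qed.

(** Self-adjointness is not part of [closed_ideal]; it follows from [x x^*] being in [I]. *)
Lemma ci_star I x : closed_ideal I -> I x -> I (star x).
Proof.
by move=> cI Ix; apply: ci_sq => //; rewrite starK; exact: ciMr.
Qed.

Lemma ci_le I p q : closed_ideal I -> psd (em p) -> psd (em q - em p) ->
  I q -> I p.
Proof.
move=> cI hp hqp Iq; have [h [hs h2 _ _]] := pos_sqrt hp.
rewrite -h2; apply: ciMl => //; apply: ci_lim => // e e0.
have hq : psd (em q) by rewrite -(subrK (em p) (em q)); exact: psdD.
have [v [u [_ _ _ HQ H]]] := approx_unit hq e0.
exists (h ** u); last by apply: (H h).1; rewrite hs h2.
by apply: ciMl => //; have [] := HQ I (ci_subalg cI) Iq.
Qed.

Lemma ig_ci b : closed_ideal (ideal_generated b).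
Proof.
split.
- apply: closed_bigI => I [[]] //.
- by move=> I [[]].
- move=> k x y hx hy I [cI Ib]; have [_ _ h _] := cI.
  by apply: h; [exact: hx|exact: hy].
- move=> a x hx; split=> I [cI Ib]; [apply: ciMl => //|apply: ciMr => //];
  exact: hx.
Qed.

Lemma ig_self b : ideal_generated b b.
Proof. by move=> I [_]; exact. Qed.

Lemma ig_min I a b : closed_ideal I -> I b -> ideal_generated b a -> I a.
Proof. by move=> cI Ib; apply; split=> // _ ->. Qed.

End ClosedIdeals.

Section ProperlyInfinite.
Variables (R : realType) (A : cstarAlgType R).
Implicit Types (a b c d p q s x y z : A) (I J : set A).

(* [c + a <= a] in the Cuntz semigroup, for [a] and [c] placed orthogonally. *)
Definition absorbs a c : Prop := forall e : R, 0 < e -> exists y z,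
  [/\ nm (star y ** a ** y - a) <= e, nm (star z ** a ** z - c) <= e &
      nm (star y ** a ** z) <= e].

(** Absorb [c] next to a copy of [a], then [d] inside that copy: [y y'] carries [a] and [z + y z']
    carries [c + d]. The inner pair comes first, since its norms multiply the error of the outer
    one. *)
Lemma absorbsD a c d : star a = a ->
  absorbs a c -> absorbs a d -> absorbs a (c + d).
Proof.
move=> as_ hc hd e e0; have e40 : 0 < e / 4 by lra.
have [y' [z' [h1 h2 h3]]] := hd _ e40.
pose K := 1 + nm y' + nm z'.
have [y0 z0] : 0 <= nm y' /\ 0 <= nm z' by split; exact: nm_ge0.
have [f f0 fe] : exists2 f : R, 0 < f & f * (K ^+ 2) <= e / 4.
  by apply: small_mul => //; rewrite sqr_ge0.
have f0' := ltW f0.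
have fy : 0 <= f * nm y' by rewrite mulr_ge0.
have fz : 0 <= f * nm z' by rewrite mulr_ge0.
have fyy : 0 <= f * (nm y' * nm y') by rewrite !mulr_ge0.
have fyz : 0 <= f * (nm y' * nm z') by rewrite !mulr_ge0.
have fzz : 0 <= f * (nm z' * nm z') by rewrite !mulr_ge0.
have {}fe : f + f * nm y' + f * nm y' + f * nm z' + f * nm z' +
    f * (nm y' * nm y') + f * (nm y' * nm z') + f * (nm y' * nm z') +
    f * (nm z' * nm z') <= e / 4.
  by apply: le_trans fe; rewrite /K le_eqVlt; apply/orP; left; apply/eqP; ring.
have [y [z [k1 k2 k3]]] := hc _ f0.
have k4 : nm (star z ** a ** y) <= f.
  by rewrite -nm_star !starM starK as_ smulA.
have c1 u v : nm (star u ** (star y ** a ** y - a) ** v) <= f * (nm u * nm v).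
  apply: le_trans (nm_conj3 _ _ _) _; rewrite mulrAC mulrC ler_wpM2r//.
  by rewrite mulr_ge0 ?nm_ge0.
exists (y ** y'), (z + y ** z'); split.
- rewrite starM.
  have -> : star y' ** star y ** a ** (y ** y') - a =
      star y' ** (star y ** a ** y - a) ** y' + (star y' ** a ** y' - a).
    by rewrite smulBr smulBl !smulA; lin.
  by apply: le_trans (nmD _ _) _; have := c1 y' y'; lra.
- rewrite starD starM.
  have -> : (star z + star z' ** star y) ** a ** (z + y ** z') - (c + d) =
      (star z ** a ** z - c) + (star z' ** a ** z' - d) +
      star z' ** (star y ** a ** y - a) ** z' +
      star z ** a ** y ** z' + star z' ** (star y ** a ** z).
    rewrite smulBr smulBl !(smulDl, smulDr) !smulA; lin.
  have b1 : nm (star z ** a ** y ** z') <= f * nm z'.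
    by apply: le_trans (nmM _ _) _; rewrite ler_wpM2r ?nm_ge0.
  have b2 : nm (star z' ** (star y ** a ** z)) <= f * nm z'.
    by apply: le_trans (nmM _ _) _; rewrite nm_star mulrC ler_wpM2r ?nm_ge0.
  have b3 := c1 z' z'.
  apply: le_trans (nmD _ _) _; apply: le_trans (lerD (nmD _ _) (lexx _)) _.
  apply: le_trans (lerD (lerD (nmD _ _) (lexx _)) (lexx _)) _.
  apply: le_trans (lerD (lerD (lerD (nmD _ _) (lexx _)) (lexx _)) (lexx _)) _.
  lra.
- rewrite starM.
  have -> : star y' ** star y ** a ** (z + y ** z') =
      star y' ** (star y ** a ** z) +
      star y' ** (star y ** a ** y - a) ** z' + star y' ** a ** z'.
    rewrite smulBr smulBl !(smulDl, smulDr) !smulA; lin.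
  have b2 : nm (star y' ** (star y ** a ** z)) <= f * nm y'.
    by apply: le_trans (nmM _ _) _; rewrite nm_star mulrC ler_wpM2r ?nm_ge0.
  have b3 := c1 y' z'.
  apply: le_trans (nmD _ _) _; apply: le_trans (lerD (nmD _ _) (lexx _)) _.
  lra.
Qed.

Lemma absorbs_le a c d : absorbs a c -> psd (em d) -> psd (em c - em d) ->
  absorbs a d.
Proof.
move=> hc hd hcd e e0; have e20 : 0 < e / 2 by lra.
have [v hv] := hereditary hd hcd e20.
have v0 := nm_ge0 v.
have [f f0 fe] : exists2 f : R, 0 < f & f * ((1 + nm v) ^+ 2) <= e / 2.
  by apply: small_mul => //; rewrite sqr_ge0.
have [y [z [h1 h2 h3]]] := hc _ f0.
exists y, (z ** v); split.
- by apply: le_trans h1 _; nra.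
- have -> : star (z ** v) ** a ** (z ** v) - d =
    star v ** (star z ** a ** z - c) ** v + (star v ** c ** v - d).
    by rewrite starM smulBr smulBl !smulA; lin.
  apply: le_trans (nmD _ _) _.
  have : nm (star v ** (star z ** a ** z - c) ** v) <= f * (nm v * nm v).
    apply: le_trans (nm_conj3 _ _ _) _; rewrite mulrAC mulrC ler_wpM2r//.
    by rewrite mulr_ge0.
  nra.
- rewrite smulA; apply: le_trans (nmM _ _) _.
  apply: (@le_trans _ _ (f * nm v)); first by rewrite ler_wpM2r.
  nra.
Qed.

Lemma absorbs_conj a c r : absorbs a c -> absorbs a (star r ** c ** r).
Proof.
move=> hc e e0; have r0 := nm_ge0 r.
have [f f0 fe] : exists2 f : R, 0 < f & f * ((1 + nm r) ^+ 2) <= e.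
  by apply: small_mul => //; rewrite sqr_ge0.
have [y [z [h1 h2 h3]]] := hc _ f0.
exists y, (z ** r); split.
- by apply: le_trans h1 _; nra.
- have -> : star (z ** r) ** a ** (z ** r) - star r ** c ** r =
    star r ** (star z ** a ** z - c) ** r.
    by rewrite starM smulBr smulBl !smulA.
  apply: (@le_trans _ _ (f * (nm r * nm r))); last nra.
  apply: le_trans (nm_conj3 _ _ _) _; rewrite mulrAC mulrC ler_wpM2r//.
  by rewrite mulr_ge0.
- rewrite smulA; apply: le_trans (nmM _ _) _.
  apply: (@le_trans _ _ (f * nm r)); first by rewrite ler_wpM2r.
  nra.
Qed.

Lemma absorbs_scale a c (r : R) : absorbs a c -> absorbs a ((r ^+ 2)%:C%C *: c).
Proof.
move=> hc e e0; have r0 := normr_ge0 r.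
have [f f0 fe] : exists2 f : R, 0 < f & f * ((1 + `|r|) ^+ 2) <= e.
  by apply: small_mul => //; rewrite sqr_ge0.
have [y [z [h1 h2 h3]]] := hc _ f0.
exists y, (r%:C%C *: z); split.
- by apply: le_trans h1 _; nra.
- rewrite starZ conj_real !(smulZl, smulZr) scalerA -rmorphM -expr2 -scalerBr.
  rewrite nmZr normrX; apply: le_trans (ler_wpM2l (sqr_ge0 _) h2) _.
  by rewrite expr2; nra.
- rewrite smulZr nmZr; apply: le_trans (ler_wpM2l r0 h3) _; nra.
Qed.

Lemma absorbs_lim a c :
  (forall e : R, 0 < e -> exists2 d, absorbs a d & nm (c - d) <= e) ->
  absorbs a c.
Proof.
move=> H e e0; have e20 : 0 < e / 2 by lra.
have [d hd cd] := H _ e20; have [y [z [h1 h2 h3]]] := hd _ e20.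
exists y, z; split; [lra| |lra].
by apply: le_trans (nm_tri d _ _) _; rewrite (nmBC d); lra.
Qed.

Lemma absorbs0 a : psd (em a) -> absorbs a 0.
Proof.
move=> ha e e0; have h0 : psd (em a - em a) by rewrite subrr; exact: psd0.
have [v hv] := hereditary ha h0 e0.
exists v, 0; split => //; first by rewrite smul0r subrr nm0 ltW.
by rewrite smul0r nm0 ltW.
Qed.

(** Recasts absorption as membership in a closed ideal ([absorbed_ci]). Proper infiniteness of [a]
    then becomes the question whether this ideal contains [a]. *)
Definition absorbed a : set A := [set x | absorbs a (star x ** x)].

Lemma par_law x y : star (x + y) ** (x + y) + star (x - y) ** (x - y) =
  (star x ** x + star x ** x) + (star y ** y + star y ** y).
Proof. rewrite starB starD !(smulDl, smulDr, smulBl, smulBr, smulNl, smulNr); lin. Qed.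

(** By the parallelogram law, [(x + y)^* (x + y) <= 2 x^* x + 2 y^* y]. *)
Lemma absorbedD a x y : psd (em a) ->
  absorbed a x -> absorbed a y -> absorbed a (x + y).
Proof.
move=> ha hx hy; have as_ := psd_em_star ha.
have h := absorbsD as_ (absorbsD as_ hx hx) (absorbsD as_ hy hy).
apply: absorbs_le h (psd_em_sq _) _.
by rewrite -emB -par_law addrAC subrr add0r; exact: psd_em_sq.
Qed.

Lemma absorbedMr a x r : absorbed a x -> absorbed a (x ** r).
Proof.
by move=> hx; rewrite /absorbed /= starM -smulA (smulA (star x)) smulA;
   exact: absorbs_conj.
Qed.

Lemma sq_le_norm r : psd ((ur (nm r ^+ 2) : unitz A) - em (star r ** r)).
Proof.
apply: psd_sub_ob; first exact: psd_star (psd_em_sq r).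
by apply/ob_em; rewrite nm_cstar.
Qed.

Lemma absorbedMl a x r : absorbed a x -> absorbed a (r ** x).
Proof.
move=> hx; apply: absorbs_le (absorbs_scale (nm r) hx) (psd_em_sq _) _.
rewrite starM emZ.
have -> : (nm r ^+ 2)%:C%C *: em (star x ** x) - em (star x ** star r ** (r ** x)) =
   ustar (em x) * (ur (nm r ^+ 2) - em (star r ** r)) * em x.
  by rewrite mulrBr mulrBl ur_mulr -scalerAl !emM !em_star !mulrA.
exact: psd_conj (sq_le_norm r).
Qed.

Lemma absorbed_ci a : psd (em a) -> closed_ideal (absorbed a).
Proof.
move=> ha; have as_ := psd_em_star ha; split.
- apply: nm_closed => x H; apply: absorbs_lim => e e0.
  have x0 := nm_ge0 x.
  have [f f0 fe] : exists2 f : R, 0 < f & f * (2 * nm x + 1) <= e.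
    by apply: small_mul => //; lra.
  have [|y hy xy] := H (Num.min f 1); first by rewrite lt_min f0 ltr01.
  have xy1 : nm (x - y) <= f by rewrite (le_trans xy)// ge_min lexx.
  have xy2 : nm (x - y) <= 1 by rewrite (le_trans xy)// ge_min lexx orbT.
  exists (star y ** y) => //.
  have -> : star x ** x - star y ** y = star (x - y) ** y + star x ** (x - y).
    by rewrite starB smulBl smulBr; lin.
  have y1 : nm y <= nm x + 1.
    by apply: le_trans (half_norm_nm y x) _; rewrite nmBC; lra.
  have := nmM (star (x - y)) y; have := nmM (star x) (x - y); rewrite !nm_star.
  have := nmD (star (x - y) ** y) (star x ** (x - y)).
  have := nm_ge0 (x - y); have := nm_ge0 y; nra.
- by rewrite /absorbed /= smul0r; exact: absorbs0.
- move=> k x y hx hy; apply: absorbedD => //.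
  have -> : k *: x = x ** 0 + k *: x by rewrite smul0r add0r.
  rewrite smul0r add0r /absorbed /= starZ smulZl smulZr scalerA.
  have -> : k^* * k = (nm (k : R[i]^o) ^+ 2)%:C%C.
    by rewrite mulrC -normCK nmC rmorphXn.
  exact: absorbs_scale.
- by move=> r x hx; split; [exact: absorbedMl|exact: absorbedMr].
Qed.

End ProperlyInfinite.

(** * Comparison absorbs orthogonal and square-zero elements *)

Section Nilpotents.
Variables (R : realType) (A : cstarAlgType R).
Implicit Types (a b c d m n p q x y z : A) (I J : set A).

Definition ideal_comparison : Prop := forall a b, psd (em a) -> psd (em b) ->
  ideal_generated b a ->
  forall e : R, 0 < e -> exists x, nm (star x ** b ** x - a) <= e.

Lemma psd_fst (T : unitz A) : psd T -> exists2 r : R, 0 <= r & T.1 = r%:C%C.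
Proof.
move=> [Ts [M M0 [h _]]]; have /= Ts1 := congr1 fst Ts.
have r1 : T.1 \is Num.real by rewrite CrealE Ts1.
have TE : T.1 = (complex.Re T.1)%:C%C by rewrite RRe_real.
exists (complex.Re T.1) => //.
have : nm (M%:C%C - T.1 : R[i]^o) <= M.
  by apply: le_trans h; rewrite /= /GRing.scale /= mulr1.
have -> : M%:C%C - T.1 = (M - complex.Re T.1)%:C%C by rewrite {1}TE rmorphB.
by rewrite nm_real ler_norml => /andP[]; lra.
Qed.

Lemma parts_fst (P N : unitz A) : psd P -> psd N -> P * N = 0 ->
  (P - N).1 = 1 -> N.1 = 0.
Proof.
move=> /psd_fst[r r0 Pr] /psd_fst[s s0 Ns] PN; rewrite /= => h.
have /= := congr1 fst PN; rewrite Pr Ns -rmorphM => /eqP.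
rewrite fmorph_eq0 mulf_eq0 => /orP[/eqP r00|/eqP -> //].
by exfalso; move: h; rewrite Pr Ns r00 => /(congr1 (@complex.Re R)) /=; lra.
Qed.

Lemma parts_em (P N : unitz A) : psd P -> psd N -> P * N = 0 ->
  (P - N).1 = 0 -> P.1 = 0 /\ N.1 = 0.
Proof.
move=> /psd_fst[r r0 Pr] /psd_fst[s s0 Ns] PN; rewrite /= => h.
have rs : r = s.
  by move: h; rewrite Pr Ns => /(congr1 (@complex.Re R)) /=; lra.
have /= := congr1 fst PN; rewrite Pr Ns rs -rmorphM => /eqP.
by rewrite fmorph_eq0 mulf_eq0 orbb => /eqP ->.
Qed.

Lemma annihilator_subalg m : closed_subalg [set z | m ** z = 0].
Proof.
split=> [|/=|k x y /= hx hy|x y /= hx hy].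
- apply: nm_closed => x H; apply: nm_small => e e0.
  have [d d0 de] := small_mul (nm_ge0 m) e0.
  have [y /= my xy] := H _ d0.
  rewrite -[x](subrK y) smulDr my addr0; apply: le_trans (nmM _ _) _.
  by rewrite mulrC; apply: le_trans de; rewrite ler_wpM2r ?nm_ge0.
- exact: smul0r.
- by rewrite smulDr smulZr hx hy scaler0 addr0.
- by rewrite smulA hx smul0l.
Qed.

(** Comparison gives [y^* m y] close to [a] and [w^* a w] close to [m + n]. Then [w y1] carries [a]
    through [m], where [y1 = (1 - u) y] has been cleared of its component along [n], and [w n]
    carries [n^3] orthogonally to it. *)
Lemma absorbs_orth a m n : ideal_comparison -> psd (em a) -> psd (em m) ->
  psd (em n) -> m ** n = 0 -> ideal_generated m a ->
  ideal_generated a (m + n) -> absorbed a n.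
Proof.
move=> comp ha hm hn mn ma amn.
have ms := psd_em_star hm; have ns := psd_em_star hn.
have nm_ : n ** m = 0 by rewrite -ns -ms -starM mn star0.
have [r [rs r2 hr _]] := pos_sqrt hn.
(* What is obtained directly is [n (m + n) n = n^3]; the ideal property of [absorbed a] then returns
   to [n]. *)
suff : absorbs a (n ** n ** n).
  have cI := absorbed_ci ha.
  have -> : n ** n ** n = star (r ** n) ** (r ** n).
    by rewrite starM ns rs -!smulA; congr (_ ** _); rewrite !smulA r2.
  move=> h; have {}h : absorbed a (n ** n).
    by rewrite -{1}r2 -smulA; exact: (ciMl r cI h).
  by apply: (ci_sq cI); rewrite ns.
move=> e e0; have e40 : 0 < e / 4 by lra.
have [y hy] := comp _ _ ha hm ma _ e40.
have y0 := nm_ge0 y; have n0 := nm_ge0 n; have r0 := nm_ge0 r.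
have [d d0 de] : exists2 d : R, 0 < d &
    d * (nm y * (nm r * nm y) + nm y * (nm r * nm n)) <= e / 4.
  by apply: small_mul => //; rewrite addr_ge0// ?mulr_ge0.
have [v [u [_ _ [hu hu1] HQ H]]] := approx_unit hn d0.
have us := psd_em_star hu.
have [_ mu] := HQ _ (annihilator_subalg m) mn; rewrite /= in mu.
have um : u ** m = 0 by rewrite -us -ms -starM mu star0.
have ur_ : nm (r - u ** r) <= d by apply: (H r).2; rewrite rs r2 subrr; exact: psd0.
have ru : nm (r - r ** u) <= d by apply: (H r).1; rewrite rs r2 subrr; exact: psd0.
pose y1 := y - u ** y.
have y1E : nm y1 <= nm y.
  have [_ /(_ y)] := hu1; rewrite uaD ua1 uaN ua_em mul1r; exact.
have my1 : m ** y1 = m ** y by rewrite smulBr smulA mu smul0l subr0.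
have y1m : star y1 ** m = star y ** m.
  by rewrite starB starM us smulBl -smulA um smul0r subr0.
have ry1 : nm (r ** y1) <= d * nm y.
  have -> : r ** y1 = (r - r ** u) ** y by rewrite smulBr smulBl smulA.
  by apply: le_trans (nmM _ _) _; rewrite ler_wpM2r.
have [f f0 fe] : exists2 f : R, 0 < f & f * ((nm y + nm n + 1) ^+ 2) <= e / 4.
  by apply: small_mul => //; rewrite sqr_ge0.
have hMs : psd (em (m + n)) by exact: psd_emD.
have [w hw] := comp _ _ hMs ha amn _ f0.
have wE s t : star (w ** s) ** a ** (w ** t) =
    star s ** (star w ** a ** w - (m + n)) ** t + star s ** (m + n) ** t.
  by rewrite starM smulBr smulBl !smulA; lin.
have wB s t : nm s <= nm y + nm n + 1 -> nm t <= nm y + nm n + 1 ->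
    nm (star s ** (star w ** a ** w - (m + n)) ** t) <= e / 4.
  move=> hs ht; apply: le_trans fe; apply: le_trans (nm_conj3 _ _ _) _.
  rewrite mulrAC [leRHS]mulrC expr2; apply: ler_pM => //; rewrite ?mulr_ge0 ?nm_ge0//.
  by apply: ler_pM => //; rewrite ?nm_ge0.
have y1n : nm (star y1 ** n ** y1) <= e / 4.
  have -> : star y1 ** n ** y1 = star (r ** y1) ** (r ** y1).
    by rewrite starM rs -{1}r2 !smulA.
  apply: le_trans (nmM _ _) _; rewrite nm_star.
  have h : nm (r ** y1) <= nm r * nm y.
    by apply: le_trans (nmM _ _) _; rewrite ler_wpM2l.
  apply: le_trans (ler_pM (nm_ge0 _) (nm_ge0 _) ry1 h) _.
  apply: le_trans de; rewrite -mulrA ler_wpM2l ?(ltW d0)// lerDl !mulr_ge0//.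
have Y1 : nm y1 <= nm y + nm n + 1 by lra.
have N1 : nm n <= nm y + nm n + 1 by lra.
exists (w ** y1), (w ** n); split; rewrite wE.
- have -> : star y1 ** (m + n) ** y1 = star y ** m ** y + star y1 ** n ** y1.
    by rewrite (smulDr (star y1) m n) smulDl y1m -(smulA _ m y1) my1 smulA.
  have := wB _ _ Y1 Y1; set E := star y1 ** _ ** y1 => hE.
  have -> : E + (star y ** m ** y + star y1 ** n ** y1) - a =
    E + (star y ** m ** y - a) + star y1 ** n ** y1 by lin.
  apply: le_trans (nmD _ _) _; have := nmD E (star y ** m ** y - a); lra.
- have -> : star n ** (m + n) ** n = n ** n ** n.
    by rewrite ns smulDr nm_ add0r.
  by rewrite addrK; apply: le_trans (wB _ _ N1 N1) _; lra.
- have -> : star y1 ** (m + n) ** n = star (r ** y1) ** (r ** n).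
    rewrite (smulDr (star y1) m n) smulDl -(smulA _ m) mn smul0r add0r starM rs.
    by rewrite -{1}r2 !smulA.
  apply: le_trans (nmD _ _) _.
  have h2 : nm (star (r ** y1) ** (r ** n)) <= e / 4.
    apply: le_trans (nmM _ _) _; rewrite nm_star.
    apply: le_trans (ler_pM (nm_ge0 _) (nm_ge0 _) ry1 (nmM _ _)) _.
    by apply: le_trans de; rewrite -mulrA ler_wpM2l ?(ltW d0)// lerDr !mulr_ge0.
  by have := wB _ _ Y1 N1; lra.
Qed.

(** Since [x^2 = 0], [p = x^* x] and [q = x x^*] are orthogonal, and they generate the same ideal.
    [absorbs_orth] is applied to a cut-down [n] of [q] and to [m = g a g + p], where [g] annihilates
    [n] and equals 1 modulo the ideal of [q]. The summand [p] recovers what the cut by [g] loses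
    from [a]. *)
Lemma absorbed_nilpotent a x : ideal_comparison -> psd (em a) ->
  ideal_generated a x -> x ** x = 0 -> absorbed a x.
Proof.
move=> comp ha ax x2; have cI := absorbed_ci ha; have cK := ig_ci a.
pose p := star x ** x; pose q := x ** star x.
have xs2 : star x ** star x = 0 by rewrite -starM x2 star0.
have pq : p ** q = 0.
  by rewrite /p /q smulA -(smulA _ x x) x2 smul0r smul0l.
have hp : psd (em p) := psd_em_sq x; have hq : psd (em q) := psd_em_sqr x.
suff Iq : absorbed a q.
  by rewrite -[x]starK; apply: (ci_star cI); apply: (ci_sq cI); rewrite starK.
apply: (ci_lim cI) => e e0; have en := lt0r_neq0 e0.
have ei : 0 <= e^-1 by rewrite invr_ge0 ltW.
(* The positive part is [g = (1 - q / e)_+], of scalar part 1, and the negative part is [n] with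
   [e n = (q - e)_+]. *)
pose T : unitz A := 1 - e^-1%:C%C *: em q.
have Ts : ustar T = T by rewrite ustarB ustar1 ustarZr (psd_star hq).
have [g [N [[hg hN TE gN Ng] [Tc TQ _ _]]]] := psd_parts Ts.
have N0 : N.1 = 0.
  by apply: (parts_fst hg hN gN); rewrite -TE /T /= scaler0 subr0.
pose n := up N; have nE : em n = N by exact: em_up.
have hn : psd (em n) by rewrite nE.
have TQ' Q : closed_subalg Q -> Q q -> Q n.
  move=> Qs Qq; have QT : Q T.2.
    by rewrite /T /= sub0r; apply: closed_subalgN => //; exact: closed_subalgZ.
  apply: (TQ Q Qs QT _).2.
  apply: (closed_subalgD Qs); last exact: (closed_subalgM Qs).
  by apply: (closed_subalgD Qs); exact: (closed_subalgZ _ Qs).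
have gT : g * em q = em q * g.
  have h : em q * T = T * em q.
    by rewrite mulrBr mulrBl mulr1 mul1r -scalerAr -scalerAl.
  by have [-> _] := Tc _ h.
have g1 : g.1 = 1.
  by rewrite -[g](subrK N) -TE /T /= N0 scaler0 subr0 addr0.
have qN : q - e%:C%C *: n = up (e%:C%C *: (1 - g)).
  apply: em_inj; rewrite em_up.
    have -> : g = T + N by rewrite TE subrK.
    rewrite emB emZ nE /T opprD addrA opprB addrCA subrr addr0 scalerBr.
    by rewrite scaleCK.
  by rewrite /= g1 subrr scaler0.
exists (e%:C%C *: n).
  have -> : e%:C%C *: n = e%:C%C *: n + 0 by rewrite addr0.
  have [_ I0 ID _] := cI; apply: ID => //.
  have pn : p ** n = 0 by exact: TQ' (annihilator_subalg p) pq.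
  pose m0 := up (g * em a * g).
  have m0E : em m0 = g * em a * g by apply: em_up; rewrite /= !(mulr0, mul0r).
  have hm0 : psd (em m0).
    by rewrite m0E -{1}(psd_star hg); exact: psd_conj.
  have hm : psd (em (m0 + p)) by exact: psd_emD.
  pose c := n - e^-1%:C%C *: q.
  have gE : g = 1 + em c.
    have -> : g = T + N by rewrite TE subrK.
    by rewrite /T emB nE emZ; lin.
  have m0A : m0 = a + c ** a + (a + c ** a) ** c.
    apply: em_inj; rewrite m0E gE !(emD, emM) mulrDl mul1r mulrDr mulr1 //.
  have Km (I : set A) : closed_ideal I -> I q -> I c.
    move=> hI Iq; have sI := ci_subalg hI; apply: (closed_subalgD sI).
      exact: TQ' sI Iq.
    by apply: (closed_subalgN sI); exact: (closed_subalgZ _ sI).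
  have sa := ci_subalg cK.
  have Kp : ideal_generated a p by exact: (ciMl _ cK ax).
  have Kq : ideal_generated a q by exact: (ciMr _ cK ax).
  have Kn : ideal_generated a n by exact: (TQ' _ sa Kq).
  apply: (@absorbs_orth a (m0 + p)) => //.
  - rewrite smulDl pn addr0; apply: em_inj; rewrite emM m0E nE.
    by rewrite -mulrA gN mulr0.
  - have cM := ig_ci (m0 + p); have sM := ci_subalg cM.
    have Mm := @ig_self _ _ (m0 + p).
    have Mp : ideal_generated (m0 + p) p.
      by apply: (ci_le cM) Mm => //; rewrite -emB addrK.
    have Mx : ideal_generated (m0 + p) x := ci_sq cM Mp.
    have Mc : ideal_generated (m0 + p) c := Km _ cM (ciMr (star x) cM Mx).
    have -> : a = (m0 + p) - p - c ** a - (a + c ** a) ** c.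
      by rewrite m0A; lin.
    apply: (closed_subalgD sM).
      apply: (closed_subalgD sM).
        by apply: (closed_subalgD sM) => //; exact: (closed_subalgN sM).
      by apply: (closed_subalgN sM); exact: (ciMr _ cM).
    by apply: (closed_subalgN sM); exact: (ciMl _ cM).
  - have Ka := @ig_self _ _ a.
    apply: (closed_subalgD sa) => //; apply: (closed_subalgD sa) => //.
    rewrite m0A; apply: (closed_subalgD sa).
      by apply: (closed_subalgD sa) => //; exact: (ciMl _ cK).
    by apply: (ciMl _ cK); exact: (Km _ cK Kq).
(* As [q - e n = e (1 - g)], the approximation error is at most [e] once [0 <= 1 - g <= 1]. *)
have hg1 : psd (1 - g).
  have gg : g * g = g * T by rewrite TE mulrBr gN subr0.
  have -> : 1 - g = (1 - g) * (1 - g) + g * (1 - g).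
    by rewrite -mulrDl subrK mul1r.
  apply: psdD; first by apply: psd_sq; rewrite ustarB ustar1 psd_star.
  have -> : g * (1 - g) = g * (e^-1%:C%C *: em q).
    by rewrite mulrBr gg -mulrBr /T opprB addrCA subrr addr0.
  apply: psd_mulC => //; first exact: psdZ.
  by rewrite -scalerAr -scalerAl gT.
have h1 : ob (1 - g) 1 by apply: psd_le_ob => //; rewrite ur1 opprB addrCA subrr addr0.
rewrite qN; apply/ob_em; rewrite em_up; last first.
  by rewrite /= g1 subrr scaler0.
by apply: ob_le (obZp (ltW e0) h1); rewrite mulr1.
Qed.

End Nilpotents.

(** * A closed ideal that is prime on orthogonal pairs *)

Section PrimeIdeal.
Variables (R : realType) (A : cstarAlgType R).
Implicit Types (a b c d m n p q x y z : A) (I J : set A).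

Lemma smallest_ci (S : set A) : closed_ideal (smallest (@closed_ideal R A) S).
Proof.
split.
- apply: closed_bigI => I [[]] //.
- by move=> I [[]].
- move=> k x y hx hy I [cI Ib]; have [_ _ h _] := cI.
  by apply: h; [exact: hx|exact: hy].
- move=> a x hx; split=> I [cI Ib]; [apply: (ciMl a cI)|apply: (ciMr a cI)];
  exact: hx.
Qed.

(** A lower bound for the quotient norm of [x], without forming the quotient as a C*-algebra. *)
Definition far J x (d : R) : Prop := forall j, J j -> d <= nm (x - j).

Lemma unit_cut (u x : A) : star u = u -> ob (1 - em u) 1 ->
  nm (x - u ** x) <= nm x /\ nm (x - x ** u) <= nm x.
Proof.
move=> us [_ hu].
have h y : nm (y - u ** y) <= nm y.
  by have := hu y; rewrite uaD ua1 uaN ua_em mul1r.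
split=> //; rewrite -nm_star starB starM us -(nm_star x); exact: h.
Qed.

Lemma ideal_unit J j (e : R) : closed_ideal J -> J j -> 0 < e ->
  exists u, [/\ J u, star u = u, ob (1 - em u) 1 & nm (j - j ** u) <= e].
Proof.
move=> cJ Jj e0.
have [q [u [_ _ [hu hu1] HQ H]]] := approx_unit (psd_em_sq j) e0.
exists u; split=> //; [|exact: psd_em_star|].
- have := HQ J (ci_subalg cJ) (ciMl (star j) cJ Jj); by case.
- by apply: (H j).1; rewrite subrr; exact: psd0.
Qed.

(** The C*-identity for the quotient norm. For [j] in [J] and an approximate unit [u] of [J],
    [|x (1 - u)|^2 = |(1 - u) x^2 (1 - u)|], which is at most [|x^2 - j|] up to a small error. *)
Lemma far_sq J x (d : R) : closed_ideal J -> 0 <= d -> star x = x ->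
  far J x d -> far J (x ** x) (d ^+ 2).
Proof.
move=> cJ d0 xs hx j Jj; apply/ler_addgt0Pr => e e0.
have [u [Ju us hu ju]] := ideal_unit cJ Jj e0.
have h1 : d <= nm (x - x ** u) by apply: hx; exact: (ciMl x cJ Ju).
apply: (@le_trans _ _ (nm (x - x ** u) ^+ 2)); first by rewrite ler_pXn2r ?nnegrE ?nm_ge0.
rewrite -nm_cstar starB starM xs us.
have -> : (x - u ** x) ** (x - x ** u) =
   let w := (x ** x - j) - u ** (x ** x - j) in
   (w - w ** u) + ((j - j ** u) - u ** (j - j ** u)).
  by rewrite /= !(smulBr, smulBl) !smulA; lin.
rewrite /=; apply: le_trans (nmD _ _) _; apply: lerD.
  apply: le_trans (unit_cut _ us hu).2 _; exact: (unit_cut _ us hu).1.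
by apply: le_trans (unit_cut _ us hu).1 _.
Qed.

(** The power [x^(2^k)], built by squaring because the quotient norm is only known to be
    multiplicative on squares. *)
Fixpoint sqk x k : A := if k is l.+1 then sqk x l ** sqk x l else x.

Lemma sqk_star x k : star x = x -> star (sqk x k) = sqk x k.
Proof. by move=> xs; elim: k => //= k IH; rewrite starM IH. Qed.

Lemma sqk_far J x (d : R) k : closed_ideal J -> 0 <= d -> star x = x ->
  far J x d -> far J (sqk x k) (d ^+ (2 ^ k)).
Proof.
move=> cJ d0 xs hx; elim: k => [|k IH]; first by rewrite expn0 expr1.
rewrite expnSr exprM; apply: far_sq => //; first by rewrite exprn_ge0.
exact: sqk_star.
Qed.

Lemma sqk_nm x k : nm (sqk x k) <= nm x ^+ (2 ^ k).
Proof.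
elim: k => [|k IH]; first by rewrite expn0 expr1.
rewrite expnSr exprM expr2; apply: le_trans (nmM _ _) _.
by apply: ler_pM; rewrite ?nm_ge0.
Qed.

Lemma ciB J x y : closed_ideal J -> J x -> J y -> J (x - y).
Proof.
move=> cJ Jx Jy; apply: (closed_subalgD (ci_subalg cJ)) => //.
exact: (closed_subalgN (ci_subalg cJ)).
Qed.

Lemma ciD J x y : closed_ideal J -> J x -> J y -> J (x + y).
Proof. by move=> cJ; exact: (closed_subalgD (ci_subalg cJ)). Qed.

Lemma ciZ J (k : R[i]) x : closed_ideal J -> J x -> J (k *: x).
Proof. by move=> cJ; exact: (closed_subalgZ k (ci_subalg cJ)). Qed.

Lemma sqk_mod J x y k : closed_ideal J -> J (x - y) -> J (sqk x k - sqk y k).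
Proof.
move=> cJ Jxy; elim: k => //= k IH.
have -> : sqk x k ** sqk x k - sqk y k ** sqk y k =
    (sqk x k - sqk y k) ** sqk x k + sqk y k ** (sqk x k - sqk y k).
  by rewrite smulBl smulBr; lin.
by apply: (ciD cJ); [exact: (ciMr _ cJ IH)|exact: (ciMl _ cJ IH)].
Qed.

Lemma closed_mulr J c x : closed_ideal J ->
  (forall e : R, 0 < e -> exists2 y, J (y ** c) & nm (x - y) <= e) -> J (x ** c).
Proof.
move=> cJ H; apply: (ci_lim cJ) => e e0.
have [d d0 de] := small_mul (nm_ge0 c) e0; have [y Jy xy] := H _ d0.
exists (y ** c) => //; rewrite -smulBl; apply: le_trans (nmM _ _) _.
by apply: le_trans de; rewrite ler_wpM2r ?nm_ge0.
Qed.

Lemma closed_mull J c x : closed_ideal J ->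
  (forall e : R, 0 < e -> exists2 y, J (c ** y) & nm (x - y) <= e) -> J (c ** x).
Proof.
move=> cJ H; apply: (ci_lim cJ) => e e0.
have [d d0 de] := small_mul (nm_ge0 c) e0; have [y Jy xy] := H _ d0.
exists (c ** y) => //; rewrite -smulBr; apply: le_trans (nmM _ _) _.
by apply: le_trans de; rewrite mulrC ler_wpM2r ?nm_ge0.
Qed.

Definition add_gen J p : set A := smallest (@closed_ideal R A) (J `|` [set p]).

Lemma add_gen_ci J p : closed_ideal (add_gen J p).
Proof. exact: smallest_ci. Qed.

Lemma add_gen_sub J p : J `<=` add_gen J p.
Proof. by move=> x Jx I [_]; apply; left. Qed.

Lemma add_gen_in J p : add_gen J p p.
Proof. by move=> I [_]; apply; right. Qed.

Lemma add_gen_min J p I x : closed_ideal I -> J `<=` I -> I p ->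
  add_gen J p x -> I x.
Proof. by move=> cI JI Ip; apply; split=> // y [/JI|/= ->]. Qed.

(** The elements [w] with [w A q] inside [J] form a closed ideal containing [J] and [p]; the same
    argument is then repeated for the right factor. Without a unit, [w ** q] and [w ** y ** q] have
    to be followed separately. *)
Lemma add_gen_mul J p q x z : closed_ideal J -> J (p ** q) ->
  (forall y, J (p ** y ** q)) -> add_gen J p x -> add_gen J q z -> J (x ** z).
Proof.
move=> cJ Jpq Jpyq hx hz.
have hT w : add_gen J p w -> J (w ** q) /\ forall y, J (w ** y ** q).
  apply: (@add_gen_min _ _ [set w | J (w ** q) /\ forall y, J (w ** y ** q)]).
  - split.
    + apply: nm_closed => /= v H; split=> [|y].
        by apply: closed_mulr => // e /H[w' [h _] vw]; exists w'.
      rewrite -smulA; apply: closed_mulr => // e /H[w' [_ h] vw].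
      by exists w' => //; rewrite smulA.
    + by split=> [|y]; rewrite !smul0l; have [] := cJ.
    + move=> k v w' [v1 v2] [w1 w2]; have [_ _ h _] := cJ.
      by split=> [|y]; rewrite !smulDl !smulZl; exact: h.
    + move=> b v [v1 v2]; split; split=> [|y].
      * by rewrite -smulA; exact: (ciMl b cJ v1).
      * by rewrite -!smulA (smulA v); exact: (ciMl b cJ (v2 y)).
      * exact: v2.
      * by rewrite -(smulA v b y); exact: v2.
  - move=> w' Jw; split=> [|y]; first exact: (ciMr _ cJ Jw).
    by rewrite -smulA; exact: (ciMr _ cJ Jw).
  - by [].
pose W := [set z | forall x, add_gen J p x ->
  J (x ** z) /\ forall y, J (x ** y ** z)].
have : W z.
  move: hz; apply: (@add_gen_min J q W).
  - split.
    + apply: nm_closed => /= v H x' hx'; split=> [|y].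
        by apply: closed_mull => // e /H[w' h vw]; exists w' => //; have [] := h _ hx'.
      by apply: closed_mull => // e /H[w' h vw]; exists w' => //; have [] := h _ hx'.
    + by move=> x' _; split=> [|y]; rewrite !smul0r; have [] := cJ.
    + move=> k v w hv hw x' hx'; have [_ _ h _] := cJ.
      have [v1 v2] := hv _ hx'; have [w1 w2] := hw _ hx'.
      by split=> [|y]; rewrite !smulDr !smulZr; exact: h.
    + move=> b v hv; split=> x' hx'; have [v1 v2] := hv _ hx'.
        by split=> [|y]; rewrite smulA// -(smulA x').
      by split=> [|y]; rewrite smulA; [exact: (ciMr b cJ v1)|exact: (ciMr b cJ (v2 y))].
  - move=> w Jw x' _; split=> [|y]; exact: (ciMl _ cJ Jw).
  - by move=> x' /hT.
by move=> /(_ _ hx)[].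
Qed.

(** The factor 3 serves the bound [Y X + (X + Y) Y <= 3 X Y] that concludes [prime_ideal]. *)
Lemma geometric_pow2 (t : R) : 0 <= t -> t < 1 -> exists k, 3 * t ^+ (2 ^ k) < 1.
Proof.
move=> t0 t1.
have : (fun i : nat => t ^+ i) @ \oo --> (0 : R) by apply: cvg_expr; rewrite ger0_norm.
move=> /cvgrPdist_lt/(_ 3^-1)[|N _ /(_ N (leqnn _))]; first by rewrite invr_gt0.
rewrite sub0r normrN ger0_norm ?exprn_ge0// => h; exists N.
have : t ^+ (2 ^ N) <= t ^+ N.
  by apply: ler_wiXn2l => //; [exact: ltW|rewrite ltnW// ltn_expl].
lra.
Qed.

(* A closed ideal maximal among those containing [I] at distance [dist(a, I)]
   from [a]: the norm on the quotient being multiplicative on squares, it is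
   prime as far as orthogonal pairs are concerned. *)
Lemma prime_ideal I a : closed_ideal I -> star a = a -> ~ I a ->
  exists J (d : R), [/\ closed_ideal J, I `<=` J, 0 < d, far J a d &
    forall p q, p ** q = 0 -> (forall y, J (p ** y ** q)) -> J p \/ J q].
Proof.
move=> cI as_ Ia.
pose E : set R := [set nm (a - j) | j in I].
have E0 : E !=set0 by exists (nm (a - 0)), 0 => //; have [] := cI.
have Elb : has_lbound E by exists 0 => _ [j _ <-]; exact: nm_ge0.
have hE : has_inf E by [].
pose d := inf E.
have farI : far I a d by move=> j Ij; apply: ge_inf => //; exists j.
have d0 : 0 < d.
  rewrite lt_neqAle; apply/andP; split; last first.
    by apply: lb_le_inf => // _ [j _ <-]; exact: nm_ge0.
  apply/negP => /eqP d0; apply: Ia; apply: (ci_lim cI) => e e0.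
  have [_ [j Ij <-] h] := inf_adherent e0 hE.
  by exists j => //; apply: ltW; rewrite -/d -d0 add0r in h.
(* Closedness is left out because unions of chains lose it. Maximality restores it, as the closure
   of [J] keeps its distance from [a]. *)
pose alg X := [/\ X 0, forall (k : R[i]) x y, X x -> X y -> X (k *: x + y) &
  forall b x, X x -> X (b ** x) /\ X (x ** b)].
pose P X := [/\ alg X, I `<=` X & far X a d].
have aI : alg I by case: cI.
have [J PJ Jmax] : exists2 J, P J & forall K, J `<=` K -> P K -> K `<=` J.
  pose Q X := X = set0 \/ P X.
  have [|J [QJ Jmax]] := @Zorn_bigcup A Q.
    move=> F FQ Ftot.
    have [[X FX PX]|noX] := pselect (exists2 X, F X & P X); last first.
      left; rewrite -subset0 => x [X FX Xx]; case: (FQ _ FX) => [X0|PX].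
        by rewrite X0 in Xx.
      by case: noX; exists X.
    right; have PF Y y : F Y -> Y y -> P Y.
      by move=> FY Yy; case: (FQ _ FY) => // Y0; rewrite Y0 in Yy.
    have [[X0 _ _] IX _] := PX; split; first split.
    - by exists X.
    - move=> k x y [Y FY Yx] [Z FZ Zy].
      have [[_ hY _] _ _] := PF _ _ FY Yx; have [[_ hZ _] _ _] := PF _ _ FZ Zy.
      have [YZ|ZY] := Ftot _ _ FY FZ.
        by exists Z => //; apply: hZ => //; exact: YZ.
      by exists Y => //; apply: hY => //; exact: ZY.
    - move=> b x [Y FY Yx]; have [[_ _ hY] _ _] := PF _ _ FY Yx.
      by have [h1 h2] := hY b _ Yx; split; exists Y.
    - by move=> x /IX Xx; exists X.
    - by move=> j [Y FY Yj]; have [_ _ h] := PF _ _ FY Yj; exact: h.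
  exists J => [|K JK PK].
    case: QJ => // J0; exfalso; apply: (Jmax I); last by right; split.
    by rewrite J0; split => // I0; apply: (I0 0); have [] := aI.
  apply: contrapT => nKJ; apply: (Jmax K); last by right.
  by split.
have [aJ IJ farJ] := PJ.
have cJ : closed_ideal J.
  pose L := [set x | forall e : R, 0 < e -> exists2 y, J y & nm (x - y) <= e].
  have JL : J `<=` L by move=> x Jx e e0; exists x; rewrite // subrr nm0 ltW.
  have LJ : L `<=` J.
    apply: (Jmax L JL); split.
    - have [J0 JD JM] := aJ; split; first exact: JL.
      + move=> k x y Lx Ly e e0; have e20 : 0 < e / 2 by lra.
        have [f f0 fe] := small_mul (nm_ge0 (k : R[i]^o)) e20.
        have [x' Jx' xx] := Lx _ f0; have [y' Jy' yy] := Ly _ e20.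
        exists (k *: x' + y'); first exact: JD.
        have -> : k *: x + y - (k *: x' + y') = k *: (x - x') + (y - y') by lin.
        apply: le_trans (nmD _ _) _; rewrite nmZ.
        have := nm_ge0 (k : R[i]^o); nra.
      + move=> b x Lx; split=> e e0.
          have [f f0 fe] := small_mul (nm_ge0 b) e0; have [y Jy xy] := Lx _ f0.
          exists (b ** y); first by case: (JM b _ Jy).
          rewrite -smulBr; apply: le_trans (nmM _ _) _; apply: le_trans fe.
          by rewrite mulrC ler_wpM2r ?nm_ge0.
        have [f f0 fe] := small_mul (nm_ge0 b) e0; have [y Jy xy] := Lx _ f0.
        exists (y ** b); first by case: (JM b _ Jy).
        rewrite -smulBl; apply: le_trans (nmM _ _) _; apply: le_trans fe.
        by rewrite ler_wpM2r ?nm_ge0.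
    - by move=> x /IJ; exact: JL.
    - move=> x Lx; apply/ler_addgt0Pr => e e0; have [y Jy xy] := Lx _ e0.
      apply: le_trans (farJ _ Jy) _; apply: le_trans (nm_tri x _ _) _.
      by rewrite lerD2l.
  have [J0 JD JM] := aJ; split => //; apply: nm_closed => x h.
  exact: LJ.
exists J, d; split=> // p q pq Jpq.
apply: contrapT => /not_orP[Jp Jq].
have step r : ~ J r -> exists2 j, add_gen J r j & nm (a - j) < d.
  move=> Jr; apply: contrapT => h; apply: Jr.
  apply: (Jmax (add_gen J r) (@add_gen_sub J r)); last exact: add_gen_in.
  have [_ h1 h2 h3] := add_gen_ci J r; split; first by split.
    by move=> x /IJ; exact: add_gen_sub.
  move=> j hj; rewrite leNgt; apply/negP => hlt; apply: h; by exists j.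
have [j1 J1 h1] := step _ Jp; have [j2 J2 h2] := step _ Jq.
pose rho := Num.max (nm (a - j1)) (nm (a - j2)).
have r1 : nm (a - j1) <= rho by rewrite le_max lexx.
have r2 : nm (a - j2) <= rho by rewrite le_max lexx orbT.
have rd : rho < d by rewrite gt_max h1 h2.
have rho0 : 0 <= rho by apply: le_trans r1; exact: nm_ge0.
(* With [rho = d - 2 tau] one gets [rho (d + tau) < d^2]. Correcting [a] by an element of [I] then
   yields [a0] of norm at most [d + tau]. *)
pose tau := (d - rho) / 2.
have tau0 : 0 < tau by rewrite /tau; lra.
have [_ [i Ii <-] hi] := inf_adherent tau0 hE; rewrite -/d in hi.
pose i' := (2^-1 : R)%:C%C *: (i + star i).
have Ji' : J i'.
  by apply: (ciZ _ cJ); apply: (ciD cJ); [exact: IJ|apply: (ci_star cJ); exact: IJ].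
pose a0 := a - i'.
have h2x x : (2^-1 : R)%:C%C *: (x + x) = x.
  have -> : x + x = (2 : R)%:C%C *: x by rewrite rmorph_nat scaler_nat mulr2n.
  by rewrite scalerA -rmorphM /= mulVf// rmorph1 scale1r.
have a0s : star a0 = a0.
  rewrite /a0 /i' starB as_ starZ conj_real starD starK; lin.
have na0 : nm a0 <= d + tau.
  have -> : a0 = (2^-1 : R)%:C%C *: ((a - i) + star (a - i)).
    by rewrite starB as_ /a0 -{1}(h2x a) /i'; lin.
  rewrite nmZr ger0_norm ?invr_ge0//.
  have := nmD (a - i) (star (a - i)); rewrite nm_star; lra.
have far0 : far J a0 d.
  by move=> j Jj; rewrite /a0 -addrA -opprD; apply: farJ; exact: (ciD cJ).
have th1 : rho * (d + tau) / d ^+ 2 < 1.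
  rewrite ltr_pdivrMr ?exprn_gt0// mul1r /tau; nra.
have th0 : 0 <= rho * (d + tau) / d ^+ 2.
  by rewrite !mulr_ge0 ?invr_ge0 ?sqr_ge0//; lra.
have [k hk] := geometric_pow2 th0 th1.
(* [u v] falls into [J], so [A0^2 - u v] has norm at least [d^(2n)]. It equals [B1 A0 + u B2], of
   norm at most [3 rho^n (d + tau)^n], which is smaller by the choice of [k]. *)
pose n := (2 ^ k)%N : nat; pose B1 := sqk (a - j1) k; pose B2 := sqk (a - j2) k.
pose A0 := sqk a0 k; pose u := A0 - B1; pose v := A0 - B2.
have Ju : add_gen J p u.
  apply: (sqk_mod _ (add_gen_ci _ _)).
  have -> : a0 - (a - j1) = j1 - i' by rewrite /a0; lin.
  by apply: (ciB (add_gen_ci _ _)) => //; exact: add_gen_sub.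
have Jv : add_gen J q v.
  apply: (sqk_mod _ (add_gen_ci _ _)).
  have -> : a0 - (a - j2) = j2 - i' by rewrite /a0; lin.
  by apply: (ciB (add_gen_ci _ _)) => //; exact: add_gen_sub.
have Jpq' : J (p ** q) by rewrite pq; case: aJ.
have Juv := add_gen_mul cJ Jpq' Jpq Ju Jv.
have far2 : far J (A0 ** A0) ((d ^+ n) ^+ 2).
  apply: far_sq => //; rewrite ?exprn_ge0 ?(ltW d0)//; first exact: sqk_star.
  apply: sqk_far => //; exact: ltW.
have := far2 _ Juv.
have -> : A0 ** A0 - u ** v = B1 ** A0 + u ** B2.
  by rewrite /u /v smulBl !smulBr smulBl; lin.
have nA : nm A0 <= (d + tau) ^+ n.
  apply: le_trans (sqk_nm _ _) _; apply: lerXn2r; rewrite ?nnegrE ?nm_ge0//; lra.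
have nB1 : nm B1 <= rho ^+ n.
  by apply: le_trans (sqk_nm _ _) _; apply: lerXn2r; rewrite ?nnegrE ?nm_ge0.
have nB2 : nm B2 <= rho ^+ n.
  by apply: le_trans (sqk_nm _ _) _; apply: lerXn2r; rewrite ?nnegrE ?nm_ge0.
have X0 : 0 <= (d + tau) ^+ n by rewrite exprn_ge0//; lra.
have Y0 : 0 <= rho ^+ n by rewrite exprn_ge0.
have XY : rho ^+ n <= (d + tau) ^+ n by apply: lerXn2r; rewrite ?nnegrE//; lra.
have Z0 : 0 < (d ^+ n) ^+ 2 by rewrite !exprn_gt0.
have hk' : 3 * (rho ^+ n * (d + tau) ^+ n) < (d ^+ n) ^+ 2.
  move: hk; rewrite -/n.
  have -> : (rho * (d + tau) / d ^+ 2) ^+ n =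
      rho ^+ n * (d + tau) ^+ n / (d ^+ n) ^+ 2.
    by rewrite expr_div_n exprMn -!exprM mulnC.
  by rewrite [3 * _]mulrA ltr_pdivrMr// mul1r.
have := nmD (B1 ** A0) (u ** B2); have := nmM B1 A0; have := nmM u B2.
have := nmB A0 B1; rewrite -/u.
have := nm_ge0 A0; have := nm_ge0 B1; have := nm_ge0 B2; have := nm_ge0 u.
move: nA nB1 nB2 X0 Y0 XY hk'.
set X := (d + tau) ^+ n; set Y := rho ^+ n; set D := (d ^+ n) ^+ 2.
move=> nA nB1 nB2 X0 Y0 XY hk' u0 b20 b10 A00 hu huB hBA hs hD.
have e1 : nm B1 * nm A0 <= Y * X by apply: ler_pM.
have e2 : nm u * nm B2 <= (X + Y) * Y.
  by apply: ler_pM => //; apply: le_trans hu _; apply: lerD.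
have : D <= Y * X + (X + Y) * Y.
  apply: le_trans hD _; apply: le_trans hs _; apply: lerD.
    exact: le_trans hBA e1.
  exact: le_trans huB e2.
move: XY X0 Y0 hk'; clear; move: X Y D => X Y D; nra.
Qed.

End PrimeIdeal.

(** * A character from the failure of absorption *)

Section ProperInfiniteness.
Variables (R : realType) (A : cstarAlgType R).
Implicit Types (a b c d h m n p q x y z : A) (I J : set A).

Lemma em_parts k : star k = k -> exists p n,
  [/\ psd (em p), psd (em n), k = p - n, p ** n = 0 & n ** p = 0] /\
  forall Q : set A, closed_subalg Q -> Q k -> Q p /\ Q n.
Proof.
move=> ks; have Ks : ustar (em k) = em k by rewrite -em_star ks.
have [P [N [[hP hN KE PN NP] [_ KQ _ _]]]] := psd_parts Ks.
have [P0 N0] : P.1 = 0 /\ N.1 = 0 by apply: parts_em hP hN PN _; rewrite -KE.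
exists (up P), (up N); rewrite !em_up//; split; first split => //.
- by apply: em_inj; rewrite emB !em_up.
- by apply: em_inj; rewrite emM !em_up.
- by apply: em_inj; rewrite emM !em_up.
move=> Q Qs Qk; apply: KQ => //=.
rewrite scale0r !add0r; exact: (closed_subalgM Qs).
Qed.

(* Compressing by [1 - u] for an approximate unit [u] of [J]. *)
Lemma dist_le J x y h : closed_ideal J -> psd (em x) -> psd (em y) ->
  J (x + y - h) -> forall e : R, 0 < e -> exists2 j, J j & nm (x - j) <= nm h + e.
Proof.
move=> cJ hx hy Jh e e0.
have [u [Ju us hu ju]] := ideal_unit cJ Jh e0.
pose w := 1 - em u; have ws : ustar w = w by rewrite ustarB ustar1 -em_star us.
pose j := u ** x + (x ** u - u ** x ** u).
have Jj : J j.
  apply: (ciD cJ); first exact: (ciMr _ cJ Ju).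
  apply: (ciB cJ); [exact: (ciMl _ cJ Ju)|exact: (ciMl _ cJ Ju)].
exists j => //.
have xE : em (x - j) = w * em x * w.
  rewrite /j /w !(emD, emN, emM); ncring.
apply: (@le_trans _ _ (nm (up (w * em (x + y) * w)))).
  apply: pos_le_nm; first by rewrite xE -{1}ws; exact: psd_conj.
  rewrite em_up; last by rewrite /= mulr0 mul0r.
  by rewrite xE -mulrBl -mulrBr -emB addrC addKr -{1}ws; exact: psd_conj.
have -> : up (w * em (x + y) * w) =
    ((h - u ** h) - (h - u ** h) ** u) +
    (((x + y - h) - (x + y - h) ** u) - u ** ((x + y - h) - (x + y - h) ** u)).
  apply: em_inj; rewrite em_up; last by rewrite /= mulr0 mul0r.
  by rewrite /w !(emD, emN, emM); ncring.
apply: le_trans (nmD _ _) _; apply: lerD.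
  by apply: le_trans (unit_cut _ us hu).2 _; exact: (unit_cut _ us hu).1.
by apply: le_trans (unit_cut _ us hu).1 _.
Qed.

Lemma scaleCB (r s : R) x : (r - s)%:C%C *: x = r%:C%C *: x - s%:C%C *: x.
Proof. by rewrite rmorphB scalerBl. Qed.

Lemma psd_emZ (r : R) x : 0 <= r -> psd (em x) -> psd (em (r%:C%C *: x)).
Proof. by move=> r0 hx; rewrite emZ; exact: psdZ. Qed.

(** A Dedekind cut: modulo [J] the element [h - t a] is positive for [t] in [U] and negative for [t]
    in [L]. At the supremum of [U] it is squeezed to 0. *)
Lemma scalar_mod J a h (d : R) : closed_ideal J -> psd (em a) -> 0 < d ->
  far J a d -> star h = h ->
  (forall t : R, exists p n, [/\ psd (em p), psd (em n),
     h - t%:C%C *: a = p - n & J p \/ J n]) ->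
  exists t : R, J (h - t%:C%C *: a).
Proof.
move=> cJ ha d0 fa hs dich.
pose U : set R := [set t | exists p n, [/\ psd (em p), psd (em n),
     h - t%:C%C *: a = p - n & J n]].
pose L : set R := [set t | exists p n, [/\ psd (em p), psd (em n),
     h - t%:C%C *: a = p - n & J p]].
have UL t : U t \/ L t.
  by have [p [n [hp hn E [Jp|Jn]]]] := dich t; [right|left]; exists p, n.
have Udown s t : s <= t -> U t -> U s.
  move=> st [p [n [hp hn E Jn]]]; exists (p + (t - s)%:C%C *: a), n; split=> //.
    by apply: psd_emD => //; apply: psd_emZ; rewrite ?subr_ge0.
  rewrite scaleCB addrAC -E; lin.
(* If [t a <= h] modulo [J], then [t d <= |h|]; this bounds [U] from above and, with [- h], [L] from
   below. *)
have bound t p n : 0 <= t -> psd (em p) -> 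
    (J (t%:C%C *: a + p - h) \/ J (t%:C%C *: a + p + h)) -> t * d <= nm h.
  move=> t0 hp H.
  have ht : psd (em (t%:C%C *: a)) by exact: psd_emZ.
  have : forall e : R, 0 < e -> exists2 j, J j & nm (t%:C%C *: a - j) <= nm h + e.
    case: H => H; first exact: dist_le H.
    by rewrite -(nmN h); apply: (dist_le cJ ht hp); rewrite opprK.
  have [->|tn] := eqVneq t 0; first by rewrite mul0r nm_ge0.
  have tp : 0 < t by rewrite lt_neqAle eq_sym tn.
  move=> {}H; apply/ler_addgt0Pr => e /H[j Jj hj].
  rewrite mulrC -ler_pdivlMr// mulrC; apply: le_trans (fa (t^-1%:C%C *: j) _) _.
    exact: ciZ.
  rewrite ler_pdivlMl//; apply: le_trans hj.
  rewrite -{1}(gtr0_norm tp) -nmZr scalerBr scalerA -rmorphM /= mulfV//.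
  by rewrite rmorph1 scale1r.
have Ub t : U t -> t <= nm h / d.
  move=> [p [n [hp hn E Jn]]]; rewrite ler_pdivlMr//.
  case: (lerP t 0) => [t0|/ltW t0].
    by apply: le_trans (nm_ge0 h); rewrite mulr_le0_ge0// ltW.
  apply: (bound t p n) => //; left.
  have -> : t%:C%C *: a + p - h = n.
    have -> : p = h - t%:C%C *: a + n by rewrite E subrK.
    by lin.
  by [].
have Lb t : L t -> - (nm h / d) <= t.
  move=> [p [n [hp hn E Jp]]]; rewrite lerNl ler_pdivlMr//.
  case: (lerP (- t) 0) => [t0|/ltW t0].
    by apply: le_trans (nm_ge0 h); rewrite mulr_le0_ge0// ltW.
  apply: (bound _ n p) => //; right.
  have -> : (- t)%:C%C *: a + n + h = p.
    have -> : h = p - n + t%:C%C *: a by rewrite -E subrK.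
    by rewrite rmorphN scaleNr; lin.
  by [].
have hU : has_sup U.
  split; last by exists (nm h / d) => t /Ub.
  exists (- (nm h / d) - 1); case: (UL (- (nm h / d) - 1)) => // /Lb; lra.
pose t0 := sup U; exists t0; apply: (ci_lim cJ) => e e0.
have a0 := nm_ge0 a.
have [f f0 fe] : exists2 f : R, 0 < f & f * (3 * nm a + 1) <= e.
  by apply: small_mul => //; lra.
have U1 : U (t0 - f).
  have [s Us hsup] := sup_adherent f0 hU; apply: Udown Us; exact: ltW.
have L1 : L (t0 + f).
  case: (UL (t0 + f)) => // Ut.
  have : t0 + f <= t0 by apply: ub_le_sup => //; case: hU.
  by rewrite gerDl leNgt f0.
have [p [n' [hp hn' E1 Jn']]] := U1; have [p' [n [hp' hn E2 Jp']]] := L1.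
(* The cuts at [t0 - f] and [t0 + f] differ by [2 f a], so [dist_le] puts [p] within [2 f |a| + f]
   of [J]; moving from [t0 - f] to [t0] costs another [f |a|]. *)
have Jpn : J (p + n - (f + f)%:C%C *: a).
  have -> : p + n - (f + f)%:C%C *: a = n' + p'.
    have -> : p = h - (t0 - f)%:C%C *: a + n' by rewrite E1 subrK.
    have -> : n = p' - (h - (t0 + f)%:C%C *: a) by rewrite E2; lin.
    by rewrite !rmorphD rmorphN; lin.
  exact: ciD.
have [j Jj hj] := dist_le cJ hp hn Jpn f0.
exists (j - n'); first exact: ciB.
have -> : h - t0%:C%C *: a - (j - n') = (p - j) - f%:C%C *: a.
  have -> : p = h - (t0 - f)%:C%C *: a + n' by rewrite E1 subrK.
  by rewrite rmorphD rmorphN; lin.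
apply: le_trans (nmB _ _) _; rewrite nmZr gtr0_norm//.
apply: le_trans fe; move: hj; rewrite nmZr ger0_norm; [lra|lra].
Qed.

(** Otherwise let [J] be the prime ideal obtained from [absorbed a]. For orthogonal [p], [n] in the
    ideal of [a] every [p y n] has square zero, hence is absorbed, so [J] contains [p] or [n]. Then
    [scalar_mod] makes the ideal of [a] one-dimensional modulo [J], and [a x = chi(x) a] modulo [J]
    defines a character. *)
Lemma self_absorbing a : ideal_comparison A -> ~ (exists chi, @character R A chi) ->
  psd (em a) -> absorbed a a.
Proof.
move=> comp nochar ha; apply: contrapT => nIa; apply: nochar.
have as_ := psd_em_star ha.
have cI := absorbed_ci ha.
have [J [d [cJ IJ d0 fa prime]]] := prime_ideal cI as_ nIa.
have cK := ig_ci a.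
have Ja : ~ J a by move=> /fa; rewrite subrr nm0 leNgt d0.
have Jaa : ~ J (a ** a) by rewrite -{1}as_ => /(ci_sq cJ).
have real_case h : ideal_generated a h -> star h = h ->
    exists t : R, J (h - t%:C%C *: a).
  move=> Kh hs; apply: (scalar_mod cJ ha d0 fa hs) => t.
  pose k := h - t%:C%C *: a.
  have Kk : ideal_generated a k.
    apply: (ciB cK) => //; apply: (ciZ _ cK); exact: ig_self.
  have ks : star k = k by rewrite /k starB starZ conj_real hs as_.
  have [p [n [[hp hn kE pn np] HQ]]] := em_parts ks.
  have [Kp Kn] := HQ _ (ci_subalg cK) Kk.
  exists p, n; split=> //; apply: prime => // y; apply: IJ.
  apply: absorbed_nilpotent => //; first exact: (ciMl _ cK Kn).
  by rewrite -!smulA (smulA n) np smul0l !smul0r.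
have ex x : ideal_generated a x -> exists l : R[i], J (x - l *: a).
  move=> Kx; have Ks := ci_star cK Kx.
  pose c : R[i] := 'i; have cc : c^* = - c by exact: conjCi.
  have c2 : c * c = -1 by rewrite -expr2 sqrCi.
  pose h := (2^-1 : R)%:C%C *: (x + star x).
  pose g := (2^-1 : R)%:C%C *: (c *: (star x - x)).
  have [||t Jt] := real_case h.
  - by apply: (ciZ _ cK); exact: (ciD cK).
  - by rewrite starZ conj_real starD starK addrC.
  have [||s Js] := real_case g.
  - by apply: (ciZ _ cK); apply: (ciZ _ cK); exact: (ciB cK).
  - by rewrite !starZ conj_real cc starB starK scaleNr -scalerN opprB.
  have hh : (2^-1 : R)%:C%C + (2^-1 : R)%:C%C = 1 :> R[i].
    by rewrite -rmorphD /= -(rmorph1 (@real_complex R)); congr (_%:C%C); lra.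
  exists (t%:C%C + c * s%:C%C).
  have -> : x - (t%:C%C + c * s%:C%C) *: a =
      (h - t%:C%C *: a) + c *: (g - s%:C%C *: a).
    have -> : x = ((2^-1 : R)%:C%C + (2^-1 : R)%:C%C) *: x by rewrite hh scale1r.
    have -> : c *: (g - s%:C%C *: a) =
      (2^-1 : R)%:C%C *: ((c * c) *: (star x - x)) - (c * s%:C%C) *: a.
      by rewrite /g; lin.
    by rewrite c2 /h; lin.
  by apply: (ciD cJ) => //; exact: (ciZ _ cJ).
have uniq (l m : R[i]) : J (l *: a - m *: a) -> l = m.
  rewrite -scalerBl => h; apply: contrapT => lm; apply: Ja.
  have n0 : l - m != 0 by rewrite subr_eq0; apply/eqP.
  by rewrite -[a]scale1r -(mulVf n0) -scalerA; exact: (ciZ _ cJ).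
have [chi hchi] : {chi : A -> R[i] & forall x, J (a ** x - chi x *: a)}.
  apply: (@boolp.choice _ _ (fun x (l : R[i]) => J (a ** x - l *: a))) => x; apply: ex; apply: (ciMr _ cK); exact: ig_self.
have chiP x l : J (a ** x - l *: a) -> chi x = l.
  move=> h; apply: uniq.
  have -> : chi x *: a - l *: a = (a ** x - l *: a) - (a ** x - chi x *: a) by lin.
  exact: (ciB cJ).
exists chi; split; first split.
- move=> k x y; apply: chiP.
  have -> : a ** (k *: x + y) - (k *: chi x + chi y) *: a =
      k *: (a ** x - chi x *: a) + (a ** y - chi y *: a).
    by rewrite smulDr smulZr scalerDl -scalerA; lin.
  by apply: (ciD cJ) => //; exact: (ciZ _ cJ).
- move=> x y; apply: (chiP _ (chi x * chi y)).
  have -> : a ** (x ** y) - (chi x * chi y) *: a =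
     (a ** x - chi x *: a) ** y + chi x *: (a ** y - chi y *: a).
    by rewrite smulBl smulA smulZl scalerBr scalerA; lin.
  by apply: (ciD cJ); [exact: (ciMr _ cJ)|exact: (ciZ _ cJ)].
- move=> x; apply: (chiP _ (chi x)^*).
  (* Compatibility with the involution needs the scalar of right multiplication: it agrees with
     [chi x] because [(a x) a = a (x a)] and [a^2] is not in [J]. *)
  have [l hl] : exists l : R[i], J (x ** a - l *: a).
    by apply: ex; apply: (ciMl _ cK); exact: ig_self.
  have lx : l = chi x.
    apply: contrapT => lx; apply: Jaa.
    have n0 : l - chi x != 0 by rewrite subr_eq0; apply/eqP.
    rewrite -[a ** a]scale1r -(mulVf n0) -scalerA; apply: (ciZ _ cJ).
    have -> : (l - chi x) *: (a ** a) =
        (a ** x - chi x *: a) ** a - a ** (x ** a - l *: a).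
      by rewrite smulBl smulBr smulZl smulZr smulA; lin.
    by apply: (ciB cJ); [exact: (ciMr _ cJ)|exact: (ciMl _ cJ)].
  have := ci_star cJ hl; rewrite starB starM starZ as_ lx; exact.
- have t0 : chi a != 0.
    apply/eqP => c0; apply: Jaa; have := hchi a; rewrite c0 scale0r subr0; exact.
  move=> z; exists ((z / chi a) *: a); apply: chiP.
  have -> : a ** ((z / chi a) *: a) - z *: a = (z / chi a) *: (a ** a - chi a *: a).
    by rewrite smulZr scalerBr scalerA divfK.
  exact: (ciZ _ cJ).
Qed.

End ProperInfiniteness.

(** * Pure infiniteness through comparison and absorption *)

Section PurelyInfinite.
Variables (R : realType) (A : cstarAlgType R).
Implicit Types (a b c d h m p q x y z : A).

Lemma pi_comparison : purely_infinite A -> ideal_comparison A.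
Proof.
move=> [_ H] a b ha hb hab e e0.
have [x /cvg_nm hx] := H a b ((positiveP _).2 ha) ((positiveP _).2 hb) hab.
have [N /(_ N (leqnn _))] := hx _ e0; rewrite subr0 => h; exists (x N).
by move: h; rewrite /nm normr_id.
Qed.

Lemma comparison_pi : ideal_comparison A ->
  ~ (exists chi, @character R A chi) -> purely_infinite A.
Proof.
move=> comp nochar; split=> // a b /positiveP ha /positiveP hb hab.
have H n : exists x, nm (star x ** b ** x - a) <= n.+1%:R^-1.
  by apply: comp => //; rewrite invr_gt0.
have [x hx] := boolp.choice H; exists x; apply: nm_cvg => e e0.
have [N HN] := natV_small e0; exists N => n Nn.
by rewrite subr0 /nm normr_id; apply: le_trans (hx n) _; exact: HN.
Qed.

(** [self_absorbing] speaks of [a^* a = a^2]; the root of [a] lies in the same closed ideal, and its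
    square is [a]. *)
Lemma properly_infinite a : purely_infinite A -> psd (em a) -> absorbs a a.
Proof.
move=> piA ha; have [nochar _] := piA.
have h := self_absorbing (pi_comparison piA) nochar ha.
have [r [rs r2 _ _]] := pos_sqrt ha.
have : absorbed a r by apply: (ci_sq (absorbed_ci ha)); rewrite rs r2.
by rewrite /absorbed /= rs r2.
Qed.

(** One splitting of [a] gives a new copy [z] and a partial isometry-like [y]; the previous copies
    are carried by [y] beside [z]. *)
Lemma many_copies a n (e : R) : psd (em a) -> absorbs a a -> 0 < e ->
  exists w : nat -> A, forall i j, (i < n)%N -> (j < n)%N ->
    nm (star (w i) ** a ** w j - (if i == j then a else 0)) <= e.
Proof.
move=> ha hab; have as_ := psd_em_star ha.
elim: n e => [|n IH] e e0; first by exists (fun=> 0).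
have e20 : 0 < e / 2 by lra.
have [w hw] := IH _ e20.
pose K := \sum_(i < n) nm (w i).
have K0 : 0 <= K by apply: sumr_ge0 => i _; exact: nm_ge0.
have wK i : (i < n)%N -> nm (w i) <= K.
  move=> ni; rewrite /K (bigD1 (Ordinal ni))//= lerDl.
  by apply: sumr_ge0 => j _; exact: nm_ge0.
have [d d0 de] : exists2 d : R, 0 < d & d * ((K + 1) ^+ 2) <= e / 2.
  by apply: small_mul => //; rewrite sqr_ge0.
have dK : d * K <= e by nra.
have dKK : d * (K * K) <= e / 2 by nra.
have [y [z [h1 h2 h3]]] := hab _ d0.
have h4 : nm (star z ** a ** y) <= d by rewrite -nm_star !starM starK as_ smulA.
exists (fun i => if i is k.+1 then y ** w k else z) => -[|i] [|j] /=.
- by move=> _ _; apply: le_trans h2 _; nra.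
- rewrite ltnS subr0 smulA => _ /wK hj; apply: le_trans (nmM _ _) _.
  apply: le_trans dK; apply: ler_pM; rewrite ?nm_ge0//.
- rewrite ltnS subr0 starM => /wK hi _; rewrite -smulA -smulA.
  apply: le_trans (nmM _ _) _; rewrite nm_star smulA.
  by apply: le_trans dK; rewrite mulrC; apply: ler_pM; rewrite ?nm_ge0.
- rewrite !ltnS eqSS starM => ni nj.
  have -> : star (w i) ** star y ** a ** (y ** w j) - (if i == j then a else 0) =
      star (w i) ** (star y ** a ** y - a) ** w j +
      (star (w i) ** a ** w j - (if i == j then a else 0)).
    by rewrite smulBr smulBl !smulA; lin.
  apply: le_trans (nmD _ _) _; have := hw _ _ ni nj.
  suff : nm (star (w i) ** (star y ** a ** y - a) ** w j) <= d * (K * K) by lra.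
  apply: le_trans (nm_conj3 _ _ _) _; rewrite mulrAC mulrC.
  apply: ler_pM; rewrite ?mulr_ge0 ?nm_ge0//.
  by apply: ler_pM; rewrite ?nm_ge0 ?wK.
Qed.

End PurelyInfinite.

(** * Actions of compact groups *)

Section GroupActions.
Variables (R : realType) (G : topGroupType) (A : cstarAlgType R).
Variable alpha : cstarAction G A.
Hypothesis cG : compact [set: G].
Implicit Types (x y z : A) (g h u : G).

Lemma act_inv g x : alpha g^-1%g (alpha g x) = x.
Proof. by rewrite -actM mulVg act1. Qed.

Lemma act_nm g x : nm (alpha g x) = nm x.
Proof.
have h k y : nm (alpha k y) <= nm y by rewrite nmle -nmE act_contractive.
by apply/eqP; rewrite eq_le h -{1}(act_inv g x) h.
Qed.

Lemma act_nmB g x y : nm (alpha g x - alpha g y) = nm (x - y).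
Proof. by rewrite -actB act_nm. Qed.

Lemma act_sum g (I : Type) (r : seq I) (P : pred I) (F : I -> A) :
  alpha g (\sum_(i <- r | P i) F i) = \sum_(i <- r | P i) alpha g (F i).
Proof. exact: (big_morph _ (@actD _ _ _ alpha g) (@act0 _ _ _ alpha g)). Qed.

Lemma near_nm (T : topologicalType) (V : normedModType R[i]) (f : T -> V) t (e : R) :
  {for t, continuous f} -> 0 < e -> \forall s \near t, nm (f s - f t) <= e.
Proof.
move=> /cvgrPdist_le cf e0.
have e1 : 0 < e%:C%C :> R[i] by rewrite ltcE /= eqxx.
by apply: filterS (cf _ e1) => s; rewrite -nmle nmBC.
Qed.

Lemma nm_continuous (T : topologicalType) (V : normedModType R[i]) (f : T -> V) t :
  (forall e : R, 0 < e -> \forall s \near t, nm (f s - f t) <= e) ->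
  {for t, continuous f}.
Proof.
move=> H; apply/cvgrPdist_le => e e0.
have e1 : 0 < complex.Re e by move: e0; rewrite ltcE /= => /andP[].
have eE : e = (complex.Re e)%:C%C.
  by case: (e) e0 => a b; rewrite ltcE /= => /andP[/eqP -> _].
by apply: filterS (H _ e1) => s; rewrite nmle distrC -eE.
Qed.

(** The tube lemma: compactness of [G] makes a local condition on [u] near 1 uniform in [h]. *)
Lemma near_one_all (P : G -> G -> Prop) :
  (forall h, \forall h' \near h & u \near (1%g : G), P u h') ->
  \forall u \near (1%g : G), forall h, P u h.
Proof.
move=> H; move/compact_near_coveringP : cG.
move=> /(_ G (nbhs (1%g : G)) P _ (fun h _ => H h)).
by apply: filterS => u hu h; exact: hu.
Qed.

Lemma act_equi x (e : R) : 0 < e ->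
  \forall u \near (1%g : G), forall h, nm (alpha u (alpha h x) - alpha h x) <= e.
Proof.
move=> e0; apply: near_one_all => h; have e30 : 0 < e / 3 by lra.
have c1 := near_nm (@act_continuous _ _ _ alpha x h) e30.
have c2 := near_nm (@act_continuous _ _ _ alpha (alpha h x) 1%g) e30.
near=> h' u.
have h1 : nm (alpha h' x - alpha h x) <= e / 3 by near: h'.
have h2 : nm (alpha u (alpha h x) - alpha h x) <= e / 3.
  by rewrite -{2}(act1 alpha (alpha h x)); near: u.
apply: le_trans (nm_tri (alpha u (alpha h x)) _ _) _; rewrite act_nmB.
apply: le_trans (lerD (lexx _) (nm_tri (alpha h x) _ _)) _.
by rewrite (nmBC (alpha h x)); lra.
Unshelve. all: by end_near. Qed.

Lemma finite_net (U : set G) : nbhs (1%g : G) U ->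
  exists gs : seq G, forall g, exists2 k, k \in gs & U (k^-1 * g)%g.
Proof.
move=> U1; have := cG; rewrite compact_cover => cc.
have [|g _|D _ HD] := cc G [set: G] (fun k => [set g | U (k^-1 * g)%g]°).
- by move=> k _; exact: open_interior.
- exists g => //.
  have : {for g, continuous (fun h => (g^-1 * h)%g)}.
    apply: (@continuous_comp _ _ _ (fun h => (g^-1%g, h))
      (fun p : G * G => (p.1 * p.2)%g)); last exact: mulg_continuous.
    by apply: cvg_pair; [exact: cvg_cst|exact: cvg_id].
  by rewrite /prop_for /continuous_at /= mulVg => /(_ U U1).
exists ((finmap.enum_fset D)) => g; have [k kD] := HD g I.
by move=> /interior_subset h; exists k.
Qed.

Lemma act_net x (e : R) : 0 < e ->
  exists gs : seq G, forall g, exists2 k, k \in gs &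
    forall h, nm (alpha g (alpha h x) - alpha k (alpha h x)) <= e.
Proof.
move=> e0; have [gs H] := finite_net (act_equi x e0); exists gs => g.
have [k kg hk] := H g; exists k => // h.
by rewrite -{1}(mulVKg k g) actM act_nmB.
Qed.

Definition avg (gs : seq G) y : A :=
  ((size gs)%:R^-1 : R)%:C%C *: \sum_(k <- gs) alpha k y.

(* [y] belongs to the closed convex hull of the orbit of [x], expressed by
   estimates that pass to averages. *)
Definition in_hull x y : Prop :=
  (forall (L : A -> A) z (r : R), linear L ->
     (forall g, nm (L (alpha g x) - z) <= r) ->
     forall g, nm (L (alpha g y) - z) <= r) /\
  (forall u k (r : R), (forall h, nm (alpha u (alpha h x) - alpha k (alpha h x)) <= r) ->
     forall h, nm (alpha u (alpha h y) - alpha k (alpha h y)) <= r).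

Lemma in_hull_trans y x z : in_hull x y -> in_hull y z -> in_hull x z.
Proof.
move=> [h1 h2] [k1 k2]; split=> [L w r lL H|u k r H].
  by apply: k1 => // g; exact: h1.
by apply: k2 => h; exact: h2.
Qed.

Lemma size_pos (I : Type) (s : seq I) : s <> [::] -> (0 < size s)%N.
Proof. by case: s. Qed.

Lemma natV_scale n z : (0 < n)%N -> ((n%:R^-1 : R)%:C%C *: (z *+ n)) = z.
Proof.
move=> n0; have -> : z *+ n = (n%:R : R)%:C%C *: z by rewrite rmorph_nat scaler_nat.
by rewrite scalerA -rmorphM /= mulVf ?rmorph1 ?scale1r// pnatr_eq0 -lt0n.
Qed.

Lemma avg_nm (I : Type) (s : seq I) (F : I -> A) z (r : R) : s <> [::] ->
  (forall i, nm (F i - z) <= r) ->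
  nm (((size s)%:R^-1 : R)%:C%C *: \sum_(i <- s) F i - z) <= r.
Proof.
move=> s0 H; have n0 : 0 < (size s)%:R :> R by rewrite ltr0n size_pos.
have -> : z = ((size s)%:R^-1 : R)%:C%C *: \sum_(i <- s) z.
  by rewrite big_const_seq count_predT iter_addr_0 natV_scale// size_pos.
rewrite -scalerBr -sumrB nmZr ger0_norm ?invr_ge0// ler_pdivrMl//.
apply: le_trans (nm_sum _ _ _) _.
apply: le_trans (ler_sum _ (fun i _ => H i)) _.
by rewrite big_const_seq count_predT iter_addr_0 mulr_natl.
Qed.

Lemma avg_act g gs y : alpha g (avg gs y) =
  ((size gs)%:R^-1 : R)%:C%C *: \sum_(k <- gs) alpha (g * k)%g y.
Proof.
by rewrite /avg actZ act_sum; congr (_ *: _); apply: eq_bigr => k _; rewrite actM.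
Qed.

Lemma linear_sum (L : A -> A) (I : Type) (s : seq I) (F : I -> A) (c : R[i]) :
  linear L -> L (c *: \sum_(i <- s) F i) = c *: \sum_(i <- s) L (F i).
Proof.
move=> lL.
have L0 : L 0 = 0 by have := lL (-1) 0 0; rewrite scaleN1r oppr0 addr0 scaleN1r addNr.
have LZ k x : L (k *: x) = k *: L x by rewrite -[k *: x]addr0 lL L0 addr0.
have LD x y : L (x + y) = L x + L y by rewrite -[x]scale1r lL !scale1r.
by rewrite LZ (big_morph L LD L0).
Qed.

Lemma in_hull_avg x gs : gs <> [::] -> in_hull x (avg gs x).
Proof.
move=> gs0; split=> [L z r lL H g|u k r H h].
  by rewrite avg_act linear_sum//; exact: avg_nm.
have := @avg_nm G gs (fun k' => alpha (u * h * k')%g x - alpha (k * h * k')%g x) 0 r gs0.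
rewrite sumrB scalerBr subr0 -!actM !avg_act; apply=> i.
by rewrite subr0 -!mulgA !(actM _ u) !(actM _ k).
Qed.

Definition osc y (r : R) := forall g, nm (alpha g y - y) <= r.

(** Each translate of [y] is [e]-close to one of the translates that are averaged and [d]-close to
    the others. One term of the mean thus improves from [d] to [e], a gain of
    [(d - e) / size gs]. *)
Lemma osc_avg x y gs (d e : R) : gs <> [::] -> in_hull x y -> osc y d ->
  (forall g, exists2 k, k \in gs &
     forall h, nm (alpha g (alpha h x) - alpha k (alpha h x)) <= e) ->
  osc (avg gs y) (d - (d - e) / (size gs)%:R).
Proof.
move=> gs0 [_ xy] oy H g; set m : R := (size gs)%:R.
have m0 : 0 < m by rewrite ltr0n size_pos.
rewrite avg_act; apply: avg_nm => // k.
set l := (g * k)%g; have [k0 k0g hk0] := H l.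
have hk : nm (alpha l y - alpha k0 y) <= e.
  by have := xy _ _ _ hk0 1%g; rewrite act1.
have -> : alpha l y = (m^-1 : R)%:C%C *: \sum_(i <- gs) alpha l y.
  by rewrite big_const_seq count_predT iter_addr_0 natV_scale// size_pos.
rewrite /avg -scalerBr -sumrB nmZr ger0_norm ?invr_ge0 ?(ltW m0)//.
rewrite ler_pdivrMl// mulrBr mulrCA mulfV ?lt0r_neq0// mulr1.
apply: le_trans (nm_sum _ _ _) _.
have odd_ i : nm (alpha l y - alpha i y) <= d.
  by rewrite -{1}(mulVKg i l) actM act_nmB.
rewrite (perm_big _ (perm_to_rem k0g)) big_cons.
have -> : m * d - (d - e) = e + (size (rem k0 gs))%:R * d.
  rewrite size_rem// /m -{1}(prednK (n := size gs)) ?size_pos//.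
  by rewrite -natr1; ring.
apply: lerD => //.
apply: le_trans (ler_sum _ (fun i _ => odd_ i)) _.
by rewrite big_const_seq count_predT iter_addr_0 mulr_natl.
Qed.

Lemma small_osc x (e : R) : 0 < e -> exists2 y, in_hull x y & osc y e.
Proof.
move=> e0; have e20 : 0 < e / 2 by lra.
have [gs Hgs] := act_net x e20.
have gs0 : gs <> [::] by move=> gsE; have [k] := Hgs 1%g; rewrite gsE.
pose m : R := (size gs)%:R.
have m1 : 1 <= m by rewrite ler1n size_pos.
(* The bound on the oscillation evolves by [d |-> q d + (e / 2) / m], whose fixed point is
   [e / 2]. *)
pose q := 1 - m^-1.
have mV : 0 < m^-1 <= 1 by rewrite invr_gt0 invf_le1; lra.
have q0 : 0 <= q by rewrite /q; lra.
have q1 : q < 1 by rewrite /q; lra.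
pose d0 := nm x + nm x.
have H n : exists2 y, in_hull x y & osc y (e / 2 + q ^+ n * d0).
  elim: n => [|n [y xy oy]].
    exists x => [|g]; first by split.
    rewrite expr0 mul1r; have := nmB (alpha g x) x; rewrite act_nm /d0; lra.
  exists (avg gs y); first exact: in_hull_trans xy (in_hull_avg _ gs0).
  have := osc_avg gs0 xy oy Hgs; rewrite -/m => h g; apply: le_trans (h g) _.
  by rewrite exprS /q le_eqVlt; apply/orP; left; apply/eqP; ring.
have [f f0 fe] := small_mul (addr_ge0 (nm_ge0 x) (nm_ge0 x)) e20.
have : (fun i : nat => q ^+ i) @ \oo --> (0 : R) by apply: cvg_expr; rewrite ger0_norm.
move=> /cvgrPdist_lt/(_ _ f0)[N _ /(_ N (leqnn _))].
rewrite sub0r normrN ger0_norm ?exprn_ge0// => hN.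
have [y xy oy] := H N; exists y => // g; apply: le_trans (oy g) _.
have : q ^+ N * d0 <= f * d0 by rewrite ler_wpM2r ?(ltW hN)// addr_ge0 ?nm_ge0.
rewrite -/d0 in fe; lra.
Qed.

(* A fixed point in the closed convex hull of the orbit, obtained without Haar
   measure by averaging until the oscillation along the orbit vanishes. *)
Lemma invariant_mean x : exists c, (forall g, alpha g c = c) /\
  forall (L : A -> A) (K : R) z (r : R), linear L ->
    (forall y, nm (L y) <= K * nm y) ->
    (forall g, nm (L (alpha g x) - z) <= r) -> nm (L c - z) <= r.
Proof.
have step (p : nat * A) : exists y, in_hull p.2 y /\ osc y (p.1.+1%:R^-1).
  have [|y hy oy] := @small_osc p.2 (p.1.+1%:R^-1); first by rewrite invr_gt0.
  by exists y.
have [f hf] := boolp.choice step.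
(* Later terms lie in the hull of the orbit of [y n.+1], whose oscillation is at most [1 / (n + 1)],
   so the sequence is Cauchy and its limit is fixed. *)
pose y := fix y n := if n is k.+1 then f (k, y k) else x.
have yS n : in_hull (y n) (y n.+1) /\ osc (y n.+1) (n.+1%:R^-1) := hf (n, y n).
have yy n m : (n <= m)%N -> in_hull (y n) (y m).
  move=> /subnKC <-; elim: (m - n)%N => [|k IH]; first by rewrite addn0; split.
  by rewrite addnS; apply: in_hull_trans IH _; have [] := yS (n + k)%N.
have lid : linear (@id A) by [].
have yd n m : (n < m)%N -> nm (y m - y n.+1) <= n.+1%:R^-1.
  move=> nm'; have [h _] := yy _ _ nm'.
  have := h id (y n.+1) _ lid (yS n).2 1%g; by rewrite act1.
have [c hc] : exists c : A, y @ \oo --> c.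
  apply: nm_complete => e /natV_small[N HN]; exists N.+1 => -[//|n] m Nn nm'.
  by apply: le_trans (yd _ _ nm') _; exact: HN.
move/cvg_nm in hc; exists c; split=> [g|L K z r lL LK H].
  apply/subr0_eq/nm_small => e e0; have e30 : 0 < e / 3 by lra.
  have [N HN] := hc _ e30; have [M HM] := natV_small e30.
  pose n := maxn N M; have h1 : nm (y n.+1 - c) <= e / 3.
    by apply: HN; rewrite leqW// leq_maxl.
  have h2 : nm (alpha g (y n.+1) - y n.+1) <= e / 3.
    by apply: le_trans ((yS n).2 g) _; apply: HM; rewrite leq_maxr.
  apply: le_trans (nm_tri (alpha g (y n.+1)) _ _) _; rewrite act_nmB (nmBC c).
  by apply: le_trans (lerD (lexx _) (nm_tri (y n.+1) _ _)) _; lra.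
apply/ler_addgt0Pr => e e0.
have K0 : 0 <= `|K| by [].
have [d d0 de] := small_mul K0 e0; have [N /(_ N (leqnn _)) HN] := hc _ d0.
apply: le_trans (nm_tri (L (y N)) _ _) _; rewrite addrC; apply: lerD.
  by have [h _] := yy _ _ (leq0n N); have := h L z r lL H 1%g; rewrite act1.
have -> : L c - L (y N) = L (c - y N).
  by rewrite addrC -scaleN1r -lL scaleN1r addrC.
apply: le_trans (LK _) _; rewrite nmBC; apply: le_trans de.
rewrite mulrC; apply: le_trans (ler_wpM2l (nm_ge0 _) (ler_norm K)) _.
by rewrite ler_wpM2r.
Qed.

End GroupActions.

(** * Separable invariant subalgebras, as closures of countably many star terms *)

Inductive star_term : Type :=
| SLeaf of nat
| SAdd of star_term & star_term
| SMul of star_term & star_term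
| SStar of star_term
| SScale of (rat * rat)%type & star_term.

Fixpoint star_term_enc (t : star_term) : GenTree.tree (nat + rat * rat) :=
  match t with
  | SLeaf n => GenTree.Leaf (inl n)
  | SAdd s t => GenTree.Node 0 [:: star_term_enc s; star_term_enc t]
  | SMul s t => GenTree.Node 1 [:: star_term_enc s; star_term_enc t]
  | SStar s => GenTree.Node 2 [:: star_term_enc s]
  | SScale q s => GenTree.Node 3 [:: GenTree.Leaf (inr q); star_term_enc s]
  end.

Fixpoint star_term_dec (t : GenTree.tree (nat + rat * rat)) : option star_term :=
  match t with
  | GenTree.Leaf (inl n) => Some (SLeaf n)
  | GenTree.Node 0 [:: s; t] =>
      if (star_term_dec s, star_term_dec t) is (Some s', Some t')
      then Some (SAdd s' t') else None
  | GenTree.Node 1 [:: s; t] =>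
      if (star_term_dec s, star_term_dec t) is (Some s', Some t')
      then Some (SMul s' t') else None
  | GenTree.Node 2 [:: s] => omap SStar (star_term_dec s)
  | GenTree.Node 3 [:: GenTree.Leaf (inr q); s] => omap (SScale q) (star_term_dec s)
  | _ => None
  end.

Lemma star_term_encK : pcancel star_term_enc star_term_dec.
Proof. by elim=> //= [s -> t ->|s -> t ->|s ->|q s ->]. Qed.

HB.instance Definition _ := Countable.copy star_term (pcan_type star_term_encK).

Lemma real_rat_dense (R : realType) (x e : R) : 0 < e ->
  exists q : rat, `|x - ratr q| <= e.
Proof.
move=> e0; have [|q] := @rat_in_itvoo R (x - e) (x + e); first by lra.
rewrite in_itv /= => /andP[h1 h2]; exists q; rewrite ler_norml; lra.
Qed.

Lemma complex_rat_dense (R : realType) (z : R[i]) (e : R) : 0 < e ->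
  exists q : rat * rat, nm (z - Complex (ratr q.1) (ratr q.2) : R[i]^o) <= e.
Proof.
move=> e0; have e20 : 0 < e / 2 by lra.
have [p hp] := real_rat_dense (complex.Re z) e20.
have [q hq] := real_rat_dense (complex.Im z) e20.
exists (p, q); apply: le_trans (nm_le_ReIm _) _; rewrite !raddfB /=; lra.
Qed.

Lemma dense_sequence (T : ptopologicalType) : @second_countable T ->
  exists t : nat -> T, forall (U : set T) (x : T), nbhs x U -> exists n, U (t n).
Proof.
move=> [B cB [_ hB]].
have /countable_injP[f finj] := cB.
pose pick n := xget point [set x | exists V, [/\ B V, f V = n & V x]].
exists pick => U x /hB[V [BV Vx] VU]; exists (f V); apply: VU.
rewrite /pick; case: xgetP => [y -> [W [BW fW Wy]]|/(_ x)]; last first.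
  by case; exists V.
have WV : W = V by apply: finj => //; exact: mem_set.
by move: Wy; rewrite WV.
Qed.

Section SeparableInvariant.
Variables (R : realType) (G : topGroupType) (A : cstarAlgType R).
Variable alpha : cstarAction G A.
Hypothesis cG : compact [set: G].
Hypothesis scG : @second_countable G.
Implicit Types (x y z : A) (g h u : G).

Section Generated.
Variables (o : nat -> A) (tau : nat -> G).
Hypothesis tau_dense : forall (U : set G) (x : G), nbhs x U -> exists n, U (tau n).

Definition orbit_seq n : A :=
  if unpickle n is Some (i, j) then alpha (tau j) (o i) else 0.

Fixpoint sev (t : star_term) : A :=
  match t with
  | SLeaf n => orbit_seq n
  | SAdd s t => sev s + sev t
  | SMul s t => sev s ** sev t
  | SStar s => star (sev s)
  | SScale q s => Complex (ratr q.1) (ratr q.2) *: sev s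
  end.

Definition gen_set : set A :=
  [set x | forall e : R, 0 < e -> exists t, nm (x - sev t) <= e].

Lemma gen_sev t : gen_set (sev t).
Proof. by move=> e e0; exists t; rewrite subrr nm0 ltW. Qed.

Lemma gen_closed : closed gen_set.
Proof.
apply: nm_closed => x H e e0; have e20 : 0 < e / 2 by lra.
have [y hy xy] := H _ e20; have [t yt] := hy _ e20; exists t.
by apply: le_trans (nm_tri y _ _) _; lra.
Qed.

Lemma gen_D x y : gen_set x -> gen_set y -> gen_set (x + y).
Proof.
move=> hx hy e e0; have e20 : 0 < e / 2 by lra.
have [s xs] := hx _ e20; have [t yt] := hy _ e20; exists (SAdd s t) => /=.
have -> : x + y - (sev s + sev t) = (x - sev s) + (y - sev t) by lin.
by apply: le_trans (nmD _ _) _; lra.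
Qed.

Lemma gen_star x : gen_set x -> gen_set (star x).
Proof.
by move=> hx e /hx[s xs]; exists (SStar s); rewrite /= -starB nm_star.
Qed.

Lemma gen_M x y : gen_set x -> gen_set y -> gen_set (x ** y).
Proof.
move=> hx hy e e0.
have [f f0 fe] : exists2 f : R, 0 < f & f * (nm x + nm y + 1) <= e.
  by apply: small_mul => //; have := nm_ge0 x; have := nm_ge0 y; lra.
have [|s xs] := hx (Num.min f 1); first by rewrite lt_min f0 ltr01.
have [t yt] := hy _ f0; exists (SMul s t) => /=.
have xs1 : nm (x - sev s) <= f by rewrite (le_trans xs)// ge_min lexx.
have xs2 : nm (x - sev s) <= 1 by rewrite (le_trans xs)// ge_min lexx orbT.
have -> : x ** y - sev s ** sev t = (x - sev s) ** y + sev s ** (y - sev t).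
  by rewrite smulBl smulBr; lin.
apply: le_trans (nmD _ _) _.
have hs : nm (sev s) <= nm x + 1.
  by apply: le_trans (half_norm_nm _ x) _; rewrite nmBC; lra.
have := nmM (x - sev s) y; have := nmM (sev s) (y - sev t).
have := nm_ge0 y; have := nm_ge0 x; have := nm_ge0 (y - sev t).
have := nm_ge0 (sev s); nra.
Qed.

Lemma gen_Z k x : gen_set x -> gen_set (k *: x).
Proof.
move=> hx e e0; have e20 : 0 < e / 2 by lra.
have [f f0 fe] := small_mul (nm_ge0 x) e20.
have [q hq] := complex_rat_dense k f0; pose l : R[i] := Complex (ratr q.1) (ratr q.2).
have [d d0 de] := small_mul (nm_ge0 (l : R[i]^o)) e20.
have [s xs] := hx _ d0; exists (SScale q s); rewrite /= -/l.
have -> : k *: x - l *: sev s = (k - l) *: x + l *: (x - sev s).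
  by rewrite scalerBl scalerBr; lin.
apply: le_trans (nmD _ _) _; rewrite !nmZ.
have h1 : nm (k - l : R[i]^o) * nm x <= f * nm x by rewrite ler_wpM2r ?nm_ge0.
have h2 : nm (l : R[i]^o) * nm (x - sev s) <= nm (l : R[i]^o) * d.
  by rewrite ler_wpM2l ?nm_ge0.
by move: h2; rewrite mulrC [leRHS]mulrC; lra.
Qed.

Lemma gen_0 : gen_set 0.
Proof. by rewrite -[0](scale0r (sev (SLeaf 0))); apply: gen_Z; exact: gen_sev. Qed.

Definition gen_sub : cstarSub A :=
  @CStarSub _ _ (StarSub gen_0 gen_D gen_Z gen_M gen_star) gen_closed.

Lemma gen_orbit g i : gen_set (alpha g (o i)).
Proof.
move=> e e0; have h := near_nm (@act_continuous _ _ _ alpha (o i) g) e0.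
have [n hn] := tau_dense h; exists (SLeaf (pickle (i, n))).
by rewrite /= /orbit_seq pickleK nmBC.
Qed.

Lemma gen_base i : gen_set (o i).
Proof. by rewrite -(act1 alpha (o i)); exact: gen_orbit. Qed.

(** The leaves only contain translates along the dense sequence [tau]; [gen_orbit] supplies the
    other translates by continuity, and [alpha g] passes through the remaining term constructors. *)
Lemma gen_invariant : invariant_sub alpha gen_set.
Proof.
move=> g x hx; have hs t : gen_set (alpha g (sev t)).
  elim: t => [n|s IHs t IHt|s IHs t IHt|s IHs|q s IHs] /=.
  - rewrite /orbit_seq; case: unpickle => [[i j]|]; last by rewrite act0; exact: gen_0.
    by rewrite -actM; exact: gen_orbit.
  - by rewrite actD; exact: gen_D.
  - by rewrite act_smul; exact: gen_M.
  - by rewrite act_star; exact: gen_star.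
  - by rewrite actZ; exact: gen_Z.
apply: (closed_nm gen_closed) => e /hx[t xt].
by exists (alpha g (sev t)); rewrite ?act_nmB.
Qed.

Lemma gen_separable : separable gen_set.
Proof.
exists (range sev); split.
- apply: (@sub_countable _ _ _ [set: star_term]); first exact: card_image_le.
  exact: countableP.
- by move=> _ [t _ <-]; exact: gen_sev.
- move=> x hx; have : closure (range sev) x; last by [].
  apply: (closed_nm (@closed_closure _ _)) => e /hx[t xt]; exists (sev t) => //.
  by apply: subset_closure; exists t.
Qed.

End Generated.

Lemma generated_sub (o : nat -> A) : exists D : cstarSub A,
  [/\ invariant_sub alpha (D : starSub A), separable (D : starSub A) &
      forall i, star_sub D (o i)].
Proof.
have [t ht] := dense_sequence scG; exists (gen_sub o t); split.
- exact: gen_invariant ht.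
- exact: gen_separable.
- exact: gen_base ht.
Qed.

(** A far member [u N] of the approximate unit acts almost trivially on the whole orbit of each [d],
    by compactness. Hence every translate of [u N] does so on [d], and the estimate passes to the
    invariant mean. *)
Lemma invariant_unit (s : seq A) (e : R) : sigma_unital A -> 0 < e ->
  exists c, [/\ forall g, alpha g c = c, nm c <= 1 &
    forall d, d \in s -> nm (c ** d - d) <= e /\ nm (d ** c - d) <= e].
Proof.
move=> [u [hu Hu]] e0; have e30 : 0 < e / 3 by lra.
have u1 n : nm (u n) <= 1 by rewrite nmle rmorph1; have [] := hu n.
have [N HN] : exists N, forall d, d \in s -> forall g,
    nm (u N ** alpha g d - alpha g d) <= e /\ nm (alpha g d ** u N - alpha g d) <= e.
  suff [N HN] : exists N, forall n, (N <= n)%N -> forall d, d \in s -> forall g,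
    nm (u n ** alpha g d - alpha g d) <= e /\ nm (alpha g d ** u n - alpha g d) <= e.
    by exists N; exact: HN.
  elim: s => [|d s [N HN]]; first by exists 0%N.
  have [gs Hgs] := act_net alpha cG d e30.
  have [M HM] : exists M, forall n, (M <= n)%N -> forall k, k \in gs ->
      nm (u n ** alpha k d - alpha k d) <= e / 3 /\
      nm (alpha k d ** u n - alpha k d) <= e / 3.
    elim: (gs) => [|k ks [M HM]]; first by exists 0%N.
    have [/cvg_nm h1 /cvg_nm h2] := Hu (alpha k d).
    have [M1 H1] := h1 _ e30; have [M2 H2] := h2 _ e30.
    exists (maxn M (maxn M1 M2)) => n; rewrite !geq_max => /and3P[n1 n2 n3] k'.
    rewrite in_cons => /orP[/eqP ->|]; last exact: HM.
    by split; [exact: H1|exact: H2].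
  exists (maxn N M) => n; rewrite geq_max => /andP[n1 n2] d'.
  rewrite in_cons => /orP[/eqP ->|]; last exact: HN.
  move=> g; have [k kgs /(_ 1%g)] := Hgs g; rewrite act1 => hk.
  have [h1 h2] := HM n n2 k kgs; have un := u1 n.
  have B : nm (alpha g d - alpha k d) <= e / 3 by [].
  split.
    have -> : u n ** alpha g d - alpha g d = u n ** (alpha g d - alpha k d) +
        (u n ** alpha k d - alpha k d) - (alpha g d - alpha k d).
      by rewrite smulBr; lin.
    apply: le_trans (nmB _ _) _; apply: le_trans (lerD (nmD _ _) (lexx _)) _.
    have := nmM (u n) (alpha g d - alpha k d); have := nm_ge0 (u n).
    have := nm_ge0 (alpha g d - alpha k d); nra.
  have -> : alpha g d ** u n - alpha g d = (alpha g d - alpha k d) ** u n +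
      (alpha k d ** u n - alpha k d) - (alpha g d - alpha k d).
    by rewrite smulBl; lin.
  apply: le_trans (nmB _ _) _; apply: le_trans (lerD (nmD _ _) (lexx _)) _.
  have := nmM (alpha g d - alpha k d) (u n); have := nm_ge0 (u n).
  have := nm_ge0 (alpha g d - alpha k d); nra.
have [c [cf cL]] := invariant_mean alpha cG (u N); exists c; split=> // [|d ds].
  have := cL id 1 0 1; rewrite subr0; apply => [//|y|g]; first by rewrite mul1r.
  by rewrite subr0 act_nm.
split.
- apply: (cL (fun x => x ** d) (nm d)) => [k x y|y|g].
  + by rewrite smulDl smulZl.
  + by rewrite mulrC nmM.
  + have E : d = alpha g (alpha g^-1%g d) by rewrite -actM mulgV act1.
    rewrite {}E -act_smul act_nmB.
    by have [] := HN d ds g^-1%g.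
- apply: (cL (fun x => d ** x) (nm d)) => [k x y|y|g].
  + by rewrite smulDr smulZr.
  + exact: nmM.
  + have E : d = alpha g (alpha g^-1%g d) by rewrite -actM mulgV act1.
    rewrite {}E -act_smul act_nmB.
    by have [] := HN d ds g^-1%g.
Qed.

End SeparableInvariant.

(** * Asymptotic calculus in Rokhlin systems *)

Local Notation eta := Defs.eta.

Section RokhlinSequences.
Variables (R : realType) (G : topGroupType) (A : cstarAlgType R).
Variable alpha : cstarAction G A.
Implicit Types (d x y : A) (g h : G) (a b u v : nat -> A).

Definition tend0 u : Prop :=
  forall e : R, 0 < e -> exists N, forall n, (N <= n)%N -> nm (u n) <= e.

Lemma tend0D u v : tend0 u -> tend0 v -> tend0 (fun n => u n + v n).
Proof.
move=> hu hv e e0; have e20 : 0 < e / 2 by lra.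
have [N HN] := hu _ e20; have [M HM] := hv _ e20.
exists (maxn N M) => n; rewrite geq_max => /andP[/HN h1 /HM h2].
by apply: le_trans (nmD _ _) _; lra.
Qed.

Lemma tend0N u : tend0 u -> tend0 (fun n => - u n).
Proof. by move=> hu e /hu[N HN]; exists N => n /HN; rewrite nmN. Qed.

Lemma tend0B u v : tend0 u -> tend0 v -> tend0 (fun n => u n - v n).
Proof. by move=> hu hv; apply: tend0D => //; exact: tend0N. Qed.

Lemma tend0_le u v (K : R) : tend0 v -> (forall n, nm (u n) <= K * nm (v n)) ->
  tend0 u.
Proof.
move=> hv H e e0; have [d d0 de] := small_mul (normr_ge0 K) e0.
have [N HN] := hv _ d0; exists N => n /HN hn; apply: le_trans (H n) _.
apply: le_trans de; rewrite mulrC.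
apply: le_trans (ler_wpM2l (nm_ge0 _) (ler_norm K)) _.
by rewrite ler_wpM2r.
Qed.

Lemma tend0_eq u v : (forall n, u n = v n) -> tend0 v -> tend0 u.
Proof. by move=> E hv e /hv[N HN]; exists N => n; rewrite E; exact: HN. Qed.

Lemma tend0_0 : tend0 (fun=> 0).
Proof. by move=> e e0; exists 0%N => n _; rewrite nm0 ltW. Qed.

Lemma tend0_sum (I : Type) (s : seq I) (F : I -> nat -> A) :
  (forall i, tend0 (F i)) -> tend0 (fun n => \sum_(i <- s) F i n).
Proof.
move=> H; elim: s => [|i s IH].
  by apply: tend0_eq tend0_0 => n; rewrite big_nil.
by apply: tend0_eq (tend0D (H i) IH) => n; rewrite big_cons.
Qed.

Definition bddseq u : Prop := exists M : R, forall n, nm (u n) <= M.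

Lemma tend0_mull u v : bddseq u -> tend0 v -> tend0 (fun n => u n ** v n).
Proof.
move=> [M hM] hv; apply: (tend0_le (K := M) hv) => n.
by apply: le_trans (nmM _ _) _; rewrite ler_wpM2r ?nm_ge0.
Qed.

Lemma tend0_mulr u v : bddseq u -> tend0 v -> tend0 (fun n => v n ** u n).
Proof.
move=> [M hM] hv; apply: (tend0_le (K := M) hv) => n.
by apply: le_trans (nmM _ _) _; rewrite mulrC ler_wpM2r ?nm_ge0.
Qed.

Lemma bddseq_cst x : bddseq (fun=> x).
Proof. by exists (nm x). Qed.

Lemma bddseqM u v : bddseq u -> bddseq v -> bddseq (fun n => u n ** v n).
Proof.
move=> [M hM] [N hN]; exists (M * N) => n; apply: le_trans (nmM _ _) _.
by apply: ler_pM; rewrite ?nm_ge0.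
Qed.

Lemma bddseq_star u : bddseq u -> bddseq (fun n => star (u n)).
Proof. by move=> [M hM]; exists M => n; rewrite nm_star. Qed.

Lemma bounded_bddseq u : bddseq u -> bounded_seqs_set u.
Proof. by move=> [M hM]; exists M%:C%C => n; rewrite -nmle. Qed.

Lemma linf_bddseq (al : linf A) : bddseq (val al).
Proof.
have [M hM] := subval_in al; exists (complex.Re M) => n.
have := hM n; rewrite nmE lecE /=; by case: (M) => p q /= /andP[].
Qed.

Lemma null_tend0 (al : linf A) : star_ideal (null_seqs A) al <-> tend0 (val al).
Proof.
split=> [/cvg_nm h e /h[N HN]|h].
  by exists N => n /HN; rewrite subr0.
by apply: nm_cvg => e /h[N HN]; exists N => n; rewrite subr0; exact: HN.
Qed.

Lemma etaB (al bl : linf A) : eta al - eta bl = eta (al - bl).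
Proof.
apply: (addIr (eta bl)); rewrite subrK.
have := quot_piD (null_seqs A) (al - bl) bl; rewrite subrK; exact.
Qed.

Lemma eta0P (al : linf A) : eta al = 0 <-> tend0 (val al).
Proof.
have e0 : 0 = eta (0 : linf A) by rewrite -(subrr (0 : linf A)) -etaB subrr.
rewrite e0; split=> h.
  by have := (quot_piP (null_seqs A) al (0 : linf A)).1 h; rewrite subr0 => /(null_tend0 al).1.
by apply: (quot_piP (null_seqs A) al (0 : linf A)).2; rewrite subr0; exact: (null_tend0 al).2.
Qed.

Lemma etaM (al bl : linf A) : eta al ** eta bl = eta (al ** bl).
Proof. exact: quot_smulE. Qed.

Variables (D : cstarSub A) (Dinv : invariant_sub alpha (D : starSub A)).

(** A lift of [X] through both quotient maps, [kappa] and [eta]. *)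
Definition rep a (X : centralF D) : Prop := exists (al : linf A)
  (x : subAlg (commutant D)), [/\ val al = a, val x = eta al & X = kappa x].

Lemma rep_bddseq a X : rep a X -> bddseq a.
Proof. by move=> [al [x [<- _ _]]]; exact: linf_bddseq. Qed.

Lemma rep_comm a X d : rep a X -> star_sub D d ->
  tend0 (fun n => a n ** d - d ** a n).
Proof.
move=> [al [x [<- xa _]]] Dd; have := subval_in x d Dd; rewrite xa.
move=> /eqP; rewrite -subr_eq0 => /eqP; rewrite !etaM etaB => /eta0P.
by apply: tend0_eq.
Qed.

(** The annihilator has been divided out, so two lifts agree only after multiplication by elements
    of [D]. *)
Lemma rep_uniq a b X d : rep a X -> rep b X -> star_sub D d ->
  tend0 (fun n => (a n - b n) ** d).
Proof.
move=> [al [x [<- xa ->]]] [bl [y [<- yb xy]]] Dd.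
have /quot_piP h := xy; have [+ _] := h _ Dd.
rewrite [val (x - y)]/= xa yb etaB etaM => /eta0P; by apply: tend0_eq.
Qed.

Lemma rep_lin (k : R[i]) a b X Y : rep a X -> rep b Y ->
  rep (fun n => k *: a n + b n) (k *: X + Y).
Proof.
move=> [al [x [<- xa ->]]] [bl [y [<- yb ->]]].
exists (k *: al + bl), (k *: x + y); split=> //.
- rewrite /= xa yb; have -> : k *: eta al = quot_pi (null_seqs A) (k *: al).
    exact: quot_scaleE.
  exact/esym/quot_piD.
- have -> : k *: kappa x = quot_pi (annihilator D) (k *: x) by exact: quot_scaleE.
  exact/esym/quot_piD.
Qed.

Lemma rep_mul a b X Y : rep a X -> rep b Y ->
  rep (fun n => a n ** b n) (X ** Y).
Proof.
move=> [al [x [<- xa ->]]] [bl [y [<- yb ->]]].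
exists (al ** bl), (x ** y); split=> //.
- by rewrite /= xa yb etaM.
- exact: quot_smulE.
Qed.

Lemma rep_star a X : rep a X -> rep (fun n => star (a n)) (star X).
Proof.
move=> [al [x [<- xa ->]]]; exists (star al), (star x); split=> //.
- by rewrite /= xa; exact: quot_starE.
- exact: quot_starE.
Qed.

Lemma rep_act g a X : rep a X -> rep (fun n => alpha g (a n)) (act_F Dinv g X).
Proof.
move=> [al [x [<- xa ->]]]; exists (act_linf alpha g al), (act_comm Dinv g x).
split=> //; first by rewrite /= xa act_infE.
exact: act_FE.
Qed.

Definition act_equicontinuous a : Prop := forall e : R, 0 < e ->
  \forall u \near (1%g : G), forall n, nm (alpha u (a n) - a n) <= e.

Lemma linf_alpha_equi (al : linf A) : linf_alpha alpha al -> act_equicontinuous (val al).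
Proof.
move=> H e e0; have e1 : 0 < e%:C%C :> R[i] by rewrite ltcE /= eqxx.
pose U : set (nat -> A) :=
  [set f | forall n, nm (f n - alpha 1%g (val al n)) <= e].
have hU : nbhs ((fun n => alpha 1%g (val al n)) : {uniform nat -> A}) U.
  apply/uniform_nbhs; exists [set p | ball p.1 e%:C%C p.2]; split.
    by rewrite -entourage_ballE; exists e%:C%C.
  move=> f hf n; have := hf n I; rewrite /= -ball_normE /= -nmlt nmBC => h.
  exact: ltW.
apply: (@filterS _ (nbhs (1%g : G)) _ _ _ _ (H 1%g _ hU)) => u hu n.
by have := hu n; rewrite act1.
Qed.

Lemma linf_alpha_fixed (al : linf A) : (forall g n, alpha g (val al n) = val al n) ->
  linf_alpha alpha al.
Proof.
move=> H.
have E : (fun g => (fun n => alpha g (val al n)) : {uniform nat -> A}) =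
   (fun=> (val al : {uniform nat -> A})).
  by apply/funext => g; apply/funext => n; exact: H.
by rewrite /linf_alpha /= E => x; exact: cvg_cst.
Qed.

End RokhlinSequences.

Section RokhlinSystems.
Variables (R : realType) (G : topGroupType) (A : cstarAlgType R).
Variable alpha : cstarAction G A.
Hypothesis cG : compact [set: G].
Hypothesis scG : @second_countable G.

(** What remains of the Rokhlin homomorphism on the level of sequences. The factor from [D] may
    stand on the right throughout, because the [c f] asymptotically commute with [D]. *)
Record rokhlin_system (D : cstarSub A) (c : contG R G -> nat -> A) : Prop := {
  rs_bounded : forall f, bddseq (c f) ;
  rs_equi : forall f, act_equicontinuous alpha (c f) ;
  rs_comm : forall f d, star_sub D d -> tend0 (fun n => c f n ** d - d ** c f n) ;
  rs_lin : forall (k : R[i]) f h d, star_sub D d ->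
    tend0 (fun n => (c (k *: f + h) n - (k *: c f n + c h n)) ** d) ;
  rs_mul : forall f h d, star_sub D d ->
    tend0 (fun n => (c (f ** h) n - c f n ** c h n) ** d) ;
  rs_star : forall f d, star_sub D d ->
    tend0 (fun n => (c (star f) n - star (c f n)) ** d) ;
  rs_one : forall d, star_sub D d -> tend0 (fun n => c (contG1 R G) n ** d - d) ;
  rs_act : forall g f d, star_sub D d ->
    tend0 (fun n => (c (left_translate g f) n - alpha g (c f n)) ** d) }.

(** Invariance places the class of this sequence in [F_alpha(D, A)], where [phi 1] acts as a unit.
    Multiplying by it transports that unit law to the sequences in [rs_one]. *)
Lemma invariant_unit_sequence (D : cstarSub A) : sigma_unital A ->
  separable (D : starSub A) -> exists u : nat -> A,
  [/\ forall n g, alpha g (u n) = u n, bddseq u,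
      forall d, star_sub D d -> tend0 (fun n => u n ** d - d) &
      forall d, star_sub D d -> tend0 (fun n => d ** u n - d)].
Proof.
move=> sA [S [/countable_injP[f finj] SD DS]].
pose v n : A := xget 0 [set x | S x /\ f x = n].
have vf x : S x -> v (f x) = x.
  move=> Sx; rewrite /v; case: xgetP => [y -> [Sy fxy]|/(_ x)[]//].
  by apply: finj => //; exact/mem_set.
have H n : exists c, [/\ forall g, alpha g c = c, nm c <= 1 &
    forall d, d \in [seq v i | i <- iota 0 n.+1] ->
      nm (c ** d - d) <= n.+1%:R^-1 /\ nm (d ** c - d) <= n.+1%:R^-1].
  by apply: (invariant_unit alpha cG) => //; rewrite invr_gt0.
have [u hu] := boolp.choice H; exists u.
have near x e : S x -> 0 < e -> exists N, forall n, (N <= n)%N ->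
    nm (u n ** x - x) <= e /\ nm (x ** u n - x) <= e.
  move=> Sx /natV_small[N HN]; exists (maxn N (f x)) => n.
  rewrite geq_max => /andP[/HN hn fn]; have [_ _ /(_ x)] := hu n.
  case; last by move=> h1 h2; split; apply: le_trans hn.
  by apply/mapP; exists (f x); rewrite ?vf// mem_iota.
have u1 n : nm (u n) <= 1 by have [] := hu n.
split=> [n g||d Dd e e0|d Dd e e0].
- by have [] := hu n.
- by exists 1.
- have e30 : 0 < e / 3 by lra.
  have [y [Sy]] : exists y, S y /\ nm (d - y) <= e / 3.
    have e3C : 0 < (e / 3)%:C%C :> R[i] by rewrite ltcE /= eqxx.
    have [y [Sy]] := DS _ Dd _ (nbhsx_ballx d (e / 3)%:C%C e3C).
    by rewrite -ball_normE /= -nmlt => /ltW h; exists y.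
  have [N HN] := near y _ Sy e30; move=> dy; exists N => n /HN[h _].
  have -> : u n ** d - d = u n ** (d - y) + (u n ** y - y) - (d - y).
    by rewrite smulBr; lin.
  apply: le_trans (nmB _ _) _; apply: le_trans (lerD (nmD _ _) (lexx _)) _.
  have := nmM (u n) (d - y); have := u1 n; have := nm_ge0 (u n).
  have := nm_ge0 (d - y); nra.
- have e30 : 0 < e / 3 by lra.
  have [y [Sy]] : exists y, S y /\ nm (d - y) <= e / 3.
    have e3C : 0 < (e / 3)%:C%C :> R[i] by rewrite ltcE /= eqxx.
    have [y [Sy]] := DS _ Dd _ (nbhsx_ballx d (e / 3)%:C%C e3C).
    by rewrite -ball_normE /= -nmlt => /ltW h; exists y.
  have [N HN] := near y _ Sy e30; move=> dy; exists N => n /HN[_ h].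
  have -> : d ** u n - d = (d - y) ** u n + (y ** u n - y) - (d - y).
    by rewrite smulBl; lin.
  apply: le_trans (nmB _ _) _; apply: le_trans (lerD (nmD _ _) (lexx _)) _.
  have := nmM (d - y) (u n); have := u1 n; have := nm_ge0 (u n).
  have := nm_ge0 (d - y); nra.
Qed.

Lemma rokhlin_sequences (o : nat -> A) : sigma_unital A -> rokhlin alpha ->
  exists (D : cstarSub A) (c : contG R G -> nat -> A),
  [/\ invariant_sub alpha (D : starSub A), forall i, star_sub D (o i) &
      rokhlin_system D c].
Proof.
move=> sA rA; have [D [Dinv sD Do]] := generated_sub alpha scG o.
have [phi [[plin pM pV] pa p1 pact]] := rA D Dinv sD.
have H f : exists a, rep a (phi f) /\ act_equicontinuous alpha a.
  have [x [al hal alx] xp] := pa f; exists (val al).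
  split; last exact: linf_alpha_equi.
  by exists al, x.
have [c hc] := boolp.choice H.
have cr f := (hc f).1.
exists D, c; split=> //; split=> [f|f|f d Dd|k f h d Dd|f h d Dd|f d Dd|d Dd|g f d Dd].
- exact: rep_bddseq (cr f).
- exact: (hc f).2.
- exact: rep_comm (cr f) Dd.
- by apply: rep_uniq (cr _) _ Dd; rewrite plin; exact: rep_lin.
- by apply: rep_uniq (cr _) _ Dd; rewrite pM; exact: rep_mul.
- by apply: rep_uniq (cr _) _ Dd; rewrite pV; exact: rep_star.
(* From [phi 1 [u] = [u]] the sequence [(c 1 u - u) d] tends to 0, while [u d] tends to [d]. *)
- have [u [uf bu ul ur']] := invariant_unit_sequence sA sD.
  pose ul' : linf A := to_sub (S := bounded_seqs A) (bounded_bddseq bu).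
  have hcom : commutant_set D (eta ul').
    move=> y Dy; apply/eqP; rewrite -subr_eq0; apply/eqP.
    rewrite !etaM etaB; apply/eta0P.
    apply: tend0_eq (tend0B (ul _ Dy) (ur' _ Dy)) => n /=; lin.
  pose x : subAlg (commutant D) := to_sub (S := commutant D) hcom.
  have xa : centralF_alpha alpha (kappa x).
    exists x => //; exists ul' => //; apply: linf_alpha_fixed => g n; exact: uf.
  have ru : rep u (kappa x) by exists ul', x.
  have r1 := rep_mul (cr (contG1 R G)) ru.
  rewrite (p1 _ xa).1 in r1.
  have h := rep_uniq r1 ru Dd.
  have h2 := tend0_mull (rep_bddseq (cr (contG1 R G))) (ul _ Dd).
  apply: tend0_eq (tend0D (tend0B h h2) (ul _ Dd)) => n.
  by rewrite smulBl smulBr smulA; lin.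
- by apply: rep_uniq (cr _) _ Dd; rewrite (pact g f); exact: rep_act.
Qed.

End RokhlinSystems.

(** * Asymptotic equality and a Cauchy-Schwarz bound *)

Section AsymptoticEquality.
Variables (R : realType) (A : cstarAlgType R).
Implicit Types (d x y : A) (a b u v w : nat -> A).

Definition aeq u v : Prop := tend0 (fun n => u n - v n).

Lemma aeq_refl u : aeq u u.
Proof. by apply: tend0_eq (@tend0_0 R A) => n; rewrite subrr. Qed.

Lemma aeq_sym u v : aeq u v -> aeq v u.
Proof. by move=> h; apply: tend0_eq (tend0N h) => n; rewrite opprB. Qed.

Lemma aeq_trans v u w : aeq u v -> aeq v w -> aeq u w.
Proof. by move=> h k; apply: tend0_eq (tend0D h k) => n; lin. Qed.

Lemma aeqD u v a b : aeq u v -> aeq a b ->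
  aeq (fun n => u n + a n) (fun n => v n + b n).
Proof. by move=> h k; apply: tend0_eq (tend0D h k) => n; lin. Qed.

Lemma aeqB u v a b : aeq u v -> aeq a b ->
  aeq (fun n => u n - a n) (fun n => v n - b n).
Proof. by move=> h k; apply: tend0_eq (tend0B h k) => n; lin. Qed.

Lemma aeq_sum (I : Type) (s : seq I) (F H : I -> nat -> A) :
  (forall i, aeq (F i) (H i)) ->
  aeq (fun n => \sum_(i <- s) F i n) (fun n => \sum_(i <- s) H i n).
Proof.
by move=> h; apply: tend0_eq (tend0_sum s h) => n; rewrite -sumrB.
Qed.

Lemma aeqMl w u v : bddseq w -> aeq u v ->
  aeq (fun n => w n ** u n) (fun n => w n ** v n).
Proof. by move=> bw h; apply: tend0_eq (tend0_mull bw h) => n; rewrite smulBr. Qed.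

Lemma aeqMr w u v : bddseq w -> aeq u v ->
  aeq (fun n => u n ** w n) (fun n => v n ** w n).
Proof. by move=> bw h; apply: tend0_eq (tend0_mulr bw h) => n; rewrite smulBl. Qed.

Lemma aeq_star u v : aeq u v -> aeq (fun n => star (u n)) (fun n => star (v n)).
Proof.
move=> h; apply: (tend0_le (K := 1) h) => n.
by rewrite -starB nm_star mul1r.
Qed.

Lemma aeq_eql u u' v : u =1 u' -> aeq u' v -> aeq u v.
Proof. by move=> h; apply: tend0_eq => n; rewrite h. Qed.

Lemma aeq_eqr v v' u : v' =1 v -> aeq u v' -> aeq u v.
Proof. by move=> h; apply: tend0_eq => n; rewrite h. Qed.

Lemma aeq_eventually u v (e : R) : aeq u v -> 0 < e ->
  exists N, forall n, (N <= n)%N -> nm (u n) <= nm (v n) + e.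
Proof.
move=> h /h[N HN]; exists N => n /HN hn.
by have := half_norm_nm (u n) (v n); lra.
Qed.

Lemma smul_suml (I : Type) (s : seq I) (F : I -> A) y :
  (\sum_(i <- s) F i) ** y = \sum_(i <- s) F i ** y.
Proof. by apply: (big_morph (fun x => x ** y)) => [a b|]; rewrite (smulDl, smul0l). Qed.

Lemma smul_sumr (I : Type) (s : seq I) (F : I -> A) y :
  y ** (\sum_(i <- s) F i) = \sum_(i <- s) y ** F i.
Proof. by apply: (big_morph (smul y)) => [a b|]; rewrite (smulDr, smul0r). Qed.

Lemma star_sum (I : Type) (s : seq I) (F : I -> A) :
  star (\sum_(i <- s) F i) = \sum_(i <- s) star (F i).
Proof. by apply: (big_morph star) => [a b|]; rewrite (starD, star0). Qed.

(* Cauchy-Schwarz: with [b_i = d_i x_i] and [S = \sum_i x_i^* b_i], expand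
   [\sum_i (b_i - k^-1 x_i S)^* (b_i - k^-1 x_i S) >= 0]. *)
Lemma nm_sum_conj (I : Type) (s : seq I) (x d : I -> A) (k M : R) :
  nm (\sum_(i <- s) star (x i) ** x i) <= k -> 0 < k -> 0 <= M ->
  (forall i, nm (d i) <= M) ->
  nm (\sum_(i <- s) star (x i) ** d i ** x i) <= k * M.
Proof.
move=> hk k0 M0 hd; set X := \sum_(i <- s) star (x i) ** x i in hk.
set S := \sum_(i <- s) _; pose b i := d i ** x i.
pose Q := \sum_(i <- s) star (b i) ** b i.
have kn : k != 0 by rewrite gt_eqF.
have SE : S = \sum_(i <- s) star (x i) ** b i.
  by apply: eq_bigr => i _; rewrite /b smulA.
have hX : psd (em X) by apply: psd_em_sum => i; exact: psd_em_sq.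
have hQ : psd ((M ^+ 2)%:C%C *: em X - em Q).
  rewrite -emZ -emB /X /Q scaler_sumr -sumrB; apply: psd_em_sum => i.
  rewrite /b starM -smulA (smulA (star (d i))).
  have -> : (M ^+ 2)%:C%C *: (star (x i) ** x i) -
      star (x i) ** (star (d i) ** d i ** x i) =
      up (ustar (em (x i)) * (ur (M ^+ 2) - em (star (d i) ** d i)) * em (x i)).
    rewrite mulrBr mulrBl ur_mulr -em_star -!emM -scalerAl -emM -emZ -emB.
    by rewrite /up /= !smulA.
  rewrite em_up; last by rewrite /= mulr0.
  apply: psd_conj; have hs := psd_em_sq (d i).
  apply: (psd_sub_ob (psd_star hs)); apply/ob_em; rewrite nm_cstar.
  by have := hd i; have := nm_ge0 (d i); nra.
have hS : psd (em Q - k^-1%:C%C *: em (star S ** S)).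
  pose t i := b i - k^-1%:C%C *: (x i ** S).
  have E : \sum_(i <- s) star (t i) ** t i = Q - k^-1%:C%C *: (star S ** S)
      - k^-1%:C%C *: (star S ** S) + (k^-1 ^+ 2)%:C%C *: (star S ** X ** S).
    have E1 : star S ** S = \sum_(i <- s) star (b i) ** x i ** S.
      rewrite -smul_suml SE star_sum; congr (_ ** _); apply: eq_bigr => i _.
      by rewrite starM starK.
    have E2 : star S ** S = \sum_(i <- s) star S ** (star (x i) ** b i).
      by rewrite -smul_sumr -SE.
    have E3 : star S ** X ** S = \sum_(i <- s) star S ** (star (x i) ** x i) ** S.
      by rewrite -smul_suml -smul_sumr.
    rewrite {1}E1 E2 E3.
    rewrite !scaler_sumr /Q -!sumrB -big_split /=; apply: eq_bigr => i _.
    rewrite /t starB starZ conj_real starM smulBl !smulBr !smulZl !smulZr.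
    rewrite scalerA -rmorphM -expr2 !smulA; lin.
  have -> : em Q - k^-1%:C%C *: em (star S ** S) =
     em (\sum_(i <- s) star (t i) ** t i) +
     (k^-1 ^+ 2)%:C%C *: (ustar (em S) * (ur k - em X) * em S).
    rewrite E mulrBr mulrBl ur_mulr -em_star -scalerAl -!emM scalerBr scalerA.
    rewrite -rmorphM expr2 -mulrA mulVf// mulr1 !(emD, emN, emZ).
    by lin.
  apply: psdD; first by apply: psd_em_sum => i; exact: psd_em_sq.
  apply: psdZ; first by rewrite sqr_ge0.
  by apply: psd_conj; apply: psd_sub_ob (psd_star hX) _; apply/ob_em.
have hf : psd (em ((k * M ^+ 2)%:C%C *: X) - em (star S ** S)).
  have := psdZ (ltW k0) (psdD hQ hS); rewrite addrA subrK scalerBr !scalerA.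
  by rewrite -!rmorphM mulfV// scale1r -emZ.
have := pos_le_nm (psd_em_sq S) hf; rewrite nm_cstar nmZr ger0_norm; last first.
  by rewrite mulr_ge0 ?sqr_ge0 ?ltW.
move=> h; apply: le_sqr_nm; rewrite ?nm_ge0 ?mulr_ge0 ?(ltW k0)//.
apply: le_trans h _; have hk' : 0 <= k - nm X by rewrite subr_ge0.
have := mulr_ge0 (mulr_ge0 (ltW k0) (sqr_ge0 M)) hk'; clear; nra.
Qed.

End AsymptoticEquality.

(** The sum of all [x^* x + x x^*] gives an approximate unit [u] for both sides. It is replaced by
    [2 u - u^2 = 1 - (1 - u)^2], which lies between 0 and 1 because [|1 - u| <= 1], and so has norm
    at most 1. *)
Lemma seq_unit (R : realType) (A : cstarAlgType R) (s : seq A) (e : R) : 0 < e ->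
  exists u, [/\ star u = u, nm u <= 1,
    forall Q : set A, closed_subalg Q -> (forall x, x \in s -> Q x /\ Q (star x)) ->
      Q u &
    forall x, x \in s -> nm (x - x ** u) <= e /\ nm (x - u ** x) <= e].
Proof.
move=> e0; have e30 : 0 < e / 3 by lra.
pose f (x : A) := star x ** x + x ** star x.
have hf (x : A) : psd (em (f x)).
  by apply: psd_emD; [exact: psd_em_sq|exact: psd_em_sqr].
pose p := \sum_(x <- s) f x.
have hp : psd (em p) by apply: psd_em_sum.
have hle (x : A) : x \in s -> psd (em p - em (f x)).
  by move=> xs; rewrite /p (big_rem x)//= emD addrAC subrr add0r; exact: psd_em_sum.
have [q [u [qs uE [hu u1] uQ ux]]] := approx_unit hp e30.
have us : star u = u := psd_em_star hu.
have u2 : nm u <= 1 + 1.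
  by apply/ob_em; have := obB (@ob1 _ A) u1; rewrite opprB addrC subrK.
exists (u + u - u ** u); split.
- by rewrite starB starD starM us.
- have s1 : ustar (1 - em u) = 1 - em u by rewrite ustarB ustar1 (psd_star hu).
  have h1 : psd (1 - em (u + u - u ** u)).
    have := psd_sq s1; rewrite !(emD, emN, emM) => h.
    by move: h; congr psd; ncring.
  apply/ob_em; apply: psd_le_ob; rewrite ?ur1//.
  have h2 : psd (1 + (1 - em u)).
    have := psd_sub_ob _ (obN u1); rewrite opprK ur1; apply.
    by rewrite ustarN s1.
  have := psd_mulC hu h2; rewrite !(emD, emN, emM) => h.
  have -> : em u + em u - em u * em u = em u * (1 + (1 - em u)) by ncring.
  by apply: h; ncring.
- move=> Q sQ H; have Qu : Q u.
    apply: (uQ Q sQ _).2; rewrite /p; elim: (s) H => [|x r IH] H.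
      by rewrite big_nil; case: sQ.
    rewrite big_cons; apply: (closed_subalgD sQ); last first.
      by apply: IH => y ys; apply: H; rewrite in_cons ys orbT.
    have [h1 h2] := H x (mem_head _ _).
    by apply: (closed_subalgD sQ); exact: (closed_subalgM sQ).
  apply: (closed_subalgD sQ); first exact: (closed_subalgD sQ).
  by apply: (closed_subalgN sQ); exact: (closed_subalgM sQ).
- move=> x /hle h.
  have h1 : nm (x - x ** u) <= e / 3.
    apply: (ux x).1; have := psdD h (psd_em_sqr x).
    by rewrite /f emD; congr psd; lin.
  have h2 : nm (x - u ** x) <= e / 3.
    apply: (ux x).2; have := psdD h (psd_em_sq x).
    by rewrite /f emD; congr psd; lin.
  have bd (y z : A) : nm y <= e / 3 -> nm z <= nm y * nm u -> nm (y - z) <= e.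
    move=> hy hz; apply: le_trans (nmB _ _) _; have := nm_ge0 y; nra.
  split.
    have -> : x - x ** (u + u - u ** u) = (x - x ** u) - (x - x ** u) ** u.
      by rewrite !(smulBl, smulBr, smulDr, smulA); lin.
    by apply: bd => //; exact: nmM.
  have -> : x - (u + u - u ** u) ** x = (x - u ** x) - u ** (x - u ** x).
    by rewrite !(smulBl, smulBr, smulDl, smulA); lin.
  by apply: bd => //; rewrite mulrC; exact: nmM.
Qed.

Lemma cstar_closed_subalg (R : realType) (A : cstarAlgType R) (D : cstarSub A) :
  closed_subalg (D : starSub A).
Proof.
split=> [||k x y Dx Dy|x y Dx Dy]; [exact: cstar_sub_closed|exact: star_sub0| |].
  by apply: star_subD => //; exact: star_subZ.
exact: star_subM.
Qed.

(** * Calculus with Rokhlin systems *)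

Section SystemCalculus.
Variables (R : realType) (G : topGroupType) (A : cstarAlgType R).
Variables (alpha : cstarAction G A) (D : cstarSub A) (c : contG R G -> nat -> A).
Hypothesis sys : rokhlin_system alpha D c.
Implicit Types (f h : contG R G) (d : A).

Lemma sys_comm f d : star_sub D d ->
  aeq (fun n => c f n ** d) (fun n => d ** c f n).
Proof. exact: rs_comm sys _ _. Qed.

Lemma sys_lin (k : R[i]) f h d : star_sub D d ->
  aeq (fun n => c (k *: f + h) n ** d) (fun n => k *: (c f n ** d) + c h n ** d).
Proof.
move=> Dd; apply: tend0_eq (rs_lin sys k f h Dd) => n.
by rewrite smulBl smulDl smulZl.
Qed.

Lemma sys_mul f h d : star_sub D d ->
  aeq (fun n => c (f ** h) n ** d) (fun n => c f n ** (c h n ** d)).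
Proof.
by move=> Dd; apply: tend0_eq (rs_mul sys f h Dd) => n; rewrite smulBl smulA.
Qed.

Lemma sys_star f d : star_sub D d ->
  aeq (fun n => c (star f) n ** d) (fun n => star (c f n) ** d).
Proof.
by move=> Dd; apply: tend0_eq (rs_star sys f Dd) => n; rewrite smulBl.
Qed.

Lemma sys_one d : star_sub D d -> aeq (fun n => c (contG1 R G) n ** d) (fun=> d).
Proof. exact: rs_one sys _. Qed.

Lemma sys_act g f d : star_sub D d ->
  aeq (fun n => c (left_translate g f) n ** d) (fun n => alpha g (c f n) ** d).
Proof.
by move=> Dd; apply: tend0_eq (rs_act sys g f Dd) => n; rewrite smulBl.
Qed.

Lemma sys_zero d : star_sub D d -> aeq (fun n => c 0 n ** d) (fun=> 0).
Proof.
move=> Dd; have := sys_lin (- 1) 0 0 Dd; rewrite scaler0 addr0 => h.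
by apply: aeq_eqr h => n; lin.
Qed.

Lemma sys_sum (I : Type) (s : seq I) (F : I -> contG R G) d : star_sub D d ->
  aeq (fun n => c (\sum_(i <- s) F i) n ** d)
      (fun n => \sum_(i <- s) c (F i) n ** d).
Proof.
move=> Dd; elim: s => [|i s IH].
  rewrite big_nil; apply: aeq_eqr (sys_zero Dd) => n; by rewrite big_nil.
rewrite big_cons; have h := sys_lin 1 (F i) (\sum_(j <- s) F j) Dd.
rewrite scale1r in h; apply: aeq_trans h _.
apply: aeq_eqr (aeqD (aeq_refl _) IH) => n.
by rewrite big_cons scale1r.
Qed.

Lemma sys_comm_star f d : star_sub D d ->
  aeq (fun n => star (c f n) ** d) (fun n => d ** star (c f n)).
Proof.
move=> Dd; apply: aeq_sym; have := aeq_star (sys_comm f (star_subV Dd)).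
move=> h; apply: aeq_eql (aeq_eqr _ h) => n; by rewrite starM starK.
Qed.

Lemma sys_mulstar f h d : star_sub D d ->
  aeq (fun n => c (star f ** h) n ** d) (fun n => star (c f n) ** (c h n ** d)).
Proof.
move=> Dd; apply: aeq_trans (sys_mul _ _ Dd) _.
have bf := rs_bounded sys f; have bs := rs_bounded sys (star f).
have bh := rs_bounded sys h.
apply: aeq_trans (aeqMl bs (sys_comm h Dd)) _.
apply: aeq_trans (aeq_eql _ (aeqMr bh (sys_star f Dd))) _ => [n|].
  by rewrite smulA.
apply: aeq_eql (aeqMl (bddseq_star bf) (aeq_sym (sys_comm h Dd))) => n.
by rewrite smulA.
Qed.

(** Turns a quadratic expression in the lifts into one lift with a coefficient from [D], the shape
    that [system_norm] can bound. *)
Lemma sys_quad f h p b q : star_sub D p -> star_sub D b -> star_sub D q ->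
  aeq (fun n => star (c f n ** p) ** b ** (c h n ** q))
      (fun n => c (star f ** h) n ** (star p ** b ** q)).
Proof.
move=> Dp Db Dq; have Dp' : star_sub D (star p) by exact: star_subV.
have Dpb : star_sub D (star p ** b) by exact: star_subM.
have Dpbq : star_sub D (star p ** b ** q) by exact: star_subM.
have bh := rs_bounded sys h; have bs := bddseq_star (rs_bounded sys f).
apply: aeq_sym; apply: aeq_trans (sys_mulstar _ _ Dpbq) _.
have h1 := aeqMl bs (aeqMr (bddseq_cst q) (sys_comm h Dpb)).
apply: aeq_trans (aeq_eql _ h1) _ => [n|]; first by rewrite !smulA.
have h2 := aeqMr (bddseqM bh (bddseq_cst q)) (aeqMr (bddseq_cst b) (sys_comm_star f Dp')).
apply: aeq_trans (aeq_eql _ (aeq_eqr _ h2)) (aeq_refl _) => n.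
  by rewrite !smulA.
by rewrite starM !smulA.
Qed.

(* Compress by an approximate unit [e] of the [d_i] and apply [nm_sum_conj] to
   [x_i = c(xi_i) e], for which [\sum_i x_i^* x_i] is close to [e^2]. *)
Lemma system_norm (I : finType) (xi : I -> contG R G) (d : I -> A) (M e : R) :
  (forall i, star_sub D (d i)) ->
  \sum_i star (xi i) ** xi i = contG1 R G -> 0 <= M ->
  (forall i, xi i != 0 -> nm (d i) <= M) -> 0 < e ->
  exists N, forall n, (N <= n)%N ->
    nm (\sum_i c (star (xi i) ** xi i) n ** d i) <= M + e.
Proof.
move=> Dd xi1 M0 dM e0.
(* The bound [M] is known only where [xi i] is nonzero. Elsewhere the coefficient is set to 0, which
   changes the sum by a null sequence. *)
pose d' i := if xi i == 0 then 0 else d i.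
have Dd' i : star_sub D (d' i) by rewrite /d'; case: ifP => // _; exact: star_sub0.
have d'M i : nm (d' i) <= M.
  by rewrite /d'; case: eqVneq => [_|/dM//]; rewrite nm0.
pose F i := star (xi i) ** xi i.
have dd' i : aeq (fun n => c (F i) n ** d i) (fun n => c (F i) n ** d' i).
  rewrite /d'; case: eqVneq => [x0|_]; last exact: aeq_refl.
  have F0 : F i = 0 by rewrite /F x0 smul0r.
  rewrite F0; apply: aeq_eqr (sys_zero (Dd i)) => n; by rewrite smul0r.
have [B HB] : exists B : I -> R, forall i n, nm (c (F i) n) <= B i.
  have h i : exists B : R, forall n, nm (c (F i) n) <= B.
    exact: rs_bounded sys (F i).
  by have [B HB] := boolp.choice h; exists B.
pose K := \sum_i B i.
have B0 i : 0 <= B i by apply: le_trans (HB i 0%N); exact: nm_ge0.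
have K0 : 0 <= K by apply: sumr_ge0.
have e40 : 0 < e / 4 by lra.
have e20 : 0 < e / 2 by lra.
have [t t0 tK] := small_mul K0 e40.
have [u [us u1 uQ uu]] := seq_unit [seq d' i | i <- enum I] t0.
have Du : star_sub D u.
  apply: uQ; first exact: cstar_closed_subalg.
  by move=> x /mapP[i _ ->]; split; [|exact: star_subV].
have dist i : nm (d' i - u ** d' i ** u) <= t + t.
  have [h1 h2] : nm (d' i - d' i ** u) <= t /\ nm (d' i - u ** d' i) <= t.
    by apply: uu; apply/mapP; exists i; rewrite ?mem_enum.
  have -> : d' i - u ** d' i ** u = (d' i - d' i ** u) + (d' i - u ** d' i) ** u.
    by rewrite smulBl; lin.
  apply: le_trans (nmD _ _) _; apply: lerD h1 _.
  apply: le_trans (nmM _ _) _; apply: le_trans h2.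
  by rewrite ler_piMr ?nm_ge0.
have Dudu i : star_sub D (u ** d' i ** u) by do !apply: star_subM.
have Duu : star_sub D (u ** u) by exact: star_subM.
pose x n i := c (xi i) n ** u.
have one : aeq (fun n => \sum_i star (x n i) ** x n i) (fun=> u ** u).
  apply: aeq_trans (aeq_sum (H := fun i n => c (F i) n ** (u ** u)) _ _) _.
    move=> i; have h := sys_mulstar (xi i) (xi i) Duu; apply: aeq_sym.
    apply: aeq_trans h _; have bs := bddseq_star (rs_bounded sys (xi i)).
    have h2 := aeqMl bs (aeqMr (bddseq_cst u) (sys_comm (xi i) Du)).
    apply: aeq_trans (aeq_eql _ h2) _ => [n|]; first by rewrite !smulA.
    have h := aeqMr (bddseqM (rs_bounded sys (xi i)) (bddseq_cst u))
      (sys_comm_star (xi i) Du).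
    by apply: aeq_eql (aeq_eqr _ h) => n; rewrite ?starM ?us !smulA.
  have := sys_sum (index_enum I) F Duu; rewrite xi1 => h.
  exact: aeq_trans (aeq_sym h) (sys_one Duu).
have [r1 r1r re] : exists2 r1 : R, 0 < r1 & r1 * M <= e / 4 by exact: small_mul.
have [N1 HN1] := aeq_eventually one r1r.
have conj_ : aeq (fun n => \sum_i star (x n i) ** d' i ** x n i)
    (fun n => \sum_i c (F i) n ** (u ** d' i ** u)).
  apply: aeq_sum => i; apply: aeq_eqr (sys_quad _ _ Du (Dd' i) Du) => n.
  by rewrite us.
have all_ := aeq_sum (index_enum I) dd'.
have e80 : 0 < e / 8 by lra.
have [N2 HN2] := aeq_eventually all_ e80.
have [N3 HN3] := aeq_eventually (aeq_sym conj_) e80.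
exists (maxn N1 (maxn N2 N3)) => n; rewrite !geq_max => /and3P[/HN1 h1 /HN2 h2 /HN3 h3].
have uu1 : nm (u ** u) <= 1.
  apply: le_trans (nmM _ _) _; have := nm_ge0 u; nra.
have h4 : nm (\sum_i star (x n i) ** d' i ** x n i) <= (1 + r1) * M.
  apply: nm_sum_conj => //; last by lra.
  by apply: le_trans h1 _; lra.
have h5 : nm (\sum_i c (F i) n ** d' i - \sum_i c (F i) n ** (u ** d' i ** u)) <=
    K * (t + t).
  rewrite -sumrB; apply: le_trans (nm_sum _ _ _) _; rewrite /K mulr_suml.
  apply: ler_sum => i _; rewrite -smulBr; apply: le_trans (nmM _ _) _.
  by apply: ler_pM; rewrite ?nm_ge0.
have h6 := half_norm_nm (\sum_i c (F i) n ** d' i) (\sum_i c (F i) n ** (u ** d' i ** u)).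
rewrite /F in h2 h3 h5 h6 *; clear - h2 h3 h4 h5 h6 re tK; lra.
Qed.

End SystemCalculus.

(** * Partitions of unity by squares *)

Section PartitionOfUnity.
Variables (R : realType) (G : topGroupType).
Hypothesis cG : compact [set: G].
Hypothesis hG : hausdorff_space G.

Lemma mulgl_continuous (g : G) : continuous (fun h : G => (g * h)%g).
Proof.
move=> h; apply: (@continuous_comp _ _ _ (fun h => (g, h))
  (fun p : G * G => (p.1 * p.2)%g)); last exact: mulg_continuous.
by apply: cvg_pair; [exact: cvg_cst|exact: cvg_id].
Qed.

Lemma bump (U : set G) : nbhs (1%g : G) U -> exists b : G -> R,
  [/\ continuous b, forall g, 0 <= b g, b 1%g = 1 & forall g, b g != 0 -> U g].
Proof.
move=> U1; have nG := compact_normal hG cG.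
have [f [cf f01 f0 f1]] : exists f : G -> R, [/\ continuous f, range f `<=` `[0, 1],
    f @` [set 1%g] `<=` [set 0] & f @` (~` U°) `<=` [set 1]].
  apply/uniform_separatorP; apply: (normal_completely_regular (R := R)) => //.
  - exact: hausdorff_accessible.
  - by apply: open_closedC; exact: open_interior.
exists (fun g => 1 - f g); split=> [g|g||g].
- by apply: cvgB; [exact: cvg_cst|exact: cf].
- have /f01 : range f (f g) by exists g.
  by rewrite /= in_itv /= => /andP[_]; rewrite subr_ge0.
- by rewrite (f0 (f 1%g)) ?subr0//; exists 1%g.
- apply: contraNP => nU; rewrite subr_eq0 eq_sym; apply/eqP; apply: f1.
  by exists g => // /interior_subset.
Qed.

Lemma real_contG (f : G -> R) : continuous f ->
  contG_set (fun g => (f g)%:C%C : R[i]^o).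
Proof.
move=> cf g; apply: nm_continuous => e e0.
have /cvgrPdist_le/(_ _ e0) := cf g; apply: filterS => h hh.
by rewrite -rmorphB nm_real distrC.
Qed.

(** The functions [x i] are the square roots of the members of a partition, as the Cauchy-Schwarz
    bound in [system_norm] requires; hence the normalization by the root of [\sum_i B_i^2]. *)
Lemma partition_of_unity (U : set G) : nbhs (1%g : G) U ->
  exists (n : nat) (g : 'I_n -> G) (x : 'I_n -> contG R G),
    \sum_i star (x i) ** x i = contG1 R G /\
    forall i h, val (x i) h != 0 -> U ((g i)^-1 * h)%g.
Proof.
move=> U1; have [b [cb b0 b1 bU]] := bump U1.
have V1 : nbhs (1%g : G) [set g | 2^-1 < b g].
  apply: (cvgr_gt (b 1%g)); first exact: cb.
  by rewrite b1; lra.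
have [gs Hgs] := finite_net cG V1.
pose g (i : 'I_(size gs)) := tnth (in_tuple gs) i.
pose B i h := b ((g i)^-1 * h)%g.
have cB i : continuous (B i).
  move=> h; apply: (@continuous_comp _ _ _ (fun h => ((g i)^-1 * h)%g) b).
    exact: mulgl_continuous.
  exact: cb.
pose S h := \sum_i B i h ^+ 2.
have cS : continuous S.
  by apply: continuous_big => [|i _ h]; [exact: add_continuous|exact: (cvgM (cB i h) (cB i h))].
have S0 h : 0 < S h.
  have [k kg hk] := Hgs h; have [i ki] : exists i, k = g i.
    by apply/(tnthP (in_tuple gs)); exact: kg.
  rewrite /S (bigD1 i)//=; apply: ltr_pwDl; last first.
    by apply: sumr_ge0 => j _; exact: sqr_ge0.
  by apply: exprn_gt0; rewrite /B -ki; apply: lt_trans hk; lra.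
pose f i h := B i h / Num.sqrt (S h).
have sS h : Num.sqrt (S h) != 0 by rewrite gt_eqF// sqrtr_gt0.
have cf i : continuous (f i).
  move=> h; apply: cvgM; first exact: cB.
  apply: cvgV; first exact: sS.
  exact: (continuous_comp (cS h) (@sqrt_continuous R (S h))).
exists (size gs), g, (fun i => to_sub (S := contG_sub R G) (real_contG (cf i))).
split=> [|i h].
  apply/val_inj/funext => h.
  have -> : val (\sum_i star (to_sub (S := contG_sub R G) (real_contG (cf i))) **
      to_sub (S := contG_sub R G) (real_contG (cf i))) h =
      \sum_i ((f i h)%:C%C)^* * (f i h)%:C%C.
    by rewrite (big_morph (fun z : contG R G => val z h) (id1 := 0) (op1 := +%R)).
  under eq_bigr => i _ do rewrite conj_real -rmorphM -expr2 /f exprMn exprVn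
    sqr_sqrtr ?(ltW (S0 h))//.
  rewrite -rmorph_sum -mulr_suml mulfV ?rmorph1//; exact: (lt0r_neq0 (S0 h)).
by rewrite /= => fn; apply: bU; apply: contraNneq fn => B0; rewrite /f /B B0 mul0r.
Qed.

End PartitionOfUnity.

(** * Discretized orbit functions *)

Section Transfer.
Variables (R : realType) (G : topGroupType) (A : cstarAlgType R).
Variable alpha : cstarAction G A.
Hypothesis cG : compact [set: G].

(** Equicontinuity in [g], uniform in [n], lets compactness replace the index depending on [g] by a
    common one, at the cost of [e]. *)
Lemma uniform_eventually (F : G -> nat -> A) (r e : R) : 0 < e ->
  (forall g, \forall h \near g, forall n, nm (F h n - F g n) <= e) ->
  (forall g, exists N, forall n, (N <= n)%N -> nm (F g n) <= r) ->
  exists N, forall n, (N <= n)%N -> forall g, nm (F g n) <= r + e.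
Proof.
move=> e0 Fe Fr; have := (compact_near_coveringP [set: G]).1 cG nat \oo
  (fun n g => nm (F g n) <= r + e) _ _.
case=> [g _|N _ HN]; last by exists N => n Nn g; exact: HN.
have [N HN] := Fr g; exists ([set h | forall n, nm (F h n - F g n) <= e],
  [set n | (N <= n)%N]); first by split; [exact: Fe|exists N].
move=> [h n] /= [h1 /HN h2].
by apply: le_trans (half_norm_nm _ (F g n)) _; have := h1 n; lra.
Qed.

Lemma equi_near (y : nat -> A) (e : R) : act_equicontinuous alpha y -> 0 < e ->
  forall g, \forall h \near g, forall n, nm (alpha h (y n) - alpha g (y n)) <= e.
Proof.
move=> ey e0 g; have c1 : {for g, continuous (fun h => (g^-1 * h)%g)}.
  exact: mulgl_continuous.
have h1 : nbhs (g^-1 * g)%g [set u | forall n, nm (alpha u (y n) - y n) <= e].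
  by rewrite mulVg; exact: ey.
apply: (@filterS _ (nbhs g) _ _ _ _ (c1 _ h1)) => h /= hh n.
by rewrite -{1}(mulVKg g h) actM act_nmB.
Qed.

Lemma equicontinuousD y z : act_equicontinuous alpha y -> act_equicontinuous alpha z ->
  act_equicontinuous alpha (fun n => y n + z n).
Proof.
move=> hy hz e e0; have e20 : 0 < e / 2 by lra.
near=> u => n; have -> : alpha u (y n + z n) - (y n + z n) =
    (alpha u (y n) - y n) + (alpha u (z n) - z n) by rewrite actD; lin.
apply: le_trans (nmD _ _) _; rewrite (splitr e); apply: lerD.
  by move: n; near: u; exact: hy.
by move: n; near: u; exact: hz.
Unshelve. all: by end_near. Qed.

Lemma equicontinuousM y z : bddseq y -> bddseq z ->
  act_equicontinuous alpha y -> act_equicontinuous alpha z ->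
  act_equicontinuous alpha (fun n => y n ** z n).
Proof.
move=> [M yM] [N zN] hy hz e e0; have e20 : 0 < e / 2 by lra.
have M0 : 0 <= M by apply: le_trans (yM 0%N); exact: nm_ge0.
have N0 : 0 <= N by apply: le_trans (zN 0%N); exact: nm_ge0.
have [d d0 dM] := small_mul M0 e20; have [t t0 tN] := small_mul N0 e20.
near=> u => n; have -> : alpha u (y n ** z n) - y n ** z n =
    (alpha u (y n) - y n) ** alpha u (z n) + y n ** (alpha u (z n) - z n).
  by rewrite act_smul smulBl smulBr; lin.
apply: le_trans (nmD _ _) _; rewrite (splitr e); apply: lerD.
  apply: le_trans (nmM _ _) _; rewrite act_nm; apply: le_trans tN.
  apply: ler_pM; rewrite ?nm_ge0//; move: n; near: u; exact: hy.
apply: le_trans (nmM _ _) _; apply: le_trans dM; rewrite mulrC.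
apply: ler_pM; rewrite ?nm_ge0//; move: n; near: u; exact: hz.
Unshelve. all: by end_near. Qed.

Lemma equicontinuous_cst x : act_equicontinuous alpha (fun=> x).
Proof.
move=> e e0; apply: filterS (act_equi alpha cG x e0) => u hu _.
by have := hu 1%g; rewrite act1.
Qed.

Lemma equicontinuous_sum (I : Type) (s : seq I) (F : I -> nat -> A) :
  (forall i, act_equicontinuous alpha (F i)) ->
  act_equicontinuous alpha (fun n => \sum_(i <- s) F i n).
Proof.
move=> H; elim: s => [|i s IH] e e0.
  apply: filterE => u n; by rewrite big_nil act0 subr0 nm0 ltW.
apply: filterS (equicontinuousD (H i) IH e0) => u hu n.
by rewrite big_cons; exact: hu.
Qed.

Variables (D : cstarSub A) (c : contG R G -> nat -> A).
Hypothesis sys : rokhlin_system alpha D c.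
Hypothesis Dinv : invariant_sub alpha (D : starSub A).

Lemma contG_mulE (p q : contG R G) t : val (p ** q) t = val p t * val q t.
Proof. by []. Qed.

Lemma contG_starE (p : contG R G) t : val (star p) t = (val p t)^*.
Proof. by []. Qed.

Lemma left_translateE g (p : contG R G) t :
  val (left_translate g p) t = val p (g^-1 * t)%g.
Proof. by []. Qed.

Lemma contG_mulC (f h : contG R G) : f ** h = h ** f.
Proof. by apply/val_inj/funext => g; rewrite !contG_mulE mulrC. Qed.

Variables (m : nat) (k : 'I_m -> G) (X : 'I_m -> contG R G).
Hypothesis X1 : \sum_i star (X i) ** X i = contG1 R G.
Local Notation f i := (star (X i) ** X i).

(** A discrete version of the image of [t |-> alpha_t(x)]. This function is invariant under
    [F |-> alpha_g(F(g^-1 t))], which explains the near invariance, and its pointwise norm is that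
    of [x]. *)
Definition smear x n := \sum_i c (f i) n ** alpha (k i) x.

Lemma smear_bdd x : star_sub D x -> exists N, forall n, (N <= n)%N ->
  nm (smear x n) <= nm x + 1.
Proof.
move=> Dx; apply: (system_norm sys (xi := X) (d := fun i => alpha (k i) x)) => //.
- by move=> i; exact: Dinv.
- exact: nm_ge0.
- by move=> i _; rewrite act_nm.
Qed.

Lemma contG_absM (p q : contG R G) :
  star (p ** q) ** (p ** q) = star p ** p ** (star q ** q).
Proof.
apply/val_inj/funext => t.
by rewrite !contG_mulE !contG_starE !contG_mulE rmorphM mulrACA.
Qed.

Lemma contG_sum_mul (p : contG R G) (F : 'I_m -> contG R G) :
  \sum_i p ** F i = p ** \sum_i F i.
Proof. by rewrite (big_morph (smul p) (@smulDr _ _ p) (@smul0r _ _ p)). Qed.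

Lemma contG_mulr1 (p : contG R G) : p ** contG1 R G = p.
Proof. by apply/val_inj/funext => t; exact: mulr1. Qed.

Lemma contG_neq0 (p : contG R G) : p != 0 -> exists t, val p t != 0.
Proof.
move=> p0; apply: contrapT => H; case/eqP: p0; apply/val_inj/funext => t.
by apply: contrapT => pt; apply: H; exists t; apply/eqP.
Qed.

Lemma left_translate1 g : left_translate g (contG1 R G) = contG1 R G.
Proof. exact/val_inj. Qed.

Lemma left_translate_abs g p :
  left_translate g (star p ** p) = star (left_translate g p) ** left_translate g p :> contG R G.
Proof.
apply/val_inj/funext => t.
by rewrite left_translateE !contG_mulE !contG_starE left_translateE.
Qed.

Lemma left_translate_sum g (F : 'I_m -> contG R G) :
  left_translate g (\sum_i F i) = \sum_i left_translate g (F i).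
Proof. by apply: (big_morph (left_translate g)) => [p q|]; exact/val_inj. Qed.

Lemma pair_sum_one (Y : 'I_m -> contG R G) :
  \sum_i star (Y i) ** Y i = contG1 R G ->
  \sum_(p : 'I_m * 'I_m) star (X p.1 ** Y p.2) ** (X p.1 ** Y p.2) = contG1 R G.
Proof.
move=> Y1; rewrite -(pair_bigA _ (fun i j => star (X i ** Y j) ** (X i ** Y j)))/=.
rewrite -[RHS]X1; apply: eq_bigr => i _.
under eq_bigr => j _ do rewrite contG_absM.
by rewrite contG_sum_mul Y1 contG_mulr1.
Qed.

Lemma sys_sum_one d (F : 'I_m -> contG R G) (p : contG R G) : star_sub D d ->
  \sum_i F i = contG1 R G ->
  aeq (fun n => c p n ** d) (fun n => \sum_i c (p ** F i) n ** d).
Proof.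
move=> Dd F1; have := sys_sum sys (index_enum 'I_m) (fun i => p ** F i) Dd.
by rewrite contG_sum_mul F1 contG_mulr1.
Qed.

(* The difference is asymptotically the sum of [c(f_i L_h f_j)] times
   [alpha_(h k_j) x - alpha_(k_i) x]. *)
Lemma smear_invariant x (d e : R) h : star_sub D x -> 0 < e -> 0 <= d ->
  (forall i t, val (X i) t != 0 -> nm (alpha t x - alpha (k i) x) <= d) ->
  exists N, forall n, (N <= n)%N ->
    nm (alpha h (smear x n) - smear x n) <= d + d + e.
Proof.
move=> Dx e0 d0 Hd; pose Y i := left_translate h (X i).
have Y1 : \sum_i star (Y i) ** Y i = contG1 R G.
  rewrite -[RHS](left_translate1 h) -X1 left_translate_sum.
  by apply: eq_bigr => i _; rewrite left_translate_abs.
pose z (p : 'I_m * 'I_m) := alpha (h * k p.2)%g x - alpha (k p.1) x.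
have Da g : star_sub D (alpha g x) by exact: Dinv.
have Dz p : star_sub D (z p) by apply: (closed_subalgD (cstar_closed_subalg D)); last
  apply: (closed_subalgN (cstar_closed_subalg D)); exact: Da.
have e20 : 0 < e / 2 by lra.
have Mz p : X p.1 ** Y p.2 != 0 -> nm (z p) <= d + d.
  move=> /contG_neq0[t]; rewrite [val _ t](_ : _ = val (X p.1) t * val (Y p.2) t)//.
  rewrite mulf_eq0 negb_or => /andP[/Hd h1]; rewrite /Y /= => /Hd h2.
  rewrite /z; apply: le_trans (nm_tri (alpha t x) _ _) _; apply: lerD => //.
  by rewrite nmBC -{1}(mulVKg h t) !(actM alpha h) act_nmB.
have [N1 HN1] := system_norm sys (xi := fun p => X p.1 ** Y p.2) Dz (pair_sum_one Y1)
  (addr_ge0 d0 d0) Mz e20.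
pose F p := star (X p.1 ** Y p.2) ** (X p.1 ** Y p.2).
have E1 : aeq (fun n => alpha h (smear x n))
    (fun n => \sum_p c (F p) n ** alpha (h * k p.2)%g x).
  apply: (aeq_trans (v := fun n =>
    \sum_j c (left_translate h (f j)) n ** alpha (h * k j)%g x)).
    have H := aeq_sum (index_enum _)
      (fun j => aeq_sym (sys_act sys h (f j) (Da (h * k j)%g))).
    apply: aeq_eql H => n.
    by rewrite act_sum; apply: eq_bigr => j _; rewrite act_smul -actM.
  apply: aeq_trans (aeq_sum (index_enum _)
    (fun j => sys_sum_one (left_translate h (f j)) (Da (h * k j)%g) X1)) _.
  apply: aeq_eql (aeq_refl _) => n; rewrite exchange_big pair_bigA /=.
  by apply: eq_bigr => p _; rewrite /F contG_absM contG_mulC left_translate_abs.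
have E2 : aeq (smear x) (fun n => \sum_p c (F p) n ** alpha (k p.1) x).
  apply: aeq_trans (aeq_sum (index_enum _)
    (fun j => sys_sum_one (f j) (Da (k j)) Y1)) _.
  apply: aeq_eql (aeq_refl _) => n; rewrite pair_bigA /=.
  by apply: eq_bigr => p _; rewrite /F contG_absM.
have E : aeq (fun n => alpha h (smear x n) - smear x n)
    (fun n => \sum_p c (F p) n ** z p).
  apply: aeq_eqr (aeqB E1 E2) => n; rewrite -sumrB.
  by apply: eq_bigr => p _; rewrite -smulBr.
have [N2 HN2] := aeq_eventually E e20.
exists (maxn N1 N2) => n; rewrite geq_max => /andP[/HN1 h1 /HN2 h2].
by apply: le_trans h2 _; lra.
Qed.

(** Only pairs with overlapping supports contribute, and for these [k_i] and [k_j] move [y] almost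
    alike. Up to that error the coefficient is [alpha_(k_i)(x^* b y - z)], of the same norm as
    [x^* b y - z]. *)
Lemma smear_quad x y b z (d e : R) : star_sub D x -> star_sub D y -> star_sub D b ->
  star_sub D z -> (forall g, alpha g b = b) -> (forall g, alpha g z = z) ->
  0 < e -> 0 <= d ->
  (forall i t, val (X i) t != 0 -> nm (alpha t y - alpha (k i) y) <= d) ->
  exists N, forall n, (N <= n)%N ->
    nm (star (smear x n) ** b ** smear y n - z) <=
    nm (star x ** b ** y - z) + nm x * nm b * (d + d) + e.
Proof.
move=> Dx Dy Db Dz bf zf e0 d0 Hd.
have Da g a : star_sub D a -> star_sub D (alpha g a) by exact: Dinv.
pose w (p : 'I_m * 'I_m) := star (alpha (k p.1) x) ** b ** alpha (k p.2) y.
have Dw p : star_sub D (w p).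
  by do !apply: star_subM; rewrite //; [apply: star_subV|]; exact: Da.
have Dwz p : star_sub D (w p - z).
  by apply: star_subD => //; exact: (closed_subalgN (cstar_closed_subalg D)).
pose F p := star (X p.1 ** X p.2) ** (X p.1 ** X p.2).
have E1 : aeq (fun n => star (smear x n) ** b ** smear y n)
    (fun n => \sum_p c (F p) n ** w p).
  apply: (aeq_trans (v := fun n => \sum_p
      star (c (f p.1) n ** alpha (k p.1) x) ** b ** (c (f p.2) n ** alpha (k p.2) y))).
    apply: aeq_eql (aeq_refl _) => n; rewrite /smear star_sum !smul_suml.
    rewrite -(pair_bigA _ (fun i j => star (c (f i) n ** alpha (k i) x) ** b **
      (c (f j) n ** alpha (k j) y)))/=.
    by apply: eq_bigr => i _; rewrite smul_sumr.
  apply: aeq_sum => p; apply: aeq_trans (sys_quad sys _ _ (Da _ _ Dx) Db (Da _ _ Dy)) _.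
  apply: aeq_eql (aeq_refl _) => n; rewrite /F contG_absM; congr (c _ n ** _).
  by congr (_ ** _); rewrite starM starK.
have E2 : aeq (fun=> z) (fun n => \sum_p c (F p) n ** z).
  apply: aeq_trans (aeq_sym (sys_one sys Dz)) _.
  by have := sys_sum sys (index_enum _) F Dz; rewrite (pair_sum_one X1).
have E : aeq (fun n => star (smear x n) ** b ** smear y n - z)
    (fun n => \sum_p c (F p) n ** (w p - z)).
  apply: aeq_eqr (aeqB E1 E2) => n; rewrite -sumrB.
  by apply: eq_bigr => p _; rewrite -smulBr.
have e20 : 0 < e / 2 by lra.
pose M := nm (star x ** b ** y - z) + nm x * nm b * (d + d).
have M0 : 0 <= M by rewrite addr_ge0 ?mulr_ge0 ?nm_ge0 ?addr_ge0.
have Mw p : X p.1 ** X p.2 != 0 -> nm (w p - z) <= M.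
  move=> /contG_neq0[t]; rewrite [val _ t](_ : _ = val (X p.1) t * val (X p.2) t)//.
  rewrite mulf_eq0 negb_or => /andP[/Hd h1 /Hd h2].
  have -> : w p - z = alpha (k p.1) (star x ** b ** y - z) +
      star (alpha (k p.1) x) ** b ** (alpha (k p.2) y - alpha (k p.1) y).
    by rewrite actB !act_smul act_star bf zf smulBr /w; lin.
  apply: le_trans (nmD _ _) _; rewrite act_nm lerD2l.
  apply: le_trans (nm_conj3 _ _ _) _; rewrite act_nm; apply: ler_pM;
    rewrite ?mulr_ge0 ?nm_ge0//.
  by apply: le_trans (nm_tri (alpha t y) _ _) _; apply: lerD; rewrite // nmBC.
have [N1 HN1] := system_norm sys (xi := fun p => X p.1 ** X p.2) Dwz
  (pair_sum_one X1) M0 Mw e20.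
have [N2 HN2] := aeq_eventually E e20.
exists (maxn N1 N2) => n; rewrite geq_max => /andP[/HN1 h1 /HN2 h2].
by apply: le_trans h2 _; rewrite /M in h1; lra.
Qed.

Lemma smear_equi x : act_equicontinuous alpha (smear x).
Proof.
apply: equicontinuous_sum => i; apply: equicontinuousM.
- exact: rs_bounded sys _.
- exact: bddseq_cst.
- exact: rs_equi sys _.
- exact: equicontinuous_cst.
Qed.

End Transfer.

Lemma eventually_forall (I : finType) (P : I -> nat -> Prop) :
  (forall i, exists N, forall n, (N <= n)%N -> P i n) ->
  exists N, forall n, (N <= n)%N -> forall i, P i n.
Proof.
move=> /boolp.choice[N HN]; exists (\max_i N i) => n Nn i; apply: HN.
exact: leq_trans (leq_bigmax i) Nn.
Qed.

(** * Moving solutions into the fixed point algebra *)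

Section FixedPointTransfer.
Variables (R : realType) (G : topGroupType) (A : cstarAlgType R).
Variable alpha : cstarAction G A.
Hypothesis sA : sigma_unital A.
Hypothesis cG : compact [set: G].
Hypothesis hG : hausdorff_space G.
Hypothesis scG : @second_countable G.
Hypothesis rA : rokhlin alpha.

Lemma orbit_partition (J : finType) (x : J -> A) (d : R) : 0 < d ->
  exists (m : nat) (k : 'I_m -> G) (X : 'I_m -> contG R G),
    \sum_i star (X i) ** X i = contG1 R G /\
    forall i t, val (X i) t != 0 -> forall j, nm (alpha t (x j) - alpha (k i) (x j)) <= d.
Proof.
move=> d0; pose U := [set u | forall j, nm (alpha u (x j) - x j) <= d].
have U1 : nbhs (1%g : G) U.
  apply: filter_forall => j; apply: filterS (act_equi alpha cG (x j) d0) => u hu.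
  by have := hu 1%g; rewrite act1.
have [m [k [X [X1 XU]]]] := partition_of_unity R cG hG U1.
exists m, k, X; split=> // i t /XU h j.
rewrite -{1}(mulVKg (k i) t) actM act_nmB; exact: h.
Qed.

(** A whole family is moved at once because absorption relates two elements: both have to be smeared
    with the same partition and evaluated at the same index before averaging. *)
Lemma transfer (J : finType) (x : J -> A) b (z : J -> J -> A) (e : R) :
  (forall g, alpha g b = b) -> (forall i j g, alpha g (z i j) = z i j) -> 0 < e ->
  exists y : J -> A, (forall j g, alpha g (y j) = y j) /\
    forall i j, nm (star (y i) ** b ** y j - z i j) <=
      nm (star (x i) ** b ** x j - z i j) + e.
Proof.
move=> bf zf e0.
pose s := b :: [seq x j | j <- enum J] ++ [seq z p.1 p.2 | p <- enum {: J * J}].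
have [D [c [Dinv Ds sys]]] := rokhlin_sequences cG scG (nth 0 s) sA rA.
have Dm a : a \in s -> star_sub D a.
  by move=> /(nthP 0)[i _ <-]; exact: Ds.
have Db : star_sub D b by apply: Dm; rewrite mem_head.
have Dx j : star_sub D (x j).
  apply: Dm; rewrite in_cons mem_cat; apply/orP; right; apply/orP; left.
  by apply/mapP; exists j; rewrite ?mem_enum.
have Dz i j : star_sub D (z i j).
  apply: Dm; rewrite in_cons mem_cat; apply/orP; right; apply/orP; right.
  by apply/mapP; exists (i, j); rewrite ?mem_enum.
pose K := \sum_j nm (x j) + 1; pose B := nm b.
have xK j : nm (x j) + 1 <= K.
  by rewrite lerD2r (bigD1 j)//= lerDl; apply: sumr_ge0 => i _; exact: nm_ge0.
have K0 : 0 <= K by apply: addr_ge0 => //; apply: sumr_ge0 => i _; exact: nm_ge0.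
have B0 : 0 <= B by exact: nm_ge0.
(* Averaging costs [3 d K B] on either side, [smear_quad] costs [2 d K B + d]. *)
have [d d0 de] : exists2 d, 0 < d & d * (8 * (K * B) + 1) <= e.
  by apply: small_mul => //; rewrite addr_ge0 ?mulr_ge0.
have d20 : 0 < d / 2 by lra.
have [m [k [X [X1 Xd]]]] := orbit_partition x d0.
pose l j := smear alpha c k X (x j).
have [N1 H1] := eventually_forall (fun j => smear_bdd sys Dinv k X1 (Dx j)).
have [N2 H2] : exists N, forall n, (N <= n)%N -> forall j g,
    nm (alpha g (l j n) - l j n) <= d + d + d / 2 + d / 2.
  apply: eventually_forall => j; apply: uniform_eventually => // [g|g].
    apply: filterS (equi_near (smear_equi cG sys k X (x j)) d20 g) => h hh n.
    have -> : alpha h (l j n) - l j n - (alpha g (l j n) - l j n) =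
      alpha h (l j n) - alpha g (l j n) by lin.
    exact: hh.
  apply: (smear_invariant sys Dinv X1) => //; first exact: ltW.
  by move=> i t h; exact: Xd.
have [N3 H3] : exists N, forall n, (N <= n)%N -> forall p : J * J,
    nm (star (l p.1 n) ** b ** l p.2 n - z p.1 p.2) <=
    nm (star (x p.1) ** b ** x p.2 - z p.1 p.2) + nm (x p.1) * nm b * (d + d) + d.
  apply: eventually_forall => p; apply: (smear_quad sys Dinv X1) => //; first exact: ltW.
  by move=> i t h; exact: Xd.
pose n := maxn N1 (maxn N2 N3).
have {}H1 j : nm (l j n) <= K.
  by apply: le_trans (xK j); apply: H1; rewrite leq_max leqnn.
have {}H2 j g : nm (alpha g (l j n) - l j n) <= d + d + d.
  have -> : d + d + d = d + d + d / 2 + d / 2 by lra.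
  by apply: H2; rewrite !leq_max leqnn orbT.
have {}H3 i j := H3 n (leq_trans (leq_maxr _ _) (leq_maxr _ _)) (i, j).
have [y hy] := boolp.choice (fun j => invariant_mean alpha cG (l j n)).
exists y; split=> [j g|i j]; first exact: (hy j).1.
have lid : linear (id : A -> A) by [].
have id1 (w : A) : nm (id w) <= 1 * nm w by rewrite mul1r.
have yK j' : nm (y j') <= K.
  have := (hy j').2 id 1 0 K lid id1; rewrite subr0; apply => g.
  by rewrite subr0 act_nm.
have yl j' : nm (y j' - l j' n) <= d + d + d by apply: ((hy j').2 id 1).
have -> : star (y i) ** b ** y j - z i j = (star (l i n) ** b ** l j n - z i j) +
    star (y i - l i n) ** b ** y j + star (l i n) ** b ** (y j - l j n).
  by rewrite starB !smulBl !smulBr; lin.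
apply: le_trans (nmD _ _) _; apply: le_trans (lerD (nmD _ _) (lexx _)) _.
have h1 : nm (star (y i - l i n) ** b ** y j) <= (d + d + d) * B * K.
  apply: le_trans (nm_conj3 _ _ _) _.
  by apply: ler_pM; rewrite ?mulr_ge0 ?nm_ge0//; apply: ler_pM; rewrite ?nm_ge0.
have h2 : nm (star (l i n) ** b ** (y j - l j n)) <= K * B * (d + d + d).
  apply: le_trans (nm_conj3 _ _ _) _.
  by apply: ler_pM; rewrite ?mulr_ge0 ?nm_ge0//; apply: ler_pM; rewrite ?nm_ge0.
have h3 : nm (x i) * nm b * (d + d) <= K * B * (d + d).
  apply: ler_pM; rewrite ?mulr_ge0 ?nm_ge0 ?addr_ge0 ?(ltW d0)//.
  by apply: ler_pM; rewrite ?nm_ge0//; have := xK i; lra.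
have := H3 i j; move: h1 h2 h3 de; rewrite /=; clear; nra.
Qed.

End FixedPointTransfer.

(** * Characters are contractive *)

Section Characters.
Variables (R : realType) (A : cstarAlgType R).

Lemma star_hom_scalars (chi : A -> R[i]^o) : star_hom chi ->
  [/\ {morph chi : x y / x + y}, forall k x, chi (k *: x) = k * chi x,
      {morph chi : x y / x ** y >-> x * y} & forall x, chi (star x) = (chi x)^*].
Proof.
move=> [cl cM cV]; have c0 : chi 0 = 0.
  by have := cl (- 1) 0 0; rewrite scaler0 addr0 scaleN1r addNr.
split=> // [x y|k x]; first by have := cl 1 x y; rewrite !scale1r.
by have := cl k x 0; rewrite !addr0 c0 addr0.
Qed.

(** If [|chi x|] exceeded [|x|], a multiple [a] of [x^* x] would satisfy [|a| < 1 < chi a]. Then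
    [a^2 = 2 k - k^2] with [k] self-adjoint forces [(chi a)^2 = 2 u - u^2 <= 1] for the real number
    [u = chi k]. *)
Lemma scalar_nm (chi : A -> R[i]^o) x : star_hom chi ->
  nm (chi x) <= nm x.
Proof.
move=> /star_hom_scalars[cD cZ cM cV]; rewrite leNgt; apply/negP => h.
set r := nm (chi x) in h; set n := nm x in h.
have n0 : 0 <= n by exact: nm_ge0.
have r0 : 0 < r by apply: le_lt_trans h.
have rn : 0 < r ^+ 2 + n ^+ 2 by apply: ltr_pwDl; rewrite ?exprn_gt0 ?sqr_ge0.
(* The reciprocal of the mean of [r^2] and [n^2], so that [c n^2 < 1 < c r^2]. *)
pose c := 2 / (r ^+ 2 + n ^+ 2); have c0 : 0 < c by rewrite divr_gt0.
have c1 : c * n ^+ 2 < 1 by rewrite mulrAC ltr_pdivrMr//; nra.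
have c2 : 1 < c * r ^+ 2 by rewrite mulrAC ltr_pdivlMr//; nra.
pose a := c%:C%C *: (star x ** x).
have as_ : star a = a by rewrite starZ conj_real starM starK.
have a1 : `|a| < 1.
  by rewrite -(rmorph1 (@real_complex R)) -nmlt nmZr ger0_norm ?(ltW c0)// nm_cstar.
have [k [ks _ kk]] := sqrt_fixpoint as_ a1.
have ca : chi a = (c * r ^+ 2)%:C%C.
  rewrite cZ cM cV [RHS]rmorphM; congr (_ * _).
  by rewrite mulrC -normCK nmC -/r rmorphXn.
have ck : chi k = (complex.Re (chi k))%:C%C.
  have : (chi k)^* = chi k by rewrite -cV ks.
  by case: (chi k) => u v /= [] /eqP; rewrite eqNr => /eqP ->.
have E : chi a * chi a = chi k + chi k - chi k * chi k.
  by rewrite -!cM kk -scaleN1r !cD cZ mulN1r.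
have := congr1 (@complex.Re R) E; rewrite ca ck -!(rmorphM, rmorphD, rmorphN) /=.
set u := complex.Re (chi k); move: c2; set s := c * r ^+ 2; clear => s1 E.
have := sqr_ge0 (u - 1); nra.
Qed.

End Characters.

(** * Pure infiniteness of the fixed point algebra *)

Section FixedPointAlgebra.
Variables (R : realType) (G : topGroupType) (A : cstarAlgType R).
Variable alpha : cstarAction G A.
Hypothesis sA : sigma_unital A.
Hypothesis cG : compact [set: G].
Hypothesis hG : hausdorff_space G.
Hypothesis scG : @second_countable G.
Hypothesis rA : rokhlin alpha.
Hypothesis piA : purely_infinite A.
Local Notation C := (fixed_point_algebra alpha).

Lemma fixed_val (x : C) g : alpha g (val x) = val x.
Proof. exact: (subval_in x). Qed.

Lemma fixed_lift (x : A) : (forall g, alpha g x = x) -> exists y : C, val y = x.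
Proof. by move=> h; exists (to_sub (S := fixed_sub alpha) h). Qed.

Lemma psd_fixed (a : C) : psd (em a) -> psd (em (val a)).
Proof. by move=> /positiveP[x ->]; apply/positiveP; exists (val x). Qed.

Lemma ideal_fixed (a b : C) : ideal_generated b a -> ideal_generated (val b) (val a).
Proof.
move=> h I [cI /(_ _ erefl) Ib].
apply: (ig_min (I := [set x : C | I (val x)]) _ Ib h); split.
- apply: nm_closed => x hx; apply: (ci_lim cI) => e /hx[y Iy xy].
  by exists (val y).
- by case: cI.
- by move=> k x y Ix Iy; have [_ _ H _] := cI; exact: H.
- move=> c x Ix; split; first exact: (ciMl (val c) cI Ix).
  exact: (ciMr (val c) cI Ix).
Qed.

Lemma fixed_comparison : ideal_comparison C.
Proof.
move=> a b /psd_fixed ha /psd_fixed hb /ideal_fixed hab e e0.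
have e20 : 0 < e / 2 by lra.
have [x hx] := pi_comparison piA ha hb hab e20.
have [y [yf hy]] := transfer sA cG hG scG rA (fun=> x) (z := fun _ _ : unit => val a)
  (fixed_val b) (fun _ _ => fixed_val a) e20.
have [u uy] := fixed_lift (yf tt); exists u.
have := hy tt tt; rewrite -uy => h.
by apply: le_trans h _; lra.
Qed.

Lemma fixed_absorbs (a : C) : psd (em a) -> absorbs a a.
Proof.
move=> /psd_fixed ha e e0; have e20 : 0 < e / 2 by lra.
have [y [z [h1 h2 h3]]] := properly_infinite piA ha e20.
pose Z (i j : bool) : A := if i == j then val a else 0.
have Zf i j g : alpha g (Z i j) = Z i j.
  by rewrite /Z; case: ifP => _; rewrite ?act0 ?fixed_val.
have [w [wf hw]] := transfer sA cG hG scG rA (fun i : bool => if i then y else z)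
  (fixed_val a) Zf e20.
have [u uy] := fixed_lift (wf true); have [v vz] := fixed_lift (wf false).
exists u, v; split.
- by have := hw true true; rewrite -uy => h; apply: le_trans h _; rewrite /Z /=; lra.
- by have := hw false false; rewrite -vz => h; apply: le_trans h _; rewrite /Z /=; lra.
- have := hw true false; rewrite -uy -vz /Z /= subr0 => h; apply: le_trans h _.
  by rewrite subr0; lra.
Qed.

(** Normalize to [chi a = 1]. Then [|chi y|^2] and [|chi z|^2] are near 1, while [|chi y| |chi z|]
    is near 0. *)
Lemma absorbs_no_character (E : cstarAlgType R) :
  (forall a : E, psd (em a) -> absorbs a a) -> ~ (exists chi, @character R E chi).
Proof.
move=> H [chi [hchi /(_ 1)[x x1]]]; have [cD cZ cM cV] := star_hom_scalars hchi.
have small y : nm (chi y) <= nm y by exact: scalar_nm.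
have cB y z : chi (y - z) = chi y - chi z by rewrite -scaleN1r cD cZ mulN1r.
have [a a1 ha] : exists2 a, chi a = 1 & psd (em a).
  exists (star x ** x); last exact: psd_em_sq.
  by rewrite cM cV x1 conjC1 mulr1.
have e0 : 0 < 1 / 4 :> R by lra.
have [y [z [h1 h2 h3]]] := H a ha _ e0.
have := le_trans (small _) h1; have := le_trans (small _) h2.
have := le_trans (small _) h3.
rewrite !cB !cM !cV a1 !mulr1 nmMC nm_conj => k3 k2 k1.
have half w : nm ((chi w)^* * chi w - 1) <= 1 / 4 -> 3 / 4 <= nm (chi w) ^+ 2.
  move=> k; have := half_norm_nm (1 : R[i]^o) ((chi w)^* * chi w).
  by rewrite nm1 nmBC nmMC nm_conj -expr2; lra.
have := half _ k1; have := half _ k2; move: k3.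
have := nm_ge0 (chi y); have := nm_ge0 (chi z).
set p := nm _; set q := nm _; clear => p0 q0 h3 hp hq.
have h : 3 / 4 * (3 / 4) <= p ^+ 2 * q ^+ 2 by apply: ler_pM; lra.
have h' : (q * p) * (q * p) <= 1 / 4 * (1 / 4) by apply: ler_pM; rewrite ?mulr_ge0.
nra.
Qed.

Theorem fixed_purely_infinite : purely_infinite C.
Proof.
apply: comparison_pi; first exact: fixed_comparison.
exact: absorbs_no_character fixed_absorbs.
Qed.

End FixedPointAlgebra.

(** * Density in C(G, A) *)

Section Density.
Variables (R : realType) (G : topGroupType) (A : cstarAlgType R).
Variable alpha : cstarAction G A.
Hypothesis sA : sigma_unital A.
Hypothesis cG : compact [set: G].
Hypothesis hG : hausdorff_space G.
Hypothesis scG : @second_countable G.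
Hypothesis rA : rokhlin alpha.

Definition unif_near (F : G -> nat -> A) : Prop := forall g (e : R), 0 < e ->
  \forall h \near g, forall n, nm (F h n - F g n) <= e.

Lemma unif_nearD F H : unif_near F -> unif_near H ->
  unif_near (fun g n => F g n + H g n).
Proof.
move=> hF hH g e e0; have e20 : 0 < e / 2 by lra.
near=> h => n; have -> : F h n + H h n - (F g n + H g n) =
  (F h n - F g n) + (H h n - H g n) by lin.
apply: le_trans (nmD _ _) _; rewrite (splitr e); apply: lerD.
  by move: n; near: h; exact: hF.
by move: n; near: h; exact: hH.
Unshelve. all: by end_near. Qed.

Lemma unif_near_sum (I : Type) (s : seq I) (F : I -> G -> nat -> A) :
  (forall i, unif_near (F i)) -> unif_near (fun g n => \sum_(i <- s) F i g n).
Proof.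
move=> H; elim: s => [|i s IH] g e e0.
  by apply: filterE => h n; rewrite !big_nil subr0 nm0 ltW.
by apply: filterS (unif_nearD (H i) IH g e0) => h hh n; rewrite !big_cons; exact: hh.
Qed.

Lemma unif_nearM y F : bddseq y -> unif_near F -> unif_near (fun g n => y n ** F g n).
Proof.
move=> [M yM] hF g e e0.
have M0 : 0 <= M by apply: le_trans (yM 0%N); exact: nm_ge0.
have [d d0 dM] := small_mul M0 e0.
apply: filterS (hF g d d0) => h hh n.
rewrite -smulBr.
apply: le_trans (nmM _ _) _; apply: le_trans dM; rewrite mulrC.
by apply: ler_pM; rewrite ?nm_ge0.
Qed.

(** Conjugation is continuous and fixes 1, so compactness controls all conjugates of [w] at once. *)
Lemma conj_near (V : set G) : nbhs (1%g : G) V ->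
  \forall w \near (1%g : G), forall p, V (p * w * p^-1)%g.
Proof.
move=> V1; apply: (near_one_all cG) => p.
have cf : {for (p, 1%g), continuous (fun q : G * G => (q.1 * q.2 * q.1^-1)%g)}.
  apply: (@continuous_comp _ _ _ (fun q : G * G => ((q.1 * q.2)%g, (q.1^-1)%g))
    (fun q : G * G => (q.1 * q.2)%g)); last exact: mulg_continuous.
  apply: cvg_pair; first exact: mulg_continuous.
  apply: (@continuous_comp _ _ _ (@fst G G) (fun q => q^-1)%g).
    exact: cvg_fst.
  exact: invg_continuous.
by have := cf V; rewrite /= mulg1 mulgV => /(_ V1).
Qed.

(** Write [p w q = (p w p^-1) (p q)]: the conjugates of [w] stay near 1 uniformly in [p], and [f] is
    uniformly continuous under left translation. *)
Lemma translation_near (f : G -> A) (e : R) : continuous f -> 0 < e ->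
  \forall w \near (1%g : G), forall p q,
    nm (f (p * w * q)%g - f (p * q)%g) <= e /\ nm (f (p * w^-1 * q)%g - f (p * q)%g) <= e.
Proof.
move=> cf e0.
have V1 : \forall v \near (1%g : G), forall r, nm (f (v * r)%g - f r) <= e.
  apply: (near_one_all cG) => r; have e20 : 0 < e / 2 by lra.
  have c2 : {for (r, 1%g), continuous (fun q : G * G => f (q.2 * q.1)%g)}.
    apply: (@continuous_comp _ _ _ (fun q : G * G => (q.2 * q.1)%g) f); last exact: cf.
    apply: (@continuous_comp _ _ _ (fun q : G * G => (q.2, q.1))
      (fun q : G * G => (q.1 * q.2)%g)); last exact: mulg_continuous.
    by apply: cvg_pair; [exact: cvg_snd|exact: cvg_fst].
  have c1 : {for (r, 1%g), continuous (fun q : G * G => f q.1)}.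
    by apply: (@continuous_comp _ _ _ (@fst G G) f); [exact: cvg_fst|exact: cf].
  apply: (@filterS _ (nbhs (r, 1%g)) _ _ _ _ (filterI (near_nm c2 e20) (near_nm c1 e20))).
  move=> [h v] /= [h1 h2]; rewrite mul1g in h1.
  by apply: le_trans (nm_tri (f r) _ _) _; rewrite (nmBC (f r)); lra.
have W1 : \forall w \near (1%g : G), forall p q, nm (f (p * w * q)%g - f (p * q)%g) <= e.
  apply: filterS (conj_near V1) => w hw p q.
  by have := hw p (p * q)%g; rewrite !mulgA mulgVK.
have iW : \forall w \near (1%g : G), forall p q, nm (f (p * w^-1 * q)%g - f (p * q)%g) <= e.
  have ci : {for (1%g : G), continuous (fun g : G => (g^-1)%g)} by exact: invg_continuous.
  have h : nbhs (1^-1)%g [set w | forall p q, nm (f (p * w * q)%g - f (p * q)%g) <= e].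
    by rewrite invg1.
  exact: (ci _ h).
near=> w => p q; split; first by move: p q; near: w.
by move: p q; near: w.
Unshelve. all: by end_near. Qed.

Lemma dense_values (f : G -> A) : continuous f -> exists o : nat -> A,
  forall D : cstarSub A, (forall i, star_sub D (o i)) -> forall g, star_sub D (f g).
Proof.
move=> cf; have [t ht] := dense_sequence scG.
exists (fun n => f (t n)) => D Dt g; apply: (closed_nm (@cstar_sub_closed _ _ D)) => e e0.
have [n hn] := ht _ _ (near_nm (cf g) e0); exists (f (t n)) => //.
by rewrite nmBC.
Qed.

(* Averaging [f(k_i k_j^-1)] with the weights [c(f_i) alpha_t(c(f_j))], which
   asymptotically vanish unless [t] is close to [k_i k_j^-1]. *)
Lemma translates_dense (f : G -> A) (e : R) : continuous f -> 0 < e ->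
  exists s : seq (A * A), forall g, nm (f g - \sum_(p <- s) p.1 ** alpha g p.2) <= e.
Proof.
move=> cf e0; have e40 : 0 < e / 5 by lra.
have [q hq] := dense_values cf.
have [D [c [Dinv Do sys]]] := rokhlin_sequences cG scG q sA rA.
have Dfv := hq D Do.
have [m [k [X [X1 XU]]]] := partition_of_unity R cG hG (translation_near cf e40).
pose d (p : 'I_m * 'I_m) := f (k p.1 * (k p.2)^-1)%g.
pose ab i := star (X i) ** X i.
pose F t n := \sum_p (d p ** c (ab p.1) n) ** alpha t (c (ab p.2) n) - f t.
have FN : exists N, forall n, (N <= n)%N -> forall t, nm (F t n) <= e / 5 + e / 5 + e / 5 + e / 5 + e / 5.
  apply: (uniform_eventually cG e40) => [t|t].
    have : unif_near F.
      apply: unif_nearD; last first.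
        move=> g r r0; apply: filterS (near_nm (cf g) r0) => h hh _.
        by rewrite -opprD nmN.
      apply: unif_near_sum => p; apply: unif_nearM.
        by apply: bddseqM; [exact: bddseq_cst|exact: rs_bounded sys _].
      by move=> g r r0; exact: equi_near (rs_equi sys _) r0 g.
    by move=> /(_ t _ e40).
  pose Y i := left_translate t (X i).
  have Y1 : \sum_i star (Y i) ** Y i = contG1 R G.
    rewrite -[RHS](left_translate1 R t) -X1 left_translate_sum.
    by apply: eq_bigr => i _; rewrite left_translate_abs.
  pose H p := star (X p.1 ** Y p.2) ** (X p.1 ** Y p.2).
  have M0 : 0 <= e / 5 + e / 5 by lra.
  have Dz (p : 'I_m * 'I_m) : star_sub D (d p - f t).
    by apply: star_subD; [exact: Dfv|apply: (closed_subalgN (cstar_closed_subalg D)); exact: Dfv].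
  have Mz p : X p.1 ** Y p.2 != 0 -> nm (d p - f t) <= e / 5 + e / 5.
    move=> /contG_neq0[h]; rewrite [val _ h](_ : _ = val (X p.1) h * val (Y p.2) h)//.
    rewrite mulf_eq0 negb_or => /andP[/XU h1]; rewrite /Y /= => /XU h2.
    set u := ((k p.1)^-1 * h)%g in h1; set v := ((k p.2)^-1 * (t^-1 * h))%g in h2.
    (* Overlapping supports of [X_i] and the translate of [X_j] give [t = k_i u v^-1 k_j^-1] with
       [u] and [v] near 1, so [f t] is close to [d p]. *)
    have tE : t = (k p.1 * u * (v^-1 * (k p.2)^-1))%g.
      by rewrite /u /v mulVKg !invgM !invgK mulgK mulVKg.
    rewrite nmBC {1}tE; apply: le_trans (nm_tri (f (k p.1 * v^-1 * (k p.2)^-1)%g) _ _) _.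
    have l1 := (h1 (k p.1) (v^-1 * (k p.2)^-1)%g).1.
    have l2 := (h2 (k p.1) ((k p.2)^-1)%g).2.
    by rewrite !mulgA in l1 l2 *; exact: lerD.
  have [N1 HN1] := system_norm sys (xi := fun p => X p.1 ** Y p.2) Dz
    (pair_sum_one X1 Y1) M0 Mz e40.
  have E1 : aeq (fun n => \sum_p (d p ** c (ab p.1) n) ** alpha t (c (ab p.2) n))
      (fun n => \sum_p c (H p) n ** d p).
    apply: aeq_sum => p; have Dd : star_sub D (d p) by exact: Dfv.
    have b1 := rs_bounded sys (ab p.1); have b2 := rs_bounded sys (ab p.2).
    have b3 : bddseq (fun n => alpha t (c (ab p.2) n)).
      by have [M hM] := b2; exists M => n; rewrite act_nm.
    apply: aeq_trans (aeqMr b3 (aeq_sym (sys_comm sys (ab p.1) Dd))) _.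
    have com : aeq (fun n => d p ** alpha t (c (ab p.2) n)) (fun n => alpha t (c (ab p.2) n) ** d p).
      apply: aeq_sym.
      have h := sys_comm sys (ab p.2) (Dinv t^-1%g (d p) Dd); rewrite /aeq in h *.
      apply: (tend0_le (K := 1) h) => n.
      by rewrite mul1r -[leRHS](act_nm alpha t) actB !act_smul -actM mulgV act1.
    apply: aeq_trans (aeq_eql _ (aeqMl b1 com)) _ => [n|]; first by rewrite smulA.
    apply: aeq_trans (aeqMl b1 (aeq_sym (sys_act sys t (ab p.2) Dd))) _.
    apply: aeq_trans (aeq_sym (sys_mul sys _ _ Dd)) _.
    by rewrite /H contG_absM left_translate_abs; exact: aeq_refl.
  have E2 : aeq (fun=> f t) (fun n => \sum_p c (H p) n ** f t).
    apply: aeq_trans (aeq_sym (sys_one sys (Dfv t))) _.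
    by have := sys_sum sys (index_enum _) H (Dfv t); rewrite (pair_sum_one X1 Y1).
  have E : aeq (F t) (fun n => \sum_p c (H p) n ** (d p - f t)).
    apply: aeq_eqr (aeqB E1 E2) => n; rewrite -sumrB.
    by apply: eq_bigr => p _; rewrite -smulBr.
  have [N2 HN2] := aeq_eventually E e40.
  exists (maxn N1 N2) => n; rewrite geq_max => /andP[/HN1 h1 /HN2 h2].
  by apply: le_trans h2 _; move: h1; rewrite /H; lra.
have [N /(_ N (leqnn _)) HN] := FN.
exists [seq (d p ** c (ab p.1) N, c (ab p.2) N) | p <- enum {: 'I_m * 'I_m}] => g.
rewrite big_map big_enum /= nmBC; apply: le_trans (HN g) _; lra.
Qed.

End Density.

(** * Functionals and Haar integrals *)

(* Koenig's argument: a minimal sublinear functional is linear. *)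
Section HahnBanach.
Variables (R : realType) (V : normedModType R[i]).
Implicit Types (x y : V) (p q : V -> R) (t : R).
Local Notation "t *' x" := (t%:C%C *: x) (at level 40).

Definition sublinear p : Prop := [/\ forall x y, p (x + y) <= p x + p y,
  forall t x, 0 <= t -> p (t *' x) <= t * p x & forall x, p x <= nm x].

Lemma sublinear0 p : sublinear p -> p 0 = 0.
Proof.
move=> [pD pZ _]; apply/eqP; rewrite eq_le.
have := pZ 0 0 (lexx 0); rewrite scaler0 mul0r => -> /=.
by have := pD 0 0; rewrite addr0; lra.
Qed.

Lemma sublinearZ p t x : sublinear p -> 0 <= t -> p (t *' x) = t * p x.
Proof.
move=> sp t0; have [_ pZ _] := sp; have [->|tn] := eqVneq t 0.
  by rewrite scale0r mul0r (sublinear0 sp).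
have tp : 0 < t by rewrite lt_def tn.
apply/eqP; rewrite eq_le pZ//= -ler_pdivlMl//.
have := pZ t^-1 (t *' x); rewrite scalerA -rmorphM mulVf// scale1r; apply.
by rewrite invr_ge0.
Qed.

Lemma sublinear_lb p x : sublinear p -> - nm x <= p x.
Proof.
move=> sp; have [pD pZ pn] := sp; have := pD x (- x); rewrite subrr (sublinear0 sp).
by have := pn (- x); rewrite nmN; lra.
Qed.

(** Lowers [p] as far as sublinearity allows while enforcing [shrink p y x + p y <= p (x + y)]. A
    minimal [p] coincides with [shrink p y] for every [y], hence is superadditive as well. *)
Definition shrink p y x : R := inf [set r | exists2 t, 0 <= t & r = p (x + t *' y) - t * p y].

Lemma shrink_le p y x t : sublinear p -> 0 <= t -> shrink p y x <= p (x + t *' y) - t * p y.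
Proof.
move=> sp t0; have [pD pZ pn] := sp; apply: ge_inf; last by exists t.
exists (- nm x) => r [s s0 ->]; have := pD (x + s *' y) (- x).
by rewrite addrAC subrr add0r sublinearZ//; have := pn (- x); rewrite nmN; lra.
Qed.

Lemma shrink_ge p y x r : (forall t, 0 <= t -> r <= p (x + t *' y) - t * p y) ->
  r <= shrink p y x.
Proof.
move=> H; apply: lb_le_inf; first by eexists; exists 0.
by move=> _ [t t0 ->]; exact: H.
Qed.

Lemma shrink_sublinear p y : sublinear p -> sublinear (shrink p y).
Proof.
move=> sp; have [pD pZ pn] := sp; split=> [x x'|t x t0|x].
- rewrite -lerBlDr; apply: shrink_ge => t t0.
  rewrite lerBlDr -lerBlDl; apply: shrink_ge => t' t'0; rewrite lerBlDl.
  apply: le_trans (shrink_le y _ sp (addr_ge0 t0 t'0)) _.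
  have -> : x + x' + (t + t') *' y = (x + t *' y) + (x' + t' *' y).
    by rewrite rmorphD scalerDl; lin.
  have := pD (x + t *' y) (x' + t' *' y); lra.
- have [->|tn] := eqVneq t 0.
    rewrite scale0r mul0r; apply: le_trans (shrink_le y 0 sp (lexx 0)) _.
    by rewrite scale0r addr0 (sublinear0 sp); lra.
  have tp : 0 < t by rewrite lt_def tn.
  rewrite -ler_pdivrMl//; apply: shrink_ge => s s0; rewrite ler_pdivrMl//.
  apply: le_trans (shrink_le y _ sp (mulr_ge0 t0 s0)) _.
  have -> : t *' x + (t * s) *' y = t *' (x + s *' y).
    by rewrite rmorphM scalerDr scalerA.
  have := pZ t (x + s *' y) t0; lra.
- apply: le_trans (shrink_le y x sp (lexx 0)) _.
  by rewrite scale0r addr0 mul0r subr0.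
Qed.

Lemma minimal_sublinear p : sublinear p -> exists q, [/\ sublinear q,
  forall x, q x <= p x & forall r, sublinear r -> (forall x, r x <= q x) -> r = q].
Proof.
move=> sp; pose T := {q : V -> R | sublinear q /\ forall x, q x <= p x}.
pose le_ (a b : T) := `[< forall x, sval b x <= sval a x >].
have svalI (a b : T) : sval a = sval b -> a = b.
  by case: a b => a ha [b hb] /= ab; subst b; congr exist; exact: Prop_irrelevance.
have p0 : T by exists p.
have [|||A tA|[q [sq qp]] qmin] := @Zorn T le_.
- by move=> a; apply/asboolP.
- move=> a b c /asboolP ab /asboolP bc; apply/asboolP => x.
  exact: le_trans (bc x) (ab x).
- by move=> a b /asboolP ab /asboolP ba; apply/svalI/funext => x; apply/eqP; rewrite eq_le ab ba.
- have [[a0 Aa0]|A0] := pselect (exists a, A a); last first.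
    by exists p0 => a Aa; case: A0; exists a.
  pose m x := inf [set r | exists2 a, A a & r = sval a x].
  have mle a x : A a -> m x <= sval a x.
    move=> Aa; apply: ge_inf; last by exists a.
    exists (- nm x) => _ [b _ ->]; apply: sublinear_lb; exact: (svalP b).1.
  have mge x r : (forall a, A a -> r <= sval a x) -> r <= m x.
    move=> H; apply: lb_le_inf; first by eexists; exists a0.
    by move=> _ [a Aa ->]; exact: H.
  have sm : sublinear m.
    split=> [x y|t x t0|x].
    + rewrite -lerBlDr; apply: (mge _ _) => a Aa; rewrite lerBlDr -lerBlDl; apply: (mge _ _) => b Ab.
      rewrite lerBlDl; have [aD _ _] := (svalP a).1; have [bD _ _] := (svalP b).1.
      have [/asboolP ab|/asboolP ba] := tA a b Aa Ab.
        apply: le_trans (mle b _ Ab) _; apply: le_trans (bD x y) _.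
        by rewrite lerD2r; exact: ab.
      apply: le_trans (mle a _ Aa) _; apply: le_trans (aD x y) _.
      by rewrite lerD2l; exact: ba.
    + have [->|tn] := eqVneq t 0.
        rewrite scale0r mul0r; apply: le_trans (mle a0 _ Aa0) _.
        by rewrite (sublinear0 (svalP a0).1).
      have tp : 0 < t by rewrite lt_def tn.
      rewrite -ler_pdivrMl//; apply: (mge _ _) => a Aa; rewrite ler_pdivrMl//.
      by apply: le_trans (mle a _ Aa) _; have [_ h _] := (svalP a).1; exact: h.
    + by apply: le_trans (mle a0 _ Aa0) _; have [_ _ h] := (svalP a0).1; exact: h.
  have mp x : m x <= p x by apply: le_trans (mle a0 _ Aa0) ((svalP a0).2 x).
  by exists (exist _ m (conj sm mp)) => a Aa; apply/asboolP => x; exact: mle.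
exists q; split=> // r sr rq.
have rp x : r x <= p x by apply: le_trans (rq x) (qp x).
by have := qmin (exist _ r (conj sr rp)) (asboolT rq) => /(congr1 sval).
Qed.

Lemma minimal_additive q : sublinear q ->
  (forall r, sublinear r -> (forall x, r x <= q x) -> r = q) ->
  {morph q : x y / x + y}.
Proof.
move=> sq qmin x y; apply/eqP; rewrite eq_le; have [qD _ _] := sq.
rewrite qD /=; have E : shrink q y = q.
  apply: qmin => [|z]; first exact: shrink_sublinear.
  by apply: le_trans (shrink_le y z sq (lexx 0)) _; rewrite scale0r addr0 mul0r subr0.
have := shrink_le y x sq (ler01); rewrite E scale1r mul1r; lra.
Qed.

(** The descent to a minimal functional begins at [shrink nm v], which forces the value at [- v]
    below [- |v|] and keeps the functional nonzero at [v]. *)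
Lemma real_functional v : v != 0 -> exists f : V -> R,
  [/\ {morph f : x y / x + y}, forall t x, f (t *' x) = t * f x,
      forall x, `|f x| <= nm x & f v != 0].
Proof.
move=> v0; have sn : sublinear (@nm R V).
  split=> [x y|t x t0|x //]; first exact: nmD.
  by rewrite nmZr ger0_norm.
have [q [sq qn qmin]] := minimal_sublinear (shrink_sublinear v sn).
have qD := minimal_additive sq qmin; have [_ qZ qle] := sq.
have q0 := sublinear0 sq.
have qN x : q (- x) = - q x by have := qD x (- x); rewrite subrr q0; lra.
have qZp t x : 0 <= t -> q (t *' x) = t * q x.
  move=> t0; apply/eqP; rewrite eq_le qZ//=.
  by have := qZ t (- x) t0; rewrite scalerN !qN; lra.
exists q; split=> // [t x|x|].
- have [t0|/ltW t0] := leP 0 t; first exact: qZp.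
  have := qZp (- t) x; rewrite oppr_ge0 => /(_ t0).
  by rewrite rmorphN scaleNr qN; lra.
- by rewrite ler_norml qle andbT sublinear_lb.
- have := qn (- v); have := shrink_le v (- v) sn ler01.
  rewrite scale1r addNr nm0 mul1r qN => h1 h2.
  have : 0 < nm v by rewrite lt_def nm_ge0 andbT; apply: contraNneq v0 => /nm_eq0 ->.
  by move=> h3; apply/eqP => q1; lra.
Qed.

Lemma separating_functional x : (forall phi : V -> R[i]^o, linear phi ->
  continuous phi -> phi x = 0) -> x = 0.
Proof.
move=> H; apply: contrapT => /eqP x0; have [f [fD fZ fn fx]] := real_functional x0.
(* The standard complexification [f(y) - i f(i y)] of a real functional. *)
pose j : R[i] := Complex 0 1; pose phi y : R[i]^o := Complex (f y) (- f (j *: y)).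
have cZ (k : R[i]) y : f (k *: y) = complex.Re k * f y + complex.Im k * f (j *: y).
  have -> : k *: y = complex.Re k *' y + complex.Im k *' (j *: y).
    rewrite scalerA -scalerDl; congr (_ *: _); case: k => a b.
    by apply/eqP; rewrite eq_complex /= !(mul0r, mulr0, mulr1, subr0, add0r, addr0) !eqxx.
  by rewrite fD !fZ.
have jk (a b : R) y : j *: (Complex a b *: y) = Complex (- b) a *: y.
  rewrite scalerA; congr (_ *: _); apply/eqP; rewrite eq_complex /=.
  by rewrite !(mul0r, mul1r, sub0r, add0r) !eqxx.
have lphi : linear phi.
  move=> [a b] y z; apply/eqP; rewrite /phi eq_complex scalerDr jk !fD (cZ (Complex a b)) (cZ (Complex (- b) a)) /=.
  by apply/andP; split; apply/eqP; ring.
have cphi : continuous phi.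
  move=> y; apply: nm_continuous => e e0; have e20 : 0 < e / 2 by lra.
  have := near_nm (fun A h => h : nbhs y A) e20; apply: filterS => h hh.
  have -> : phi h - phi y = phi (h - y).
    by have := lphi (- 1) y h; rewrite !scaleN1r (addrC h) => ->; rewrite addrC.
  apply: le_trans (nm_le_ReIm _) _; rewrite /= normrN (splitr e); apply: lerD.
    exact: le_trans (fn _) hh.
  apply: le_trans (fn _) _; rewrite nmZ.
  have -> : nm (j : R[i]^o) = 1.
    by rewrite /nm normc_def /= expr0n expr1n add0r sqrtr1.
  by rewrite mul1r.
by have := H phi lphi cphi => -[] /eqP; rewrite (negPf fx).
Qed.

End HahnBanach.

(** * Scalar and weak integrals over the group *)

Section HaarIntegrals.
Variables (R : realType) (G : topGroupType) (mu : probability (borel G) R).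
Hypothesis cG : compact [set: G].
Implicit Types h : G -> R.

Lemma continuous_borel h : continuous h -> measurable_fun [set: borel G] (h : borel G -> R).
Proof.
move=> /continuousP ch; apply: (measurability _ (RGenOpens.measurableE R)).
move=> _ [_ [a [b ->] <-]]; rewrite setTI; apply: sub_sigma_algebra.
exact/ch/interval_open.
Qed.

Lemma continuous_integrable h : continuous h ->
  mu.-integrable [set: borel G] (EFin \o (h : borel G -> R)).
Proof.
move=> ch; apply: measurable_bounded_integrable => //.
- by apply: le_lt_trans (probability_le1 mu measurableT) _; rewrite ltry.
- exact: continuous_borel.
- have /compact_bounded[M [Mr HM]] : compact (h @` [set: G]).
    by apply: continuous_compact => //; exact: continuous_subspaceT.
  by exists M; split=> // x Mx y _; apply: HM => //; exists y.
Qed.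

Lemma Rintegral_prob_cst (r : R) : \int[mu]_x r = r.
Proof.
rewrite Rintegral_cst //=; set m := mu _; have -> : m = 1%E.
  exact: (@probability_setT _ _ _ mu).
by rewrite mulr1.
Qed.

Lemma Rintegral_bound h (K : R) : continuous h -> (forall g, h g <= K) ->
  \int[mu]_x h x <= K.
Proof.
move=> ch hK; rewrite -[leRHS]Rintegral_prob_cst; apply: le_Rintegral => //.
- exact: continuous_integrable.
- by apply: continuous_integrable => x; exact: cvg_cst.
Qed.

Lemma Rintegral_translate h (g : G) : left_haar mu -> continuous h ->
  \int[mu]_x h (g * x)%g = \int[mu]_x h x.
Proof.
move=> inv ch; pose phi : borel G -> borel G := fun x => (g * x)%g.
have mphi : measurable_fun [set: borel G] phi.
  apply: (measurability _ (erefl : @measurable _ (borel G) = <<s @open G >>)).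
  move=> _ [U oU <-]; rewrite setTI; apply: sub_sigma_algebra.
  by have /continuousP := @mulgl_continuous G g; exact.
have cg : continuous (fun x : G => h (g * x)%g).
  by move=> x; apply: (@continuous_comp _ _ _ (fun x : G => (g * x)%g) h);
    [exact: mulgl_continuous|exact: ch].
have mh : measurable_fun [set: borel G] (fun x : borel G => (h x)%:E).
  by apply/measurable_EFinP; exact: continuous_borel.
have ih : mu.-integrable (phi @^-1` [set: borel G])
    ((fun x : borel G => (h x)%:E) \o phi).
  by rewrite preimage_setT; exact: continuous_integrable cg.
have E := integral_pushforward mphi mh ih measurableT.
rewrite preimage_setT in E; rewrite /Rintegral; congr fine.
rewrite -[LHS]E; apply: eq_measure_integral => B mB _; exact: inv.
Qed.

Lemma Re_continuous (f : G -> R[i]^o) : continuous f ->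
  continuous (fun g => complex.Re (f g)).
Proof.
move=> cf g; apply/cvgrPdist_le => e e0; have := near_nm (cf g) e0.
apply: filterS => h hh; rewrite distrC; apply: le_trans hh.
by rewrite -raddfB; exact: Re_le_nm.
Qed.

Lemma Im_continuous (f : G -> R[i]^o) : continuous f ->
  continuous (fun g => complex.Im (f g)).
Proof.
move=> cf g; apply/cvgrPdist_le => e e0; have := near_nm (cf g) e0.
apply: filterS => h hh; rewrite distrC; apply: le_trans hh.
by rewrite -raddfB; exact: Im_le_nm.
Qed.

Lemma cintegral_translate (f : G -> R[i]) (g : G) : left_haar mu ->
  continuous (f : G -> R[i]^o) -> cintegral mu (fun x => f (g * x)%g) = cintegral mu f.
Proof.
move=> inv cf; rewrite /cintegral; congr Complex.
  exact: (Rintegral_translate g inv (Re_continuous cf)).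
exact: (Rintegral_translate g inv (Im_continuous cf)).
Qed.

Lemma vintegral_cst (V : completeNormedModType R[i]) (v : V) : vintegral mu (fun=> v) = v.
Proof.
rewrite /vintegral; case: xgetP => [w _ H|/(_ v)[]]; last first.
  move=> phi _ _; rewrite /cintegral !Rintegral_prob_cst; by case: (phi v).
apply/eqP; rewrite -subr_eq0; apply/eqP; apply: separating_functional => phi lphi cphi.
have := lphi (- 1) v w; rewrite !scaleN1r (addrC _ w) => ->.
rewrite (H phi lphi cphi) /cintegral !Rintegral_prob_cst.
by case: (phi v) => a b; rewrite addNr.
Qed.

Variables (A : cstarAlgType R) (alpha : cstarAction G A).

(** If the weak integral exists, functionals separate points and [phi \o alpha g] is again a
    functional, so left invariance of [mu] applies. Otherwise the value is the default 0, which is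
    fixed too. *)
Lemma vintegral_fixed (w : A) : left_haar mu ->
  forall g, alpha g (vintegral mu (fun r => alpha r w)) = vintegral mu (fun r => alpha r w).
Proof.
move=> inv g; rewrite /vintegral; case: xgetP => [v _ H|_]; last exact: act0.
apply/eqP; rewrite -subr_eq0; apply/eqP; apply: separating_functional => phi lphi cphi.
have := lphi (- 1) v (alpha g v); rewrite !scaleN1r (addrC _ (alpha g v)) => ->.
have lg : linear (phi \o alpha g : A -> R[i]^o).
  by move=> k x y; rewrite /= actD actZ lphi.
have cg : continuous (phi \o alpha g : A -> R[i]^o).
  move=> x; apply: (@continuous_comp _ _ _ (alpha g) phi); last exact: cphi.
  apply: nm_continuous => e e0; have := near_nm (fun B k => k : nbhs x B) e0.
  by apply: filterS => y; rewrite act_nmB.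
have E1 := H _ lg cg; rewrite /= in E1; rewrite E1 (H phi lphi cphi).
have -> : cintegral mu (fun r => phi (alpha g (alpha r w))) =
    cintegral mu (fun r => phi (alpha (g * r)%g w)).
  by congr (cintegral mu); apply/funext => r; rewrite actM.
rewrite (cintegral_translate (f := fun r => phi (alpha r w))) ?addNr// => r.
apply: (@continuous_comp _ _ _ (alpha^~ w) phi); last exact: cphi.
exact: act_continuous.
Qed.

End HaarIntegrals.

(** * Hilbert spaces *)

Section HilbertSpaces.
Variables (R : realType) (H : hilbertType R).
Implicit Types x y z : H.

Lemma dotD x y z : dot (x + y) z = dot x z + dot y z.
Proof. by have := dot_linear 1 x y z; rewrite scale1r mul1r. Qed.

Lemma dot0 z : dot (0 : H) z = 0.
Proof. by apply: (addIr (dot (0 : H) z)); rewrite -dotD !add0r. Qed.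

Lemma dotZ (k : R[i]) x z : dot (k *: x) z = k * dot x z.
Proof. by have := dot_linear k x 0 z; rewrite !addr0 dot0 addr0. Qed.

Lemma dotDr x y z : dot x (y + z) = dot x y + dot x z.
Proof. by rewrite (dot_conj (y + z)) dotD rmorphD (dot_conj y x) (dot_conj z x). Qed.

Lemma dotN x z : dot (- x) z = - dot x z.
Proof. by rewrite -scaleN1r dotZ mulN1r. Qed.

Lemma dotNr x z : dot x (- z) = - dot x z.
Proof. by rewrite (dot_conj (- z)) dotN rmorphN (dot_conj z x). Qed.

Lemma Re_dot_norm x : complex.Re (dot x x) = nm x ^+ 2.
Proof. by rewrite dot_norm nmE -rmorphXn. Qed.

(** The norm already satisfies the triangle inequality, so Cauchy-Schwarz results from expanding
    [|x + y|^2 <= (|x| + |y|)^2]. *)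
Lemma Re_dot_le x y : complex.Re (dot x y) <= nm x * nm y.
Proof.
have := nmD x y; have := nm_ge0 (x + y); have := Re_dot_norm (x + y).
rewrite dotD !dotDr !raddfD /= !Re_dot_norm (dot_conj x y).
have -> : complex.Re (dot x y)^* = complex.Re (dot x y) by case: (dot x y).
have := nm_ge0 x; have := nm_ge0 y.
move: (complex.Re _) => r; move: (nm _) (nm _) (nm _) => p q s; clear; nra.
Qed.

(** Real and imaginary parts are bounded separately; the resulting factor 2 is harmless for
    continuity. *)
Lemma dot_nm x y : nm (dot x y : R[i]^o) <= (nm x * nm y) + (nm x * nm y).
Proof.
have bd z : nm z <= nm x -> `|complex.Re (dot z y)| <= nm x * nm y.
  move=> zx; rewrite ler_norml; have h := ler_wpM2r (nm_ge0 y) zx.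
  apply/andP; split; last exact: le_trans (Re_dot_le z y) h.
  have := Re_dot_le (- z) y; rewrite nmN dotN raddfN /= => h1.
  by rewrite lerNl; exact: le_trans h1 h.
apply: le_trans (nm_le_ReIm _) _; apply: lerD; first exact: bd.
have := bd ((Complex 0 (-1)) *: x); rewrite dotZ.
have -> : complex.Re (Complex 0 (-1) * dot x y) = complex.Im (dot x y).
  by case: (dot x y) => a b /=; rewrite mul0r mulN1r sub0r opprK.
apply; rewrite nmZ.
have -> : nm (Complex 0 (-1) : R[i]^o) = 1.
  by rewrite /nm normc_def /= expr0n sqrrN expr1n add0r sqrtr1.
by rewrite mul1r.
Qed.

Lemma dot_continuous y : continuous (fun x => dot x y : R[i]^o).
Proof.
move=> x; apply: nm_continuous => e e0.
have [d d0 de] : exists2 d, 0 < d & d * (nm y + nm y) <= e.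
  by apply: small_mul => //; rewrite addr_ge0 ?nm_ge0.
have := near_nm (fun B k => k : nbhs x B) d0; apply: filterS => z hz.
rewrite -dotN -dotD; apply: le_trans (dot_nm _ _) _; rewrite -mulrDr.
by apply: le_trans de; rewrite ler_wpM2r// addr_ge0 ?nm_ge0.
Qed.

Lemma dot_linearl y : linear (fun x => dot x y : R[i]^o).
Proof. by move=> k x z; rewrite dot_linear. Qed.

End HilbertSpaces.

(** * Covariant representations and integrated forms *)

Section CovariantRepresentations.
Variables (R : realType) (G : topGroupType) (A : cstarAlgType R).
Variables (alpha : cstarAction G A) (H : hilbertType R).
Variables (pi : A -> H -> H) (U : G -> H -> H).
Hypothesis rep_ : covariant_rep alpha pi U.

Lemma cov_U_nm g x : nm (U g x) = nm x.
Proof.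
apply/eqP; rewrite -(eqrXn2 (n := 2)) ?nm_ge0// -!Re_dot_norm.
by rewrite (cov_U_unitary rep_).
Qed.

Lemma cov_piB a b x : pi (a - b) x = pi a x - pi b x.
Proof.
by have := cov_piD rep_ (- 1) b a x; rewrite !scaleN1r (addrC _ a) (addrC _ (pi a x)).
Qed.

Lemma cov_piDr a b x : pi (a + b) x = pi a x + pi b x.
Proof. by have := cov_piD rep_ 1 a b x; rewrite !scale1r. Qed.

Lemma cov_pi_Br a x y : pi a (x - y) = pi a x - pi a y.
Proof.
by have := cov_pi_linear rep_ a (- 1) y x; rewrite !scaleN1r (addrC _ x) (addrC _ (pi a x)).
Qed.

(* If [h^2 = a^* a < 1] and [h^2 = 2 k - k^2] then
   [|x|^2 - |pi(a) x|^2 = |x - pi(k) x|^2]. *)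
Lemma cov_pi_unit a x : nm a < 1 -> nm (pi a x) <= nm x.
Proof.
move=> a1; have [h [hs h2 _ _]] := pos_sqrt (psd_em_sq a).
have h1 : `|h| < 1.
  have := nm_cstar h; rewrite hs h2 nm_cstar => E.
  rewrite -(rmorph1 (@real_complex R)) -nmlt; have := nm_ge0 h; have := nm_ge0 a.
  by move=> *; nra.
have [k [ks _ kk]] := sqrt_fixpoint hs h1.
have E : dot (pi a x) (pi a x) = dot (pi k x) x + dot x (pi k x) - dot (pi k x) (pi k x).
  rewrite -(cov_piV rep_) -(cov_piM rep_) -h2 kk cov_piB cov_piDr dotD dotN dotD.
  have k1 := cov_piV rep_ k x x; have k2 := cov_piV rep_ k (pi k x) x.
  by rewrite ks in k1 k2; rewrite (cov_piM rep_) k2 -k1.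
have := Re_dot_norm (x - pi k x); rewrite dotD !dotDr !dotN !dotNr opprK.
have := congr1 (@complex.Re R) E; rewrite !raddfD !raddfN /= !Re_dot_norm.
move=> E1 E2; have := sqr_ge0 (nm (x - pi k x)) => h0.
apply: le_sqr_nm; rewrite ?nm_ge0//; lra.
Qed.

Lemma cov_pi_nm a x : nm (pi a x) <= nm a * nm x.
Proof.
apply/ler_addgt0Pr => e e0.
have [d d0 de] := small_mul (nm_ge0 x) e0.
have c0 : 0 < nm a + d by rewrite ltr_wpDl ?nm_ge0.
have cn : nm a + d != 0 by rewrite gt_eqF.
have := @cov_pi_unit ((nm a + d)^-1%:C%C *: a) x.
have -> : pi ((nm a + d)^-1%:C%C *: a) x = (nm a + d)^-1%:C%C *: pi a x.
  have p0 : pi 0 x = 0 by rewrite -(subrr a) cov_piB subrr.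
  by have := cov_piD rep_ (nm a + d)^-1%:C%C a 0 x; rewrite p0 !addr0.
rewrite !nmZr ger0_norm ?invr_ge0 ?(ltW c0)// mulrC ltr_pdivrMr// mul1r ltrDl.
move=> /(_ d0); rewrite ler_pdivrMl// mulrDl; lra.
Qed.

Lemma integrand_continuous (f : G -> A) x : continuous f ->
  continuous (fun g => pi (f g) (U g x)).
Proof.
move=> cf g; apply: nm_continuous => e e0; have e20 : 0 < e / 2 by lra.
have [d d0 de] := small_mul (nm_ge0 x) e20.
have [t t0 te] := small_mul (nm_ge0 (f g)) e20.
near=> h.
have h1 : nm (f h - f g) <= d by near: h; exact: near_nm (cf g) d0.
have h2 : nm (U h x - U g x) <= t.
  by near: h; exact: near_nm (@cov_U_continuous _ _ _ _ _ _ _ rep_ x g) t0.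
have -> : pi (f h) (U h x) - pi (f g) (U g x) =
    pi (f h - f g) (U h x) + pi (f g) (U h x - U g x).
  by rewrite cov_piB cov_pi_Br; lin.
apply: le_trans (nmD _ _) _; rewrite (splitr e); apply: lerD.
  apply: le_trans (cov_pi_nm _ _) _; rewrite cov_U_nm; apply: le_trans de.
  by rewrite ler_wpM2r ?nm_ge0.
apply: le_trans (cov_pi_nm _ _) _; apply: le_trans te; rewrite mulrC.
by rewrite ler_wpM2r ?nm_ge0.
Unshelve. all: by end_near. Qed.

Variable mu : probability (borel G) R.
Hypothesis cG : compact [set: G].

(** Pairing the weak integral [v] with itself gives [|v|^2] as the integral of the real part of
    [dot (pi (f g) (U g x)) v], at most [M |x| |v|]. *)
Lemma integrated_bound (f : G -> A) (M : R) x : continuous f ->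
  (forall g, nm (f g) <= M) -> nm (integrated_form mu pi U f x) <= M * nm x.
Proof.
move=> cf fM; have M0 : 0 <= M by apply: le_trans (fM 1%g); exact: nm_ge0.
rewrite /integrated_form /vintegral; case: xgetP => [v _ Hv|_]; last first.
  by rewrite nm0 mulr_ge0 ?nm_ge0.
have := Hv _ (dot_linearl v) (dot_continuous (y := v)) => /(congr1 (@complex.Re R)) /=.
rewrite Re_dot_norm => E; apply: le_mul_nm; rewrite ?mulr_ge0 ?nm_ge0// E.
apply: (Rintegral_bound mu cG) => [|g].
  apply: Re_continuous => g.
  apply: (@continuous_comp _ _ _ (fun g => pi (f g) (U g x)) (fun y => dot y v : R[i]^o)).
    exact: integrand_continuous.
  exact: dot_continuous.
apply: le_trans (Re_dot_le _ _) _; rewrite ler_wpM2r ?nm_ge0//.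
apply: le_trans (cov_pi_nm _ _) _; rewrite cov_U_nm.
by rewrite ler_wpM2r ?nm_ge0.
Qed.

End CovariantRepresentations.

(** * The crossed product *)

Section CrossedProducts.
Variables (R : realType) (G : topGroupType) (A : cstarAlgType R).
Variable alpha : cstarAction G A.
Hypothesis cG : compact [set: G].
Variable mu : probability (borel G) R.
Hypothesis inv : left_haar mu.
Variables (B : cstarAlgType R) (iota : (G -> A) -> B).
Hypothesis cp : crossed_product mu alpha iota.
Implicit Types (y z c : A) (f : G -> A).

(** As [mu] has total mass 1, a uniform bound dominates all integrated forms, hence the universal
    norm; uniform approximation in [C(G, A)] thus carries over to [B]. *)
Lemma iota_nm f (M : R) : continuous f -> (forall g, nm (f g) <= M) -> nm (iota f) <= M.
Proof.
move=> cf fM; have M0 : 0 <= M by apply: le_trans (fM 1%g); exact: nm_ge0.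
rewrite nmle; apply: (cp_norm_lub cp) => //; first by rewrite lecE /= eqxx.
move=> H pi U rep_ x; rewrite nmE (nmE x) -rmorphM lecE /= eqxx /=.
exact: (integrated_bound rep_ mu cG x cf fM).
Qed.

Lemma iotaD f f' : continuous f -> continuous f' ->
  iota (fun g => f g + f' g) = iota f + iota f'.
Proof.
move=> cf cf'; have := cp_linear cp 1 cf cf'; rewrite !scale1r => <-.
by congr iota; apply/funext => g; rewrite /= -[in LHS](scale1r (f g)).
Qed.

Lemma iota0 : iota (fun=> 0) = 0.
Proof.
have c0 : continuous (fun _ : G => 0 : A) by move=> g; exact: cvg_cst.
apply: (addIr (iota (fun=> 0))); rewrite add0r -iotaD//.
by congr iota; apply/funext => g; rewrite addr0.
Qed.

Lemma iotaB f f' : continuous f -> continuous f' ->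
  iota (fun g => f g - f' g) = iota f - iota f'.
Proof.
move=> cf cf'; have cN : continuous (fun g => - f' g) by move=> g; exact: cvgN (cf' g).
rewrite iotaD//; congr (_ + _); apply: (addIr (iota f')); rewrite addNr -iotaD//.
by rewrite -iota0; congr iota; apply/funext => g; rewrite addNr.
Qed.

Lemma iota_sum (I : Type) (s : seq I) (F : I -> G -> A) :
  (forall i, continuous (F i)) ->
  iota (fun g => \sum_(i <- s) F i g) = \sum_(i <- s) iota (F i).
Proof.
move=> cF; elim: s => [|i s IH].
  by rewrite big_nil -iota0; congr iota; apply/funext => g; rewrite big_nil.
rewrite big_cons -IH -iotaD//.
  by congr iota; apply/funext => g; rewrite big_cons.
by apply: continuous_big => //; exact: add_continuous.
Qed.

Definition ic y : B := iota (fun=> y).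

Lemma cst_continuous' y : continuous (fun _ : G => y).
Proof. by move=> g; exact: cvg_cst. Qed.

Lemma translate_continuous y z : continuous (fun g => y ** alpha g z).
Proof.
move=> g; apply: (@continuous_comp _ _ _ (alpha^~ z) (smul y)).
  exact: act_continuous.
exact: smul_continuous.
Qed.

Lemma icD y z : ic (y + z) = ic y + ic z.
Proof. by rewrite /ic -iotaD//; exact: cst_continuous'. Qed.

Lemma icB y z : ic (y - z) = ic y - ic z.
Proof. by rewrite /ic -iotaB//; exact: cst_continuous'. Qed.

Lemma ic0 : ic 0 = 0. Proof. exact: iota0. Qed.

Lemma icZ (k : R[i]) y : ic (k *: y) = k *: ic y.
Proof.
have := cp_linear cp k (@cst_continuous' y) (@cst_continuous' 0); by rewrite iota0 !addr0 => E; rewrite -[RHS]E.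
Qed.

Lemma ic_sum (I : Type) (s : seq I) (F : I -> A) :
  ic (\sum_(i <- s) F i) = \sum_(i <- s) ic (F i).
Proof. exact: (big_morph ic icD ic0). Qed.

Lemma ic_nm y : nm (ic y) <= nm y.
Proof. by apply: iota_nm => //; exact: cst_continuous'. Qed.

Lemma ic_star y : star (ic y) = iota (fun g => alpha g (star y)).
Proof. by rewrite -(cp_star cp); last exact: cst_continuous'. Qed.

(** In the convolution, [alpha r] and [alpha (r^-1 * g)] compose to [alpha g], so the integrand is
    constant in [r]. *)
Lemma ic_mulstar y z : ic y ** star (ic z) = iota (fun g => y ** alpha g (star z)).
Proof.
rewrite ic_star -(cp_conv cp).
- congr iota; apply/funext => g; rewrite /conv -[RHS](vintegral_cst mu).
  by congr (vintegral mu); apply/funext => r; rewrite -actM mulVKg.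
- exact: cst_continuous'.
- exact: act_continuous.
Qed.

(** This convolution is constant in the group variable; its value is the weak mean of the orbit of
    [star y ** z], the conditional expectation onto the fixed points. *)
Lemma ic_starmul y z : exists c, (forall g, alpha g c = c) /\ star (ic y) ** ic z = ic c.
Proof.
exists (vintegral mu (fun r => alpha r (star y ** z))); split.
  exact: (vintegral_fixed cG alpha (star y ** z) inv).
rewrite ic_star -(cp_conv cp).
- congr iota; apply/funext => g; congr (vintegral mu); apply/funext => r.
  by rewrite act_smul.
- exact: act_continuous.
- exact: cst_continuous'.
Qed.

Lemma ic_mulr y c : (forall g, alpha g c = c) -> ic (y ** c) = ic y ** ic c.
Proof.
move=> cf; rewrite -(cp_conv cp); try exact: cst_continuous'.
congr iota; apply/funext => g; rewrite /conv -[LHS](vintegral_cst mu).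
by congr (vintegral mu); apply/funext => r; rewrite cf.
Qed.

Lemma ic_fixed_star c : (forall g, alpha g c = c) -> star (ic c) = ic (star c).
Proof.
by move=> cf; rewrite ic_star; congr iota; apply/funext => g; rewrite act_star cf.
Qed.

Lemma ic_mul_fixed_star y c : (forall g, alpha g c = c) ->
  ic y ** star (ic c) = ic (y ** star c).
Proof.
move=> cf; rewrite ic_fixed_star// ic_mulr// => g.
by rewrite act_star cf.
Qed.

Hypothesis sA : sigma_unital A.
Hypothesis hG : hausdorff_space G.
Hypothesis scG : @second_countable G.
Hypothesis rA : rokhlin alpha.

Lemma ic_dense (b : B) (e : R) : 0 < e -> exists s : seq (A * A),
  nm (b - \sum_(p <- s) ic p.1 ** star (ic p.2)) <= e.
Proof.
move=> e0; have e20 : 0 < e / 2 by lra.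
have [f cf fb] : exists2 f, continuous f & nm (b - iota f) <= e / 2.
  have e2C : 0 < (e / 2)%:C%C :> R[i] by rewrite ltcE /= eqxx.
  have [|x [/interior_subset xb [f cf fx]]] :=
      cp_dense cp (O := (ball b (e / 2)%:C%C)°) _ (@open_interior _ _).
    by exists b; exact: nbhsx_ballx.
  by move: xb; rewrite -fx -ball_normE /= -nmlt => /ltW h; exists f.
have [s hs] := translates_dense sA cG hG scG rA cf e20.
exists [seq (p.1, star p.2) | p <- s]; rewrite big_map /=.
have -> : \sum_(p <- s) ic p.1 ** star (ic (star p.2)) =
    iota (fun g => \sum_(p <- s) p.1 ** alpha g p.2).
  rewrite iota_sum => [|p]; last exact: translate_continuous.
  by apply: eq_bigr => p _; rewrite ic_mulstar; congr iota; apply/funext => g; rewrite starK.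
apply: le_trans (nm_tri (iota f) _ _) _; rewrite (splitr e); apply: lerD fb _.
rewrite -iotaB//; last first.
  by apply: continuous_big => [|p _]; [exact: add_continuous|exact: translate_continuous].
apply: iota_nm => // g; apply: cvgB; first exact: cf.
have cS : continuous (fun g => \sum_(p <- s) p.1 ** alpha g p.2).
  by apply: continuous_big => [|p _]; [exact: add_continuous|exact: translate_continuous].
exact: cS.
Qed.

End CrossedProducts.

(** * Compressing the crossed product into the fixed point algebra *)

Section Compression.
Variables (R : realType) (G : topGroupType) (A : cstarAlgType R).
Variable alpha : cstarAction G A.
Hypothesis cG : compact [set: G].
Variable mu : probability (borel G) R.
Hypothesis inv : left_haar mu.
Variables (B : cstarAlgType R) (iota : (G -> A) -> B).
Hypothesis cp : crossed_product mu alpha iota.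
Hypothesis sA : sigma_unital A.
Hypothesis hG : hausdorff_space G.
Hypothesis scG : @second_countable G.
Hypothesis rA : rokhlin alpha.
Hypothesis piA : purely_infinite A.
Local Notation C := (fixed_point_algebra alpha).
Local Notation kp := (ic iota).

Lemma ic_starmul_val y z : exists c : C, star (kp y) ** kp z = kp (val c).
Proof.
have [c [cf ->]] := ic_starmul cG inv cp y z.
by have [d dc] := fixed_lift cf; exists d; rewrite dc.
Qed.

Lemma span_approx (b : B) (K e : R) : 0 <= K -> 0 < e -> exists s : seq (A * A),
  nm (b - \sum_(p <- s) kp p.1 ** star (kp p.2)) * K <= e.
Proof.
move=> K0 e0; have [d d0 de] := small_mul K0 e0.
have [s hs] := ic_dense cG cp sA hG scG rA b d0; exists s.
by apply: le_trans de; rewrite ler_wpM2r.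
Qed.

(** Up to approximation the elements [kp y] form a left ideal: [kp u ** star (kp v) ** kp y = kp (u
    ** c)] with [c] fixed, and the [kp u ** star (kp v)] span a dense subspace. *)
Lemma mul_ic_approx (q : B) y (e : R) : 0 < e -> exists w, nm (q ** kp y - kp w) <= e.
Proof.
move=> e0; have [s hs] := span_approx q (nm_ge0 (kp y)) e0.
have /boolp.choice[c hc] (p : A * A) := ic_starmul_val p.2 y.
exists (\sum_(p <- s) p.1 ** val (c p)); apply: le_trans hs.
have -> : kp (\sum_(p <- s) p.1 ** val (c p)) =
    (\sum_(p <- s) kp p.1 ** star (kp p.2)) ** kp y.
  rewrite (ic_sum cp) smul_suml; apply: eq_bigr => p _.
  by rewrite (ic_mulr cp) ?(hc p) -?smulA ?hc//; exact: fixed_val.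
by rewrite -smulBl; exact: nmM.
Qed.

Definition compresses (Q : B) : Prop := forall (r : B) (e : R), 0 < e ->
  exists c : C, nm (Q ** r ** star Q - kp (val c)) <= e.

(** On a spanning element the compression splits as [(Q kp y) (Q kp z)^*], a product of images of
    fixed points. *)
Lemma compressesP (Q : B) : (forall y, exists c : C, Q ** kp y = kp (val c)) ->
  compresses Q.
Proof.
move=> /boolp.choice[c hc] r e e0.
have K0 : 0 <= nm Q * nm Q by rewrite mulr_ge0 ?nm_ge0.
have [s hs] := span_approx r K0 e0.
exists (\sum_(p <- s) c p.1 ** star (c p.2)); apply: le_trans hs.
have -> : kp (val (\sum_(p <- s) c p.1 ** star (c p.2))) =
    Q ** (\sum_(p <- s) kp p.1 ** star (kp p.2)) ** star Q.
  rewrite (big_morph (val : C -> A) (id1 := 0) (op1 := +%R))// (ic_sum cp).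
  rewrite smul_sumr smul_suml; apply: eq_bigr => p _.
  rewrite smulA hc -smulA -starM hc (ic_mul_fixed_star cp)//; exact: fixed_val.
rewrite -smulBl -smulBr; apply: le_trans (nmM _ _) _; rewrite nm_star.
apply: le_trans (ler_wpM2r (nm_ge0 _) (nmM _ _)) _.
by rewrite (mulrC (nm Q)) mulrA.
Qed.

(* [Q = \sum_i kp(S_i) kp(w_i)^*] with [S_i^* S_j] close to [delta_ij a], for
   [a] in [C] an approximate unit for the [w_i]. *)
Lemma compression_sum n (w : nat -> A) (e : R) : 0 < e -> exists Q : B,
  compresses Q /\
  nm (star Q ** Q - \sum_(i < n) kp (w i) ** star (kp (w i))) <= e.
Proof.
move=> e0; have e20 : 0 < e / 2 by lra.
pose W := \sum_(i < n) nm (w i).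
have W0 : 0 <= W by apply: sumr_ge0 => i _; exact: nm_ge0.
have wW (i : 'I_n) : nm (kp (w i)) <= W.
  apply: le_trans (ic_nm cG cp _) _.
  by rewrite /W (bigD1 i)//= lerDl; apply: sumr_ge0 => j _; exact: nm_ge0.
have [t t0 te] : exists2 t, 0 < t & t * ((n%:R * n%:R) * (W * W)) <= e / 2.
  by apply: small_mul => //; rewrite !mulr_ge0.
have [d d0 de] : exists2 d, 0 < d & (d + d) * (n%:R * W) <= e / 2.
  have [d d0 de] : exists2 d, 0 < d & d * (n%:R * W) <= e / 4.
    by apply: small_mul; [rewrite mulr_ge0|lra].
  by exists d => //; lra.
pose s := [seq w (nat_of_ord i) | i <- enum 'I_n] ++
  [seq star (w (nat_of_ord i)) | i <- enum 'I_n].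
have [c0 [c0f c01 c0s]] := invariant_unit alpha cG s sA d0.
have [c cE] := fixed_lift c0f.
have wc (i : 'I_n) : nm (w i ** (star (val c) ** val c) - w i) <= d + d.
  have h1 : nm (w i ** val c - w i) <= d.
    rewrite cE; apply: (c0s _ _).2; rewrite mem_cat; apply/orP; left.
    by apply/mapP; exists i; rewrite ?mem_enum.
  have h2 : nm (w i ** star (val c) - w i) <= d.
    rewrite -nm_star starB starM starK cE; apply: (c0s _ _).1.
    rewrite mem_cat; apply/orP; right; by apply/mapP; exists i; rewrite ?mem_enum.
  have -> : w i ** (star (val c) ** val c) - w i =
      (w i ** star (val c) - w i) ** val c + (w i ** val c - w i).
    by rewrite smulBl smulA; lin.
  apply: le_trans (nmD _ _) _; apply: lerD h1; apply: le_trans (nmM _ _) _.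
  by apply: le_trans (ler_wpM2r (nm_ge0 _) h2) _; rewrite cE; nra.
(* Since [S_i = c u_i], the product [S_i^* S_j] is [u_i^* a u_j], which [many_copies] makes close to
   [delta_ij a]; the choice of [c] makes [w_i a] close to [w_i]. *)
pose a : C := star c ** c; have ha : psd (em a) by exact: psd_em_sq.
have [u hu] := many_copies n ha (fixed_absorbs sA cG hG scG rA piA ha) t0.
pose S i : C := c ** u i.
have Sf i g : alpha g (val (S i)) = val (S i) by exact: fixed_val.
pose Q := \sum_(i < n) kp (val (S i)) ** star (kp (w i)).
exists Q; split.
  apply: compressesP => y; have /boolp.choice[z hz] i := ic_starmul_val (w i) y.
  exists (\sum_(i < n) S i ** z i); rewrite /Q smul_suml.
  rewrite (big_morph (val : C -> A) (id1 := 0) (op1 := +%R))// (ic_sum cp).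
  by apply: eq_bigr => i _; rewrite -smulA hz -(ic_mulr cp)//; exact: fixed_val.
pose D i j : A := val (star (S i) ** S j) - (if i == j then val a else 0).
have DE (i j : 'I_n) : nm (kp (D i j)) <= t.
  apply: le_trans (ic_nm cG cp _) _.
  have -> : D i j = val (star (u i) ** a ** u j - (if nat_of_ord i == nat_of_ord j then a else 0)).
    rewrite /D /S /a /= starM !smulA; case: eqP => _ //.
  exact: (hu i j (ltn_ord i) (ltn_ord j)).
have E1 : star Q ** Q = \sum_(i < n) \sum_(j < n)
    kp (w i) ** kp (val (star (S i) ** S j)) ** star (kp (w j)).
  rewrite /Q star_sum smul_suml; apply: eq_bigr => i _; rewrite smul_sumr.
  apply: eq_bigr => j _; rewrite starM starK (ic_fixed_star cp)//.
  rewrite smulA -(smulA _ _ (kp (val (S j)))) -(ic_mulr cp)//.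
have E2 : star Q ** Q - \sum_(i < n) kp (w i) ** star (kp (w i)) =
    \sum_(i < n) \sum_(j < n) kp (w i) ** kp (D i j) ** star (kp (w j)) +
    \sum_(i < n) kp (w i ** (star (val c) ** val c) - w i) ** star (kp (w i)).
  rewrite E1 -big_split -sumrB; apply: eq_bigr => i _ /=.
  have -> : kp (w i ** (star (val c) ** val c) - w i) ** star (kp (w i)) =
      kp (w i) ** kp (val a) ** star (kp (w i)) - kp (w i) ** star (kp (w i)).
    by rewrite (icB cp) (ic_mulr cp) ?smulBl// => g; exact: fixed_val a g.
  rewrite addrA; congr (_ - _).
  have -> : kp (w i) ** kp (val a) ** star (kp (w i)) = \sum_(j < n)
      (if j == i then kp (w i) ** kp (val a) ** star (kp (w i)) else 0).
    by rewrite -big_mkcond big_pred1_eq.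
  rewrite -big_split; apply: eq_bigr => j _ /=; rewrite /D (icB cp) smulBr smulBl.
  rewrite (eq_sym j i); case: (eqVneq i j) => [<-|ij].
    by rewrite eqxx; lin.
  have -> : (nat_of_ord i == nat_of_ord j) = false by apply/negbTE.
  by rewrite (ic0 cp) smul0r smul0l subr0 addr0.
rewrite E2; apply: le_trans (nmD _ _) _; rewrite (splitr e); apply: lerD.
  apply: le_trans te; apply: le_trans (nm_sum _ _ _) _.
  have hK (i j : 'I_n) : nm (kp (w i) ** kp (D i j) ** star (kp (w j))) <= W * t * W.
    apply: le_trans (nm3 _ _ _) _; rewrite nm_star.
    by apply: ler_pM; rewrite ?mulr_ge0 ?nm_ge0//; apply: ler_pM; rewrite ?nm_ge0.
  apply: (@le_trans _ _ (\sum_(i < n) \sum_(j < n) (W * t * W))).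
    by apply: ler_sum => i _; apply: le_trans (nm_sum _ _ _) _; exact: ler_sum.
  by rewrite !sumr_const !card_ord -(mulr_natl (W * t * W)) -(mulr_natl (n%:R * _)); lra.
apply: le_trans de; apply: le_trans (nm_sum _ _ _) _.
apply: (@le_trans _ _ (\sum_(i < n) ((d + d) * W))).
  apply: ler_sum => i _; apply: le_trans (nmM _ _) _; rewrite nm_star.
  apply: ler_pM; rewrite ?nm_ge0//.
  by apply: le_trans (ic_nm cG cp _) _; exact: wc.
by rewrite sumr_const card_ord -mulr_natl; lra.
Qed.

Lemma approx_unit_nm (p u : B) : psd (em u) -> ob (1 - em u) 1 -> nm u <= 2.
Proof.
move=> hu u1; apply/ob_em; have := obB (@ob1 _ B) u1.
by rewrite opprB addrC subrK.
Qed.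

(** Approximating each [x] by sums of [kp y ** star (kp z)], it suffices to have a unit for the left
    factors [kp y]. Such a unit [u = q P q] is itself a sum of [z_i z_i^*] with [z_i = q kp(y_i)],
    and [z_i] is close to some [kp w_i] by the left ideal property; [compression_sum] then provides
    [Q^* Q] near [u]. From [|u| <= 2] and an error of at most 2 comes [|Q|^2 <= 4]. *)
Lemma left_compression (s : seq B) (e : R) : 0 < e -> exists Q : B,
  [/\ compresses Q, nm Q <= 2 & forall x, x \in s -> nm (star Q ** Q ** x - x) <= e].
Proof.
move=> e0; have t0 : 0 < e / 8 by lra.
set t := e / 8 in t0.
have /boolp.choice[L hL] (x : B) : exists l : seq (A * A),
    nm (x - \sum_(p <- l) kp p.1 ** star (kp p.2)) <= t.
  by have [l] := span_approx x ler01 t0; rewrite mulr1 => h; exists l.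
pose X x := \sum_(p <- L x) kp p.1 ** star (kp p.2).
pose ys := flatten [seq [seq p.1 | p <- L x] | x <- s].
pose P := \sum_(y <- ys) kp y ** star (kp y).
have hP : psd (em P) by apply: psd_em_sum => y; exact: psd_em_sqr.
pose M := \sum_(x <- s) \sum_(p <- L x) nm (kp p.2).
have M0 : 0 <= M by apply: sumr_ge0 => x _; apply: sumr_ge0 => p _; exact: nm_ge0.
have [t1 t10 t1M] := small_mul M0 t0.
have [q [u [qs uE [hu u1] _ hx]]] := approx_unit hP t10.
have u2 := approx_unit_nm P hu u1.
have yu y : y \in ys -> nm (kp y - u ** kp y) <= t1.
  move=> yin; apply: (hx _).2; rewrite /P (big_rem y)//= emD addrAC subrr add0r.
  by apply: psd_em_sum => z; exact: psd_em_sqr.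
have Xu x : x \in s -> nm (X x - u ** X x) <= t.
  move=> xs; apply: le_trans t1M; rewrite /X smul_sumr -sumrB.
  apply: le_trans (nm_sum _ _ _) _.
  apply: (@le_trans _ _ (\sum_(p <- L x) t1 * nm (kp p.2))).
    rewrite big_seq [leRHS]big_seq; apply: ler_sum => p pL.
    rewrite smulA -smulBl; apply: le_trans (nmM _ _) _; rewrite nm_star.
    rewrite ler_wpM2r ?nm_ge0//; apply: yu; apply/flattenP.
    by exists [seq p.1 | p <- L x]; [apply/mapP; exists x|apply/mapP; exists p].
  rewrite -mulr_sumr ler_wpM2l ?(ltW t10)// /M (big_rem x)//= lerDl.
  by apply: sumr_ge0 => y _; apply: sumr_ge0 => p _; exact: nm_ge0.
pose K := \sum_(x <- s) nm x.
have K0 : 0 <= K by apply: sumr_ge0 => x _; exact: nm_ge0.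
have xK x : x \in s -> nm x <= K.
  by move=> xs; rewrite /K (big_rem x)//= lerDl; apply: sumr_ge0 => y _; exact: nm_ge0.
have [t3 [t30 t3K t31]] : exists t3, [/\ 0 < t3, t3 * (2 * K) <= e / 2 & t3 <= 1].
  have m0 : 0 < Num.min 1 (e / 2) by rewrite lt_min ltr01; lra.
  have [t3 t30 h] : exists2 t3, 0 < t3 & t3 * (2 * K + 1) <= Num.min 1 (e / 2).
    by apply: small_mul => //; lra.
  move: h; rewrite le_min => /andP[h1 h2]; exists t3; split=> //; nra.
pose n := size ys; pose y i := nth 0 ys i; pose z i := q ** kp (y i).
pose N := \sum_(i < n) nm (z i).
have N0 : 0 <= N by apply: sumr_ge0 => i _; exact: nm_ge0.
have zN (i : 'I_n) : nm (z i) <= N.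
  by rewrite /N (bigD1 i)//= lerDl; apply: sumr_ge0 => j _; exact: nm_ge0.
have n0 : 0 <= n%:R :> R by exact: ler0n.
have [t2 [t20 t2n t21]] : exists t2, [/\ 0 < t2, t2 * (n%:R * (2 * N + 1)) <= t3 & t2 <= 1].
  have [t2 t20 h] : exists2 t2, 0 < t2 & t2 * (n%:R * (2 * N + 1) + 1) <= t3.
    by apply: small_mul => //; rewrite addr_ge0 ?mulr_ge0//; lra.
  have h' : 0 <= n%:R * (2 * N + 1) by rewrite mulr_ge0//; lra.
  by exists t2; split=> //; nra.
have /boolp.choice[w hw] i := mul_ic_approx q (y i) t20.
have uS : u = \sum_(i < n) z i ** star (z i).
  rewrite uE /P smul_sumr smul_suml (big_nth 0) big_mkord.
  by apply: eq_bigr => i _; rewrite /z starM qs !smulA.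
have wu : nm (\sum_(i < n) kp (w i) ** star (kp (w i)) - u) <= t3.
  rewrite uS -sumrB; apply: le_trans (nm_sum _ _ _) _.
  apply: (@le_trans _ _ (\sum_(i < n) t2 * (2 * N + 1))).
    apply: ler_sum => i _; have h := hw i; rewrite nmBC -/(z i) in h.
    have -> : kp (w i) ** star (kp (w i)) - z i ** star (z i) =
       (kp (w i) - z i) ** star (kp (w i)) + z i ** star (kp (w i) - z i).
      by rewrite smulBl starB smulBr; lin.
    apply: le_trans (nmD _ _) _; have := half_norm_nm (kp (w i)) (z i).
    have := nmM (kp (w i) - z i) (star (kp (w i))).
    have := nmM (z i) (star (kp (w i) - z i)); rewrite !nm_star.
    have := zN i; have := nm_ge0 (z i); have := nm_ge0 (kp (w i) - z i).
    have := nm_ge0 (kp (w i)); move: h t21 (ltW t20) N0.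
    move: (nm (kp (w i) - z i)) (nm (kp (w i))) (nm (z i)) (nm (z i ** _)) => a b c d.
    by move: (nm _) => f *; nra.
  by rewrite sumr_const card_ord -mulr_natl; lra.
have [Q [cQ hQ]] := compression_sum n w t30.
have Qu : nm (star Q ** Q - u) <= t3 + t3.
  by apply: le_trans (nm_tri _ _ _) _; exact: lerD hQ wu.
exists Q; split=> // [|x xs].
  have := half_norm_nm (star Q ** Q) u; rewrite nm_cstar; have := nm_ge0 Q.
  move: Qu u2 t31; move: (nm Q) (nm u) (nm (star Q ** Q - u)) => a b c *; nra.
have -> : star Q ** Q ** x - x = (star Q ** Q - u) ** x + u ** (x - X x) -
    (X x - u ** X x) - (x - X x).
  by rewrite smulBl smulBr; lin.
apply: le_trans (nmB _ _) _; apply: le_trans (lerD (nmB _ _) (lexx _)) _.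
apply: le_trans (lerD (lerD (nmD _ _) (lexx _)) (lexx _)) _.
have h1 := le_trans (nmM (star Q ** Q - u) x) (ler_pM (nm_ge0 _) (nm_ge0 _) Qu (xK x xs)).
have h2 := le_trans (nmM u (x - X x)) (ler_pM (nm_ge0 _) (nm_ge0 _) u2 (hL x)).
have := Xu x xs; have := hL x; rewrite -/(X x) => h3 h4.
by move: h1 h2 h3 h4 t3K; rewrite -/(X x) /t; lra.
Qed.

Lemma compression (s : seq B) (e : R) : 0 < e -> exists Q : B,
  [/\ compresses Q, nm Q <= 2 & forall x, x \in s ->
    nm (star Q ** Q ** x - x) <= e /\ nm (x ** (star Q ** Q) - x) <= e].
Proof.
move=> e0; have [Q [cQ Q2 hQ]] := left_compression (s ++ [seq star x | x <- s]) e0.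
exists Q; split=> // x xs; split; first by apply: hQ; rewrite mem_cat xs.
rewrite -nm_star starB !starM starK; apply: hQ; rewrite mem_cat map_f//.
by rewrite orbT.
Qed.

End Compression.

(** * Generated ideals and cut-downs *)

Section GeneratedIdeals.
Variables (R : realType) (A : cstarAlgType R).
Implicit Types (a b c x y : A).

Lemma ideal_generated_approx a b (e : R) : ideal_generated b a -> 0 < e ->
  exists s : seq (A * A), nm (a - \sum_(p <- s) p.1 ** b ** p.2) <= e.
Proof.
pose I := [set x : A | forall e : R, 0 < e ->
  exists s : seq (A * A), nm (x - \sum_(p <- s) p.1 ** b ** p.2) <= e].
suff cI : closed_ideal I.
  have Ib : I b.
    move=> {}e e0; have e20 : 0 < e / 2 by lra.
    have [u [_ u1 _ ub]] := seq_unit [:: b] e20; have [h1 h2] := ub b (mem_head _ _).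
    exists [:: (u, u)]; rewrite big_seq1 /=.
    have -> : b - u ** b ** u = (b - b ** u) + (b - u ** b) ** u by rewrite smulBl; lin.
    apply: le_trans (nmD _ _) _; rewrite (splitr e); apply: lerD h1 _.
    apply: le_trans (nmM _ _) _; apply: le_trans h2; by rewrite ler_piMr ?nm_ge0.
  by move=> /(ig_min cI Ib); exact.
split.
- apply: nm_closed => x H {}e e0; have e20 : 0 < e / 2 by lra.
  have [y Iy xy] := H _ e20; have [s hs] := Iy _ e20; exists s.
  by apply: le_trans (nm_tri y _ _) _; rewrite (splitr e); exact: lerD.
- by move=> {}e e0; exists [::]; rewrite big_nil subr0 nm0 ltW.
- move=> k x y Ix Iy {}e e0; have e20 : 0 < e / 2 by lra.
  have [d d0 de] := small_mul (nm_ge0 (k : R[i]^o)) e20.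
  have [s hs] := Ix _ d0; have [t ht] := Iy _ e20.
  exists ([seq (k *: p.1, p.2) | p <- s] ++ t); rewrite big_cat big_map /=.
  have -> : \sum_(p <- s) (k *: p.1) ** b ** p.2 = k *: \sum_(p <- s) p.1 ** b ** p.2.
    by rewrite scaler_sumr; apply: eq_bigr => p _; rewrite !smulZl.
  set S := \sum_(p <- s) _ in hs *; set T := \sum_(p <- t) _ in ht *.
  have -> : k *: x + y - (k *: S + T) = k *: (x - S) + (y - T) by rewrite scalerBr; lin.
  apply: le_trans (nmD _ _) _; rewrite (splitr e); apply: lerD ht.
  by rewrite nmZ mulrC; apply: le_trans de; rewrite ler_wpM2r ?nm_ge0.
- move=> a0 x Ix; split=> {}e e0; have [d d0 de] := small_mul (nm_ge0 a0) e0;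
    have [s hs] := Ix _ d0.
    exists [seq (a0 ** p.1, p.2) | p <- s]; rewrite big_map /=.
    have -> : \sum_(p <- s) a0 ** p.1 ** b ** p.2 = a0 ** \sum_(p <- s) p.1 ** b ** p.2.
      by rewrite smul_sumr; apply: eq_bigr => p _; rewrite !smulA.
    rewrite -smulBr; apply: le_trans (nmM _ _) _; rewrite mulrC; apply: le_trans de.
    by rewrite ler_wpM2r ?nm_ge0.
  exists [seq (p.1, p.2 ** a0) | p <- s]; rewrite big_map /=.
  have -> : \sum_(p <- s) p.1 ** b ** (p.2 ** a0) = (\sum_(p <- s) p.1 ** b ** p.2) ** a0.
    by rewrite smul_suml; apply: eq_bigr => p _; rewrite !smulA.
  rewrite -smulBl; apply: le_trans (nmM _ _) _; apply: le_trans de.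
  by rewrite ler_wpM2r ?nm_ge0.
Qed.

(** The equation reads [n^3 = d n c n - (c n)^* (c n) <= d n c n], so [|n^3| <= d |c| |n|^2], while
    the C*-identity gives [|n|^4 <= |n| |n^3|]. *)
Lemma negative_part_bound (c n : A) (d : R) : star c = c -> psd (em n) -> 0 < d ->
  n ** (c ** c - d%:C%C *: c) ** n = - (n ** n ** n) -> nm n <= d * nm c.
Proof.
move=> cs hn d0 nkn; have ns := psd_em_star hn.
have h3 : nm (n ** n ** n) <= d * nm c * nm n ^+ 2.
  have hn3 : psd (em (n ** n ** n)) by have := psd_em_conj n hn; rewrite ns.
  have : nm (n ** n ** n) <= nm (d%:C%C *: (n ** c ** n)).
    apply: pos_le_nm => //.
    have -> : em (d%:C%C *: (n ** c ** n)) - em (n ** n ** n) = em (star (c ** n) ** (c ** n)).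
      rewrite -emB -[n ** n ** n]opprK -nkn starM ns cs; congr em.
      by rewrite smulBr smulBl smulZr smulZl !smulA; lin.
    exact: psd_em_sq.
  move=> h; apply: le_trans h _; rewrite nmZr ger0_norm ?(ltW d0)// -mulrA.
  rewrite ler_wpM2l ?(ltW d0)//; apply: le_trans (nm3 _ _ _) _.
  by rewrite expr2 mulrA (mulrC (nm c)).
have n2 : nm (n ** n) = nm n ^+ 2 by rewrite -{1}ns nm_cstar.
have n4 : nm n ^+ 2 * nm n ^+ 2 <= nm n * nm (n ** n ** n).
  rewrite -n2 -expr2 -nm_cstar starM ns; apply: le_trans (nmM _ _).
  by rewrite !smulA.
have [n0|n0] := eqVneq (nm n) 0.
  by rewrite n0 mulr_ge0 ?nm_ge0 ?(ltW d0).
have np0 : 0 < nm n by rewrite lt_def n0 nm_ge0.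
have h : nm n ^+ 3 * nm n <= nm n ^+ 3 * (d * nm c).
  apply: (@le_trans _ _ (nm n * nm (n ** n ** n))).
    by apply: le_trans n4; rewrite -!exprD -exprSr.
  apply: (@le_trans _ _ (nm n * (d * nm c * nm n ^+ 2))).
    by rewrite ler_wpM2l ?nm_ge0.
  by rewrite le_eqVlt; apply/orP; left; apply/eqP; ring.
by rewrite ler_pM2l ?exprn_gt0 in h.
Qed.

Lemma cut_down c (d : R) : star c = c -> exists p n,
  [/\ psd (em p), psd (em n), c ** c - d%:C%C *: c = p - n,
      p ** (c ** c - d%:C%C *: c) ** p = p ** p ** p &
      n ** (c ** c - d%:C%C *: c) ** n = - (n ** n ** n)].
Proof.
move=> cs; have ks : star (c ** c - d%:C%C *: c) = c ** c - d%:C%C *: c.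
  by rewrite starB starM starZ conj_real cs.
have [p [n [[hp hn kE pn np] _]]] := em_parts ks.
exists p, n; split=> //; first by rewrite kE smulBr pn subr0.
by rewrite kE smulBr np sub0r smulNl.
Qed.

Lemma ideal_cube I (p : A) : closed_ideal I -> psd (em p) -> I (p ** p ** p) -> I p.
Proof.
move=> cI /psd_em_star ps I3; apply: (ci_sq cI); rewrite ps; apply: (ci_sq cI).
by rewrite starM ps smulA; exact: (ciMr p cI I3).
Qed.

(** The cut-down approximates [c^2] instead of [c], so membership has to be known in the ideal of
    [b^2]. *)
Lemma ideal_square a b : psd (em b) -> ideal_generated b a -> ideal_generated (b ** b) a.
Proof.
move=> /psd_em_star bs h J [cJ /(_ _ erefl) Jb]; apply: (ig_min cJ _ h).
by apply: (ci_sq cJ); rewrite bs.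
Qed.

End GeneratedIdeals.

(* In the application [f] maps a fixed point [c] to the image under [iota] of
   the function with constant value [c]. *)
Section Ascent.
Variables (R : realType) (C B : cstarAlgType R) (f : C -> B).
Hypothesis hf : star_hom f.
Hypothesis fcomp : forall (s : seq B) (e : R), 0 < e -> exists Q : B,
  [/\ forall (r : B) (e : R), 0 < e -> exists c, nm (Q ** r ** star Q - f c) <= e,
      nm Q <= 2 &
      forall x, x \in s ->
        nm (star Q ** Q ** x - x) <= e /\ nm (x ** (star Q ** Q) - x) <= e].

Let flin : linear f. Proof. by case: hf. Qed.
Let fM x y : f (x ** y) = f x ** f y. Proof. by case: hf. Qed.
Let fS x : f (star x) = star (f x). Proof. by case: hf. Qed.
Let fD x y : f (x + y) = f x + f y.
Proof. by have := flin 1 x y; rewrite !scale1r. Qed.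
Let f0 : f 0 = 0.
Proof. by apply: (addIr (f 0)); rewrite -fD !add0r. Qed.
Let fZ (k : R[i]) x : f (k *: x) = k *: f x.
Proof. by have := flin k x 0; rewrite !addr0 f0 addr0. Qed.
Let fB x y : f (x - y) = f x - f y.
Proof. by rewrite -scaleN1r fD fZ scaleN1r. Qed.
Let fsum (I : Type) (s : seq I) (F : I -> C) :
  f (\sum_(i <- s) F i) = \sum_(i <- s) f (F i).
Proof. exact: (big_morph f fD f0). Qed.
Let fnm x : nm (f x) <= nm x.
Proof. by rewrite nmle -nmE; exact: star_hom_contractive. Qed.
Let fpsd x : psd (em x) -> psd (em (f x)).
Proof. by move=> /positiveP[y ->]; apply/positiveP; exists (f y); rewrite fM fS. Qed.

Lemma conj_nm2 (Q x : B) : nm Q <= 2 -> nm (Q ** x ** star Q) <= 4 * nm x.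
Proof.
move=> Q2; apply: le_trans (nm3 _ _ _) _; rewrite nm_star mulrAC.
rewrite ler_wpM2r ?nm_ge0//; have := nm_ge0 Q; nra.
Qed.

Lemma conj_nm2r (Q x : B) : nm Q <= 2 -> nm (star Q ** x ** Q) <= 4 * nm x.
Proof. by move=> Q2; rewrite -{2}(starK Q); apply: conj_nm2; rewrite nm_star. Qed.

(** An approximant of a positive element in the image of [f] need not come from a positive one.
    Compressing the root [h] and squaring the approximant makes positivity automatic, as [Q^* Q]
    nearly fixes [h]. *)
Lemma compress_positive (Q x h : B) (t e : R) :
  (forall (r : B) (e : R), 0 < e -> exists c, nm (Q ** r ** star Q - f c) <= e) ->
  nm Q <= 2 -> star h = h -> h ** h = x -> nm (star Q ** Q ** h - h) <= t -> 0 < e ->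
  exists c, psd (em c) /\ nm (Q ** x ** star Q - f c) <= 4 * (nm h * t) + e.
Proof.
move=> cQ Q2 hs hx ht e0; pose y := Q ** h ** star Q.
have ys : star y = y by rewrite /y !starM starK hs smulA.
have [d [d0 de d1]] : exists d, [/\ 0 < d, d * (2 * nm y + 1) <= e & d <= 1].
  have m0 : 0 < Num.min 1 e by rewrite lt_min ltr01.
  have y0 : 0 <= 2 * nm y + 1 by have := nm_ge0 y; lra.
  have [d d0] := small_mul y0 m0; rewrite le_min => /andP[h1 h2].
  by exists d; split=> //; have := nm_ge0 y; nra.
have [c hc] := cQ h d d0; exists (star c ** c); split; first exact: psd_em_sq.
have -> : Q ** x ** star Q - f (star c ** c) =
    Q ** (h ** (h - star Q ** Q ** h)) ** star Q +
    (y ** (y - f c) + star (y - f c) ** f c).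
  rewrite fM fS -hx starB ys /y !(smulBr, smulBl) !smulA; lin.
apply: le_trans (nmD _ _) _; apply: lerD.
  apply: le_trans (conj_nm2 _ Q2) _; rewrite ler_pM2l//; apply: le_trans (nmM _ _) _.
  by rewrite ler_wpM2l ?nm_ge0// nmBC.
apply: le_trans (nmD _ _) _; have := nmM y (y - f c).
have := nmM (star (y - f c)) (f c); rewrite nm_star.
have := half_norm_nm (f c) y; rewrite nmBC; rewrite -/y in hc.
move: (nm_ge0 y) (nm_ge0 (f c)) (nm_ge0 (y - f c)) hc d1 d0 de.
move: (nm (y - f c)) (nm (f c)) (nm y) (nm (y ** _)) (nm (star _ ** _)).
move=> u v w r s *; nra.
Qed.

(** With [T = Q^* Q] and [U = Q b Q^*], [b^2] is close to [T b T b T = Q^* U^2 Q], and [U^2] is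
    close to [f (c^2)], hence to [f p]. The three terms of the bound are the error of the first step
    and four times those of the other two. *)
Lemma square_approx (Q b : B) c (p : C) (t d : R) : nm Q <= 2 ->
  nm (star Q ** Q ** b - b) <= t -> nm (b ** (star Q ** Q) - b) <= t ->
  nm (Q ** b ** star Q - f c) <= d -> nm (f (c ** c) - f p) <= d * nm (f c) + d * nm (f c) ->
  t <= d -> d <= 1 -> 
  nm (b ** b - star Q ** f p ** Q) <= d * (21 * nm b + 16 * nm b + 12 * (4 * nm b + 1)).
Proof.
move=> Q2 tb bt bc cp td d1; set T := star Q ** Q in tb bt; set U := Q ** b ** star Q in bc.
have T4 : nm T <= 4 by rewrite nm_cstar; have := nm_ge0 Q; nra.
have t0 : 0 <= t by apply: le_trans tb; exact: nm_ge0.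
have U4 : nm U <= 4 * nm b by exact: conj_nm2.
have c4 : nm (f c) <= 4 * nm b + 1.
  by have := half_norm_nm (f c) U; rewrite nmBC; lra.
have h1 : nm (b - T ** b ** T) <= 5 * t.
  have -> : b - T ** b ** T = - (T ** b - b) - T ** (b ** T - b).
    by rewrite smulBr !smulA; lin.
  apply: le_trans (nmB _ _) _; rewrite nmN; have := nmM T (b ** T - b).
  have := nm_ge0 T; have := nm_ge0 (b ** T - b); nra.
have h2 : nm (b ** b - T ** b ** T ** b ** T) <= 21 * t * nm b.
  have -> : b ** b - T ** b ** T ** b ** T = - (T ** b - b) ** b + T ** b ** (b - T ** b ** T).
    by rewrite smulNl smulBl smulBr !smulA; lin.
  apply: le_trans (nmD _ _) _; have := nmM (- (T ** b - b)) b.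
  have := nmM (T ** b) (b - T ** b ** T); rewrite nmN.
  have Tb : nm (T ** b) <= 4 * nm b.
    by apply: le_trans (nmM _ _) _; rewrite ler_wpM2r ?nm_ge0.
  have b0 := nm_ge0 b.
  have h3 : nm (T ** b) * nm (b - T ** b ** T) <= 4 * nm b * (5 * t).
    by apply: ler_pM; rewrite ?nm_ge0.
  have h4 : nm (T ** b - b) * nm b <= t * nm b by rewrite ler_wpM2r.
  by move=> *; lra.
have h3 : nm (U ** U - f p) <= d * (4 * nm b + 3 * (4 * nm b + 1)).
  have -> : U ** U - f p = (U - f c) ** U + f c ** (U - f c) + (f (c ** c) - f p).
    by rewrite fM !(smulBl, smulBr); lin.
  apply: le_trans (nmD _ _) _; apply: le_trans (lerD (nmD _ _) (lexx _)) _.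
  have l1 := le_trans (nmM _ _) (ler_pM (nm_ge0 _) (nm_ge0 _) bc U4).
  have l2 := le_trans (nmM _ _) (ler_pM (nm_ge0 _) (nm_ge0 _) c4 bc).
  have l3 : d * nm (f c) <= d * (4 * nm b + 1) by rewrite ler_wpM2l// (le_trans t0).
  by lra.
have -> : b ** b - star Q ** f p ** Q = (b ** b - T ** b ** T ** b ** T) +
    star Q ** (U ** U - f p) ** Q.
  by rewrite /T /U !(smulBl, smulBr) !smulA; lin.
apply: le_trans (nmD _ _) _; apply: le_trans (lerD h2 (conj_nm2r _ Q2)) _.
have := nm_ge0 b => b0; have : t * nm b <= d * nm b by rewrite ler_wpM2r.
lra.
Qed.

(** Substituting [Q^* f(p) Q] for [b] in [\sum w_1 b w_2] and compressing by [Q] leaves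
    [\sum (Q w_1 Q^* ) f(p) (Q w_2 Q^* )], whose outer factors are close to the image of [f]. Ideal
    membership in [B] thereby descends to [C]. *)
Lemma ideal_lift (Q a b : B) (s : seq (B * B)) (p : C) (e t : R) :
  (forall (r : B) (e : R), 0 < e -> exists c, nm (Q ** r ** star Q - f c) <= e) ->
  nm Q <= 2 -> nm (a - \sum_(w <- s) w.1 ** b ** w.2) <= e ->
  nm (b - star Q ** f p ** Q) <= t -> t * (\sum_(w <- s) nm w.1 * nm w.2) <= e ->
  0 < e ->
  exists d, (forall I : set C, closed_ideal I -> I p -> I d) /\
    nm (Q ** a ** star Q - f d) <= 9 * e.
Proof.
move=> cQ Q2 ha hb ht e0; pose P := nm (f p); have P0 : 0 <= P := nm_ge0 _.
pose N := \sum_(w <- s) P * (4 * nm w.1 + 4 * nm w.2 + 1).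
have N0 : 0 <= N.
  apply: sumr_ge0 => w _; rewrite mulr_ge0//.
  by have := nm_ge0 w.1; have := nm_ge0 w.2; lra.
have [d [d0 de d1]] : exists d, [/\ 0 < d, d * N <= e & d <= 1].
  have m0 : 0 < Num.min 1 e by rewrite lt_min ltr01.
  have N10 : 0 <= N + 1 by lra.
  have [d d0] := small_mul N10 m0; rewrite le_min => /andP[h1 h2].
  by exists d; split=> //; nra.
have /boolp.choice[g hg] r := cQ r d d0.
exists (\sum_(w <- s) g w.1 ** p ** g w.2); split.
  move=> I cI Ip; elim: (s) => [|w r IH]; first by rewrite big_nil; case: cI.
  rewrite big_cons; apply: (ciD cI) => //; apply: (ciMr _ cI).
  exact: (ciMl _ cI).
pose q r := Q ** r ** star Q.
have h1 : nm (a - \sum_(w <- s) w.1 ** (star Q ** f p ** Q) ** w.2) <= e + e.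
  apply: le_trans (nm_tri (\sum_(w <- s) w.1 ** b ** w.2) _ _) _.
  apply: lerD ha _; apply: le_trans ht; rewrite -sumrB mulr_sumr.
  apply: le_trans (nm_sum _ _ _) _; apply: ler_sum => w _.
  rewrite -smulBl -smulBr; apply: le_trans (nm3 _ _ _) _.
  rewrite mulrAC mulrC ler_wpM2r// mulr_ge0 ?nm_ge0//.
have h2 : nm (\sum_(w <- s) q w.1 ** f p ** q w.2 -
    f (\sum_(w <- s) g w.1 ** p ** g w.2)) <= e.
  apply: le_trans de; rewrite fsum -sumrB mulr_sumr; apply: le_trans (nm_sum _ _ _) _.
  apply: ler_sum => w _; rewrite !fM.
  have -> : q w.1 ** f p ** q w.2 - f (g w.1) ** f p ** f (g w.2) =
      (q w.1 - f (g w.1)) ** f p ** q w.2 + f (g w.1) ** f p ** (q w.2 - f (g w.2)).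
    by rewrite !(smulBl, smulBr); lin.
  apply: le_trans (nmD _ _) _.
  have l1 := hg w.1; have l2 := hg w.2; rewrite -/(q _) in l1 l2.
  have l3 : nm (q w.2) <= 4 * nm w.2 by exact: conj_nm2.
  have l4 : nm (f (g w.1)) <= 4 * nm w.1 + 1.
    have := half_norm_nm (f (g w.1)) (q w.1); rewrite nmBC.
    have : nm (q w.1) <= 4 * nm w.1 by exact: conj_nm2.
    by move=> *; lra.
  have k1 : nm ((q w.1 - f (g w.1)) ** f p ** q w.2) <= d * P * (4 * nm w.2).
    apply: le_trans (nm3 _ _ _) _; apply: ler_pM; rewrite ?mulr_ge0 ?nm_ge0//.
    by apply: ler_pM; rewrite ?nm_ge0.
  have k2 : nm (f (g w.1) ** f p ** (q w.2 - f (g w.2))) <= (4 * nm w.1 + 1) * P * d.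
    apply: le_trans (nm3 _ _ _) _; apply: ler_pM; rewrite ?mulr_ge0 ?nm_ge0//.
    by apply: ler_pM; rewrite ?nm_ge0.
  by lra.
have -> : Q ** a ** star Q - f (\sum_(w <- s) g w.1 ** p ** g w.2) =
    Q ** (a - \sum_(w <- s) w.1 ** (star Q ** f p ** Q) ** w.2) ** star Q +
    (\sum_(w <- s) q w.1 ** f p ** q w.2 - f (\sum_(w <- s) g w.1 ** p ** g w.2)).
  have -> : \sum_(w <- s) q w.1 ** f p ** q w.2 =
      Q ** (\sum_(w <- s) w.1 ** (star Q ** f p ** Q) ** w.2) ** star Q.
    rewrite smul_sumr smul_suml; apply: eq_bigr => w _; by rewrite /q !smulA.
  by rewrite smulBr smulBl; lin.
apply: le_trans (nmD _ _) _; apply: le_trans (lerD (conj_nm2 _ Q2) h2) _; lra.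
Qed.

(* With [k = c^2 - d c], [p = k_+] and [h^2 = c], where [f c] is [d]-close to
   [Q b Q^*], one has [f p^3 <= (f(h p))^* Q b Q^* f(h p)]. *)
Lemma cube_subequivalent (Q b : B) (c p : C) (d e : R) : psd (em b) -> psd (em c) ->
  psd (em p) -> nm (Q ** b ** star Q - f c) <= d ->
  p ** (c ** c - d%:C%C *: c) ** p = p ** p ** p -> 0 < e ->
  exists y : B, nm (star y ** b ** y - f (p ** p ** p)) <= e.
Proof.
move=> hb hc hp hbc pk e0; have [h [hs h2 _ _]] := pos_sqrt hc.
have ps := psd_em_star hp; have bs := psd_em_star hb; have cs := psd_em_star hc.
pose W := f (h ** p); pose U := Q ** b ** star Q.
have sW : star W = f p ** f h by rewrite -fS starM hs ps fM.
have hU : psd (em U) by exact: psd_em_conjr.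
have hP3 : psd (em (f (p ** p ** p))).
  by apply: fpsd; have := psd_em_conj p hp; rewrite ps.
have hle : psd (em (star W ** U ** W) - em (f (p ** p ** p))).
  have -> : em (star W ** U ** W) - em (f (p ** p ** p)) =
      ustar (em W) * (ur d - em (f c - U)) * em W.
    have -> : f (p ** p ** p) = star W ** f c ** W - d%:C%C *: (star W ** W).
      have -> : star W ** f c ** W = f (p ** (c ** c) ** p).
        by rewrite sW /W -!fM -h2 !smulA.
      have -> : star W ** W = f (p ** c ** p) by rewrite sW /W -!fM -h2 !smulA.
      by rewrite -fZ -fB -pk smulBr smulBl smulZr smulZl.
    rewrite mulrBr mulrBl ur_mulr -scalerAl -em_star -!emM -emZ -!emB smulBr smulBl.
    by congr em; lin.
  apply: psd_conj; apply: psd_sub_ob; last by apply/ob_em; rewrite nmBC.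
  by rewrite -em_star starB (psd_em_star hU) -fS cs.
have [v hv] := hereditary hP3 hle e0.
exists (star Q ** W ** v); move: hv; congr (nm (_ - _) <= _).
by rewrite !starM starK /U !smulA.
Qed.

(** Compress [a] to [ca] and the square of [b] to [p], compare in [C] by some [x], and return:
    [cube_subequivalent] replaces [p^3] by [y^* b y], so [y f(x) Q] does for [a] and [b] what [x]
    does in [C]. *)
Lemma ascent_comparison : ideal_comparison C -> ideal_comparison B.
Proof.
move=> comp a b ha hb hab e e0; have e10 : 0 < e / 128 by lra.
(* The errors add up to [4 * 25 e1 + 5 t], at most [101 e1]. *)
set e1 := e / 128 in e10; have bs := psd_em_star hb.
have [s hs] := ideal_generated_approx (ideal_square hb hab) e10.
pose N := \sum_(w <- s) nm w.1 * nm w.2.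
have N0 : 0 <= N by apply: sumr_ge0 => w _; rewrite mulr_ge0 ?nm_ge0.
have [e2 e20 e2N] := small_mul N0 e10.
pose K := 21 * nm b + 16 * nm b + 12 * (4 * nm b + 1).
have K0 : 0 <= K by rewrite /K; have := nm_ge0 b; lra.
have [d [d0 dK d1]] : exists d, [/\ 0 < d, d * K <= e2 & d <= 1].
  have m0 : 0 < Num.min 1 e2 by rewrite lt_min ltr01.
  have K10 : 0 <= K + 1 by lra.
  have [d d0] := small_mul K10 m0; rewrite le_min => /andP[h1 h2].
  by exists d; split=> //; nra.
have [k [ks k2 _ _]] := pos_sqrt ha; have [l [ls l2 _ _]] := pos_sqrt hb.
have [t [t0 td te]] : exists t, [/\ 0 < t,
    t * (8 * nm k + 8 * nm l + 6) <= d & t * (8 * nm k + 8 * nm l + 6) <= e1].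
  have m0 : 0 < Num.min d e1 by rewrite lt_min d0.
  have L0 : 0 <= 8 * nm k + 8 * nm l + 6 by have := nm_ge0 k; have := nm_ge0 l; lra.
  have [t t0] := small_mul L0 m0; rewrite le_min => /andP[h1 h2].
  by exists t.
have tk : 0 <= t * nm k by rewrite mulr_ge0 ?nm_ge0 ?(ltW t0).
have tl : 0 <= t * nm l by rewrite mulr_ge0 ?nm_ge0 ?(ltW t0).
have [Q [cQ Q2 hQ]] := fcomp [:: a; b; k; l] t0.
have [a1 a2] : nm (star Q ** Q ** a - a) <= t /\ nm (a ** (star Q ** Q) - a) <= t.
  by apply: hQ; rewrite !inE eqxx.
have [b1 b2] : nm (star Q ** Q ** b - b) <= t /\ nm (b ** (star Q ** Q) - b) <= t.
  by apply: hQ; rewrite !inE eqxx orbT.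
have kQ : nm (star Q ** Q ** k - k) <= t by apply: (hQ _ _).1; rewrite !inE eqxx !orbT.
have lQ : nm (star Q ** Q ** l - l) <= t by apply: (hQ _ _).1; rewrite !inE eqxx !orbT.
have d20 : 0 < d / 2 by lra.
have e120 : 0 < e1 / 2 by lra.
have [c [hc bc]] := compress_positive cQ Q2 ls l2 lQ d20.
have [ca [hca ac]] := compress_positive cQ Q2 ks k2 kQ e120.
have {}bc : nm (Q ** b ** star Q - f c) <= d by apply: le_trans bc _; lra.
have {}ac : nm (Q ** a ** star Q - f ca) <= e1 by apply: le_trans ac _; lra.
have cs := psd_em_star hc.
have [p [n [hp hn kE pk nk]]] := cut_down d cs.
have nb : nm (f n) <= d * nm (f c).
  apply: negative_part_bound => //; [by rewrite -fS cs|exact: fpsd|].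
  by rewrite -!fM -fZ -fB -!fM nk -scaleN1r fZ scaleN1r.
have cp : nm (f (c ** c) - f p) <= d * nm (f c) + d * nm (f c).
  rewrite -fB; have -> : c ** c - p = d%:C%C *: c - n.
    have -> : p = (c ** c - d%:C%C *: c) + n by rewrite kE; lin.
    by lin.
  rewrite fB fZ; apply: le_trans (nmB _ _) _; apply: lerD nb.
  by rewrite nmZr ger0_norm ?(ltW d0).
have td' : t <= d by lra.
have bp := le_trans (square_approx Q2 b1 b2 bc cp td' d1) dK.
have [w [wI aw]] := ideal_lift cQ Q2 hs bp e2N e10.
(* [ca] is positive but only close to the ideal of [p3], whereas [w] lies in the ideal and need not
   be positive. Cutting [ca] by a unit [u] of [w] taken from the ideal gives both. *)
have [u [us u1 uI uw]] := seq_unit [:: w] e10.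
pose p3 := p ** p ** p.
have Iw : ideal_generated p3 w.
  apply: wI; first exact: ig_ci; apply: (ideal_cube (ig_ci _) hp); exact: ig_self.
have Iu : ideal_generated p3 u.
  apply: uI; first exact: ci_subalg (ig_ci _).
  by move=> x; rewrite inE => /eqP ->; split=> //; exact: (ci_star (ig_ci _)).
have hp3 : psd (em p3) by have := psd_em_conj p hp; rewrite (psd_em_star hp).
have hu : psd (em (u ** ca ** u)) by have := psd_em_conj u hca; rewrite us.
have Iuu : ideal_generated p3 (u ** ca ** u).
  by apply: (ciMl _ (ig_ci _)).
have [x hx] := comp _ _ hu hp3 Iuu e1 e10.
have X0 : 0 <= nm (f x) * nm (f x) by rewrite mulr_ge0 ?nm_ge0.
have [e3 e30 e3x] := small_mul X0 e10.
have [y hy] := cube_subequivalent hb hc hp bc pk e30.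
exists (y ** f x ** Q).
have h1 : nm (f (star x ** p3 ** x) - f (u ** ca ** u)) <= e1.
  by rewrite -fB; exact: le_trans (fnm _) hx.
have cw : nm (f ca - f w) <= 10 * e1.
  apply: le_trans (nm_tri (Q ** a ** star Q) _ _) _; rewrite nmBC; lra.
have fu1 : nm (f u) <= 1 by exact: le_trans (fnm _) u1.
have h2 : nm (f (u ** ca ** u) - f ca) <= 22 * e1.
  have [w1 w2] := uw w (mem_head _ _).
  have -> : f (u ** ca ** u) - f ca = f u ** (f ca - f w) ** f u -
      (f (w - u ** w) + f u ** f (w - w ** u)) - (f ca - f w).
    by rewrite !(fB, fM) !(smulBl, smulBr) !smulA; lin.
  have k1 : nm (f u ** (f ca - f w) ** f u) <= 1 * (10 * e1) * 1.
    apply: le_trans (nm3 _ _ _) _; apply: ler_pM; rewrite ?mulr_ge0 ?nm_ge0//.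
    by apply: ler_pM; rewrite ?nm_ge0.
  have k3 : nm (f (w - u ** w)) <= e1 by exact: le_trans (fnm _) w2.
  have k4 : nm (f u ** f (w - w ** u)) <= 1 * e1.
    apply: le_trans (nmM _ _) _; apply: ler_pM; rewrite ?nm_ge0//.
    exact: le_trans (fnm _) w1.
  apply: le_trans (nmB _ _) _; apply: le_trans (lerD (nmB _ _) (lexx _)) _.
  apply: le_trans (lerD (lerD (lexx _) (nmD _ _)) (lexx _)) _; lra.
have h3 : nm (star (f x) ** (star y ** b ** y - f p3) ** f x) <= e1.
  apply: le_trans (nm_conj3 _ _ _) _; apply: le_trans e3x.
  rewrite mulrAC mulrC; apply: ler_pM; rewrite ?mulr_ge0 ?nm_ge0//.
set T := star Q ** Q in a1 a2.
have T4 : nm T <= 4 by rewrite nm_cstar; have := nm_ge0 Q; nra.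
have h4 : nm (T ** a ** T - a) <= 5 * t.
  have -> : T ** a ** T - a = T ** (a ** T - a) + (T ** a - a) by rewrite smulBr smulA; lin.
  apply: le_trans (nmD _ _) _; have := nmM T (a ** T - a).
  have := nm_ge0 T; have := nm_ge0 (a ** T - a); nra.
pose Z := star (f x) ** (star y ** b ** y - f p3) ** f x +
  (f (star x ** p3 ** x) - f (u ** ca ** u)) + (f (u ** ca ** u) - f ca) +
  - (Q ** a ** star Q - f ca).
have Z4 : nm Z <= 25 * e1.
  apply: le_trans (nmD _ _) _; rewrite nmN.
  apply: le_trans (lerD (nmD _ _) (lexx _)) _.
  apply: le_trans (lerD (lerD (nmD _ _) (lexx _)) (lexx _)) _; lra.
have -> : star (y ** f x ** Q) ** b ** (y ** f x ** Q) - a =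
    star Q ** Z ** Q + (T ** a ** T - a).
  rewrite /Z /T !starM !(fB, fM, fS) !(smulBl, smulBr, smulDl, smulDr, smulNl, smulNr) !smulA.
  by lin.
apply: le_trans (nmD _ _) _; have := conj_nm2r Z Q2.
have : 5 * t <= e1 by lra.
by rewrite /e1 in Z4 *; lra.
Qed.

(** [C] having no characters, [chi \o f] vanishes. If [chi r = 1], the compression [Q r Q^*] near
    the image of [f] makes [|chi Q|^2] small, whereas [Q^* Q r] close to [r] makes it near 1. *)
Lemma ascent_no_character : (forall a : C, psd (em a) -> absorbs a a) ->
  ~ (exists chi, @character R B chi).
Proof.
move=> habs [chi [hchi /(_ 1)[r r1]]]; have [cD cZ cM cV] := star_hom_scalars hchi.
have small y : nm (chi y) <= nm y by exact: scalar_nm.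
have cf0 c : chi (f c) = 0.
  apply: contrapT => /eqP c0; apply: (absorbs_no_character habs).
  exists (chi \o f); split.
    split=> [k x y|x y|x] /=; first by rewrite flin cD cZ.
      by rewrite fM cM.
    by rewrite fS cV.
  by move=> z; exists ((z / chi (f c)) *: c); rewrite /= fZ cZ mulfVK.
have cB y z : chi (y - z) = chi y - chi z by rewrite -scaleN1r cD cZ mulN1r.
have e0 : 0 < 1 / 4 :> R by lra.
have [Q [cQ _ /(_ r (mem_head _ _))[hr _]]] := fcomp [:: r] e0.
have [c hc] := cQ r _ e0.
have := le_trans (small _) hr; have := le_trans (small _) hc.
rewrite !cB !cM !cV cf0 r1 !mulr1 subr0 (mulrC (chi Q)) => k1 k2.
have := half_norm_nm (1 : R[i]^o) ((chi Q)^* * chi Q).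
by rewrite nm1 nmBC; lra.
Qed.

Theorem ascent : ideal_comparison C -> (forall a : C, psd (em a) -> absorbs a a) ->
  purely_infinite B.
Proof.
move=> hC habs; apply: comparison_pi; first exact: ascent_comparison.
exact: ascent_no_character.
Qed.

End Ascent.

Theorem proposition4p10 (R : realType) (A : cstarAlgType R) (G : topGroupType)
    (alpha : cstarAction G A) :
  sigma_unital A ->
  compact [set: G]%classic -> hausdorff_space G -> @second_countable G ->
  rokhlin alpha ->
  purely_infinite A ->
  purely_infinite (fixed_point_algebra alpha) /\
  (forall mu : probability (borel G) R, left_haar mu ->
   forall (B : cstarAlgType R) (iota : (G -> A) -> B),
     crossed_product mu alpha iota -> purely_infinite B).
Proof.
move=> sA cG hG scG rA piA; split; first exact: fixed_purely_infinite.
move=> mu inv B iota cp.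
apply: (@ascent _ (fixed_point_algebra alpha) B (fun c => ic iota (val c))).
- split=> [k x y|x y|x] /=.
  + by rewrite (icD cp) (icZ cp).
  + by rewrite (ic_mulr cp) // => g; exact: fixed_val.
  + by rewrite (ic_fixed_star cp) // => g; exact: fixed_val.
- exact: (compression cG inv cp sA hG scG rA piA).
- exact: fixed_comparison.
- exact: fixed_absorbs.
Qed.
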